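(* Let $M$ be an oriented 3-manifold. There exist CW-complexes $CK_b=CK_b(M)$ and $CK_0=CK_0(M)$ such that for $X=X^b$ and $X=X^0$, respectively, the cellular chain complex is isomorphic to the chain complex of singular knots: $C^{CW}_*(CK_b)\cong C_*(X^b)$ and $C^{CW}_*(CK_0)\cong C_*(X^0)$. (These are the cubical complexes described in the context, with one $n$-cube for each element of $X_n^b$, respectively $X_n^0$.)
   Context: An $n$-singular knot in $M$ is an immersion $S^1\to M$ (with a chosen direction of $S^1$) which is an embedding except for $n$ transverse double points, up to direction-preserving rigid-vertex isotopy. Each double point has a canonical positive and a canonical negative resolution, determined by the orientation of $M$. $X_n^0$ is the set of $n$-singular knots $K_{1\ldots n}$ with double points ordered from $1$ to $n$, up to direction-preserving rigid-vertex isotopy mapping each double point to the one with the same label. $X_n^b$ is the set of $n$-singular knots with a base point $b$ apart from the double points, up to direction-preserving rigid-vertex isotopy carrying base point to base point and keeping it apart from the double points throughout; the double points are then naturally ordered $1,\dots,n$ in the order in which they are first met travelling along the knot from $b$. For $X=X^0$ or $X^b$, $C_n(X)$ is the $\mathbf Q$-vector space with basis $X_n$. The boundary is $\partial K_{1\ldots n}=\sum_{i=1}^n(-1)^{i+1}\mathrm{d}_iK_{1\ldots n}$, where $\mathrm{d}_iK_{1\ldots n}=K_{\times\ldots\underset{i}{+}\ldots\times}-K_{\times\ldots\underset{i}{-}\ldots\times}$ is the difference of the positive and negative resolution at the $i$-th double point, each with the induced ordering (and base point). Cellular chains are taken with coefficients in $\mathbf Q$. Construction of the complexes: the $0$-cells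 are the oriented knot types in $M$. Let $I^n=[-1,1]^n$. Inductively, for each $K_{1\ldots n}$ in $X_n^b$ (respectively $X_n^0$), $n\ge1$, an $n$-cube with characteristic map $g_{K_{1\ldots n}}:I^n\to CK^{(n)}$ is attached by the map $f_{K_{1\ldots n}}:\partial I^n\to CK^{(n-1)}$ given on the face $\{x_i=\varepsilon_i\}$, $\varepsilon_i=\pm1$, by $f_{K_{1\ldots n}}(x_1,\dots,\varepsilon_i,\dots,x_n)=g_{K_{\times\ldots\varepsilon_i\ldots\times}}(x_1,\dots,\widehat{x_i},\dots,x_n)$, where $K_{\times\ldots\varepsilon_i\ldots\times}$ is $K_{1\ldots n}$ with the $i$-th double point resolved with sign $\varepsilon_i$ and induced ordering (and base point). *)

(* Defs.v *)
From HB Require Import structures.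
From mathcomp Require Import all_boot all_order all_algebra generic_quotient.
From mathcomp Require Import all_classical all_reals all_analysis.
From mathcomp Require Import zify.
From mathcomp.multinomials Require Import freeg.
Import Order.TTheory GRing.Theory Num.Theory.
Import numFieldNormedType.Exports.

Set Implicit Arguments.
Unset Strict Implicit.
Unset Printing Implicit Defensive.

Local Open Scope classical_set_scope.
Local Open Scope ring_scope.

Fixpoint Ck (R : realType) (V W : normedModType R) (k : nat) (U : set V)
    (f : V -> W) : Prop :=
  if k is k'.+1 then
    (forall x, U x -> differentiable f x) /\
    (forall v : V, Ck k' U ('D_v f))
  else forall x, U x -> {for x, continuous f}.

(* Used for open U only. *)
Definition smooth_on (R : realType) (V W : normedModType R) (U : set V)
    (f : V -> W) : Prop :=
  forall k, Ck k U f.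

(* ch_to and ch_from are mutually inverse between the open sets ch_dom and
   ch_cod; their values outside these sets are irrelevant. *)
Record chart (R : realType) (T : topologicalType) := Chart {
  ch_dom : set T;
  ch_cod : set 'rV[R]_3;
  ch_to : T -> 'rV[R]_3;
  ch_from : 'rV[R]_3 -> T }.

Definition is_chart (R : realType) (T : topologicalType) (c : chart R T) :=
  [/\ open (ch_dom c),
      open (ch_cod c),
      forall p, ch_dom c p -> ch_cod c (ch_to c p) /\ ch_from c (ch_to c p) = p,
      forall x, ch_cod c x -> ch_dom c (ch_from c x) /\ ch_to c (ch_from c x) = x
    & (forall p, ch_dom c p -> {for p, continuous (ch_to c)}) /\
      (forall x, ch_cod c x -> {for x, continuous (ch_from c)})].

Definition oriented_compatible (R : realType) (T : topologicalType)
    (c d : chart R T) :=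
  let U := ch_cod c `&` ch_from c @^-1` ch_dom d in
  smooth_on U (ch_to d \o ch_from c) /\
  (forall x, U x -> 0 < \det (jacobian (ch_to d \o ch_from c) x)).

(* Smooth, without boundary; the orientation is given by the atlas. *)
Record oriented_3manifold (R : realType) := Oriented3Manifold {
  mfd_space :> topologicalType;
  mfd_atlas : set (chart R mfd_space);
  mfd_hausdorff : hausdorff_space mfd_space;
  mfd_countable : @second_countable mfd_space;
  mfd_chart : forall c, mfd_atlas c -> is_chart c;
  mfd_cover : forall p, exists2 c, mfd_atlas c & ch_dom c p;
  mfd_oriented : forall c d, mfd_atlas c -> mfd_atlas d ->
    oriented_compatible c d }.

Definition smooth_map (R : realType) (M : oriented_3manifold R)
    (V : normedModType R) (f : V -> M) : Prop :=
  continuous f /\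
  (forall c, mfd_atlas c -> smooth_on (f @^-1` ch_dom c) (ch_to c \o f)).

(* The oriented circle is R/Z: maps from the circle are maps on R of period 1,
   and same_pt s t says that s and t represent the same point of the circle. *)
Definition same_pt (R : realType) (s t : R) : bool := s - t \is a Num.int.

Definition periodic1 (R : realType) (T : Type) (f : R -> T) :=
  forall t, f (t + 1) = f t.

Section SingularKnots.
Context (R : realType) (M : oriented_3manifold R).

Definition velocity (c : chart R M) (f : R -> M) (t : R) : 'rV[R]_3 :=
  derive1 (ch_to c \o f) t.

Definition circle_immersion (f : R -> M) :=
  [/\ periodic1 f, smooth_map f
    & forall c t, mfd_atlas c -> ch_dom c (f t) -> velocity c f t != 0].

Definition transverse_at (f : R -> M) (s t : R) :=
  forall c, mfd_atlas c -> ch_dom c (f s) ->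
    row_free (col_mx (velocity c f s) (velocity c f t)).

(* p lists the double points of f, labelled by 'I_n; each has exactly two
   preimages, and f is injective elsewhere. *)
Definition is_singular_knot (n : nat) (f : R -> M) (p : 'I_n -> M) :=
  [/\ circle_immersion f,
      injective p,
      forall i, exists s t, [/\ ~~ same_pt s t, f s = p i, f t = p i
        & forall r, f r = p i -> same_pt r s || same_pt r t],
      forall s t, f s = f t -> ~~ same_pt s t -> exists i, f s = p i
    & forall s t, f s = f t -> ~~ same_pt s t -> transverse_at f s t].

Record singular_knot (n : nat) := SingularKnot {
  knot_map : R -> M;
  double_pt : 'I_n -> M;
  singular_knotP : is_singular_knot knot_map double_pt }.

(* The base point is f b.  The last clause says that the labels increase in
   the order in which the double points are first met from b on. *)
Definition is_based_knot (n : nat) (f : R -> M) (p : 'I_n -> M) (b : R) :=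
  [/\ is_singular_knot f p,
      forall i, f b <> p i
    & forall i j : 'I_n, (i < j)%N ->
        exists s, [/\ b <= s, f s = p i & forall t, b <= t <= s -> f t <> p j]].

Record based_knot (n : nat) := BasedKnot {
  based_map : R -> M;
  based_double_pt : 'I_n -> M;
  base_pt : R;
  based_knotP : is_based_knot based_map based_double_pt base_pt }.

(* Rigid-vertex isotopy: a smooth path through n-singular knots.  Since the
   branches at each double point stay immersed and transverse, the plane that
   they span is carried along.  Reparametrizations of the circle that preserve
   its direction are such paths. *)
Definition ordered_isotopic (n : nat) (K L : singular_knot n) :=
  exists (H : R * R -> M) (P : R -> 'I_n -> M),
  [/\ smooth_map H,
      forall u : R, 0 <= u <= 1 -> is_singular_knot (fun t => H (u, t)) (P u),
      forall i, {within `[0, 1], continuous (fun u => P u i)},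
      forall t, H (0, t) = knot_map K t /\ H (1, t) = knot_map L t
    & forall i, P 0 i = double_pt K i /\ P 1 i = double_pt L i].

(* B u is the parameter of the base point at time u. *)
Definition based_isotopic (n : nat) (K L : based_knot n) :=
  exists (H : R * R -> M) (P : R -> 'I_n -> M) (B : R -> R),
  [/\ smooth_map H,
      forall u : R, 0 <= u <= 1 ->
        is_based_knot (fun t => H (u, t)) (P u) (B u),
      {within `[0, 1], continuous B},
      forall t, H (0, t) = based_map K t /\ H (1, t) = based_map L t
    & B 0 = base_pt K /\ same_pt (B 1) (base_pt L)].

(* In the chart c, move f t by u * h t in the direction v. *)
Definition push (c : chart R M) (h : R -> R) (v : 'rV[R]_3) (f : R -> M)
    (u t : R) : M :=
  if h t == 0 then f t else ch_from c (ch_to c (f t) + (u * h t) *: v).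

(* f s and f s' are the two branches at p; the bump h moves the branch at s
   off the branch at s' in the direction v.  For eps = true (the positive
   resolution) the frame (f' s, f' s', v) is positive; this does not depend on
   which of the branches is moved, as exchanging the two branches also
   replaces v by - v.  With the usual drawing conventions it is the crossing
   of sign +1. *)
Definition resolving_push (eps : bool) (f : R -> M) (p : M) (c : chart R M)
    (h : R -> R) (v : 'rV[R]_3) :=
  exists s s' : R,
  [/\ [/\ mfd_atlas c, ~~ same_pt s s', f s = p & f s' = p],
      [/\ periodic1 h, smooth_on setT h, forall t, 0 <= h t, 0 < h s & h s' = 0],
      closure [set t | h t != 0] `<=` f @^-1` ch_dom c,
      forall u t : R, 0 <= u <= 1 -> h t != 0 ->
        ch_cod c (ch_to c (f t) + (u * h t) *: v)
    & 0 < (-1) ^+ (~~ eps) *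
          \det (\matrix_(k < 3) [:: velocity c f s; velocity c f s'; v]`_k)].

(* L is obtained from K by pushing the branches at the i-th double point apart,
   with no other change of singularities on the way: all intermediate stages
   are singular knots with the remaining double points. *)
Definition ordered_resolves (n : nat) (eps : bool) (K : singular_knot n.+1)
    (i : 'I_n.+1) (L : singular_knot n) :=
  exists c h v,
  [/\ resolving_push eps (knot_map K) (double_pt K i) c h v,
      forall u : R, 0 < u <= 1 -> is_singular_knot (push c h v (knot_map K) u)
                                (double_pt K \o fintype.lift i),
      forall t, knot_map L t = push c h v (knot_map K) 1 t
    & forall j, double_pt L j = double_pt K (fintype.lift i j)].

Definition based_resolves (n : nat) (eps : bool) (K : based_knot n.+1)
    (i : 'I_n.+1) (L : based_knot n) :=
  exists c h v,
  [/\ resolving_push eps (based_map K) (based_double_pt K i) c h v,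
      forall u : R, 0 < u <= 1 -> is_based_knot (push c h v (based_map K) u)
                                (based_double_pt K \o fintype.lift i) (base_pt K),
      forall t, based_map L t = push c h v (based_map K) 1 t,
      forall j, based_double_pt L j = based_double_pt K (fintype.lift i j)
    & base_pt L = base_pt K].

End SingularKnots.

Record knot_flavour := KnotFlavour {
  knots : nat -> Type;
  isotopic : forall n, knots n -> knots n -> Prop;
  resolves : forall n, bool -> knots n.+1 -> 'I_n.+1 -> knots n -> Prop }.

Definition ordered_flavour (R : realType) (M : oriented_3manifold R) :=
  KnotFlavour (@ordered_isotopic R M) (@ordered_resolves R M).

Definition based_flavour (R : realType) (M : oriented_3manifold R) :=
  KnotFlavour (@based_isotopic R M) (@based_resolves R M).

Definition is_isotopy_class (X : knot_flavour) n (C : set (knots X n)) :=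
  exists K, C = [set L | isotopic K L].

(* The set X_n; the isotopy relation is an equivalence. *)
Definition knot_type (X : knot_flavour) (n : nat) : Type :=
  {C : set (knots X n) | is_isotopy_class C}.

HB.instance Definition _ X n := gen_eqMixin (knot_type X n).
HB.instance Definition _ X n := gen_choiceMixin (knot_type X n).

Definition resolution (X : knot_flavour) n (eps : bool)
    (C : knot_type X n.+1) (i : 'I_n.+1) (D : knot_type X n) : Prop :=
  exists K L, [/\ sval C K, sval D L & resolves eps K i L].

Fact fglift_linear (K : choiceType) (V : lmodType rat) (f : K -> V) :
  linear (fglift f : {freeg K / rat} -> V).
Proof.
have fB := lift_is_additive f.
have fD : {morph fglift f : x y / x + y}.
  move=> x y; have f0 : fglift f 0 = 0 by rewrite -[0 in LHS](subrr 0) fB subrr.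
  by rewrite -[y in LHS]opprK fB -[- y]sub0r fB f0 sub0r opprK.
have f0 : fglift f 0 = 0 by rewrite -[0 in LHS](subrr 0) fB subrr.
move=> a x y; rewrite fD; congr (_ + _).
rewrite -[in RHS](freeg_sumE x) [a *: x](_ : _ =
  \sum_(k <- freeg.dom x) [freeg [:: (a * coeff k x, k)]]) //.
rewrite !(big_morph _ fD f0) scaler_sumr; apply: eq_bigr => k _.
by rewrite !liftU scalerA.
Qed.
HB.instance Definition _ (K : choiceType) (V : lmodType rat) (f : K -> V) :=
  GRing.isLinear.Build rat {freeg K / rat} V _ (fglift f) (fglift_linear f).

Record Qcomplex := QComplex {
  cpx_mod :> nat -> lmodType rat;
  cpx_d : forall n, {linear cpx_mod n.+1 -> cpx_mod n} }.

Definition complex_iso (C D : Qcomplex) : Prop :=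
  exists f : forall n, {linear C n -> D n},
    (forall n, bijective (f n)) /\
    (forall n x, f n (cpx_d C n x) = cpx_d D n (f n.+1 x)).

Section KnotComplex.
Context (X : knot_flavour).

(* The basis element of the eps-resolution of C at i; the resolution exists
   and is unique, so that neither the choice nor the default 0 matters. *)
Definition resolve n (eps : bool) (C : knot_type X n.+1) (i : 'I_n.+1) :
    {freeg (knot_type X n) / rat} :=
  if pselect (exists D, resolution eps C i D) is left e
  then [freeg [:: (1, sval (cid e))]] else 0.

(* 'I_n counts from 0, hence the sign (-1)^i. *)
Definition knot_boundary n (C : knot_type X n.+1) :
    {freeg (knot_type X n) / rat} :=
  \sum_(i < n.+1) (-1) ^+ i *: (resolve true C i - resolve false C i).

Definition knot_complex : Qcomplex :=
  @QComplex (fun n => {freeg (knot_type X n) / rat})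
            (fun n => GRing.Linear.clone _ _ _ _ (fglift (@knot_boundary n)) _).

End KnotComplex.

(* Quotient of a submodule Z by (its intersection with) a submodule B. *)
Section Subquotient.
Local Open Scope quotient_scope.
Context (V : lmodType rat) (Z B : submodClosed V).

Record sub_elt := SubElt { sub_val : V; sub_valP : sub_val \in Z }.

HB.instance Definition _ := [isSub for sub_val].
HB.instance Definition _ := [Choice of sub_elt by <:].
HB.instance Definition _ := [SubChoice_isSubLmodule of sub_elt by <:].

Definition sub_ker : {pred sub_elt} := [pred x | sub_val x \in B].

Fact sub_ker_zmod_closed : zmod_closed sub_ker.
Proof.
split=> [|x y xB yB].
  by change (val (0 : sub_elt) \in B); rewrite raddf0 rpred0.
by change (val (x - y) \in B); rewrite raddfB /= -scaleN1r rpredD ?rpredZ.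
Qed.
HB.instance Definition _ :=
  GRing.isZmodClosed.Build sub_elt sub_ker sub_ker_zmod_closed.

Definition subquotient : Type := Quotient.quot sub_ker.
HB.instance Definition _ := GRing.Zmodule.on subquotient.
HB.instance Definition _ := EqQuotient.on subquotient.

Definition subquotient_scale (a : rat) : subquotient -> subquotient :=
  lift_op1 (Quotient.quot sub_ker) ( *:%R a).

Fact pi_subquotient_scale a (x : sub_elt) :
  \pi_(Quotient.quot sub_ker) (a *: x) =
  subquotient_scale a (\pi_(Quotient.quot sub_ker) x).
Proof.
rewrite /subquotient_scale; unlock; apply/eqP; rewrite -Quotient.idealrBE.
rewrite -scalerBr; change (val (a *: (x - repr (\pi_(Quotient.quot sub_ker) x)))
  \in B).
rewrite linearZ rpredZ //.
suff : x - repr (\pi_(Quotient.quot sub_ker) x) \in sub_ker by [].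
by rewrite Quotient.idealrBE reprK.
Qed.

Fact subquotient_scaleA a b x :
  subquotient_scale a (subquotient_scale b x) = subquotient_scale (a * b) x.
Proof. by elim/quotW: x => x; rewrite -!pi_subquotient_scale scalerA. Qed.

Fact subquotient_scale1 : left_id 1 subquotient_scale.
Proof. by move=> x; elim/quotW: x => x; rewrite -pi_subquotient_scale scale1r. Qed.

Fact subquotient_scaleDr : right_distributive subquotient_scale +%R.
Proof.
move=> a x y; elim/quotW: x => x; elim/quotW: y => y.
by rewrite -raddfD -!pi_subquotient_scale scalerDr raddfD.
Qed.

Fact subquotient_scaleDl x : {morph subquotient_scale^~ x : a b / a + b}.
Proof.
move=> a b; elim/quotW: x => x.
by rewrite -!pi_subquotient_scale scalerDl raddfD.
Qed.

HB.instance Definition _ := GRing.Zmodule_isLmodule.Build rat subquotient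
  subquotient_scaleA subquotient_scale1 subquotient_scaleDr subquotient_scaleDl.

Definition subquotient_class (x : sub_elt) : subquotient :=
  \pi_(Quotient.quot sub_ker) x.

Definition subquotient_repr (x : subquotient) : sub_elt :=
  repr (x : Quotient.quot sub_ker).

Fact subquotient_reprK : cancel subquotient_repr subquotient_class.
Proof. by move=> x; exact: reprK. Qed.

Fact subquotient_classP (x y : sub_elt) :
  sub_val x - sub_val y \in B <-> subquotient_class x = subquotient_class y.
Proof.
have := Quotient.idealrBE sub_ker x y => xyE.
by split=> [xyB|/eqP xyB]; [apply/eqP; rewrite -xyE | move: xyB; rewrite -xyE].
Qed.

Fact subquotient_class_linear : linear subquotient_class.
Proof.
by move=> a x y; rewrite /subquotient_class raddfD /= pi_subquotient_scale.
Qed.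
HB.instance Definition _ := GRing.isLinear.Build rat sub_elt subquotient _
  subquotient_class subquotient_class_linear.
End Subquotient.

Definition insert_coord (R : realType) n (i : 'I_n.+1) (a : R) (x : 'rV[R]_n) :
    'rV[R]_n.+1 :=
  \row_j oapp (x ord0) a (unlift i j).

Definition std_simplex (R : realType) n : set 'rV[R]_n.+1 :=
  [set x | (forall i, 0 <= x ord0 i) /\ \sum_i x ord0 i = 1].

Arguments std_simplex R n : clear implicits.

Fact insert_coord_simplex (R : realType) n (i : 'I_n.+2) (x : 'rV[R]_n.+1) :
  std_simplex R n x -> std_simplex R n.+1 (insert_coord i 0 x).
Proof.
move=> [x_ge0 sum_x]; split=> [j|].
  by rewrite mxE; case: unliftP => [k|] ? //=.
rewrite (bigD1_ord i) //= mxE unlift_none /= add0r -[RHS]sum_x.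
by apply: eq_bigr => j _; rewrite mxE liftK.
Qed.

Fact insert_coord_continuous (R : realType) n (i : 'I_n.+1) (a : R) :
  continuous (@insert_coord R n i a).
Proof.
move=> x A [P nP sPA].
exists (fun k l => P k (fintype.lift i l)) => [k l|y Py].
  by have := nP k (fintype.lift i l); rewrite mxE liftK /= (ord1 k).
apply: sPA => k j; rewrite mxE; case: unliftP => [l ->|->] /=.
  by have := Py k l; rewrite (ord1 k).
by have /nbhs_singleton := nP k i; rewrite mxE unlift_none.
Qed.

(* Inserting two coordinates, first at j and then at i, in the other order. *)
Definition face_swap n (ij : 'I_n.+2 * 'I_n.+1) : 'I_n.+2 * 'I_n.+1 :=
  (fintype.lift ij.1 ij.2, inord (unbump ij.2 ij.1)).

Fact face_swap2 n (i : 'I_n.+2) (j : 'I_n.+1) :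
  (face_swap (i, j)).2 = unbump j i :> nat.
Proof.
rewrite /= inordK // /unbump; have := ltn_ord i; have := ltn_ord j.
by case: ltnP => /=; lia.
Qed.

Fact face_swapK n : involutive (@face_swap n).
Proof.
move=> [i j]; have e2 := face_swap2 i j.
case e : (face_swap (i, j)) => [k l]; move: e2; rewrite e /= => e2.
have e1 : k = bump i j :> nat by case: e => <-.
have e3 : (face_swap (k, l)).2 = j.
  apply: ord_inj; rewrite face_swap2 e1 e2 /bump /unbump.
  by case: (ltnP j i) => ? /=; lia.
rewrite [LHS]surjective_pairing e3; congr pair; apply: ord_inj => /=.
by rewrite e1 e2 /bump /unbump; case: (ltnP j i) => ? /=; lia.
Qed.

Fact face_swap_odd n (i : 'I_n.+2) (j : 'I_n.+1) :
  odd ((face_swap (i, j)).1 + (face_swap (i, j)).2) = ~~ odd (i + j).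
Proof.
rewrite face_swap2 /= /bump /unbump.
by case: (ltnP j i) => ? /=; lia.
Qed.

Fact insert_coordC (R : realType) n (i : 'I_n.+2) (j : 'I_n.+1) (x : 'rV[R]_n) :
  insert_coord i 0 (insert_coord j 0 x) =
  insert_coord (face_swap (i, j)).1 0 (insert_coord (face_swap (i, j)).2 0 x).
Proof.
set p := (face_swap _).1; set q := (face_swap _).2.
have pq : fintype.lift p q = i by rewrite -[RHS](congr1 fst (face_swapK (i, j))).
have pE : fintype.lift i j = p by [].
have qE : q = unbump j i :> nat by exact: face_swap2.
have lC l : fintype.lift i (fintype.lift j l) = fintype.lift p (fintype.lift q l).
  by apply: ord_inj; rewrite /= qE bumpC.
apply/rowP => k; rewrite !mxE.
case: (unliftP i k) => [m ->|->] /=; last first.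
  by rewrite -pq liftK /= mxE unlift_none.
rewrite mxE; case: (unliftP j m) => [l ->|->] /=.
  by rewrite lC liftK /= mxE liftK.
by rewrite pE unlift_none.
Qed.

Section SingularHomology.
Context (R : realType) (Z : topologicalType).

Definition face_incl n (i : 'I_n.+2) (x : std_simplex R n) :
    std_simplex R n.+1 :=
  exist _ (insert_coord i 0 (set_val x))
          (mem_set (insert_coord_simplex i (set_mem (valP x)))).

Fact face_incl_continuous n (i : 'I_n.+2) : continuous (@face_incl n i).
Proof.
apply: continuous_comp_initial.
rewrite (_ : _ \o _ = insert_coord i 0 \o set_val) // => x.
apply: continuous_comp; first exact: (@initial_continuous _ _ set_val).
exact: insert_coord_continuous.
Qed.

Definition singular_simplex n := continuousType (std_simplex R n) Z.

Definition singular_face n (s : singular_simplex n.+1) (i : 'I_n.+2) :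
    singular_simplex n :=
  s \o mkcts (@face_incl_continuous n i).

Definition singular_chain n := {freeg (singular_simplex n) / rat}.

Definition singular_boundary n : singular_chain n.+1 -> singular_chain n :=
  fglift (fun s => \sum_(i < n.+2)
                     (-1) ^+ i *: [freeg [:: (1 : rat, singular_face s i)]]).

HB.instance Definition _ n := GRing.Linear.on (@singular_boundary n).

Fact singular_faceC n (s : singular_simplex n.+2) (i : 'I_n.+3) (j : 'I_n.+2) :
  singular_face (singular_face s i) j =
  singular_face (singular_face s (face_swap (i, j)).1) (face_swap (i, j)).2.
Proof.
apply/continuousEP => x /=; congr (s _); apply/val_inj => /=.
exact: (insert_coordC _ _ (set_val x)).
Qed.

Fact singular_boundaryK n (c : singular_chain n.+2) :
  singular_boundary (singular_boundary c) = 0.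
Proof.
rewrite -[c]freeg_sumE !raddf_sum big1 // => s _.
have bdU m k (t : singular_simplex m.+1) :
    singular_boundary [freeg [:: (k, t)]] =
    k *: \sum_(i < m.+2) (-1) ^+ i *: [freeg [:: (1 : rat, singular_face t i)]].
  exact: liftU.
rewrite -[LHS]/(singular_boundary (singular_boundary _)) bdU linearZ linear_sum /=.
set S := \sum_(i < _) _; suff -> : S = 0 by rewrite scaler0.
pose F (ij : 'I_n.+3 * 'I_n.+2) : singular_chain n :=
  (-1) ^+ (ij.1 + ij.2) *:
    [freeg [:: (1 : rat, singular_face (singular_face s ij.1) ij.2)]].
have -> : S = \sum_ij F ij.
  rewrite -(pair_bigA _ (fun i j => F (i, j))) /=; apply: eq_bigr => i _.
  rewrite linearZ /= bdU scale1r scaler_sumr; apply: eq_bigr => j _.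
  by rewrite scalerA -exprD.
apply/eqP; rewrite -[_ == 0](_ : (2%:R *: \sum_ij F ij == 0) = _); last first.
  by rewrite scaler_eq0.
rewrite scaler_nat mulr2n {2}(reindex_inj (can_inj (@face_swapK n.+1))) /=.
rewrite -big_split big1 //= => -[i j] _.
rewrite /F -singular_faceC -scalerDl.
by rewrite -signr_odd -[X in _ + X]signr_odd face_swap_odd /=; case: odd;
  rewrite /= ?expr1 ?expr0 ?addNr ?subrr scale0r.
Qed.

(* Chains of the subspace A. *)
Definition chain_in (A : set Z) n : {pred singular_chain n} :=
  [pred c | `[< forall s : singular_simplex n, coeff s c != 0 -> range s `<=` A >]].

Fact chain_in_closed A n : submod_closed (@chain_in A n).
Proof.
split=> [|a c d /asboolP cA /asboolP dA]; apply/asboolP=> s.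
  by rewrite coeff0 eqxx.
rewrite coeffD coeffZ; have [->|/dA //] := eqVneq (coeff s d) 0.
by rewrite addr0 mulf_eq0 negb_or => /andP[_ /cA].
Qed.
HB.instance Definition _ A n := GRing.isSubmodClosed.Build rat
  (singular_chain n) (@chain_in A n) (@chain_in_closed A n).

(* Relative cycles of the pair (A, B). *)
Definition rel_cycle (A B : set Z) n : {pred singular_chain n} :=
  match n with
  | 0 => @chain_in A 0
  | n'.+1 => [pred c | (c \in @chain_in A n'.+1) &&
                      (singular_boundary c \in @chain_in B n')]
  end.

Definition rel_boundary (A B : set Z) n : {pred singular_chain n} :=
  [pred c | `[< exists2 d, d \in @chain_in A n.+1
                         & c - singular_boundary d \in @chain_in B n >]].

Fact rel_cycle_closed A B n : submod_closed (@rel_cycle A B n).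
Proof.
case: n => [|n]; first exact: chain_in_closed.
have [A0 AL] := chain_in_closed A n.+1; have [B0 BL] := chain_in_closed B n.
split=> [|a c d /andP[cA cB] /andP[dA dB]]; apply/andP; split=> //.
- by rewrite raddf0.
- exact: AL.
- by rewrite linearP; exact: BL.
Qed.
HB.instance Definition _ A B n := GRing.isSubmodClosed.Build rat
  (singular_chain n) (@rel_cycle A B n) (@rel_cycle_closed A B n).

Fact rel_boundary_closed A B n : submod_closed (@rel_boundary A B n).
Proof.
have [A0 AL] := chain_in_closed A n.+1; have [B0 BL] := chain_in_closed B n.
split=> [|a c d /asboolP[c' c'A cB] /asboolP[d' d'A dB]]; apply/asboolP.
  by exists 0 => //; rewrite raddf0 subr0.
exists (a *: c' + d'); first exact: AL.
rewrite linearP opprD addrACA -scalerBr.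
exact: BL.
Qed.
HB.instance Definition _ A B n := GRing.isSubmodClosed.Build rat
  (singular_chain n) (@rel_boundary A B n) (@rel_boundary_closed A B n).

(* H_n(A, B; Q), for B included in A. *)
Definition rel_homology (A B : set Z) n : lmodType rat :=
  @subquotient _ (@rel_cycle A B n) (@rel_boundary A B n).

(* The connecting homomorphism H_(n+1)(A, B) -> H_n(B) followed by
   H_n(B) -> H_n(B, C): the class of c is sent to the class of its boundary. *)
Section Connecting.
Variables (A B C : set Z) (n : nat).

Fact rel_cycle_boundary (c : singular_chain n.+1) :
  c \in @rel_cycle A B n.+1 -> singular_boundary c \in @rel_cycle B C n.
Proof.
move=> /andP[_]; case: n c => [//|m] c cB; apply/andP; split=> //.
by rewrite singular_boundaryK rpred0.
Qed.

Definition boundary_cycle (c : sub_elt (@rel_cycle A B n.+1)) :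
    sub_elt (@rel_cycle B C n) :=
  SubElt (rel_cycle_boundary (sub_valP c)).

Definition connecting (x : rel_homology A B n.+1) : rel_homology B C n :=
  subquotient_class _ (boundary_cycle (subquotient_repr x)).

Fact connecting_class (c : sub_elt (@rel_cycle A B n.+1)) :
  connecting (subquotient_class _ c) = subquotient_class _ (boundary_cycle c).
Proof.
apply/subquotient_classP; rewrite /= -raddfB.
have /subquotient_classP/asboolP[d dA cdB] :=
  subquotient_reprK (subquotient_class (@rel_boundary A B n.+1) c).
apply/asboolP; exists (sub_val (subquotient_repr
  (subquotient_class (@rel_boundary A B n.+1) c)) - sub_val c
  - singular_boundary d) => //.
by rewrite [X in _ - X]raddfB /= singular_boundaryK subr0 subrr rpred0.
Qed.

Fact connecting_linear : linear connecting.
Proof.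
move=> a x y; rewrite -[x]subquotient_reprK -[y]subquotient_reprK -linearP.
rewrite !connecting_class -linearP; congr subquotient_class.
by apply/val_inj; rewrite /= linearP.
Qed.
HB.instance Definition _ := GRing.isLinear.Build rat
  (rel_homology A B n.+1) (rel_homology B C n) _ connecting connecting_linear.
End Connecting.

End SingularHomology.

Definition cube (R : realType) n : set 'rV[R]_n :=
  [set x | forall i, -1 <= x ord0 i <= 1].
Arguments cube R n : clear implicits.

Definition open_cube (R : realType) n : set 'rV[R]_n :=
  [set x | forall i, -1 < x ord0 i < 1].
Arguments open_cube R n : clear implicits.

(* Whitehead's definition, with the cube as model of the closed n-ball:
   cw_map e restricted to the cube is the characteristic map of the n-cell e.
   The open cells partition the space (cw_cover, cw_disjoint), cell boundaries
   meet finitely many open cells, all of lower dimension, and the topology is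
   the weak one. *)
Record CW_complex (R : realType) (cell : nat -> Type) := CWComplex {
  cw_space :> topologicalType;
  cw_map : forall n, cell n -> 'rV[R]_n -> cw_space;
  cw_hausdorff : hausdorff_space cw_space;
  cw_continuous : forall n (e : cell n), {within cube R n, continuous (cw_map e)};
  cw_cover : forall z : cw_space,
    exists n (e : cell n) x, open_cube R n x /\ cw_map e x = z;
  cw_disjoint : forall n m (e : cell n) (e' : cell m) x y,
    open_cube R n x -> open_cube R m y -> cw_map e x = cw_map e' y ->
    existT (fun k => cell k * 'rV[R]_k)%type n (e, x) = existT _ m (e', y);
  cw_closure_finite : forall n (e : cell n),
    exists2 F : set {k & cell k}, finite_set F /\ (forall a, F a -> (tag a < n)%N)
      & forall x, cube R n x -> ~ open_cube R n x ->
          exists a y, [/\ F a, open_cube R (tag a) y & cw_map (tagged a) y = cw_map e x];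
  cw_weak : forall A : set cw_space,
    closed A <-> forall n (e : cell n), closed (cube R n `&` cw_map e @^-1` A) }.

Section CellularComplex.
Context (R : realType) (cell : nat -> Type) (Z : CW_complex R cell).

(* The union of the cells of dimension less than n, i.e. the (n-1)-skeleton. *)
Definition skeleton_lt n : set Z :=
  [set z | exists k (e : cell k) x, [/\ (k < n)%N, cube R k x & cw_map Z e x = z]].

(* H_n(Z^n, Z^(n-1); Q) *)
Definition cellular_chain n : lmodType rat :=
  rel_homology R (skeleton_lt n.+1) (skeleton_lt n) n.

Definition cellular_complex : Qcomplex :=
  @QComplex cellular_chain
    (fun n => @connecting R Z (skeleton_lt n.+2) (skeleton_lt n.+1) (skeleton_lt n) n).
End CellularComplex.

(* The n-cells are the elements of X_n, and the face {x_i = eps} of the cube of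
   C is attached along the cube of the eps-resolution of C at i. *)
Definition knot_attached (R : realType) (X : knot_flavour)
    (Z : CW_complex R (knot_type X)) : Prop :=
  forall n (C : knot_type X n.+1) i (eps : bool) (D : knot_type X n),
    resolution eps C i D ->
    forall x, cube R n x ->
      cw_map Z C (insert_coord i ((-1) ^+ (~~ eps)) x) = cw_map Z D x.

(* Main.v *)
Require Import Defs.
From HB Require Import structures.
From mathcomp Require Import all_boot all_order all_algebra generic_quotient.
From mathcomp Require Import all_classical all_reals all_analysis.
From mathcomp Require Import zify ring lra.
From mathcomp.multinomials Require Import freeg.
Import Order.TTheory GRing.Theory Num.Theory.
Import numFieldNormedType.Exports.
Set Implicit Arguments.
Unset Strict Implicit.
Unset Printing Implicit Defensive.
Local Open Scope classical_set_scope.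
Local Open Scope ring_scope.

(** Let X_n be sets with face maps satisfying the cubical identities. Attach an n-cube for each
    element of X_n: every point has a unique normal form (C, x) with x in an open cube, reached by
    deleting the extremal coordinates, and expanding the cubes from their centres retracts the
    complement of the centres of the n-cubes onto the (n-1)-skeleton. By excision the relative
    homology of the skeleta is sum over X_n of the local homology of R^n at 0, which is generated by
    the fundamental chain of the cube, and the boundary of that chain is the alternating sum of its
    faces.

    Faces of knot types are given by resolutions. In a family of immersed curves through an
    n-singular knot, compactness of the torus of pairs of parameters shows that the nearby members
    are singular knots as soon as this holds near each double point. A double point disappears if
    its two branches separate at first order transversally to both, which the displacement of a
    branch along a bump does. The admissible displacements of a given sign form a convex set, so
    that small resolutions of one sign are all isotopic; the class of the resolution is then locally
    constant along an isotopy. Displacements with disjoint supports commute, which yields the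
    cubical identities. *)

(** * Formal chains of affine simplices *)

(** Cones, subdivision and prisms are computed on lists of vertices, where they are identities in
    free modules, and are carried over to singular chains once. A singular simplex is first extended
    to the whole row space by a retraction, so that it can be composed with affine maps between
    vector spaces. In the same spirit the characteristic map of a cube is defined on all of R^n, and
    expanding a cube from its centre is multiplication by a scalar.

    [resolves] admits a push along any bump, neither small nor supported near one branch. Two such
    pushes are therefore not compared directly: each is compared with one small push whose bump is
    concentrated at one preimage of the double point, and only pushes of this kind are followed
    along an isotopy. That nearby curves are knots is proved once, for a filter on a parameter
    space; the filters used leave out the displacement 0, at which the double point is still there.

    A based isotopy comes without paths of its double points. Their continuity has to be derived
    from the order in which they are met. *)

Section FreeModules.
Local Notation "{ 'fg' K }" := {freeg K / rat} (at level 0).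

Lemma freeg_ind (K : choiceType) (P : {fg K} -> Prop) : P 0 ->
  (forall a k c, P c -> P (a *: << k >> + c)) -> forall c, P c.
Proof.
move=> P0 PS c; rewrite -[c]freeg_sumE.
elim: (freeg.dom c) => [|k s IH]; first by rewrite big_nil.
rewrite big_cons; suff -> : << coeff k c *g k >> = coeff k c *: << k >> :> {fg K}.
  exact: PS.
apply/eqP/freeg_eqP => x.
by rewrite coeffZ !coeffU mul1r.
Qed.

Lemma freeg_lin_ext (K : choiceType) (V : lmodType rat)
    (f g : {linear {fg K} -> V}) :
  (forall k, f << k >> = g << k >>) -> f =1 g.
Proof.
move=> fg; elim/freeg_ind => [|a k c IH]; first by rewrite !linear0.
by rewrite !linearP fg IH.
Qed.

Lemma fglift1 (K : choiceType) (V : lmodType rat) (f : K -> V) k :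
  fglift f << k >> = f k.
Proof. by rewrite liftU scale1r. Qed.

Definition chall (K : choiceType) (P : K -> Prop) (c : {fg K}) :=
  forall k, coeff k c != 0 -> P k.

Lemma chall0 (K : choiceType) (P : K -> Prop) : chall P 0.
Proof. by move=> k; rewrite coeff0 eqxx. Qed.

Lemma challP (K : choiceType) (P : K -> Prop) a c d :
  chall P c -> chall P d -> chall P (a *: c + d).
Proof.
move=> cP dP k; rewrite coeffD coeffZ.
have [->|/dP //] := eqVneq (coeff k d) 0.
by rewrite addr0 mulf_eq0 negb_or => /andP[_ /cP].
Qed.

Lemma challB (K : choiceType) (P : K -> Prop) c d :
  chall P c -> chall P d -> chall P (c - d).
Proof. by move=> cP dP; rewrite addrC -scaleN1r; apply: challP. Qed.

Lemma challU (K : choiceType) (P : K -> Prop) k : P k -> chall P << k >>.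
Proof. by move=> Pk l; rewrite coeffU mul1r; have [<-|_] := eqVneq k l; rewrite ?eqxx. Qed.

Lemma chall_sum (K : choiceType) (P : K -> Prop) (I : Type) (r : seq I) (Q : pred I)
    (F : I -> {fg K}) :
  (forall i, Q i -> chall P (F i)) -> chall P (\sum_(i <- r | Q i) F i).
Proof.
move=> FP; apply: (big_ind (chall P)) => //; first exact: chall0.
by move=> c d cP dP; rewrite -[c]scale1r; exact: challP.
Qed.

Lemma challZ (K : choiceType) (P : K -> Prop) a c : chall P c -> chall P (a *: c).
Proof. by move=> cP; rewrite -[_ *: _]addr0; apply: challP => //; exact: chall0. Qed.

Lemma chall_impl (K : choiceType) (P Q : K -> Prop) c :
  (forall k, P k -> Q k) -> chall P c -> chall Q c.
Proof. by move=> PQ cP k /cP/PQ. Qed.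

Lemma chall_ind (K : choiceType) (P : K -> Prop) (S : {fg K} -> Prop) : S 0 ->
  (forall a k c, P k -> S c -> S (a *: << k >> + c)) ->
  forall c, chall P c -> S c.
Proof.
move=> S0 SS c cP; rewrite -[c]freeg_sumE.
have : forall k, k \in freeg.dom c -> P k by move=> k; rewrite mem_dom => /cP.
elim: (freeg.dom c) => [|k s IH] sub; first by rewrite big_nil.
rewrite big_cons; have -> : << coeff k c *g k >> = coeff k c *: << k >> :> {fg K}.
  by apply/eqP/freeg_eqP => x; rewrite coeffZ !coeffU mul1r.
apply: SS; last by apply: IH => x xs; apply: sub; rewrite inE xs orbT.
by apply: sub; rewrite mem_head.
Qed.

Lemma chall_lift (K L : choiceType) (P : K -> Prop) (Q : L -> Prop)
    (f : K -> {fg L}) c :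
  (forall k, P k -> chall Q (f k)) -> chall P c -> chall Q (fglift f c).
Proof.
move=> fPQ; move: c; apply: chall_ind; first by rewrite linear0; exact: chall0.
by move=> a k c Pk IH; rewrite linearP /= fglift1; apply: challP => //; exact: fPQ.
Qed.
End FreeModules.

(* Formal chains: s stands for the affine simplex with vertices s; the empty
   list spans the augmentation degree. *)
Section FormalChains.
Context (V : choiceType).
Local Notation fch := {freeg (seq V) / rat}.

Definition cone (b : V) : fch -> fch := fglift (fun s => << b :: s >>).
HB.instance Definition _ b := GRing.Linear.on (cone b).

Fixpoint bds (s : seq V) : fch :=
  if s is v :: s' then << s' >> - cone v (bds s') else 0.

Definition bd : fch -> fch := fglift bds.
HB.instance Definition _ := GRing.Linear.on bd.

Lemma coneE b s : cone b << s >> = << b :: s >>. Proof. exact: fglift1. Qed.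
Lemma bdE s : bd << s >> = bds s. Proof. exact: fglift1. Qed.

(** The empty list counts as a simplex of dimension -1, so the cone formula has no exception at
    vertices and later inductions need no special low degree. *)
Lemma bd_cone b c : bd (cone b c) = c - cone b (bd c).
Proof.
apply: (@freeg_lin_ext _ _ (bd \o cone b) (idfun \- (cone b \o bd))) => s /=.
by rewrite coneE !bdE.
Qed.

Lemma bd_bd c : bd (bd c) = 0.
Proof.
elim/freeg_ind: c => [|a s c IH]; first by rewrite !linear0.
rewrite !linearP /= IH addr0 bdE; apply/eqP; rewrite scaler_eq0; apply/orP; right.
apply/eqP; elim: s => [|v s IHs] /=; first by rewrite linear0.
by rewrite linearB /= bdE bd_cone IHs linear0 subr0 subrr.
Qed.

Lemma bds_sum s :
  bds s = \sum_(i < size s) (-1) ^+ i *: << take i s ++ drop i.+1 s >>.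
Proof.
elim: s => [|v s IH] /=; first by rewrite big_ord0.
rewrite big_ord_recl /= expr0 scale1r drop0 IH; congr (_ + _).
rewrite linear_sum -sumrN; apply: eq_bigr => i _ /=.
by rewrite linearZ /= coneE exprS mulN1r scaleNr.
Qed.

Section Subdivision.
Variable b : seq V -> V.

(** Barycentric subdivision; [Tn] is the homotopy that joins it to the identity. Only naturality of
    the centre [b] matters later. The counter is fuel: on a list of length [n], [n] steps reach
    exactly the empty face. *)
Fixpoint sdn n (s : seq V) : fch :=
  if n is n'.+1 then cone (b s) (fglift (sdn n') (bds s)) else << s >>.
Fixpoint Tn n (s : seq V) : fch :=
  if n is n'.+1 then cone (b s) (<< s >> - fglift (Tn n') (bds s)) else 0.
Definition sd n : fch -> fch := fglift (sdn n).
HB.instance Definition _ n := GRing.Linear.on (sd n).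
Definition sdT n : fch -> fch := fglift (Tn n).
HB.instance Definition _ n := GRing.Linear.on (sdT n).

Lemma sdE n s : sd n << s >> = sdn n s. Proof. exact: fglift1. Qed.
Lemma sdTE n s : sdT n << s >> = Tn n s. Proof. exact: fglift1. Qed.
Lemma sdS n s : sd n.+1 << s >> = cone (b s) (sd n (bd << s >>)).
Proof. by rewrite sdE bdE. Qed.
Lemma sdTS n s : sdT n.+1 << s >> = cone (b s) (<< s >> - sdT n (bd << s >>)).
Proof. by rewrite sdTE bdE. Qed.

Lemma sd0 c : sd 0 c = c.
Proof.
elim/freeg_ind: c => [|a s c IH]; first by rewrite linear0.
by rewrite linearP /= IH sdE.
Qed.

Lemma sdT0 c : sdT 0 c = 0.
Proof.
elim/freeg_ind: c => [|a s c IH]; first by rewrite linear0.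
by rewrite linearP /= IH sdTE scaler0 addr0.
Qed.

(** The term that [bd_cone] leaves over is, by induction, a cone on the subdivision of a double
    boundary. *)
Lemma bd_sd n c : bd (sd n.+1 c) = sd n (bd c).
Proof.
elim: n c => [|n IHn]; apply: (@freeg_lin_ext _ _ (bd \o sd _) (sd _ \o bd)) => s /=.
  by rewrite sdS bd_cone !sd0 bd_bd linear0 oppr0 addr0.
by rewrite sdS bd_cone IHn bd_bd !linear0 ?oppr0 ?addr0.
Qed.

Lemma bd_sdT n c : bd (sdT n.+1 c) = c - sd n.+1 c - sdT n (bd c).
Proof.
elim: n c => [|n IHn];
  apply: (@freeg_lin_ext _ _ (bd \o sdT _) (idfun \- sd _ \- (sdT _ \o bd))) => s /=.
  by rewrite sdTS sdS bd_cone !sd0 !sdT0 !subr0.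
rewrite sdTS sdS bd_cone (linearB bd) /= IHn bd_bd linear0 subr0 subKr.
by rewrite addrAC.
Qed.
End Subdivision.
End FormalChains.

Section FormalMaps.
Context (V W : choiceType).

Definition fcmap (f : V -> W) : {freeg (seq V) / rat} -> {freeg (seq W) / rat} :=
  fglift (fun s => << map f s >>).
HB.instance Definition _ f := GRing.Linear.on (fcmap f).

Lemma fcmapE f s : fcmap f << s >> = << map f s >>. Proof. exact: fglift1. Qed.

Lemma fcmap_cone f b c : fcmap f (cone b c) = cone (f b) (fcmap f c).
Proof.
apply: (@freeg_lin_ext _ _ (fcmap f \o cone b) (cone (f b) \o fcmap f)) => s /=.
by rewrite !coneE !fcmapE coneE.
Qed.

Lemma fcmap_bd f c : fcmap f (bd c) = bd (fcmap f c).
Proof.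
apply: (@freeg_lin_ext _ _ (fcmap f \o @bd _) (@bd _ \o fcmap f)) => s /=.
rewrite !fcmapE !bdE; elim: s => [|v s IHs] /=; first by rewrite linear0.
by rewrite linearB /= fcmap_cone IHs fcmapE.
Qed.

Lemma fcmap_sd (f : V -> W) bV bW n c :
  (forall s, f (bV s) = bW (map f s)) -> fcmap f (sd bV n c) = sd bW n (fcmap f c).
Proof.
move=> fb; elim: n c => [|n IHn] c; first by rewrite !sd0.
apply: (@freeg_lin_ext _ _ (fcmap f \o sd _ _) (sd _ _ \o fcmap f)) => s /=.
by rewrite fcmapE !sdS fcmap_cone IHn fb fcmap_bd fcmapE.
Qed.

Lemma fcmap_sdT (f : V -> W) bV bW n c :
  (forall s, f (bV s) = bW (map f s)) -> fcmap f (sdT bV n c) = sdT bW n (fcmap f c).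
Proof.
move=> fb; elim: n c => [|n IHn] c; first by rewrite !sdT0 linear0.
apply: (@freeg_lin_ext _ _ (fcmap f \o sdT _ _) (sdT _ _ \o fcmap f)) => s /=.
by rewrite fcmapE !sdTS fcmap_cone linearB /= IHn fb fcmap_bd fcmapE.
Qed.

Section Prism.
Variables (b w : V -> W).

(** Unwound, this is the usual prism operator: the alternating sum over i of the simplices [b] v_0,
    ..., [b] v_i, [w] v_i, ..., [w] v_n. *)
Fixpoint prs (s : seq V) : {freeg (seq W) / rat} :=
  if s is v :: s' then << b v :: w v :: map w s' >> - cone (b v) (prs s') else 0.
Definition prism : {freeg (seq V) / rat} -> {freeg (seq W) / rat} := fglift prs.
HB.instance Definition _ := GRing.Linear.on prism.

Lemma prismE s : prism << s >> = prs s. Proof. exact: fglift1. Qed.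

Lemma prism_cone v c :
  prism (cone v c) = cone (b v) (cone (w v) (fcmap w c)) - cone (b v) (prism c).
Proof.
apply: (@freeg_lin_ext _ _ (prism \o cone v)
  ((cone (b v) \o (cone (w v) \o fcmap w)) \- (cone (b v) \o prism))) => s /=.
by rewrite coneE !prismE fcmapE !coneE.
Qed.

Lemma bd_prism c : bd (prism c) = fcmap w c - fcmap b c - prism (bd c).
Proof.
apply: (@freeg_lin_ext _ _ (@bd _ \o prism)
  (fcmap w \- fcmap b \- (prism \o @bd _))) => s /=.
elim: s => [|v s IHs].
  rewrite prismE !fcmapE !bdE /= linear0 subrr sub0r.
  by rewrite linear0 oppr0.
move: IHs; rewrite !prismE !fcmapE !bdE /= => IHs.
rewrite !linearB /= bd_cone IHs bdE /= !linearB /= prism_cone prismE coneE.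
have -> : bds (map w s) = fcmap w (bds s) by rewrite -!bdE fcmap_bd fcmapE.
rewrite !coneE; set x := cone _ (fcmap w _); set y := cone _ (prism _).
set p := prs s; set q := cone _ (cone _ _).
rewrite !opprK -!addrA (addrCA (- p)) (addrCA q) addKr.
by rewrite (addrCA (- p)) (addrCA q) (addrCA q (- p)).
Qed.
End Prism.
End FormalMaps.

(** * Retraction of the row space onto the standard simplex *)

Section Simplices.
Context (R : realType).

(** Take positive parts, with sum S. If S < 1 the deficit is shared equally among the coordinates,
    if S > 1 one divides by S; the two maxima join these cases continuously and keep the denominator
    at least 1. *)
Definition retv n (x : 'rV[R]_n.+1) : 'rV[R]_n.+1 :=
  let S := \sum_i Num.max (x ord0 i) 0 in
  \row_i ((Num.max (x ord0 i) 0 + Num.max (1 - S) 0 / n.+1%:R) / Num.max S 1).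

Lemma retv_simplex n (x : 'rV[R]_n.+1) : std_simplex R n (retv x).
Proof.
set S := \sum_i Num.max (x ord0 i) 0.
have S0 : 0 <= S by apply: sumr_ge0 => i _; rewrite le_max lexx orbT.
have m0 : 0 < Num.max S 1 by rewrite lt_max ltr01 orbT.
split=> [i|]; rewrite /retv -/S.
  rewrite mxE divr_ge0 ?(ltW m0) // addr_ge0 ?le_max ?lexx ?orbT //.
  by rewrite divr_ge0 // le_max lexx orbT.
under eq_bigr do rewrite mxE.
rewrite -mulr_suml big_split /= -/S sumr_const card_ord.
rewrite -[X in _ + X]mulr_natr divfK ?pnatr_eq0 //.
apply: (canLR (mulfK (lt0r_neq0 m0))); rewrite mul1r.
have [S1|/ltW S1] := lerP S 1; first by rewrite max_l ?subr_ge0 // addrC subrK.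
by rewrite max_r ?subr_le0 // addr0.
Qed.

Lemma retv_id n (x : 'rV[R]_n.+1) : std_simplex R n x -> retv x = x.
Proof.
move=> [x0 x1]; apply/rowP => i; rewrite mxE.
have e j : Num.max (x ord0 j) 0 = x ord0 j by rewrite max_l.
rewrite (eq_bigr _ (fun j _ => e j)) x1 e subrr !maxxx mul0r addr0 divr1.
by rewrite (ord1 0).
Qed.

Section ContinuousAt.
Context (V : normedModType R) (T : topologicalType).

Lemma contD (f g : T -> V) : continuous f -> continuous g ->
  continuous (fun y => f y + g y).
Proof. by move=> cf cg x; apply: cvgD; [exact: cf|exact: cg]. Qed.

Lemma contB (f g : T -> V) : continuous f -> continuous g ->
  continuous (fun y => f y - g y).
Proof. by move=> cf cg x; apply: cvgB; [exact: cf|exact: cg]. Qed.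

Lemma contZ (a : T -> R) (f : T -> V) : continuous a -> continuous f ->
  continuous (fun y => a y *: f y).
Proof. by move=> cf cg x; apply: cvgZ; [exact: cf|exact: cg]. Qed.

Lemma contM (f g : T -> R) : continuous f -> continuous g ->
  continuous (fun y => f y * g y).
Proof. by move=> cf cg x; apply: cvgM; [exact: cf|exact: cg]. Qed.

Lemma contV (f : T -> R) : (forall x, f x != 0) -> continuous f ->
  continuous (fun y => (f y)^-1).
Proof. by move=> f0 cf x; apply: cvgV; [exact: f0|exact: cf]. Qed.

Lemma contmax (f g : T -> R) : continuous f -> continuous g ->
  continuous (fun y => Num.max (f y) (g y)).
Proof. by move=> cf cg x; apply: continuous_max; [exact: cf|exact: cg]. Qed.

Lemma contcst (T' : topologicalType) (a : T') : continuous (fun _ : T => a).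
Proof. exact: cst_continuous. Qed.

Lemma cvg_sum_ord n (F : 'I_n -> T -> V) :
  (forall i, continuous (F i)) -> continuous (fun y => \sum_(i < n) F i y).
Proof.
move=> cF; elim: n F cF => [|n IH] F cF.
  rewrite (_ : (fun _ => _) = fun=> 0); first exact: cst_continuous.
  by apply/funext => y; rewrite big_ord0.
rewrite (_ : (fun _ => _) =
    (fun y => (\sum_(i < n) F (widen_ord (leqnSn n) i) y) + F ord_max y)); last first.
  by apply/funext => y; rewrite big_ord_recr.
by apply: contD; [apply: IH => i; exact: cF|exact: cF].
Qed.
End ContinuousAt.

Lemma continuous_row (T : topologicalType) n (F : T -> 'rV[R]_n) :
  (forall i, continuous (fun y => F y ord0 i)) -> continuous F.
Proof.
move=> cF; rewrite (_ : F = fun y => \sum_(i < n) (F y ord0 i) *: delta_mx ord0 i); last first.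
  by apply/funext => y; rewrite [LHS]row_sum_delta.
by apply: cvg_sum_ord => i; apply: contZ; [exact: cF|exact: contcst].
Qed.

Lemma continuous_entry n (i : 'I_n) : continuous (fun x : 'rV[R]_n => x ord0 i).
Proof. exact: coord_continuous. Qed.

Lemma retv_continuous n : continuous (@retv n).
Proof.
have cm i : continuous (fun x : 'rV[R]_n.+1 => Num.max (x ord0 i) 0).
  by apply: contmax; [exact: continuous_entry|exact: cst_continuous].
have cS : continuous (fun x : 'rV[R]_n.+1 => \sum_i Num.max (x ord0 i) 0).
  by apply: cvg_sum_ord => i; exact: cm.
have cc (a : R) : continuous (fun x : 'rV[R]_n.+1 => a) by exact: cst_continuous.
apply: continuous_row => i.
rewrite (_ : (fun _ => _) = (fun y : 'rV[R]_n.+1 => (Num.max (y ord0 i) 0 +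
  Num.max (1 - \sum_i Num.max (y ord0 i) 0) 0 / n.+1%:R) /
  Num.max (\sum_i Num.max (y ord0 i) 0) 1)); last by apply/funext => y; rewrite mxE.
apply: contM; last first.
  apply: contV; first by move=> x; rewrite gt_eqF // lt_max ltr01 orbT.
  by apply: contmax; [exact: cS|exact: contcst].
apply: contD; first exact: cm.
apply: contM; last exact: contcst.
by apply: contmax; [apply: contB; [exact: contcst|exact: cS]|exact: contcst].
Qed.

Definition ret n (x : 'rV[R]_n.+1) : std_simplex R n :=
  exist _ (retv x) (mem_set (retv_simplex x)).

Lemma ret_continuous n : continuous (@ret n).
Proof.
apply: continuous_comp_initial; rewrite (_ : _ \o _ = @retv n) //.
exact: retv_continuous.
Qed.

Lemma ret_val n (x : std_simplex R n) : ret (set_val x) = x.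
Proof. by apply/val_inj => /=; rewrite retv_id //; apply: set_mem; exact: valP. Qed.

End Simplices.

(** * Singular chains given by maps on the whole row space *)

Section Spx.
Context (R : realType) (Z : topologicalType).

Lemma cont_set_val n (f : 'rV[R]_n.+1 -> Z) : continuous f ->
  continuous (fun x : std_simplex R n => f (set_val x)).
Proof. by move=> cf x; apply: continuous_comp; [exact: initial_continuous|exact: cf]. Qed.

Definition spx n (f : 'rV[R]_n.+1 -> Z) (cf : continuous f) : singular_simplex R Z n :=
  mkcts (cont_set_val cf).

(** Extends a singular simplex beyond the simplex, which frees the later constructions from the
    subtype of points of the simplex. *)
Definition hat n (s : singular_simplex R Z n) (x : 'rV[R]_n.+1) : Z := s (ret x).

Lemma hat_continuous n (s : singular_simplex R Z n) : continuous (hat s).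
Proof.
move=> x; apply: (@continuous_comp _ _ _ (@ret R n)); first exact: ret_continuous.
exact: cts_fun.
Qed.

(** The default 0 makes the simplex of [f] a total function of [f], so that chains can be written
    and rewritten without a proof of continuity inside them. *)
Definition sx n (f : 'rV[R]_n.+1 -> Z) : singular_chain R Z n :=
  if pselect (continuous f) is left cf then << spx cf >> else 0.

Lemma sxE n (f : 'rV[R]_n.+1 -> Z) (cf : continuous f) : sx f = << spx cf >>.
Proof. by rewrite /sx; case: pselect => // cf'; rewrite (Prop_irrelevance cf' cf). Qed.

Lemma sx_eq n (f g : 'rV[R]_n.+1 -> Z) : continuous f -> continuous g ->
  (forall x, std_simplex R n x -> f x = g x) -> sx f = sx g.
Proof.
move=> cf cg fg; rewrite (sxE cf) (sxE cg); congr << _ >>.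
apply/continuousEP => x.
change (f (set_val x) = g (set_val x)); rewrite fg //; apply: set_mem; exact: valP.
Qed.

Lemma sx_hat n (s : singular_simplex R Z n) : sx (hat s) = << s >>.
Proof.
rewrite (sxE (@hat_continuous _ s)); congr << _ >>.
apply/continuousEP => x.
change (s (ret (set_val x)) = s x); by rewrite ret_val.
Qed.

Lemma sbdE n (s : singular_simplex R Z n.+1) : singular_boundary << s >> =
  \sum_(i < n.+2) (-1) ^+ i *: << singular_face s i >>.
Proof. exact: fglift1. Qed.

Lemma sbd_sx n (f : 'rV[R]_n.+2 -> Z) : continuous f ->
  singular_boundary (sx f) =
  \sum_(i < n.+2) (-1) ^+ i *: sx (fun x => f (insert_coord i 0 x)).
Proof.
move=> cf; rewrite (sxE cf) sbdE; apply: eq_bigr => i _; congr (_ *: _).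
have ci : continuous (fun x => f (insert_coord i 0 x)).
  move=> x; apply: continuous_comp; first exact: insert_coord_continuous.
  exact: cf.
by rewrite (sxE ci); congr << _ >>; apply/continuousEP.
Qed.

Lemma sx_in (A : set Z) n (f : 'rV[R]_n.+1 -> Z) :
  (forall x, std_simplex R n x -> A (f x)) -> sx f \in @chain_in R Z A n.
Proof.
move=> fA; rewrite /sx; case: pselect => [cf|_]; last exact: rpred0.
apply/asboolP; apply: challU => _ [x _ <-] /=; apply: fA.
by apply: set_mem; exact: valP.
Qed.

Lemma chain_in_ind (A : set Z) n (P : singular_chain R Z n -> Prop) : P 0 ->
  (forall a f c, continuous f -> (forall x, A (f x)) -> P c -> P (a *: sx f + c)) ->
  forall c, c \in @chain_in R Z A n -> P c.
Proof.
move=> P0 PS c /asboolP; move: c; apply: chall_ind => // a s c sA Pc.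
rewrite -sx_hat; apply: PS => //; first exact: hat_continuous.
by move=> x; apply: sA; exists (ret x).
Qed.

Lemma sx_ind n (P : singular_chain R Z n -> Prop) : P 0 ->
  (forall a f c, continuous f -> P c -> P (a *: sx f + c)) -> forall c, P c.
Proof.
move=> P0 PS c; apply: (chain_in_ind (A := setT)) => //; first by move=> *; exact: PS.
by apply/asboolP.
Qed.

Lemma chain_inS (A B : set Z) n c : A `<=` B -> c \in @chain_in R Z A n -> c \in @chain_in R Z B n.
Proof. by move=> AB /asboolP cA; apply/asboolP => s /cA sA; exact: subset_trans sA AB. Qed.

Lemma chain_inI (A B : set Z) n c : c \in @chain_in R Z A n -> c \in @chain_in R Z B n ->
  c \in @chain_in R Z (A `&` B) n.
Proof.
move=> /asboolP cA /asboolP cB; apply/asboolP => s s0 x sx; split.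
  exact: cA sx.
exact: cB sx.
Qed.

Lemma chain_in_setT n c : c \in @chain_in R Z (@setT Z) n.
Proof. by apply/asboolP. Qed.

Lemma chain_in_bd (A : set Z) n c : c \in @chain_in R Z A n.+1 ->
  singular_boundary c \in @chain_in R Z A n.
Proof.
move: c; apply: chain_in_ind => [|a f c cf fA IH]; first by rewrite linear0 rpred0.
rewrite linearP /= rpredD // rpredZ // sbd_sx // rpred_sum // => i _.
by rewrite rpredZ // sx_in.
Qed.

Section Realization.
Context (V : normedModType R).

Definition aff n (s : seq V) (x : 'rV[R]_n.+1) : V :=
  \sum_(i < n.+1) x ord0 i *: nth 0 s i.

Lemma aff_continuous n s : continuous (@aff n s).
Proof.
apply: cvg_sum_ord => i; apply: contZ; [exact: continuous_entry|exact: contcst].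
Qed.

Lemma aff_insert n s (i : 'I_n.+2) (x : 'rV[R]_n.+1) : size s = n.+2 ->
  aff s (insert_coord i 0 x) = aff (take i s ++ drop i.+1 s) x.
Proof.
move=> sz; rewrite /aff (bigD1_ord i) //= mxE unlift_none /= scale0r add0r.
apply: eq_bigr => j _; rewrite mxE liftK /=; congr (_ *: _).
rewrite nth_cat size_take sz ltn_ord.
rewrite /bump; case: ltnP => ji; first by rewrite nth_take //; congr nth; lia.
by rewrite nth_drop; congr nth; lia.
Qed.

(** Lists of the wrong length are sent to 0, so that the realization is linear on all formal
    chains. *)
Definition rz n (f : V -> Z) : {freeg (seq V) / rat} -> singular_chain R Z n :=
  fglift (fun s => if size s == n.+1 then sx (f \o @aff n s) else 0).
HB.instance Definition _ n f := GRing.Linear.on (rz n f).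

Lemma rzE n f s : size s = n.+1 -> rz n f << s >> = sx (f \o @aff n s).
Proof. by move=> sz; rewrite /rz fglift1 sz eqxx. Qed.

Lemma rz_cont n (f : V -> Z) s : continuous f -> continuous (f \o @aff n s).
Proof. by move=> cf x; apply: continuous_comp; [exact: aff_continuous|exact: cf]. Qed.

Definition lst n (D : set V) (s : seq V) := size s = n /\ forall v, v \in s -> D v.

Lemma rz_bd n f c : continuous f -> chall (lst n.+2 setT) c ->
  singular_boundary (rz n.+1 f c) = rz n f (bd c).
Proof.
move=> cf; move: c; apply: chall_ind => [|a s c [sz _] IH]; first by rewrite !linear0.
rewrite !linearP /= IH rzE // sbd_sx; last exact: rz_cont.
congr (_ + _); congr (_ *: _).
rewrite bdE bds_sum linear_sum sz; apply: eq_bigr => i _.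
rewrite linearZ /= rzE; last first.
  by rewrite size_cat size_take size_drop sz ltn_ord; have := ltn_ord i; lia.
by congr (_ *: sx _); apply/funext => x /=; rewrite aff_insert.
Qed.

Lemma rz_eq n (f g : V -> Z) (D : set V) c : continuous f -> continuous g ->
  (forall s x, lst n.+1 D s -> std_simplex R n x -> f (aff s x) = g (aff s x)) ->
  chall (lst n.+1 D) c -> rz n f c = rz n g c.
Proof.
move=> cf cg fg; move: c; apply: chall_ind => [|a s c sD IH]; first by rewrite !linear0.
have [sz _] := sD.
rewrite !linearP /= IH !rzE //; congr (_ *: _ + _); apply: sx_eq; try exact: rz_cont.
by move=> x Dx /=; exact: fg.
Qed.

Lemma rz_in (A : set Z) n f c : (forall v, A (f v)) -> rz n f c \in @chain_in R Z A n.
Proof.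
move=> fA; elim/freeg_ind: c => [|a s c IH]; first by rewrite linear0 rpred0.
rewrite linearP /= rpredD // rpredZ // /rz fglift1; case: ifP => _; last exact: rpred0.
by apply: sx_in => x _; exact: fA.
Qed.
End Realization.
End Spx.

(** * Singular chains, subdivision and prisms *)

Lemma fcmap_prism (V W V' W' : choiceType) (b w : V -> W) (b' w' : V' -> W')
    (p : W -> W') (q : V -> V') c :
  (forall v, p (b v) = b' (q v)) -> (forall v, p (w v) = w' (q v)) ->
  fcmap p (prism b w c) = prism b' w' (fcmap q c).
Proof.
move=> pb pw.
apply: (@freeg_lin_ext _ _ (fcmap p \o prism b w) (prism b' w' \o fcmap q)) => s /=.
rewrite fcmapE !prismE; elim: s => [|v s IHs] /=; first by rewrite linear0.
rewrite linearB /= fcmapE fcmap_cone IHs pb /= pb pw -!map_comp; congr (<< _ :: _ :: _ >> - _).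
by apply: eq_map => u /=; rewrite pw.
Qed.

Section Lists.
Context (R : realType) (V : normedModType R).
Implicit Types (D : set V) (s : seq V).

Lemma lst_cone n D b c : D b -> chall (lst n D) c -> chall (lst n.+1 D) (cone b c).
Proof.
move=> Db; apply: chall_lift => s [sz sD]; apply: challU; split=> /=; first by rewrite sz.
by move=> v; rewrite inE => /orP[/eqP->|/sD].
Qed.

Lemma lst_bds n D s : lst n.+1 D s -> chall (lst n D) (bds s).
Proof.
elim: n s => [|n IH] [|v s] [//= [sz] sD].
  case: s sz sD => //= _ sD; rewrite linear0 subr0; apply: challU; split=> // u.
have sD' u : u \in s -> D u by move=> us; apply: sD; rewrite inE us orbT.
apply: challB; first exact: challU.
by apply: lst_cone; [apply: sD; rewrite inE eqxx|exact: IH].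
Qed.

Lemma lst_bd n D c : chall (lst n.+1 D) c -> chall (lst n D) (bd c).
Proof. by apply: chall_lift => s; exact: lst_bds. Qed.

Section Sub.
Variables (b : seq V -> V) (D : set V).
Hypothesis bD : forall s, (0 < size s)%N -> (forall v, v \in s -> D v) -> D (b s).

Lemma lst_sd n c : chall (lst n D) c -> chall (lst n D) (sd b n c).
Proof.
elim: n c => [|n IH] c; first by rewrite sd0.
apply: chall_lift => s [sz sD]; rewrite -sdE sdS; apply: lst_cone.
  by apply: bD; rewrite ?sz.
by apply: IH; rewrite bdE; exact: lst_bds.
Qed.

Lemma lst_sdT n c : chall (lst n D) c -> chall (lst n.+1 D) (sdT b n c).
Proof.
elim: n c => [|n IH] c; first by rewrite sdT0 => _; exact: chall0.
apply: chall_lift => s [sz sD]; rewrite -sdTE sdTS; apply: lst_cone.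
  by apply: bD; rewrite ?sz.
by apply: challB; [exact: challU|apply: IH; rewrite bdE; exact: lst_bds].
Qed.
End Sub.

Definition bary s : V := (size s)%:R^-1 *: \sum_(v <- s) v.
End Lists.

Lemma bary_lin (R : realType) (V W : normedModType R) (l : {linear V -> W}) s :
  l (bary s) = bary (map l s).
Proof. by rewrite /bary linearZ linear_sum size_map big_map. Qed.

Lemma lst_prism (R : realType) (V W : normedModType R) (b w : V -> W)
    (D : set V) (D' : set W) n c :
  (forall v, D v -> D' (b v)) -> (forall v, D v -> D' (w v)) ->
  chall (lst n D) c -> chall (lst n.+1 D') (prism b w c).
Proof.
move=> bD wD; apply: chall_lift => s; elim: n s => [|n IH] [|v s] [//= sz sD].
  exact: chall0.
have sD' u : u \in s -> D u by move=> us; apply: sD; rewrite inE us orbT.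
have Dv : D v by apply: sD; rewrite inE eqxx.
apply: challB; last by apply: lst_cone; [exact: bD|apply: IH; split=> //; case: sz].
apply: challU; split=> [|u] /=; first by rewrite size_map; congr _.+2; case: sz.
rewrite !inE => /orP[/eqP->|/orP[/eqP->|/mapP[x xs ->]]]; [exact: bD|exact: wD|].
by apply: wD; exact: sD'.
Qed.

Section Affine.
Context (R : realType).

Lemma aff_linear (V : normedModType R) n (s : seq V) : linear (@aff R V n s).
Proof.
move=> a x y; rewrite /aff scaler_sumr -big_split; apply: eq_bigr => i _ /=.
by rewrite !mxE scalerDl scalerA.
Qed.
HB.instance Definition _ (V : normedModType R) n (s : seq V) :=
  GRing.isLinear.Build R 'rV[R]_n.+1 V _ (@aff R V n s) (aff_linear s).

Lemma aff_map (V W : normedModType R) (l : {linear V -> W}) n s (x : 'rV[R]_n.+1) :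
  size s = n.+1 -> aff (map l s) x = l (aff s x).
Proof.
move=> sz; rewrite linear_sum; apply: eq_bigr => i _.
by rewrite linearZ /= (nth_map 0) // sz.
Qed.

Lemma aff_map_fst (V W : normedModType R) n s (x : 'rV[R]_n.+1) :
  size s = n.+1 -> aff (map fst s) x = (aff s x : V * W).1.
Proof.
have ll : linear (@fst V W) by [].
pose lM := GRing.isLinear.Build _ _ _ _ _ ll.
pose L : {linear (V * W)%type -> V} := HB.pack (@fst V W) lM.
exact: (aff_map L).
Qed.

Lemma aff_map_snd (V W : normedModType R) n s (x : 'rV[R]_n.+1) :
  size s = n.+1 -> aff (map snd s) x = (aff s x : V * W).2.
Proof.
have ll : linear (@snd V W) by [].
pose lM := GRing.isLinear.Build _ _ _ _ _ ll.
pose L : {linear (V * W)%type -> W} := HB.pack (@snd V W) lM.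
exact: (aff_map L).
Qed.

Definition evs n : seq 'rV[R]_n.+1 := [seq delta_mx ord0 i | i <- enum 'I_n.+1].

Lemma size_evs n : size (evs n) = n.+1.
Proof. by rewrite size_map size_enum_ord. Qed.

Lemma nth_evs n (i : 'I_n.+1) : nth 0 (evs n) i = delta_mx ord0 i.
Proof. by rewrite (nth_map ord0) ?size_enum_ord // nth_ord_enum. Qed.

Lemma aff_evs n (x : 'rV[R]_n.+1) : aff (evs n) x = x.
Proof. by rewrite [RHS]row_sum_delta; apply: eq_bigr => i _; rewrite nth_evs. Qed.

Lemma map_aff_evs (V : normedModType R) n (s : seq V) :
  size s = n.+1 -> map (@aff R V n s) (evs n) = s.
Proof.
move=> sz; apply: (@eq_from_nth _ 0); first by rewrite size_map size_evs.
move=> i; rewrite size_map size_evs => ni; rewrite (nth_map 0) ?size_evs //.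
rewrite (nth_evs (Ordinal ni)) /aff (bigD1 (Ordinal ni)) //= mxE !eqxx scale1r.
rewrite big1 ?addr0 // => j ji; rewrite mxE eqxx /= (negPf ji).
by rewrite scale0r.
Qed.

Lemma std_simplex_aff n k (s : seq 'rV[R]_k.+1) x :
  lst n.+1 (std_simplex R k) s -> std_simplex R n x -> std_simplex R k (aff s x).
Proof.
move=> [sz sD] [x0 x1].
have sD' i : (i < n.+1)%N -> std_simplex R k (nth 0 s i).
  by move=> ni; apply: sD; rewrite mem_nth // sz.
split=> [i|].
  rewrite summxE sumr_ge0 // => j _; rewrite mxE mulr_ge0 //.
  by have [+ _] := sD' j (ltn_ord j); apply.
under eq_bigr do rewrite summxE; rewrite exchange_big /= -x1; apply: eq_bigr => j _.
under eq_bigr do rewrite mxE; rewrite -mulr_sumr.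
by have [_ ->] := sD' j (ltn_ord j); rewrite mulr1.
Qed.

Lemma delta_simplex n i : std_simplex R n (delta_mx ord0 i).
Proof.
split=> [j|]; first by rewrite mxE; case: (_ && _).
by rewrite (bigD1 i) //= mxE !eqxx big1 ?addr0 // => j ji; rewrite mxE (negPf ji).
Qed.

Lemma lst_evs n : lst n.+1 (std_simplex R n) (evs n).
Proof.
split=> [|v]; first exact: size_evs.
by move/mapP=> [i _ ->]; exact: delta_simplex.
Qed.

Lemma bary_simplex n (s : seq 'rV[R]_n.+1) : (0 < size s)%N ->
  (forall v, v \in s -> std_simplex R n v) -> std_simplex R n (bary s).
Proof.
move=> s0 sD; split=> [i|].
  rewrite mxE mulr_ge0 ?invr_ge0 // summxE big_seq sumr_ge0 // => v vs.
  by have [+ _] := sD v vs; apply.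
under eq_bigr do rewrite mxE summxE; rewrite -mulr_sumr exchange_big /=.
rewrite big_seq (eq_bigr (fun=> 1)) => [|v vs]; last by have [_ ->] := sD v vs.
rewrite -big_seq big_const_seq count_predT iter_addr_0.
by rewrite mulVf // pnatr_eq0 -lt0n.
Qed.
End Affine.

Section Ops.
Context (R : realType).
Implicit Types Z : topologicalType.

Lemma rz_map Z (V W : normedModType R) n (f : V -> Z) (l : W -> V) (D : set W) c :
  (forall s x, lst n.+1 D s -> std_simplex R n x -> aff (map l s) x = l (aff s x)) ->
  continuous f -> continuous (f \o l) -> chall (lst n.+1 D) c ->
  rz n f (fcmap l c) = rz n (f \o l) c.
Proof.
move=> ls cf cfl; move: c; apply: chall_ind => [|a s c sD IH]; first by rewrite !linear0.
have [sz _] := sD; rewrite !linearP /= IH fcmapE !rzE ?size_map //.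
congr (_ + _); congr (_ *: _); apply: sx_eq; try exact: rz_cont.
by move=> x Dx /=; rewrite ls.
Qed.

Lemma rz_evs Z n (s : singular_simplex R Z n) : rz n (hat s) << evs R n >> = << s >>.
Proof.
rewrite rzE ?size_evs // -sx_hat; congr sx; apply/funext => x /=.
by rewrite aff_evs.
Qed.

Lemma hat_spx Z n (f : 'rV[R]_n.+1 -> Z) (cf : continuous f) x :
  hat (spx cf) x = f (retv x).
Proof. by []. Qed.

Lemma continuous_pair (T U W : topologicalType) (f : T -> U) (g : T -> W) :
  continuous f -> continuous g -> continuous (fun x => (f x, g x)).
Proof. by move=> cf cg x; exact: (cvg_pair (cf x) (cg x)). Qed.

Lemma continuous_fst (T U : topologicalType) : continuous (fun p : T * U => p.1).
Proof. by move=> p; exact: cvg_fst. Qed.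

Lemma continuous_snd (T U : topologicalType) : continuous (fun p : T * U => p.2).
Proof. by move=> p; exact: cvg_snd. Qed.

Definition pushf Z Z' (p : Z -> Z') n : singular_chain R Z n -> singular_chain R Z' n :=
  fglift (fun s => sx (p \o hat s)).
HB.instance Definition _ Z Z' (p : Z -> Z') n := GRing.Linear.on (@pushf Z Z' p n).

Lemma continuous_o (T U W : topologicalType) (g : U -> W) (f : T -> U) :
  continuous g -> continuous f -> continuous (g \o f).
Proof. by move=> cg cf x; apply: continuous_comp; [exact: cf|exact: cg]. Qed.

Lemma push_sx Z Z' (p : Z -> Z') n (f : 'rV[R]_n.+1 -> Z) :
  continuous p -> continuous f -> pushf p (sx f) = sx (p \o f).
Proof.
move=> cp cf; rewrite (sxE cf) /pushf fglift1; apply: sx_eq.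
- by apply: continuous_o => //; exact: hat_continuous.
- exact: continuous_o.
- by move=> x Dx; change (p (f (retv x)) = p (f x)); rewrite retv_id.
Qed.

Lemma push_rz Z Z' (p : Z -> Z') (V : normedModType R) n (f : V -> Z) c :
  continuous p -> continuous f -> pushf p (rz n f c) = rz n (p \o f) c.
Proof.
move=> cp cf; elim/freeg_ind: c => [|a s c IH]; first by rewrite !linear0.
rewrite !linearP /= IH; congr (_ + _); congr (_ *: _).
rewrite /rz !fglift1; case: ifP => _; last by rewrite linear0.
by rewrite push_sx //; exact: rz_cont.
Qed.

Lemma push_bd Z Z' (p : Z -> Z') n (c : singular_chain R Z n.+1) : continuous p ->
  singular_boundary (pushf p c) = pushf p (singular_boundary c).
Proof.
move=> cp; move: c; apply: sx_ind => [|a f c cf IH]; first by rewrite !linear0.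
rewrite !linearP /= IH; congr (_ + _); congr (_ *: _).
rewrite push_sx // !sbd_sx //; last exact: continuous_o.
rewrite linear_sum; apply: eq_bigr => i _; rewrite linearZ /= push_sx //.
by move=> x; apply: continuous_comp; [exact: insert_coord_continuous|exact: cf].
Qed.

Lemma push_in Z Z' (p : Z -> Z') (A : set Z) (B : set Z') n c :
  (forall z, A z -> B (p z)) -> c \in @chain_in R Z A n -> pushf p c \in @chain_in R Z' B n.
Proof.
move=> pAB; move: c; apply: chain_in_ind => [|a f c cf fA IH].
  by rewrite linear0 rpred0.
rewrite linearP /= rpredD // rpredZ // (sxE cf) /pushf fglift1.
by apply: sx_in => x _ /=; apply: pAB; exact: fA.
Qed.

Lemma push_comp Z Z' Z'' (p : Z -> Z') (q : Z' -> Z'') n (c : singular_chain R Z n) :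
  continuous p -> continuous q -> pushf q (pushf p c) = pushf (q \o p) c.
Proof.
move=> cp cq; move: c; apply: sx_ind => [|a f c cf IH]; first by rewrite !linear0.
rewrite !linearP /= IH !push_sx //; first exact: continuous_o.
exact: continuous_o.
Qed.

Lemma push_id Z n (c : singular_chain R Z n) : pushf id c = c.
Proof.
move: c; apply: sx_ind => [|a f c cf IH]; first by rewrite !linear0.
by rewrite !linearP /= IH push_sx // => x; exact: cvg_id.
Qed.

(** All vertices of [U] lie in the standard simplex, hence so do its affine simplices, and there the
    retraction inside [hat] is the identity. *)
Lemma rz_natural Z (V : normedModType R) n m (f : V -> Z) s U
    (cf : continuous f) (cg : continuous (f \o @aff R V n s)) :
  size s = n.+1 -> chall (lst m.+1 (std_simplex R n)) U ->
  rz m (hat (spx cg)) U = rz m f (fcmap (@aff R V n s) U).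
Proof.
move=> sz UD; rewrite (rz_map (D := std_simplex R n)) //; last first.
  by move=> t x [tz _] _; rewrite aff_map.
apply: rz_eq UD => //; first exact: hat_continuous.
move=> t x tD Dx; rewrite hat_spx retv_id //.
exact: std_simplex_aff tD Dx.
Qed.

Section Subdiv.
Context (Z : topologicalType).

Definition ssd n : singular_chain R Z n -> singular_chain R Z n :=
  fglift (fun s => rz n (hat s) (sd (@bary R _) n.+1 << evs R n >>)).
HB.instance Definition _ n := GRing.Linear.on (@ssd n).

Definition ssdT n : singular_chain R Z n -> singular_chain R Z n.+1 :=
  fglift (fun s => rz n.+1 (hat s) (sdT (@bary R _) n.+1 << evs R n >>)).
HB.instance Definition _ n := GRing.Linear.on (@ssdT n).

(** Every affine simplex is the image of the standard one under the linear map [aff s], and linear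
    maps preserve barycentres; so the subdivision of the model simplex determines that of every
    realized chain. *)
Lemma ssd_rz (V : normedModType R) n (f : V -> Z) c : continuous f ->
  chall (lst n.+1 setT) c -> ssd (rz n f c) = rz n f (sd (@bary R _) n.+1 c).
Proof.
move=> cf; move: c; apply: chall_ind => [|a s c [sz _] IH]; first by rewrite !linear0.
rewrite !linearP /= IH; congr (_ + _); congr (_ *: _).
rewrite rzE // (sxE (rz_cont cf)) /ssd fglift1 rz_natural //; last first.
  by apply: lst_sd; [exact: bary_simplex|apply: challU; exact: lst_evs].
by rewrite (fcmap_sd _ _ (bary_lin _)) fcmapE map_aff_evs.
Qed.

Lemma ssdT_rz (V : normedModType R) n (f : V -> Z) c : continuous f ->
  chall (lst n.+1 setT) c -> ssdT (rz n f c) = rz n.+1 f (sdT (@bary R _) n.+1 c).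
Proof.
move=> cf; move: c; apply: chall_ind => [|a s c [sz _] IH]; first by rewrite !linear0.
rewrite !linearP /= IH; congr (_ + _); congr (_ *: _).
rewrite rzE // (sxE (rz_cont cf)) /ssdT fglift1 rz_natural //; last first.
  by apply: lst_sdT; [exact: bary_simplex|apply: challU; exact: lst_evs].
by rewrite (fcmap_sdT _ _ (bary_lin _)) fcmapE map_aff_evs.
Qed.

Lemma lst_evsT n : chall (lst n.+1 setT) << evs R n >>.
Proof. by apply: challU; split; [exact: size_evs|]. Qed.

Lemma ssd_bd n (c : singular_chain R Z n.+1) :
  singular_boundary (ssd c) = ssd (singular_boundary c).
Proof.
apply: (@freeg_lin_ext _ _ (@singular_boundary R Z n \o @ssd _)
  (@ssd _ \o @singular_boundary R Z n)) => s /=.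
have cs := hat_continuous (s := s).
rewrite -rz_evs ssd_rz ?rz_bd ?ssd_rz //; try exact: lst_evsT.
- by rewrite bd_sd.
- by apply: lst_bd; exact: lst_evsT.
- by apply: lst_sd => //; exact: lst_evsT.
Qed.

Lemma ssdT_bd0 (c : singular_chain R Z 0) : singular_boundary (ssdT c) = c - ssd c.
Proof.
apply: (@freeg_lin_ext _ _ (@singular_boundary R Z 0 \o @ssdT _)
  (idfun \- @ssd _)) => s /=.
have cs := hat_continuous (s := s).
rewrite -rz_evs ssd_rz ?ssdT_rz ?rz_bd //; try exact: lst_evsT.
  by rewrite bd_sdT sdT0 subr0 linearB.
by apply: lst_sdT => //; exact: lst_evsT.
Qed.

Lemma ssdT_bd n (c : singular_chain R Z n.+1) :
  singular_boundary (ssdT c) = c - ssd c - ssdT (singular_boundary c).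
Proof.
apply: (@freeg_lin_ext _ _ (@singular_boundary R Z n.+1 \o @ssdT _)
  (idfun \- @ssd _ \- (@ssdT _ \o @singular_boundary R Z n))) => s /=.
have cs := hat_continuous (s := s).
rewrite -rz_evs ssd_rz ?ssdT_rz ?rz_bd ?ssdT_rz //; try exact: lst_evsT.
- by rewrite bd_sdT !linearB.
- by apply: lst_bd; exact: lst_evsT.
- by apply: lst_sdT => //; exact: lst_evsT.
Qed.

Lemma ssd_in (A : set Z) n c : c \in @chain_in R Z A n -> ssd c \in @chain_in R Z A n.
Proof.
move=> /asboolP; move: c; apply: chall_ind => [|a s c sA IH]; first by rewrite linear0 rpred0.
rewrite linearP /= rpredD // rpredZ // /ssd fglift1; apply: rz_in => v.
by apply: sA; exists (ret v).
Qed.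

Lemma ssdT_in (A : set Z) n c : c \in @chain_in R Z A n -> ssdT c \in @chain_in R Z A n.+1.
Proof.
move=> /asboolP; move: c; apply: chall_ind => [|a s c sA IH]; first by rewrite linear0 rpred0.
rewrite linearP /= rpredD // rpredZ // /ssdT fglift1; apply: rz_in => v.
by apply: sA; exists (ret v).
Qed.

Lemma ssd_cycle (A B : set Z) n c : c \in @rel_cycle R Z A B n -> ssd c \in @rel_cycle R Z A B n.
Proof.
case: n c => [|n] c; first exact: ssd_in.
by move=> /andP[cA cB]; apply/andP; rewrite ssd_bd; split; exact: ssd_in.
Qed.

Lemma ssd_hom (A B : set Z) n c :
  c \in @rel_cycle R Z A B n -> c - ssd c \in @rel_boundary R Z A B n.
Proof.
case: n c => [|n] c.
  move=> cA; apply/asboolP; exists (ssdT c); first exact: ssdT_in.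
  by rewrite ssdT_bd0 subrr rpred0.
move=> /andP[cA cB]; apply/asboolP; exists (ssdT c); first exact: ssdT_in.
by rewrite ssdT_bd opprB addrCA subrr addr0; exact: ssdT_in.
Qed.

Lemma ssdN_hom (A B : set Z) n N c : c \in @rel_cycle R Z A B n ->
  iter N (@ssd n) c \in @rel_cycle R Z A B n /\
  c - iter N (@ssd n) c \in @rel_boundary R Z A B n.
Proof.
move=> cAB; elim: N => [|N [IH1 IH2]] /=; first by rewrite subrr rpred0.
split; first exact: ssd_cycle.
by rewrite -(subrKA (iter N (@ssd n) c)) rpredD // ssd_hom.
Qed.
End Subdiv.

Section Prism.
Context (Z Z' : topologicalType) (G : Z * R -> Z').
Hypothesis cG : continuous G.

Definition inc0 (V : normedModType R) (v : V) : V * R := (v, 0).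
Definition inc1 (V : normedModType R) (v : V) : V * R := (v, 1).

(** The homotopy [G] has all of R as its time axis, and the containment lemmas below ask for a
    condition at every real time. The homotopies to which this is applied clamp the time to
    [0, 1]. *)
Definition sprism n : singular_chain R Z n -> singular_chain R Z' n.+1 :=
  fglift (fun s => rz n.+1 (fun p : 'rV[R]_n.+1 * R => G (hat s p.1, p.2))
                     (prism (@inc0 _) (@inc1 _) << evs R n >>)).
HB.instance Definition _ n := GRing.Linear.on (@sprism n).

Lemma continuous_G (V : normedModType R) (f : V -> Z) : continuous f ->
  continuous (fun p : V * R => G (f p.1, p.2)).
Proof.
move=> cf; apply: (continuous_o cG (f := fun p : V * R => (f p.1, p.2))).
apply: continuous_pair; last exact: continuous_snd.
by apply: (continuous_o cf); exact: continuous_fst.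
Qed.

Lemma sprism_rz (V : normedModType R) n (f : V -> Z) c : continuous f ->
  chall (lst n.+1 setT) c ->
  sprism (rz n f c) =
  rz n.+1 (fun p : V * R => G (f p.1, p.2)) (prism (@inc0 _) (@inc1 _) c).
Proof.
move=> cf; move: c; apply: chall_ind => [|a s c [sz _] IH]; first by rewrite !linear0.
rewrite !linearP /= IH; congr (_ + _); congr (_ *: _).
have cg := rz_cont (n := n) (s := s) cf.
rewrite rzE // (sxE cg) /sprism fglift1.
pose D := [set p : 'rV[R]_n.+1 * R | std_simplex R n p.1].
have UD : chall (lst n.+2 D) (prism (@inc0 _) (@inc1 _) << evs R n >>).
  by apply: (lst_prism (D := std_simplex R n)) => //; apply: challU; exact: lst_evs.
pose l (p : 'rV[R]_n.+1 * R) : V * R := (aff s p.1, p.2).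
have ll : linear l.
  by move=> k p q; rewrite /l /= linearP.
pose lM := GRing.isLinear.Build _ _ _ _ _ ll.
pose L : {linear ('rV[R]_n.+1 * R)%type -> (V * R)%type} := HB.pack l lM.
have -> : << s >> = fcmap (@aff R V n s) << evs R n >> by rewrite fcmapE map_aff_evs.
rewrite -(@fcmap_prism _ _ _ _ (@inc0 _) (@inc1 _) _ _ L) //.
have cl : continuous L.
  apply: (continuous_pair (f := fun p : 'rV[R]_n.+1 * R => aff s p.1));
    last exact: continuous_snd.
  by apply: (continuous_o (@aff_continuous _ _ _ s)); exact: continuous_fst.
rewrite (rz_map (D := D)) //; last 3 first.
- by move=> t x [tz _] _; rewrite aff_map.
- exact: continuous_G.
- by apply: (continuous_o (continuous_G cf)).
apply: rz_eq UD => //; first by apply: continuous_G; exact: hat_continuous.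
  by apply: (continuous_o (continuous_G cf)).
move=> t x tD Dx; rewrite hat_spx retv_id //.
have -> : (aff t x).1 = aff (map fst t) x.
  by rewrite (aff_map_fst) //; case: tD.
apply: std_simplex_aff Dx; split; first by rewrite size_map; case: tD.
by move=> v /mapP[p pt ->]; case: tD => _ /(_ _ pt).
Qed.

Definition G0 z := G (z, 0).
Definition G1 z := G (z, 1).

Lemma rz_inc (V : normedModType R) n (f : V -> Z) c (t : R) : continuous f ->
  chall (lst n.+1 setT) c ->
  rz n (fun p : V * R => G (f p.1, p.2)) (fcmap (fun v => (v, t)) c) =
  rz n (fun v => G (f v, t)) c.
Proof.
move=> cf cD; rewrite (rz_map (D := setT)) //.
- move=> s x [sz _] [_ x1]; rewrite [LHS]surjective_pairing; congr pair.
    by rewrite -aff_map_fst ?size_map // -map_comp map_id_in.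
  rewrite -aff_map_snd ?size_map // -map_comp /aff.
  rewrite -[RHS]mul1r -x1 mulr_suml; apply: eq_bigr => i _.
  by rewrite (nth_map 0) ?sz.
- exact: continuous_G.
- apply: (continuous_o (continuous_G cf)).
  by apply: (continuous_pair (f := id)) => // ?; [exact: cvg_id|exact: cst_continuous].
Qed.

Lemma continuous_Gt t : continuous (fun z => G (z, t)).
Proof.
apply: (continuous_o cG (f := fun z => (z, t))).
by apply: (continuous_pair (f := id)) => // ?; [exact: cvg_id|exact: cst_continuous].
Qed.

Lemma sprism_bd0 (c : singular_chain R Z 0) :
  singular_boundary (sprism c) = pushf G1 c - pushf G0 c.
Proof.
apply: (@freeg_lin_ext _ _ (@singular_boundary R Z' 0 \o @sprism _)
  (@pushf Z Z' G1 0 \- @pushf Z Z' G0 0)) => s /=.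
have cs := hat_continuous (s := s).
have c1 : continuous G1 by exact: continuous_Gt.
have c0 : continuous G0 by exact: continuous_Gt.
rewrite -rz_evs sprism_rz ?rz_bd ?push_rz //; try exact: lst_evsT.
(* The boundary of a vertex is the empty simplex, whose prism is 0. *)
- rewrite bd_prism bdE (_ : prism _ _ (bds _) = 0).
    by rewrite subr0 linearB /= !rz_inc //; exact: lst_evsT.
  case: (evs R 0) (size_evs R 0) => [|v [|]] //= _.
  by rewrite linear0 subr0 prismE.
- exact: continuous_G.
- by apply: lst_prism; last exact: lst_evsT.
Qed.

Lemma sprism_bd n (c : singular_chain R Z n.+1) :
  singular_boundary (sprism c) =
  pushf G1 c - pushf G0 c - sprism (singular_boundary c).
Proof.
apply: (@freeg_lin_ext _ _ (@singular_boundary R Z' n.+1 \o @sprism _)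
  (@pushf Z Z' G1 n.+1 \- @pushf Z Z' G0 n.+1 \- (@sprism _ \o @singular_boundary R Z n))) => s /=.
have cs := hat_continuous (s := s).
have c1 : continuous G1 by exact: continuous_Gt.
have c0 : continuous G0 by exact: continuous_Gt.
rewrite -rz_evs sprism_rz ?rz_bd ?push_rz ?sprism_rz //; try exact: lst_evsT.
- by rewrite bd_prism !linearB /= !rz_inc //; exact: lst_evsT.
- by apply: lst_bd; exact: lst_evsT.
- exact: continuous_G.
- by apply: lst_prism; last exact: lst_evsT.
Qed.

Lemma sprism_in (A : set Z) (B : set Z') n c : (forall z t, A z -> B (G (z, t))) ->
  c \in @chain_in R Z A n -> sprism c \in @chain_in R Z' B n.+1.
Proof.
move=> AB /asboolP; move: c; apply: chall_ind => [|a s c sA IH]; first by rewrite linear0 rpred0.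
rewrite linearP /= rpredD // rpredZ // /sprism fglift1; apply: rz_in => v.
by apply: AB; apply: sA; exists (ret v.1).
Qed.

Lemma sprism_hom (A B : set Z) (A' B' : set Z') n c :
  (forall z t, A z -> A' (G (z, t))) -> (forall z t, B z -> B' (G (z, t))) ->
  c \in @rel_cycle R Z A B n ->
  pushf G1 c - pushf G0 c \in @rel_boundary R Z' A' B' n.
Proof.
move=> GA GB; case: n c => [|n] c.
  move=> cA; apply/asboolP; exists (sprism c); first exact: sprism_in cA.
  by rewrite sprism_bd0 subrr rpred0.
move=> /andP[cA cB]; apply/asboolP; exists (sprism c); first exact: sprism_in cA.
by rewrite sprism_bd opprB addrCA subrr addr0; exact: sprism_in cB.
Qed.
End Prism.
End Ops.

(** * Iterated subdivision makes chains small *)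

Section SmallChains.
Context (R : realType).

Definition mesh (V : normedModType R) (d : R) (s : seq V) :=
  forall u v, u \in s -> v \in s -> `|u - v| <= d.

Lemma sum_seq_const (V : lmodType R) (T : Type) (s : seq T) (x : V) :
  \sum_(i <- s) x = (size s)%:R *: x.
Proof.
elim: s => [|y s IH]; first by rewrite big_nil scale0r.
by rewrite big_cons IH /= -natr1 scalerDl scale1r addrC.
Qed.

(** The vector to the barycentre is the mean of the n+1 differences u - v, and the one with u = v
    vanishes; this gives the factor n/(n+1). *)
Lemma bary_dist (V : normedModType R) n d (s : seq V) v : size s = n.+1 ->
  0 <= d -> mesh d s -> v \in s -> `|bary s - v| <= n%:R / n.+1%:R * d.
Proof.
move=> sz d0 sd vs.
have -> : bary s - v = n.+1%:R^-1 *: \sum_(u <- s) (u - v).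
  rewrite /bary sz sumrB scalerBr; congr (_ - _).
  by rewrite sum_seq_const sz scalerA mulVf ?scale1r // pnatr_eq0.
rewrite normrZ normfV ger0_norm // mulrC [leRHS]mulrAC ler_pM2r ?invr_gt0 ?ltr0n //.
  rewrite (big_rem v) //= subrr add0r.
  apply: le_trans (ler_norm_sum _ _ _) _.
  have -> : n%:R * d = \sum_(u <- rem v s) d.
    by rewrite (sum_seq_const (V := R)) size_rem // sz.
  rewrite big_seq [leRHS]big_seq; apply: ler_sum => u us.
  by apply: sd => //; exact: mem_rem us.
Qed.

Lemma ball_bary (V : normedModType R) (b : V) r (s : seq V) : (0 < size s)%N ->
  (forall v, v \in s -> `|b - v| <= r) -> `|b - bary s| <= r.
Proof.
move=> s0 sr.
have sz : (size s)%:R != 0 :> R by rewrite pnatr_eq0 -lt0n.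
have -> : b - bary s = (size s)%:R^-1 *: \sum_(u <- s) (b - u).
  rewrite /bary sumrB scalerBr; congr (_ - _).
  by rewrite sum_seq_const scalerA mulVf ?scale1r.
rewrite normrZ normfV ger0_norm // mulrC ler_pdivrMr ?ltr0n //.
apply: le_trans (ler_norm_sum _ _ _) _.
have -> : r * (size s)%:R = \sum_(u <- s) r.
  by rewrite (sum_seq_const (V := R)) mulrC.
by rewrite big_seq [leRHS]big_seq; apply: ler_sum => u us; exact: sr.
Qed.

Definition fine (V : normedModType R) n d (s : seq V) := size s = n /\ mesh d s.

Lemma bds_fine (V : normedModType R) n d (s : seq V) :
  fine n.+1 d s -> chall (fine n d) (bds s) /\ chall (lst n [set v | v \in s]) (bds s).
Proof.
move=> [sz sd]; have sl : chall (lst n [set v | v \in s]) (bds s).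
  by apply: lst_bds; split.
split=> //; apply: chall_impl sl => t [tz ts]; split=> // u v ut vt.
by apply: sd; exact: ts.
Qed.

(** A simplex of the subdivision is a cone from a barycentre: its base is treated by induction, its
    apex by [bary_dist] and convexity of balls. The bound [m] stays fixed while [n] decreases, so
    that all faces contract by the same factor. *)
Lemma fine_sd (V : normedModType R) m n d c : (n <= m.+1)%N -> 0 <= d ->
  chall (@fine V n d) c ->
  chall (@fine V n (m%:R / m.+1%:R * d)) (sd (@bary R V) n c).
Proof.
move=> + d0; have q0 : 0 <= m%:R / m.+1%:R * d by rewrite mulr_ge0 // divr_ge0.
elim: n c => [|n IH] c nm.
  by rewrite sd0; apply: chall_impl => s [/size0nil -> _].
apply: chall_lift => s [sz sm]; rewrite -sdE sdS bdE.
have [bf bl] := bds_fine (conj sz sm).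
have b1 v : v \in s -> `|bary s - v| <= m%:R / m.+1%:R * d.
  move=> vs; apply: le_trans (bary_dist sz d0 sm vs) _.
  rewrite ler_wpM2r // ler_pdivlMr ?ltr0n // mulrAC ler_pdivrMr ?ltr0n //.
  by rewrite -!natrM ler_nat; lia.
have b2 : chall (lst n [set v | `|bary s - v| <= m%:R / m.+1%:R * d])
    (sd (@bary R V) n (bds s)).
  apply: lst_sd => [t t0 tb|]; first exact: ball_bary.
  by apply: chall_impl bl => t [tz ts]; split=> // v /ts/b1.
have b3 := IH _ (ltnW nm) bf.
apply: (chall_lift (P := fun t => fine n (m%:R / m.+1%:R * d) t /\
   lst n [set v | `|bary s - v| <= m%:R / m.+1%:R * d] t)); last first.
  by move=> t t0; split; [exact: b3|exact: b2].
move=> t [[tz tm] [_ tb]]; apply: challU; split; first by rewrite /= tz.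
move=> u v; rewrite !inE => /orP[/eqP->|ut] /orP[/eqP->|vt].
- by rewrite subrr normr0.
- exact: tb.
- by rewrite distrC; exact: tb.
- exact: tm.
Qed.

Lemma fine_sdN (V : normedModType R) n d e c : 0 <= d -> 0 < e ->
  chall (@fine V n.+1 d) c ->
  exists N, chall (@fine V n.+1 e) (iter N (sd (@bary R V) n.+1) c).
Proof.
move=> d0 e0 cd; pose q : R := n%:R / n.+1%:R.
have q0 : 0 <= q by rewrite divr_ge0.
have H N : chall (@fine V n.+1 (q ^+ N * d)) (iter N (sd (@bary R V) n.+1) c).
  elim: N => [|N IH]; first by rewrite expr0 mul1r.
  rewrite exprS -mulrA; apply: fine_sd => //.
  by rewrite mulr_ge0 // exprn_ge0.
have q1 : `|q| < 1 by rewrite ger0_norm // ltr_pdivrMr ?ltr0n // mul1r ltr_nat.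
(* Dividing by d + 1 rather than d covers the case d = 0. *)
have /cvgrPdist_lt/(_ (e / (d + 1))) := cvg_expr q1.
rewrite divr_gt0 ?ltr_wpDl // => /(_ isT) [N _ /(_ N (leqnn _))].
rewrite /= sub0r normrN ger0_norm ?exprn_ge0 // ltr_pdivlMr ?ltr_wpDl // => qN.
exists N; apply: chall_impl (H N) => s [sz sm]; split=> // u v us vs.
apply: le_trans (sm _ _ us vs) _; apply: le_trans (ltW qN).
by rewrite ler_wpM2l ?exprn_ge0 // lerDl.
Qed.

Lemma compact_simplex n : compact (std_simplex R n).
Proof.
have cI : compact [set v : 'rV[R]_n.+1 | forall i, `[0, 1]%classic (v ord0 i)].
  by apply: (@rV_compact R n.+1 (fun=> `[0, 1]%classic)) => i; exact: segment_compact.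
apply: (subclosed_compact _ cI).
  rewrite (_ : std_simplex R n = (\bigcap_(i : 'I_n.+1) [set x : 'rV[R]_n.+1 | 0 <= x ord0 i]) `&`
     ((fun x : 'rV[R]_n.+1 => \sum_i x ord0 i) @^-1` [set 1])).
    apply: closedI.
      apply: closed_bigI => i _; apply: (@closed_comp _ _ (fun x : 'rV[R]_n.+1 => x ord0 i) [set r | 0 <= r]).
        by move=> x _; exact: continuous_entry.
      exact: closed_ge.
    apply: closed_comp; last exact: closed_eq.
    by move=> x _; apply: cvg_sum_ord => i; exact: continuous_entry.
  by apply/seteqP; split=> x [x0 x1]; split=> //= i; [move=> _; exact: x0|exact: x0].
move=> x [x0 x1] i /=; rewrite in_itv /= x0 -x1 (bigD1 i) //= lerDl.
by apply: sumr_ge0.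
Qed.

Lemma lebesgue_number (Z : topologicalType) n (f : 'rV[R]_n.+1 -> Z) (O1 O2 : set Z) :
  continuous f -> open O1 -> open O2 ->
  (forall x, std_simplex R n x -> O1 (f x) \/ O2 (f x)) ->
  exists2 e, 0 < e & forall y, std_simplex R n y ->
    (forall z, `|y - z| <= e -> O1 (f z)) \/ (forall z, `|y - z| <= e -> O2 (f z)).
Proof.
move=> cf o1 o2 cov.
have /compact_near_coveringP := @compact_simplex n.
move/(_ R (0 : R)^'+ (fun e y => (forall z, `|y - z| <= e -> O1 (f z)) \/
  (forall z, `|y - z| <= e -> O2 (f z)))).
have sub (O : set Z) x : open O -> O (f x) ->
  \forall x' \near x & i \near (0 : R)^'+, forall z, `|x' - z| <= i -> O (f z).
  move=> oO Ox.
  have /nbhs_ballP[r /= r0 rO] : nbhs x (f @^-1` O).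
    by apply: cf; exact: open_nbhs_nbhs.
  exists (ball x (r / 2), [set i | i < r / 2]); first split=> /=.
  - by apply: nbhsx_ballx; rewrite divr_gt0.
  - by apply: nbhs_right_lt; rewrite divr_gt0.
  move=> [x' i] /= [xx' ir] z x'z; apply: rO.
  rewrite -ball_normE /=; move: xx'; rewrite -ball_normE /= => xx'.
  apply: le_lt_trans (ler_distD x' _ _) _; rewrite (splitr r).
  by apply: ltrD => //; exact: le_lt_trans x'z ir.
move=> H; have /H : forall x, std_simplex R n x ->
  \forall x' \near x & i \near (0 : R)^'+, (forall z, `|x' - z| <= i -> O1 (f z)) \/
  (forall z, `|x' - z| <= i -> O2 (f z)).
  by move=> x /cov [/(sub _ _ o1)|/(sub _ _ o2)]; apply: filterS => -[x' i] /=; [left|right].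
move=> E; near (0 : R)^'+ => e; exists e; first by near: e; exact: nbhs_right_gt.
by move=> y Dy; move: y Dy; near: e; exact: E.
Unshelve. all: by end_near. Qed.

Lemma iter_ssd_rz (Z : topologicalType) (V : normedModType R) n N (f : V -> Z) c :
  continuous f -> chall (lst n.+1 setT) c ->
  iter N (@ssd R Z n) (rz n f c) = rz n f (iter N (sd (@bary R V) n.+1) c).
Proof.
move=> cf cl; have H : forall N, chall (lst n.+1 setT) (iter N (sd (@bary R V) n.+1) c).
  by elim=> [//|M IH]; exact: lst_sd.
by elim: N => [//|N IH] /=; rewrite IH ssd_rz.
Qed.

Lemma iter_ssd_lin (Z : topologicalType) n N a (c d : singular_chain R Z n) :
  iter N (@ssd R Z n) (a *: c + d) = a *: iter N (@ssd R Z n) c + iter N (@ssd R Z n) d.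
Proof. by elim: N => [//|N IH] /=; rewrite IH linearP. Qed.

Lemma iter_ssd_in (Z : topologicalType) (A : set Z) n N c :
  c \in @chain_in R Z A n -> iter N (@ssd R Z n) c \in @chain_in R Z A n.
Proof. by move=> cA; elim: N => [//|N IH] /=; exact: ssd_in. Qed.

Lemma iter_ssd_bd (Z : topologicalType) n N (c : singular_chain R Z n.+1) :
  singular_boundary (iter N (@ssd R Z _) c) = iter N (@ssd R Z _) (singular_boundary c).
Proof. by elim: N => [//|N IH] /=; rewrite ssd_bd IH. Qed.

Lemma mesh_bounded (V : normedModType R) (s : seq V) : exists2 d, 0 <= d & mesh d s.
Proof.
have s0 (r : seq V) : 0 <= \sum_(w <- r) `|w| by exact: sumr_ge0.
exists (\sum_(w <- s) `|w| + \sum_(w <- s) `|w|); first by rewrite addr_ge0.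
have le u : u \in s -> `|u| <= \sum_(w <- s) `|w|.
  by move=> us; rewrite (big_rem u) //= lerDl.
by move=> u v /le us /le vs; apply: le_trans (ler_normB _ _) _; exact: lerD.
Qed.

(** The excision step. The number of subdivisions differs from simplex to simplex, but further
    subdivision keeps a chain inside its open set, so that in the induction on [c] the numbers can
    be added. *)
Lemma small_chain (Z : topologicalType) (A O1 O2 : set Z) n c : open O1 -> open O2 ->
  A `<=` O1 `|` O2 -> c \in @chain_in R Z A n ->
  exists N c1 c2, [/\ iter N (@ssd R Z n) c = c1 + c2,
    c1 \in @chain_in R Z (A `&` O1) n & c2 \in @chain_in R Z (A `&` O2) n].
Proof.
move=> o1 o2 cov; move: c; apply: chain_in_ind => [|a f c cf fA [N [c1 [c2 [e1 e2 e3]]]]].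
  by exists 0%N, 0, 0; rewrite /= addr0 !rpred0.
have covf x : std_simplex R n x -> O1 (f x) \/ O2 (f x) by move=> _; exact: cov.
have [e e0 eL] := lebesgue_number cf o1 o2 covf.
have [d d0 md] := mesh_bounded (evs R n).
have ev : chall (@fine _ n.+1 d) << evs R n >>.
  by apply: challU; split; first exact: size_evs.
have [M evM] := fine_sdN d0 e0 ev.
have fE : sx f = rz n f << evs R n >>.
  by rewrite rzE ?size_evs //; congr sx; apply/funext => x /=; rewrite aff_evs.
have evL : forall N, chall (lst n.+1 (std_simplex R n)) (iter N (sd (@bary R _) n.+1) << evs R n >>).
  elim=> [|K IH]; first by apply: challU; exact: lst_evs.
  by apply: lst_sd => //; exact: bary_simplex.
have [d1 [d2 [E1 E2 E3]]] : exists d1 d2, [/\ iter M (@ssd R Z n) (sx f) = d1 + d2,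
    d1 \in @chain_in R Z (A `&` O1) n & d2 \in @chain_in R Z (A `&` O2) n].
  rewrite fE iter_ssd_rz //; last exact: lst_evsT.
  have : chall (fun s => fine n.+1 e s /\ lst n.+1 (std_simplex R n) s)
      (iter M (sd (@bary R _) n.+1) << evs R n >>).
    by move=> s s0; split; [exact: evM|exact: (evL M)].
  move: (iter M _ _); apply: chall_ind => [|b s k [[sz sm] [_ sD]] [d1 [d2 [E1 E2 E3]]]].
    by exists 0, 0; rewrite linear0 addr0 !rpred0.
  rewrite linearP /= E1 rzE //.
  have s0 : nth 0 s 0 \in s by rewrite mem_nth // sz.
  have dist x : std_simplex R n x -> `|nth 0 s 0 - aff s x| <= e.
    move=> [x0 x1]; rewrite -[nth 0 s 0]scale1r -x1 scaler_suml -sumrB.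
    apply: le_trans (ler_norm_sum _ _ _) _; rewrite -[leRHS]mul1r -x1 mulr_suml.
    apply: ler_sum => i _; rewrite -scalerBr normrZ ger0_norm //.
    by rewrite ler_wpM2l // sm // mem_nth // sz.
  (* A small simplex lies within [e] of its first vertex, so this vertex decides to which part the
     simplex is assigned. *)
  have [H1|H2] := eL _ (sD _ s0).
    exists (b *: sx (f \o aff s) + d1), d2; rewrite addrA; split=> //.
    rewrite rpredD // rpredZ // sx_in // => x Dx; split; first exact: fA.
    by apply: H1; exact: dist.
  exists d1, (b *: sx (f \o aff s) + d2); rewrite addrCA; split=> //.
  rewrite rpredD // rpredZ // sx_in // => x Dx; split; first exact: fA.
  by apply: H2; exact: dist.
exists (M + N)%N, (a *: iter N (@ssd R Z n) d1 + iter M (@ssd R Z n) c1),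
  (a *: iter N (@ssd R Z n) d2 + iter M (@ssd R Z n) c2); split.
- rewrite iter_ssd_lin (addnC M N) iterD E1 addnC iterD e1.
  rewrite -[d1]scale1r iter_ssd_lin scale1r -[c1]scale1r iter_ssd_lin !scale1r.
  by rewrite scalerDr addrACA.
- by rewrite rpredD ?rpredZ //; exact: iter_ssd_in.
- by rewrite rpredD ?rpredZ //; exact: iter_ssd_in.
Qed.
End SmallChains.

(** * The fundamental chain of the cube *)

Section LocalHomology.
Context (R : realType).
Local Notation "{ 'fgs' n }" := {freeg (seq 'rV[R]_n) / rat} (at level 0).

Lemma insert_coord_linear n (i : 'I_n.+1) : linear (@insert_coord R n i 0).
Proof.
move=> a x y; apply/rowP => j; rewrite !mxE; case: unliftP => [k|] _ /=; first by rewrite !mxE.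
by rewrite mulr0 addr0.
Qed.

Lemma insert_coordE n (i : 'I_n.+1) (a : R) x :
  insert_coord i a x = insert_coord i 0 x + a *: delta_mx ord0 i.
Proof.
apply/rowP => j; rewrite !mxE eqxx /=; case: unliftP => [k ->|->] /=.
  by rewrite eq_sym (negPf (neq_lift _ _)) mulr0 addr0.
by rewrite eqxx mulr1 add0r.
Qed.

Lemma insert_lift n (i : 'I_n.+1) (a : R) x j : insert_coord i a x ord0 (fintype.lift i j) = x ord0 j.
Proof. by rewrite mxE liftK. Qed.

Lemma insert_same n (i : 'I_n.+1) (a : R) x : insert_coord i a x ord0 i = a.
Proof. by rewrite mxE unlift_none. Qed.

Lemma insert_coordCab n (i : 'I_n.+2) (j : 'I_n.+1) (a b : R) (x : 'rV[R]_n) :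
  insert_coord i a (insert_coord j b x) =
  insert_coord (face_swap (i, j)).1 b (insert_coord (face_swap (i, j)).2 a x).
Proof.
set p := (face_swap _).1; set q := (face_swap _).2.
have pq : fintype.lift p q = i by rewrite -[RHS](congr1 fst (face_swapK (i, j))).
have pE : fintype.lift i j = p by [].
have qE : q = unbump j i :> nat by exact: face_swap2.
have lC l : fintype.lift i (fintype.lift j l) = fintype.lift p (fintype.lift q l).
  by apply: ord_inj; rewrite /= qE bumpC.
apply/rowP => k; case: (unliftP i k) => [m ->|->]; last first.
  by rewrite insert_same -pq insert_lift insert_same.
rewrite insert_lift; case: (unliftP j m) => [l ->|->].
  by rewrite insert_lift lC !insert_lift.
by rewrite insert_same pE insert_same.
Qed.

(* The fundamental chain of the cube: the cone from its centre over its faces,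
   the sign exponent of the face x_i = (-1)^e being i + e. *)
Fixpoint cubeL n : {fgs n} :=
  if n is n'.+1 then
    cone 0 (\sum_(ie : 'I_n'.+1 * bool) (-1) ^+ (ie.1 + ie.2) *:
      fcmap (insert_coord ie.1 ((-1) ^+ ie.2)) (cubeL n'))
  else << [:: 0] >>.

Definition cubeB n : {fgs n.+1} := \sum_(ie : 'I_n.+1 * bool) (-1) ^+ (ie.1 + ie.2) *:
  fcmap (insert_coord ie.1 ((-1) ^+ ie.2)) (cubeL n).

Lemma cubeLS n : cubeL n.+1 = cone 0 (cubeB n). Proof. by []. Qed.

Lemma fcmap_comp (U V W : choiceType) (f : U -> V) (g : V -> W) c :
  fcmap g (fcmap f c) = fcmap (g \o f) c.
Proof.
apply: (@freeg_lin_ext _ _ (fcmap g \o fcmap f) (fcmap (g \o f))) => s /=.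
by rewrite !fcmapE -map_comp.
Qed.

(** By induction the boundary of each face is its own [cubeB], so the total is a sum over
    codimension two faces, each reached in two orders. The involution [t] exchanges the orders and
    reverses the sign; a sum equal to its negative is 0 over the rationals. In dimension 0 the two
    end points cancel in the augmentation degree. *)
Lemma bd_cubeB n : bd (cubeB n) = 0.
Proof.
elim: n => [|n IH].
  rewrite /cubeB -(pair_bigA _ (fun (i : 'I_1) (e : bool) => (-1) ^+ (i + e) *:
    fcmap (insert_coord i ((-1) ^+ e)) (cubeL 0))) /= big_ord1 big_bool /=.
  rewrite linearD !linearZ /= !fcmapE !bdE /= !linear0 ?subr0 ?oppr0 ?addr0.
  by rewrite addn1 addn0 expr1 expr0 scaleN1r scale1r addNr.
have bL : bd (cubeL n.+1) = cubeB n by rewrite cubeLS bd_cone IH linear0 subr0.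
pose F (p : ('I_n.+2 * bool) * ('I_n.+1 * bool)) : {fgs n.+2} :=
  (-1) ^+ (p.1.1 + p.2.1 + p.1.2 + p.2.2) *:
  fcmap (insert_coord p.1.1 ((-1) ^+ p.1.2) \o insert_coord p.2.1 ((-1) ^+ p.2.2)) (cubeL n).
have -> : bd (cubeB n.+1) = \sum_p F p.
  rewrite linear_sum -(pair_bigA _ (fun ie je => F (ie, je))) /=; apply: eq_bigr => -[i e] _.
  rewrite linearZ /= -fcmap_bd -cubeLS bL linear_sum scaler_sumr.
  apply: eq_bigr => -[j e'] _; rewrite linearZ /= scalerA -exprD fcmap_comp /F /=.
  by congr (_ ^+ _ *: _); lia.
pose t (p : ('I_n.+2 * bool) * ('I_n.+1 * bool)) : ('I_n.+2 * bool) * ('I_n.+1 * bool) :=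
  let kl := face_swap (p.1.1, p.2.1) in ((kl.1, p.2.2), (kl.2, p.1.2)).
have tK : involutive t.
  move=> [[i e] [j e']].
  have E : face_swap ((face_swap (i, j)).1, (face_swap (i, j)).2) = (i, j).
    by rewrite -surjective_pairing face_swapK.
  by rewrite -[(i, e)]/(((i, j).1, e)) -[(j, e')]/(((i, j).2, e')) -[in RHS]E.
have Ft p : F (t p) = - F p.
  case: p => [[i e] [j e']]; pose k := (face_swap (i, j)).1; pose l := (face_swap (i, j)).2.
  have odd_kl : odd (k + l) = ~~ odd (i + j) by exact: face_swap_odd.
  have -> : F (t ((i, e), (j, e'))) = (-1) ^+ (k + l + e' + e) *:
    fcmap (insert_coord k ((-1) ^+ e') \o insert_coord l ((-1) ^+ e)) (cubeL n) by [].
  have -> : F ((i, e), (j, e')) = (-1) ^+ (i + j + e + e') *: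
    fcmap (insert_coord i ((-1) ^+ e) \o insert_coord j ((-1) ^+ e')) (cubeL n) by [].
  have -> : insert_coord k ((-1) ^+ e') \o insert_coord l ((-1) ^+ e) =
    insert_coord i ((-1) ^+ e) \o @insert_coord R n j ((-1) ^+ e').
    by apply/funext => x; exact: esym (insert_coordCab i j _ _ x).
  rewrite -scaleNr; congr (_ *: _).
  rewrite -[LHS]signr_odd -[in RHS]signr_odd -signrN; congr ((-1) ^+ _).
  by rewrite (oddD _ e) (oddD _ e') odd_kl (oddD _ e') (oddD _ e); case: e e' => [] []; case: (odd (i + j)).
have S0 : \sum_p F p = - \sum_p F p.
  by rewrite {1}(reindex_inj (can_inj tK)) -sumrN; apply: eq_bigr => p _; exact: Ft.
apply/eqP; rewrite -[_ == 0](_ : (2%:R *: \sum_p F p == 0) = _); last first.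
  by rewrite scaler_eq0.
by rewrite scaler_nat mulr2n {1}S0 addNr.
Qed.

Lemma bd_cubeL n : bd (cubeL n.+1) = cubeB n.
Proof. by rewrite cubeLS bd_cone bd_cubeB linear0 subr0. Qed.

Lemma lst_fcmap (V W : normedModType R) n (D : set V) (D' : set W) (f : V -> W) c :
  (forall v, D v -> D' (f v)) -> chall (lst n D) c -> chall (lst n D') (fcmap f c).
Proof.
move=> DD; apply: chall_lift => s [sz sD]; apply: challU; split; first by rewrite size_map.
by move=> w /mapP[v vs ->]; apply: DD; exact: sD.
Qed.

Lemma cube_insert n i (e : bool) (x : 'rV[R]_n) : cube R n x ->
  cube R n.+1 (insert_coord i ((-1) ^+ e) x).
Proof.
move=> xc j; rewrite mxE; case: unliftP => [k|] _ /=; first exact: xc.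
by case: e; rewrite ?expr1 ?expr0; lra.
Qed.

Lemma lst_cubeB n : chall (lst n.+1 (cube R n)) (cubeL n) ->
  chall (lst n.+1 (cube R n.+1)) (cubeB n).
Proof.
move=> cn; apply: chall_sum => -[i e] _; apply: challZ; apply: lst_fcmap cn => v /=.
exact: cube_insert.
Qed.

Lemma lst_cubeL n : chall (lst n.+1 (cube R n)) (cubeL n).
Proof.
elim: n => [|n IH].
  by apply: challU; split=> // v _ [].
by rewrite cubeLS; apply: lst_cone; [move=> i; rewrite mxE; lra|exact: lst_cubeB].
Qed.

Lemma lstT (V : normedModType R) n (D : set V) c : chall (lst n D) c -> chall (lst n setT) c.
Proof. by apply: chall_impl => s [? _]; split. Qed.

Definition cubech n : singular_chain R 'rV[R]_n n := rz n id (cubeL n).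

Lemma idc (T : topologicalType) : continuous (@id T).
Proof. by move=> x; exact: cvg_id. Qed.

Lemma insertc n (i : 'I_n.+1) a : continuous (@insert_coord R n i a).
Proof. exact: insert_coord_continuous. Qed.

Lemma cubech_bd n : singular_boundary (cubech n.+1) =
  \sum_(ie : 'I_n.+1 * bool) (-1) ^+ (ie.1 + ie.2) *: pushf (insert_coord ie.1 ((-1) ^+ ie.2)) (cubech n).
Proof.
have lT m : chall (lst m.+1 setT) (cubeL m) by apply: lstT; exact: lst_cubeL.
rewrite rz_bd; [|exact: idc|exact: lT].
rewrite bd_cubeL linear_sum; apply: eq_bigr => -[i e] _; rewrite linearZ /=; congr (_ *: _).
rewrite push_rz; [|exact: insertc|exact: idc].
rewrite (rz_map (D := setT)) //; try exact: lT; try exact: insertc; try exact: idc.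
(* Inserting a nonzero coordinate is affine but not linear; it commutes with [aff] because the
   weights sum to 1. *)
move=> s x [sz _] [_ x1].
pose L : {linear 'rV[R]_n -> 'rV[R]_n.+1} := HB.pack (@insert_coord R n i 0)
  (GRing.isLinear.Build _ _ _ _ _ (@insert_coord_linear n i)).
rewrite [RHS]insert_coordE -[insert_coord i 0 _]/(L _) -(aff_map L) // /aff.
rewrite -[X in _ + X]scale1r -x1 scaler_suml -big_split; apply: eq_bigr => k _ /=.
rewrite !(nth_map 0) ?sz // -scalerDr; congr (_ *: _).
by rewrite [LHS]insert_coordE.
Qed.

Lemma cubech_in n : cubech n \in @chain_in R _ (cube R n) n.
Proof.
rewrite /cubech; have := @lst_cubeL n; move: (cubeL n).
apply: chall_ind => [|a s c [sz sD] IH]; first by rewrite linear0 rpred0.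
rewrite linearP /= rpredD // rpredZ // rzE //; apply: sx_in => x [x0 x1] i /=.
rewrite /aff summxE; under eq_bigr do rewrite mxE.
have sD' k : (k < n.+1)%N -> cube R n (nth 0 s k) by move=> kn; apply: sD; rewrite mem_nth // sz.
rewrite -ler_norml -[leRHS]x1; apply: le_trans (ler_norm_sum _ _ _) _.
apply: ler_sum => k _; rewrite normrM ger0_norm // -[leRHS]mulr1 ler_wpM2l //.
by rewrite ler_norml; exact: sD'.
Qed.

End LocalHomology.

(** * Local homology of the cube *)

Section Relative.
Context (R : realType).
Implicit Types Z : topologicalType.
Local Notation chin A n := (@chain_in R _ A n).
Local Notation rcyc A B n := (@rel_cycle R _ A B n).
Local Notation rbd A B n := (@rel_boundary R _ A B n).

Lemma rbdP Z (A B : set Z) n c : reflect (exists d e, [/\ d \in chin A n.+1,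
  e \in chin B n & c = singular_boundary d + e]) (c \in rbd A B n).
Proof.
apply: (iffP (asboolP _)) => [[d dA cB]|[d [e [dA eB ->]]]].
  by exists d, (c - singular_boundary d); rewrite addrCA subrr addr0.
by exists d => //; rewrite addrC addKr.
Qed.

Lemma rbd_in Z (A B : set Z) n c : c \in chin B n -> c \in rbd A B n.
Proof. by move=> cB; apply/rbdP; exists 0, c; rewrite linear0 add0r rpred0. Qed.

Lemma rbd_bd Z (A B : set Z) n c : c \in chin A n.+1 -> singular_boundary c \in rbd A B n.
Proof. by move=> cA; apply/rbdP; exists c, 0; rewrite addr0 rpred0. Qed.

Lemma rbdS Z (A A' B B' : set Z) n c : A `<=` A' -> B `<=` B' -> c \in rbd A B n -> c \in rbd A' B' n.
Proof.
move=> AA BB /rbdP[d [e [dA eB ->]]]; apply/rbdP; exists d, e; split=> //.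
  exact: chain_inS dA.
exact: chain_inS eB.
Qed.

Lemma rbd_push Z Z' (p : Z -> Z') (A B : set Z) (A' B' : set Z') n c : continuous p ->
  (forall z, A z -> A' (p z)) -> (forall z, B z -> B' (p z)) ->
  c \in rbd A B n -> pushf p c \in rbd A' B' n.
Proof.
move=> cp pA pB /rbdP[d [e [dA eB ->]]]; apply/rbdP.
exists (pushf p d), (pushf p e); split; [exact: push_in dA|exact: push_in eB|].
by rewrite linearD /= push_bd.
Qed.

Lemma rcyc_push Z Z' (p : Z -> Z') (A B : set Z) (A' B' : set Z') n c : continuous p ->
  (forall z, A z -> A' (p z)) -> (forall z, B z -> B' (p z)) ->
  c \in rcyc A B n -> pushf p c \in rcyc A' B' n.
Proof.
move=> cp pA pB; case: n c => [|n] c; first exact: push_in.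
by move=> /andP[cA cB]; apply/andP; rewrite push_bd //; split;
  [exact: push_in cA|exact: push_in cB].
Qed.

Lemma rcyc_in Z (A B : set Z) n c : c \in rcyc A B n -> c \in chin A n.
Proof. by case: n c => [|n] c // /andP[]. Qed.

Lemma rcycS Z (A A' B B' : set Z) n c : A `<=` A' -> B `<=` B' -> c \in rcyc A B n -> c \in rcyc A' B' n.
Proof.
move=> AA BB; case: n c => [|n] c; first exact: chain_inS.
by move=> /andP[cA cB]; apply/andP; split; [exact: chain_inS cA|exact: chain_inS cB].
Qed.

Lemma push_ssd Z Z' (p : Z -> Z') n (c : singular_chain R Z n) : continuous p ->
  ssd (pushf p c) = pushf p (ssd c).
Proof.
move=> cp; apply: (@freeg_lin_ext _ _ (@ssd R Z' n \o @pushf R Z Z' p n) (@pushf R Z Z' p n \o @ssd R Z n)) => s /=.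
have cs := hat_continuous (s := s); have cps := continuous_o cp cs.
rewrite -rz_evs push_rz // !ssd_rz ?push_rz //; exact: lst_evsT.
Qed.

Definition ssdN Z n N : singular_chain R Z n -> singular_chain R Z n := iter N (@ssd R Z n).
Lemma ssdN_linear Z n N : linear (@ssdN Z n N). Proof. exact: iter_ssd_lin. Qed.
HB.instance Definition _ Z n N := GRing.isLinear.Build rat (singular_chain R Z n)
  (singular_chain R Z n) _ (@ssdN Z n N) (@ssdN_linear Z n N).

Lemma push_ssdN Z Z' (p : Z -> Z') n N (c : singular_chain R Z n) : continuous p ->
  ssdN N (pushf p c) = pushf p (ssdN N c).
Proof. by move=> cp; rewrite /ssdN; elim: N => //= N ->; exact: push_ssd. Qed.

Lemma ssdN_bd Z n N (c : singular_chain R Z n.+1) :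
  singular_boundary (ssdN N c) = ssdN N (singular_boundary c).
Proof. exact: iter_ssd_bd. Qed.

Lemma ssdN_in Z (A : set Z) n N c : c \in chin A n -> ssdN N c \in chin A n.
Proof. exact: iter_ssd_in. Qed.

Lemma ssdN_rbd Z (A B : set Z) n N c : c \in rcyc A B n -> c - ssdN N c \in rbd A B n.
Proof. by move/(ssdN_hom N) => []. Qed.

Lemma ssdN_rcyc Z (A B : set Z) n N c : c \in rcyc A B n -> ssdN N c \in rcyc A B n.
Proof. by move/(ssdN_hom N) => []. Qed.

Definition aug Z n : singular_chain R Z n -> rat^o := fglift (fun=> (1 : rat^o)).
HB.instance Definition _ Z n := GRing.Linear.on (@aug Z n).

Definition kst Z (b : Z) n : singular_chain R Z n := sx (fun=> b).

Lemma aug_sx Z n (f : 'rV[R]_n.+1 -> Z) : continuous f -> aug (sx f) = 1.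
Proof. by move=> cf; rewrite (sxE cf) /aug fglift1. Qed.

Lemma push_cst Z Z' (b : Z') n (c : singular_chain R Z n) : pushf (fun=> b) c = aug c *: kst b n.
Proof.
move: c; apply: sx_ind => [|a f c cf IH]; first by rewrite !linear0 scale0r.
rewrite !linearP /= IH push_sx ?aug_sx //; last exact: cst_continuous.
by rewrite scalerDl -scalerA scale1r.
Qed.

Lemma kst_bd Z (b : Z) n : singular_boundary (kst b n.+1) = if odd n then kst b n else 0.
Proof.
rewrite sbd_sx; last exact: cst_continuous.
rewrite -[X in _ = (if odd X then _ else _)]/n -/(kst b n).
have -> : \sum_(i < n.+2) (-1) ^+ i *: kst b n = (\sum_(i < n.+2) (-1 : rat) ^+ i) *: kst b n.
  by rewrite scaler_suml.
have -> : forall m, \sum_(i < m) (-1 : rat) ^+ i = (odd m)%:R.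
  elim=> [|m IH]; first by rewrite big_ord0.
  by rewrite big_ord_recr /= IH -signr_odd; case: odd; rewrite /= ?expr1 ?expr0; lra.
by rewrite /= negbK; case: odd; rewrite ?scale1r ?scale0r.
Qed.

Lemma aug_bd Z (c : singular_chain R Z 1) : aug (singular_boundary c) = 0.
Proof.
move: c; apply: sx_ind => [|a f c cf IH]; first by rewrite !linear0.
rewrite !linearP /= IH sbd_sx // big_ord_recl big_ord1 linearD !linearZ /=.
rewrite !aug_sx; try by move=> x; apply: continuous_comp; [exact: insert_coord_continuous|exact: cf].
by rewrite expr0 scale1r addr0 /bump /= expr1 scaleN1r subrr scaler0.
Qed.

(** Lets a homotopy over [0, 1] be read as a map on all of R, the form that [sprism] takes. *)
Definition unit_clamp (t : R) : R := Num.max 0 (Num.min 1 t).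

Lemma unit_clamp_itv t : 0 <= unit_clamp t <= 1.
Proof. by rewrite /unit_clamp; apply/andP; split; rewrite ?le_max ?ge_max ?lexx ?ler01 //= ge_min lexx. Qed.

Lemma unit_clamp0 : unit_clamp 0 = 0.
Proof. by rewrite /unit_clamp min_r ?ler01 // maxxx. Qed.

Lemma unit_clamp1 : unit_clamp 1 = 1.
Proof. by rewrite /unit_clamp minxx max_r ?ler01. Qed.

Lemma unit_clamp_continuous : continuous unit_clamp.
Proof.
apply: contmax; first exact: cst_continuous.
by move=> x; apply: continuous_min; [exact: cvg_cst|exact: cvg_id].
Qed.

Section Line.
Context (V : normedModType R) (p : V -> V).
Hypothesis cp : continuous p.

Definition line (q : V * R) : V := q.1 + unit_clamp q.2 *: (p q.1 - q.1).

Lemma line_continuous : continuous line.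
Proof.
apply: contD; first exact: continuous_fst.
apply: contZ; first by apply: (continuous_o unit_clamp_continuous); exact: continuous_snd.
apply: contB; last exact: continuous_fst.
by apply: (continuous_o cp); exact: continuous_fst.
Qed.

Lemma line0 : G0 line = id.
Proof. by apply/funext => x; rewrite /G0 /line /= unit_clamp0 scale0r addr0. Qed.

Lemma line1 : G1 line = p.
Proof. by apply/funext => x; rewrite /G1 /line /= unit_clamp1 scale1r addrC subrK. Qed.

Lemma line_hom (A B A' B' : set V) n c :
  (forall z t, A z -> A' (line (z, t))) -> (forall z t, B z -> B' (line (z, t))) ->
  c \in rcyc A B n -> pushf p c - c \in rbd A' B' n.
Proof.
move=> lA lB cAB; have := sprism_hom line_continuous lA lB cAB.
by rewrite line0 line1 push_id.
Qed.
End Line.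

(** Contracting to [b] shows that [y] is, up to a boundary, [aug y] times a constant simplex. In
    half of the degrees the constant simplex bounds another one. In the others its boundary is not
    0, and pushing the equation for the boundary of [y] to the point [b] forces [aug y] = 0. *)
Lemma star_acyclic (V : normedModType R) (B : set V) (b : V) n y : B b ->
  (forall z t, B z -> B (line (fun=> b) (z, t))) ->
  y \in chin B n.+1 -> singular_boundary y = 0 ->
  exists2 u, u \in chin B n.+2 & singular_boundary u = y.
Proof.
move=> Bb st yB dy; have cb : continuous (fun _ : V => b) by exact: cst_continuous.
have H := sprism_bd (line_continuous cb) y.
rewrite line0 line1 push_id dy linear0 subr0 push_cst in H.
have sB : sprism (line (fun=> b)) y \in chin B n.+2 by apply: (sprism_in (A := B)).
have [n_odd|n_even] := boolP (odd n).
  exists (- sprism (line (fun=> b)) y); first by rewrite rpredN.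
  suff a0 : aug y = 0 by rewrite linearN /= H a0 scale0r sub0r opprK.
  have := push_bd y cb; rewrite dy linear0 push_cst linearZ /= kst_bd n_odd.
  have cbn : continuous (fun _ : 'rV[R]_n.+1 => b) by exact: cst_continuous.
  move/(congr1 (@aug _ _)); rewrite linearZ linear0 /= aug_sx //.
  by rewrite /GRing.scale /= mulr1.
exists (aug y *: kst b n.+2 - sprism (line (fun=> b)) y).
  by rewrite rpredB // rpredZ // sx_in.
by rewrite linearB linearZ /= kst_bd /= n_even H opprB addrC subrK.
Qed.

Lemma star_acyclic0 (V : normedModType R) (B : set V) (b : V) y : B b ->
  (forall z t, B z -> B (line (fun=> b) (z, t))) ->
  y \in chin B 0 -> aug y = 0 ->
  exists2 u, u \in chin B 1 & singular_boundary u = y.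
Proof.
move=> Bb st yB ay; have cb : continuous (fun _ : V => b) by exact: cst_continuous.
have H := sprism_bd0 (line_continuous cb) y.
rewrite line0 line1 push_id push_cst ay scale0r sub0r in H.
exists (- sprism (line (fun=> b)) y); last by rewrite linearN /= H opprK.
by rewrite rpredN; apply: (sprism_in (A := B)).
Qed.
Lemma bdry_cyc Z (A B : set Z) n (w : singular_chain R Z n.+1) :
  singular_boundary w \in chin A n -> singular_boundary w \in rcyc A B n.
Proof.
case: n w => [|m] w //= zA.
by apply/andP; split=> //; rewrite singular_boundaryK rpred0.
Qed.

(** The boundaries of [z1] and [z2] are opposite, since their sum is a subdivided cycle; so each
    lies in both sets. *)
Lemma bdry_split Z (A B : set Z) n N (w : singular_chain R Z n.+1) z1 z2 :
  ssdN N (singular_boundary w) = z1 + z2 -> z1 \in chin A n -> z2 \in chin B n ->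
  z1 \in rcyc A (A `&` B) n.
Proof.
case: n w z1 z2 => [|m] w z1 z2 //= E z1A z2B.
apply/andP; split=> //; apply: chain_inI; first exact: chain_in_bd.
have -> : z1 = ssdN N (singular_boundary w) - z2 by rewrite E addrK.
rewrite linearB /= ssdN_bd [singular_boundary _]singular_boundaryK linear0 sub0r rpredN.
exact: chain_in_bd.
Qed.

Lemma star_bdry (V : normedModType R) (B : set V) (b : V) n (w : singular_chain R V n.+1) : B b ->
  (forall z t, B z -> B (line (fun=> b) (z, t))) ->
  singular_boundary w \in chin B n ->
  exists2 u, u \in chin B n.+1 & singular_boundary u = singular_boundary w.
Proof.
move=> Bb st; case: n w => [|m] w yB.
  by apply: (star_acyclic0 Bb) => //; rewrite aug_bd.
by apply: (star_acyclic Bb) => //; rewrite singular_boundaryK.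
Qed.
End Relative.

(** * The pair of R^n and the complement of the origin *)

Section LocalDegree.
Context (R : realType).
Local Notation chin A n := (@chain_in R _ A n).
Local Notation rcyc A B n := (@rel_cycle R _ A B n).
Local Notation rbd A B n := (@rel_boundary R _ A B n).

Definition nz n : set 'rV[R]_n := [set x | x != 0].
Definition posh n : set 'rV[R]_n.+1 := [set x | 0 < x ord0 ord0].
(* Complement of the closed ray through the centre of the face x_0 = 1. *)
Definition offray n : set 'rV[R]_n.+1 :=
  [set x | x ord0 ord0 < 0 \/ exists j : 'I_n, x ord0 (fintype.lift ord0 j) != 0].
Definition del0 n (x : 'rV[R]_n.+1) : 'rV[R]_n := \row_j x ord0 (fintype.lift ord0 j).

Lemma del0_continuous n : continuous (@del0 n).
Proof.
apply: continuous_row => i; rewrite (_ : (fun y => _) = (fun y : 'rV[R]_n.+1 => y ord0 (fintype.lift ord0 i))).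
  exact: continuous_entry.
by apply/funext => y; rewrite mxE.
Qed.

Lemma del0_insert n a (x : 'rV[R]_n) : del0 (insert_coord ord0 a x) = x.
Proof. by apply/rowP => j; rewrite mxE insert_lift. Qed.

Lemma open_posh n : open (@posh n).
Proof.
apply: (open_comp (f := fun x : 'rV[R]_n.+1 => x ord0 ord0) (D := [set r | 0 < r])).
  by move=> x _; exact: continuous_entry.
exact: open_gt.
Qed.

Lemma open_offray n : open (@offray n).
Proof.
rewrite (_ : @offray n = [set x | x ord0 ord0 < 0] `|`
  \bigcup_(j : 'I_n) [set x | x ord0 (fintype.lift ord0 j) != 0]); last first.
  by apply/seteqP; split=> x [?|[j]]; [left|move=> ?; right; exists j|left|move=> _ ?; right; exists j].
apply: openU.
  apply: (open_comp (f := fun x : 'rV[R]_n.+1 => x ord0 ord0) (D := [set r | r < 0])).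
    by move=> x _; exact: continuous_entry.
  exact: open_lt.
apply: bigcup_open => j _.
apply: (open_comp (f := fun x : 'rV[R]_n.+1 => x ord0 (fintype.lift ord0 j)) (D := [set r | r != 0])).
  by move=> x _; exact: continuous_entry.
exact: open_neq.
Qed.

Lemma nz_cover n : @nz n.+1 `<=` @posh n `|` @offray n.
Proof.
move=> x /eqP x0; have [p|p] := ltrP 0 (x ord0 ord0); first by left.
right; have [?|p'] := ltrP (x ord0 ord0) 0; first by left.
right; apply/existsP; apply: contra_notT x0 => /existsPn H.
apply/rowP => j; rewrite mxE; case: (unliftP ord0 j) => [k ->|->].
  by apply/eqP; have := H k; rewrite negbK.
by apply: le_anti; rewrite p p'.
Qed.

Lemma offray_nz n : @offray n `<=` @nz n.+1.
Proof.
move=> x [x0|[j xj]]; apply/eqP => e; first by move: x0; rewrite e mxE ltxx.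
by move: xj; rewrite e mxE eqxx.
Qed.

Lemma posh_nz n : @posh n `<=` @nz n.+1.
Proof. by move=> x x0; apply/eqP => e; move: x0; rewrite /posh /= e mxE ltxx. Qed.

Lemma del0_nz n (x : 'rV[R]_n.+1) : posh x -> offray x -> nz (del0 x).
Proof.
move=> x0 [x1|[j xj]]; first by move: (lt_trans x0 x1); rewrite ltxx.
by apply/eqP => e; move: xj; have := congr1 (fun y : 'rV[R]_n => y ord0 j) e; rewrite !mxE => ->; rewrite eqxx.
Qed.

Lemma insert_offray n (i : 'I_n.+1) (e : bool) (x : 'rV[R]_n) : (i, e) != (ord0, false) ->
  offray (insert_coord i ((-1) ^+ e) x).
Proof.
case: (unliftP ord0 i) => [j ->|->] ie.
  right; exists j; rewrite insert_same.
  by case: e ie; rewrite ?expr1 ?expr0 ?oppr_eq0 oner_neq0.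
left; rewrite insert_same; case: e ie => // _; rewrite expr1; lra.
Qed.

Lemma insert_nz n (i : 'I_n.+1) (e : bool) (x : 'rV[R]_n) : nz (insert_coord i ((-1) ^+ e) x).
Proof.
apply/eqP => h; have := congr1 (fun y : 'rV[R]_n.+1 => y ord0 i) h; rewrite insert_same mxE.
by apply/eqP; case: e {h}; rewrite ?expr1 ?expr0 ?oppr_eq0 oner_neq0.
Qed.

Lemma nz0 : @nz 0 = set0.
Proof. by apply/seteqP; split=> x //= /eqP; case; apply/rowP => -[]. Qed.

Lemma chin0 (Z : topologicalType) n c : c \in chin (@set0 Z) n -> c = 0.
Proof.
move: c; apply: chain_in_ind => // a f c _ f0 _; exfalso; exact: (f0 0).
Qed.

Lemma cubech_cycle n : cubech R n \in rcyc setT (@nz n) n.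
Proof.
case: n => [|n]; first exact: chain_in_setT.
apply/andP; split; first exact: chain_in_setT.
rewrite cubech_bd rpred_sum // => -[i e] _; rewrite rpredZ //.
by apply: (push_in (A := setT)); [move=> z _; exact: insert_nz|exact: chain_in_setT].
Qed.

Definition top_face n : singular_chain R _ n := pushf (insert_coord ord0 (1 : R)) (cubech R n).

Lemma cubech_bd_top n : singular_boundary (cubech R n.+1) - top_face n \in chin (@offray n) n.
Proof.
rewrite cubech_bd (bigD1 (ord0, false)) //= addn0 expr0 scale1r addrAC subrr add0r.
rewrite rpred_sum // => -[i e] ie; rewrite rpredZ //.
by apply: (push_in (A := setT)); [move=> z _; exact: insert_offray|exact: chain_in_setT].
Qed.

Lemma top_posh n : top_face n \in chin (@posh n) n.
Proof.
apply: (push_in (A := setT)); last exact: chain_in_setT.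
by move=> z _; rewrite /posh /= insert_same ltr01.
Qed.

Lemma del0_top n : pushf (@del0 n) (top_face n) = cubech R n.
Proof.
rewrite push_comp; [|exact: insertc|exact: del0_continuous].
rewrite (_ : _ \o _ = id) ?push_id //; apply/funext => x /=; exact: del0_insert.
Qed.

(** Induction on n through boundaries: modulo [offray] only the top face of the cube survives,
    excision moves the relation into the half space [posh], and forgetting the first coordinate
    turns the top face into the cube of dimension one less. For n = 0 the sum of the coefficients
    decides. *)
Theorem local_homology_inj n (a : rat) : a *: cubech R n \in rbd setT (@nz n) n -> a = 0.
Proof.
elim: n a => [|n IH] a /rbdP[d [e [_ eB /eqP]]].
  rewrite nz0 in eB; rewrite (chin0 eB) addr0 => /eqP/(congr1 (@aug R _ _)).
  rewrite aug_bd linearZ /= /cubech /= rzE // aug_sx; last by apply: rz_cont; exact: idc.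
  by rewrite /GRing.scale /= mulr1.
move=> /eqP E; pose r := singular_boundary (cubech R n.+1) - top_face n.
have rB : a *: r \in chin (@offray n) n by rewrite rpredZ // cubech_bd_top.
have E2 : a *: top_face n = singular_boundary e - a *: r.
  have := congr1 (@singular_boundary R _ n) E.
  rewrite linearZ linearD /= singular_boundaryK add0r => <-.
  by rewrite scalerBr opprB addrCA subrr addr0.
have [N [e1 [e2 [eE e1A e2B]]]] := small_chain (@open_posh n) (@open_offray n) (@nz_cover n) eB.
have e2B' : e2 \in chin (@offray n) n.+1 by apply: chain_inS e2B => x [].
have e1A' : e1 \in chin (@posh n) n.+1 by apply: chain_inS e1A => x [].
pose X := ssdN N (a *: top_face n) - singular_boundary e1.
have XB : X \in chin (@offray n) n.
  rewrite /X E2 linearB /= -ssdN_bd [ssdN N e]eE linearD /=.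
  by rewrite addrAC [_ + _ - singular_boundary e1]addrAC subrr add0r rpredB ?ssdN_in ?chain_in_bd.
have XA : X \in chin (@posh n) n.
  by rewrite rpredB ?chain_in_bd // ssdN_in // rpredZ // top_posh.
have XX : pushf (@del0 n) X \in chin (@nz n) n.
  by apply: (push_in (A := @posh n `&` @offray n)); [move=> z [? ?]; exact: del0_nz|exact: chain_inI].
apply: IH; have cy : a *: cubech R n \in rcyc setT (@nz n) n by rewrite rpredZ // cubech_cycle.
rewrite -[a *: _](subrK (ssdN N (a *: cubech R n))) rpredD ?ssdN_rbd //.
apply/rbdP; exists (pushf (@del0 n) e1), (pushf (@del0 n) X); split=> //; first exact: chain_in_setT.
rewrite /X linearB /= -push_ssdN; last exact: del0_continuous.
have -> : pushf (@del0 n) (a *: top_face n) = a *: cubech R n by rewrite linearZ /= del0_top.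
rewrite push_bd; last exact: del0_continuous.
by rewrite addrCA subrr addr0.
Qed.

(** A segment towards the point -e_0, opposite to the removed ray, never meets that ray. Hence
    [offray] is star-shaped, and acyclic. *)
Lemma offray_star n z t : @offray n z ->
  @offray n (line (fun=> (- delta_mx ord0 ord0)) (z, t)).
Proof.
have /andP[u0 u1] := unit_clamp_itv t.
move=> H; rewrite /line /= /offray /=; set u := unit_clamp t in u0 u1 *.
have [u_lt1|u_ge1] := ltrP u 1; last first.
  have -> : u = 1 by lra.
  by left; rewrite !mxE eqxx /=; lra.
case: H => [z0|[j zj]]; last first.
  right; exists j; rewrite !mxE /= oppr0 sub0r mulrN -{1}[z _ _]mul1r -mulrBl.
  by rewrite mulf_neq0 // subr_eq0 gt_eqF.
by left; rewrite !mxE eqxx /=; nra.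
Qed.

Lemma posh_line n (z : 'rV[R]_n.+1) t : posh z ->
  posh (line (insert_coord ord0 1 \o @del0 n) (z, t)).
Proof.
have /andP[u0 u1] := unit_clamp_itv t.
by rewrite /posh /line /= !mxE unlift_none /=; nra.
Qed.

Lemma offray_line n (z : 'rV[R]_n.+1) t : posh z /\ offray z ->
  offray (line (insert_coord ord0 1 \o @del0 n) (z, t)).
Proof.
move=> [z0 [z1|[j zj]]]; first by move: (lt_trans z0 z1); rewrite ltxx.
right; exists j; rewrite /line /= !mxE liftK /= mxE subrr mulr0 addr0.
exact: zj.
Qed.

(** The maps of [local_homology_inj] run backwards. The projected part of the boundary of [c] yields
    the coefficient by induction. After subtracting that multiple of the cube and a chain off the
    origin, the boundary lies in [offray] and bounds there; what remains is a cycle in the whole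
    space, which is contractible. *)
Theorem local_span n c : c \in rcyc setT (@nz n) n ->
  exists a, c - a *: cubech R n \in rbd setT (@nz n) n.
Proof.
elim: n c => [|n IH] c.
  move=> _; exists (aug c); apply/rbd_in; suff {1}-> : c = aug c *: cubech R 0 by rewrite subrr rpred0.
  move: c; apply: sx_ind => [|a f c cf {1}->]; first by rewrite linear0 scale0r.
  rewrite linearP /= aug_sx // scalerDl /GRing.scale /= mulr1; congr (a *: _ + _).
  rewrite /cubech /= rzE //; apply: sx_eq => //; first by apply: rz_cont; exact: idc.
  by move=> x _; apply/rowP => -[].
move=> /andP[_ zB]; pose z := singular_boundary c; rewrite -/z in zB.
have [N [z1 [z2 [zE z1A z2B]]]] := small_chain (@open_posh n) (@open_offray n) (@nz_cover n) zB.
have {}z2B : z2 \in chin (@offray n) n by apply: chain_inS z2B => x [].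
have {}z1A : z1 \in chin (@posh n) n by apply: chain_inS z1A => x [].
have z_cyc : z \in rcyc (@nz n.+1) (@offray n) n.
  exact: bdry_cyc.
have z1_cyc : z1 \in rcyc (@posh n) (@posh n `&` @offray n) n.
  exact: bdry_split zE z1A z2B.
have cdel := @del0_continuous n.
have cins : continuous (insert_coord ord0 1 \o @del0 n) by apply: continuous_o => //; exact: insertc.
have [a Ha] : exists a, pushf (@del0 n) z1 - a *: cubech R n \in rbd setT (@nz n) n.
  apply: IH; apply: rcyc_push z1_cyc => // x [x1 x2]; exact: del0_nz.
have H1 : z1 - a *: top_face n \in rbd (@nz n.+1) (@offray n) n.
  (* Within the half space, projection to the hyperplane x_0 = 1 is joined to the identity by a
     straight line. *)
  have H2 : pushf (insert_coord ord0 1 \o @del0 n) z1 - z1 \in rbd (@nz n.+1) (@offray n) n.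
    apply: (rbdS (A := @posh n) (B := @offray n)) => //; first exact: posh_nz.
    by apply: line_hom z1_cyc => // x t; [exact: posh_line|exact: offray_line].
  rewrite -[z1 - _](subrKA (pushf (insert_coord ord0 1 \o @del0 n) z1)).
  rewrite rpredD //; first by rewrite -opprB rpredN.
  rewrite -push_comp //; last exact: insertc.
  rewrite /top_face -linearZ -linearB /=.
  apply: rbd_push Ha; first exact: insertc.
    by move=> x _; apply: posh_nz; rewrite /posh /= insert_same ltr01.
  move=> x /eqP x0; right; apply/existsP; apply: contra_notT x0 => /existsPn H.
  apply/rowP => k; rewrite mxE; have := H k; rewrite insert_lift negbK => /eqP; exact.
have H3 : z - a *: singular_boundary (cubech R n.+1) \in rbd (@nz n.+1) (@offray n) n.
  rewrite -[z - _](subrKA (ssdN N z)) rpredD ?ssdN_rbd //.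
  rewrite [ssdN N z]zE addrAC -[z1 - _](subrKA (a *: top_face n)) addrAC rpredD //.
    by rewrite rpredD // rbd_in.
  by rewrite rbd_in // -scalerBr -opprB scalerN rpredN rpredZ // cubech_bd_top.
have /rbdP[x [y [xA yB E]]] := H3.
pose c' := c - a *: cubech R n.+1 - x.
have dc' : singular_boundary c' = y.
  by rewrite /c' !linearB linearZ /= -/z E addrC addKr.
pose b : 'rV[R]_n.+1 := - delta_mx ord0 ord0.
have bB : offray b by left; rewrite !mxE eqxx /=; lra.
have [u uB uE] : exists2 u, u \in chin (@offray n) n.+1 & singular_boundary u = y.
  have st w t : @offray n w -> @offray n (line (fun=> b) (w, t)) by exact: offray_star.
  by rewrite -dc'; apply: (star_bdry bB) => //; rewrite dc'.
have [w _ wE] : exists2 w, w \in chin (@setT 'rV[R]_n.+1) n.+2 & singular_boundary w = c' - u.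
  apply: (star_acyclic (b := 0)) => //; first exact: chain_in_setT.
  by rewrite linearB /= dc' uE subrr.
exists a; apply/rbdP; exists w, (x + u); split; first exact: chain_in_setT.
  by rewrite rpredD //; apply: chain_inS uB; exact: offray_nz.
by rewrite wE /c' -[_ - x - u]addrA -opprD subrK.
Qed.
End LocalDegree.

(** * The cube complex *)

Lemma closed_cube (R : realType) n : closed (cube R n).
Proof.
have -> : cube R n = \bigcap_(i : 'I_n) [set x | -1 <= x ord0 i <= 1].
  by apply/seteqP; split=> x H i *; exact: H.
apply: closed_bigI => i _.
rewrite -[X in closed X]/[set x : 'rV[R]_n | -1 <= x ord0 i <= 1].
have -> : [set x : 'rV[R]_n | -1 <= x ord0 i <= 1] = (fun x : 'rV[R]_n => x ord0 i) @^-1` `[-1, 1].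
  by apply/seteqP; split=> x; rewrite /= in_itv.
by apply: closed_comp (fun x _ => @continuous_entry R n i x) _; exact: interval_closed.
Qed.

Section CubeComplex.
Context (R : realType) (cell : nat -> choiceType).
Variable face : forall n, bool -> 'I_n.+1 -> cell n.+1 -> cell n.
Hypothesis faceC : forall n (a b : bool) (i : 'I_n.+2) (j : 'I_n.+1) (C : cell n.+2),
  face b j (face a i C) = face a (face_swap (i, j)).2 (face b (face_swap (i, j)).1 C).

Definition delc n (i : 'I_n.+1) (x : 'rV[R]_n.+1) : 'rV[R]_n := \row_j x ord0 (fintype.lift i j).

Lemma delcK n (i : 'I_n.+1) (x : 'rV[R]_n.+1) : insert_coord i (x ord0 i) (delc i x) = x.
Proof. by apply/rowP => k; rewrite mxE; case: unliftP => [j|] -> //=; rewrite mxE. Qed.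

Lemma insertK n (i : 'I_n.+1) a (x : 'rV[R]_n) : delc i (insert_coord i a x) = x.
Proof. by apply/rowP => k; rewrite mxE insert_lift. Qed.

Definition point := {k & (cell k * 'rV[R]_k)%type}.
Definition mkp n (C : cell n) (x : 'rV[R]_n) : point := existT _ n (C, x).

Definition outside n (x : 'rV[R]_n) (i : 'I_n) := ~~ (-1 < x ord0 i < 1).

(* Coordinates outside ]-1, 1[ are removed by passing to the face. *)
Fixpoint nf n : cell n -> 'rV[R]_n -> point :=
  match n with
  | 0 => fun C x => mkp C x
  | m.+1 => fun C x =>
      if [pick i | outside x i] is Some i then nf (face (0 < x ord0 i) i C) (delc i x)
      else mkp C x
  end.

Lemma nf_open n (C : cell n) x : open_cube R _ (tagged (nf C x)).2.
Proof.
elim: n C x => [C x [] //|n IH C x] /=; case: pickP => [i _|H]; first exact: IH.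
by move=> i; have /negbFE := H i.
Qed.

Lemma nf_id n (C : cell n) x : open_cube R n x -> nf C x = mkp C x.
Proof.
case: n C x => [//|n] C x ox /=; case: pickP => // i.
by rewrite /outside ox.
Qed.

Lemma outsideP n (x : 'rV[R]_n) i :
  reflect (exists e : bool, 1 <= (-1) ^+ (~~ e) * x ord0 i) (outside x i).
Proof.
apply: (iffP idP) => [b|[[]]]; rewrite /outside ?expr0 ?expr1 /= => *; last 2 first.
- by apply/negP => /andP[? ?]; lra.
- by apply/negP => /andP[? ?]; lra.
move: b; rewrite /outside negb_and -!leNgt => /orP[x1|x1].
  by exists false; rewrite /= expr1; lra.
by exists true; rewrite /= expr0; lra.
Qed.

Lemma outside_sign (e : bool) (a : R) : 1 <= (-1) ^+ (~~ e) * a -> (0 < a) = e.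
Proof. by case: e => /=; rewrite ?expr0 ?expr1 => ?; [apply/idP|apply/negbTE; rewrite -leNgt]; lra. Qed.

(** The order in which extremal coordinates are removed does not matter. If [pick] returns an index
    k other than i, both orders lead to the same codimension two face by [faceC], and the induction
    hypothesis is used on both sides. *)
Lemma nf_insert n (C : cell n.+1) i (e : bool) a x : 1 <= (-1) ^+ (~~ e) * a ->
  nf C (insert_coord i a x) = nf (face e i C) x.
Proof.
elim: n C i e a x => [|n IH] C i e a x ea.
  rewrite /=; case: pickP => [j _|/(_ i)].
    by rewrite !ord1 insert_same (outside_sign ea) insertK.
  by move=> /outsideP; case; exists e; rewrite insert_same.
have -> : nf C (insert_coord i a x) = nf (face e i C) (delc i (insert_coord i a x)).
  set y := insert_coord i a x.
  have yi : y ord0 i = a by exact: insert_same.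
  have -> D : nf D y = if [pick i | outside y i] is Some i then nf (face (0 < y ord0 i) i D) (delc i y)
      else mkp D y by [].
  case: pickP => [k|/(_ i)]; last first.
    by move=> /outsideP; case; exists e; rewrite yi.
  move=> /outsideP[b yb]; rewrite (outside_sign yb).
  case: (unliftP i k) yb => [j kj|->] yb; last first.
    by move: yb; rewrite yi => /outside_sign; rewrite (outside_sign ea) => ->.
  have xj : x = insert_coord j (y ord0 k) (delc j x).
    by rewrite /y kj insert_lift delcK.
  have -> : delc i y = insert_coord j (y ord0 k) (delc j x) by rewrite insertK.
  rewrite (IH _ _ b) // faceC; set l := (face_swap _).2.
  have -> : y = insert_coord k (y ord0 k) (insert_coord l a (delc j x)).
    rewrite {1}/y {1}xj insert_coordCab; congr insert_coord; by rewrite kj.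
  by rewrite insertK (IH _ _ e) // kj.
by rewrite insertK.
Qed.

Lemma nf_out n (C : cell n.+1) i (e : bool) (x : 'rV[R]_n.+1) :
  1 <= (-1) ^+ (~~ e) * x ord0 i -> nf C x = nf (face e i C) (delc i x).
Proof. by move=> ex; rewrite -{1}(delcK i x) (nf_insert _ _ _ ex). Qed.

Lemma nf_ind (P : forall n, cell n -> 'rV[R]_n -> Prop) :
  (forall n (C : cell n) x, open_cube R n x -> P n C x) ->
  (forall n (C : cell n.+1) i (e : bool) (x : 'rV[R]_n.+1), 1 <= (-1) ^+ (~~ e) * x ord0 i ->
     P n (face e i C) (delc i x) -> P n.+1 C x) ->
  forall n (C : cell n) x, P n C x.
Proof.
move=> Po Pi; elim=> [|n IH] C x; first by apply: Po => -[].
have [/existsP[i /outsideP[e ie]]|] := boolP [exists i, outside x i]; first exact: Pi ie (IH _ _).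
by move=> /existsPn H; apply: Po => i; exact: negbNE (H i).
Qed.

Definition clamp n (x : 'rV[R]_n) : 'rV[R]_n :=
  \row_i Num.max (-1) (Num.min 1 (x ord0 i)).

Lemma clamp_cube n (x : 'rV[R]_n) : cube R n (clamp x).
Proof. by move=> i; rewrite mxE ge_max le_max lexx /= ge_min lexx; lra. Qed.

Lemma clamp_id n (x : 'rV[R]_n) : cube R n x -> clamp x = x.
Proof.
move=> cx; apply/rowP => i; have /andP[x0 x1] := cx i; rewrite mxE.
by rewrite (min_idPr x1) (max_idPr x0).
Qed.

Lemma clamp_continuous n : continuous (@clamp n).
Proof.
apply: continuous_row => i.
rewrite (_ : (fun _ => _) = fun x : 'rV[R]_n => Num.max (-1) (Num.min 1 (x ord0 i))); last first.
  by apply/funext => x; rewrite mxE.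
apply: contmax; first exact: cst_continuous.
have -> : (fun x : 'rV[R]_n => Num.min 1 (x ord0 i)) = (fun x => 0 - Num.max (-1) (0 - x ord0 i)).
  by apply/funext => x; rewrite !sub0r -oppr_min opprK.
apply: (@contB _ R^o); first exact: cst_continuous.
apply: contmax; first exact: cst_continuous.
by apply: (@contB _ R^o); [exact: cst_continuous|exact: continuous_entry].
Qed.

Lemma nf_clamp n (C : cell n) x : nf C (clamp x) = nf C x.
Proof.
move: n C x; apply: nf_ind => [n C x ox|n C i e x ex IH].
  by rewrite clamp_id // => i; have /andP[? ?] := ox i; rewrite !ltW.
have ex' : 1 <= (-1) ^+ (~~ e) * (clamp x) ord0 i.
  rewrite mxE; case: e ex {IH} => /=; rewrite ?expr0 ?expr1 => ex.
    by rewrite mul1r le_max; apply/orP; right; rewrite le_min; lra.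
  rewrite mulN1r lerNr ge_max lexx /= ge_min; apply/orP; right; lra.
rewrite (nf_out _ ex') (nf_out _ ex) -IH; congr nf.
by apply/rowP => j; rewrite !mxE.
Qed.

(** The points do not mention [face], but the topology depends on it; the [let] records it in the
    type for the sake of the instances below. *)
Definition cspace : Type := let f := @face in {p : point | open_cube R _ (tagged p).2}.
HB.instance Definition _ := gen_eqMixin cspace.
HB.instance Definition _ := gen_choiceMixin cspace.

Definition cmap n (C : cell n) (x : 'rV[R]_n) : cspace := exist _ (nf C x) (@nf_open _ C x).

(** The final topology for maps on all of R^n. As these factor through [clamp], it coincides with
    the one given by the closed cubes. *)
Definition cspace_open (U : set cspace) := forall n (C : cell n), open (cmap C @^-1` U).

Lemma cspace_openT : cspace_open setT.
Proof. by move=> n C; rewrite preimage_setT; exact: openT. Qed.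

Lemma cspace_openI : setI_closed cspace_open.
Proof. by move=> U V oU oV n C; rewrite preimage_setI; exact: openI. Qed.

Lemma cspace_open_bigU (I : Type) (f : I -> set cspace) :
  (forall i, cspace_open (f i)) -> cspace_open (\bigcup_i f i).
Proof. by move=> of_ n C; rewrite preimage_bigcup; apply: bigcup_open => i _; exact: of_. Qed.

HB.instance Definition _ := isOpenTopological.Build cspace
  cspace_openT cspace_openI cspace_open_bigU.

Lemma cspace_openE (U : set cspace) : open U <-> cspace_open U.
Proof. by []. Qed.

Lemma cmap_continuous n (C : cell n) : continuous (cmap C).
Proof. by apply/continuousP => U /cspace_openE. Qed.

Lemma cspace_continuous (T : topologicalType) (f : cspace -> T) :
  (forall n (C : cell n), continuous (f \o cmap C)) -> continuous f.
Proof.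
move=> cf; apply/continuousP => U oU; apply/cspace_openE => n C.
by have /continuousP/(_ _ oU) := cf n C.
Qed.

Lemma cspace_closedE (A : set cspace) : closed A <-> forall n (C : cell n), closed (cmap C @^-1` A).
Proof.
rewrite -openC cspace_openE; split=> H n C; first by rewrite -openC preimage_setC; exact: H.
by rewrite -preimage_setC openC; exact: H.
Qed.

Definition zdim (z : cspace) : nat := tag (sval z).
Definition ccell (z : cspace) : cell (zdim z) := (tagged (sval z)).1.
Definition ccoord (z : cspace) : 'rV[R]_(zdim z) := (tagged (sval z)).2.

Lemma ccoord_open z i : -1 < ccoord z ord0 i < 1.
Proof. exact: proj2_sig z i. Qed.

Lemma cspace_eq (z w : cspace) : sval z = sval w -> z = w.
Proof. by case: z w => [z zP] [w wP] /= zw; subst w; congr exist; exact: Prop_irrelevance. Qed.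

Lemma cmapK z : cmap (ccell z) (ccoord z) = z.
Proof.
apply: cspace_eq; rewrite /= nf_id; last exact: ccoord_open.
by rewrite /ccell /ccoord /zdim; case: (sval z) => k [].
Qed.

Lemma cmap_clamp n (C : cell n) x : cmap C (clamp x) = cmap C x.
Proof. by apply: cspace_eq; exact: nf_clamp. Qed.

Lemma cmap_face n (C : cell n.+1) i (e : bool) (x : 'rV[R]_n.+1) :
  1 <= (-1) ^+ (~~ e) * x ord0 i -> cmap C x = cmap (face e i C) (delc i x).
Proof. by move=> ex; apply: cspace_eq; exact: nf_out. Qed.

Lemma cmap_insert n (C : cell n.+1) i (e : bool) x :
  cmap C (insert_coord i ((-1) ^+ (~~ e)) x) = cmap (face e i C) x.
Proof. by apply: cspace_eq; apply: nf_insert; case: e; rewrite /= ?expr0 ?expr1; lra. Qed.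

Lemma zdim_cmap n (C : cell n) x : (zdim (cmap C x) <= n)%N.
Proof.
move: n C x; apply: nf_ind => [n C x ox|n C i e x ex IH].
  by rewrite /zdim /= nf_id.
by rewrite (cmap_face _ ex) ltnW.
Qed.

Lemma zdim_cmap_open n (C : cell n) x : open_cube R n x -> zdim (cmap C x) = n.
Proof. by move=> ox; rewrite /zdim /= nf_id. Qed.

Lemma zdim_cmap_out n (C : cell n) x : ~ open_cube R n x -> (zdim (cmap C x) < n)%N.
Proof.
move: n C x; apply: nf_ind => [n C x ox|n C i e x ex _ _]; first by [].
by rewrite (cmap_face _ ex) ltnS zdim_cmap.
Qed.

Lemma cmap_inj n m (C : cell n) (D : cell m) x y : open_cube R n x -> open_cube R m y ->
  cmap C x = cmap D y -> mkp C x = mkp D y.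
Proof. by move=> ox oy /(congr1 sval) /=; rewrite !nf_id. Qed.

Lemma mkp_inj n (C D : cell n) x y : mkp C x = mkp D y -> C = D /\ x = y.
Proof.
move=> H.
by have [-> ->] := Eqdep_dec.inj_pair2_eq_dec _ PeanoNat.Nat.eq_dec
  (fun k => (cell k * 'rV[R]_k)%type) _ _ _ H.
Qed.

Lemma closed_out n i (e : bool) : closed [set x : 'rV[R]_n.+1 | 1 <= (-1) ^+ (~~ e) * x ord0 i].
Proof.
have cf : continuous (fun x : 'rV[R]_n.+1 => (-1) ^+ (~~ e) * x ord0 i).
  by apply: contM; [exact: cst_continuous|exact: continuous_entry].
exact: closed_comp (fun x _ => cf x) (@closed_ge R 1).
Qed.

Lemma delc_continuous n (i : 'I_n.+1) : continuous (@delc n i).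
Proof.
apply: continuous_row => j; rewrite (_ : (fun _ => _) = fun x : 'rV[R]_n.+1 => x ord0 (fintype.lift i j)).
  exact: continuous_entry.
by apply/funext => x; rewrite mxE.
Qed.

(** Only the open cubes have to be examined: outside the open cube, the preimage of [S] is a finite
    union of sets pulled back from faces, which are closed by induction on the dimension. *)
Lemma closed_cspace (S : set cspace) :
  (forall n (C : cell n), exists B, [/\ closed B, B `<=` cmap C @^-1` S &
     forall x, open_cube R n x -> S (cmap C x) -> B x]) -> closed S.
Proof.
move=> H; apply/cspace_closedE; elim=> [|n IH] C; have [B [cB BS SB]] := H _ C.
  suff -> : cmap C @^-1` S = B by [].
  by apply/seteqP; split=> // x; apply: SB => -[].
pose F (ie : 'I_n.+1 * bool) := [set x : 'rV[R]_n.+1 | 1 <= (-1) ^+ (~~ ie.2) * x ord0 ie.1] `&`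
   delc ie.1 @^-1` (cmap (face ie.2 ie.1 C) @^-1` S).
suff -> : cmap C @^-1` S = B `|` \bigcup_(ie in [set: 'I_n.+1 * bool]) F ie.
  apply: closedU => //; apply: closed_bigcup; first exact: finite_finset.
  move=> [i e] _; apply: closedI; first exact: closed_out.
  by apply: closed_comp (IH _) => x _; exact: delc_continuous.
apply/seteqP; split=> [x Sx|x [/BS //|[[i e] _ [/= ex]]]]; last by rewrite (cmap_face C ex).
have [/existsP[i /outsideP[e ie]]|] := boolP [exists i, outside x i].
  by right; exists (i, e) => //; split=> //=; rewrite -(cmap_face C ie).
by move=> /existsPn ox; left; apply: SB => // i; exact: negbNE (ox i).
Qed.

Definition margin (r : R) (p : point) := forall i, -1 + r <= (tagged p).2 ord0 i <= 1 - r.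

Lemma ex_min n (a : 'I_n -> R) : (forall i, 0 < a i) -> exists2 r, 0 < r & forall i, r <= a i.
Proof.
move=> a0; exists (\big[Num.min/1]_i a i); first by apply: lt_bigmin => // i _; exact: a0.
by move=> i; exact: bigmin_le.
Qed.

Lemma ex_margin (z : cspace) : exists2 r, 0 < r & margin r (sval z).
Proof.
have [|r r0 H] := @ex_min _ (fun i => Num.min (1 - ccoord z ord0 i) (1 + ccoord z ord0 i)).
  by move=> i; have /andP[? ?] := @ccoord_open z i; rewrite lt_min; lra.
exists r => // i; have := H i; rewrite le_min -/(ccoord z) => /andP[? ?].
rewrite -/(ccoord z); lra.
Qed.

Lemma coord_margin r n (C : cell n) p : cube R n p -> margin r (nf C p) ->
  forall i, [\/ p ord0 i = 1, p ord0 i = -1 | -1 + r <= p ord0 i <= 1 - r].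
Proof.
move: n C p; apply: nf_ind => [n C p op cp|n C i e p ep IH cp].
  by rewrite nf_id // => H i; apply: Or33; exact: H.
rewrite (nf_out _ ep) => H j; case: (unliftP i j) => [k ->|->]; last first.
  have /andP[? ?] := cp i; case: e ep {IH H} => /=; rewrite ?expr0 ?expr1 => ?; first by apply: Or31; lra.
  by apply: Or32; lra.
have := IH _ H k; rewrite mxE; apply => l; rewrite mxE; exact: cp.
Qed.

Definition close s (z pt : point) := exists p, [/\ cube R _ p, nf (tagged pt).1 p = z
  & forall i, `|(tagged pt).2 ord0 i - p ord0 i| < s].

(** By [coord_margin] a coordinate of [p] is 1, -1 or at distance at least r from both. So when [y]
    lies on a face, [p], being closer than s, lies on the same face, and both can pass to it. *)
Lemma close_down r s n (C : cell n) y p : s <= r -> s <= 1 -> cube R n y -> cube R n p ->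
  margin r (nf C p) -> (forall i, `|y ord0 i - p ord0 i| < s) -> close s (nf C p) (nf C y).
Proof.
move=> sr s1; move: n C y p; apply: nf_ind => [n C y oy p cy cp mp yp|n C i e y ey IH p cy cp mp yp].
  by rewrite [nf C y]nf_id //; exists p.
have ep : 1 <= (-1) ^+ (~~ e) * p ord0 i.
  have := yp i; have /andP[? ?] := cy i; rewrite ltr_norml => /andP[? ?].
  by case: (coord_margin cp mp i) => [?|?|/andP[? ?]]; case: e ey {IH} => /=;
    rewrite ?expr0 ?expr1 => ?; lra.
rewrite (nf_out _ ey) (nf_out _ ep); apply: IH.
- by move=> j; rewrite mxE; exact: cy.
- by move=> j; rewrite mxE; exact: cp.
- by rewrite -(nf_out _ ep).
- by move=> j; rewrite !mxE; exact: yp.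
Qed.

Lemma close_up s z n (C : cell n) y : 0 < s -> cube R n y -> close s z (nf C y) ->
  exists p, [/\ cube R n p, nf C p = z & forall i, `|y ord0 i - p ord0 i| < s].
Proof.
move=> s0; move: n C y; apply: nf_ind => [n C y oy cy|n C i e y ey IH cy].
  by rewrite nf_id.
have ye : y ord0 i = (-1) ^+ (~~ e).
  by have /andP[? ?] := cy i; case: e ey {IH} => /=; rewrite ?expr0 ?expr1 => ?; lra.
rewrite (nf_out _ ey) => /IH[|p [cp pz yp]]; first by move=> j; rewrite mxE; exact: cy.
exists (insert_coord i ((-1) ^+ (~~ e)) p); split.
- by apply: cube_insert.
- by rewrite (nf_insert _ _ (e := e)) //; case: (e); rewrite /= ?expr0 ?expr1; lra.
- move=> j; case: (unliftP i j) => [k ->|->].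
    by have := yp k; rewrite insert_lift mxE.
  by rewrite insert_same ye subrr normr0.
Qed.

(** In every cube this traces the s-neighbourhood of all the points that represent [z]; such sets
    are open when s is at most the margin of [z]. *)
Definition nball s (z : cspace) : set cspace := [set w | close s (sval z) (sval w)].

Lemma nball_center s z : 0 < s -> nball s z z.
Proof.
move=> s0; exists (ccoord z); split.
- by move=> i; have /andP[? ?] := @ccoord_open z i; rewrite !ltW.
- by rewrite -[in RHS](cmapK z).
- by move=> i; rewrite /ccoord subrr normr0.
Qed.

Lemma nball_open r s z : 0 < s -> s <= r -> s <= 1 -> margin r (sval z) -> open (nball s z).
Proof.
move=> s0 sr s1 mz; apply/cspace_openE => n C.
suff -> : cmap C @^-1` nball s z = \bigcup_(p in [set p | cube R n p /\ nf C p = sval z])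
    [set y | forall i, `|clamp y ord0 i - p ord0 i| < s].
  apply: bigcup_open => p _; rewrite openE => y /= yp.
  have cf i : \forall y \near y, `|clamp y ord0 i - p ord0 i| < s.
    have cy : continuous (fun y : 'rV[R]_n => `|clamp y ord0 i - p ord0 i|).
      apply: (continuous_o (g := fun t : R => `|t|)); first exact: norm_continuous.
      apply: (@contB _ R^o); last exact: cst_continuous.
      by apply: (continuous_o (g := fun x : 'rV[R]_n => x ord0 i)); [exact: continuous_entry|exact: clamp_continuous].
    by apply: (cvgr_lt (F := nbhs y) _ (cy y)); exact: yp.
  exact: (@filter_forall _ _ _ (nbhs y) _ cf).
apply/seteqP; split=> [y|y [p [/= cp pz] yp]]; rewrite /nball /=.
  rewrite -nf_clamp => /(close_up s0 (@clamp_cube _ _))[p [cp pz yp]].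
  by exists p.
by rewrite -nf_clamp -pz; apply: (close_down sr) => //; [exact: clamp_cube|rewrite pz].
Qed.

(** A common point of the two neighbourhoods has, in its own cube, representatives of [z] and [w] at
    distance less than 2s. Passing to the cell of [z], the margin of [z] keeps the representative of
    [w] in the open cube; so [w] lies in the same cell, with coordinates too close to those of
    [z]. *)
Lemma cspace_hausdorff : hausdorff_space cspace.
Proof.
rewrite open_hausdorff => z w zw.
have [r1 r10 m1] := ex_margin z; have [r2 r20 m2] := ex_margin w.
have [t t0 Ht] : exists2 t, 0 < t & forall p, sval w = mkp (ccell z) p ->
    exists i, t <= `|ccoord z ord0 i - p ord0 i|.
  have [[p wp]|H] := pselect (exists p, sval w = mkp (ccell z) p); last first.
    by exists 1 => // p wp; case: H; exists p.
  have [i zp] : exists i, ccoord z ord0 i != p ord0 i.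
    apply/existsP; apply: contra_neqT zw => /existsPn H; apply: cspace_eq.
    rewrite wp -[in LHS](cmapK z) /= nf_id; last exact: ccoord_open.
    by congr mkp; apply/rowP => i; apply/eqP; rewrite -[_ == _]negbK; exact: H.
  exists `|ccoord z ord0 i - p ord0 i|; first by rewrite normr_gt0 subr_eq0.
  by move=> q; rewrite wp => /mkp_inj[_ <-]; exists i.
pose s := Num.min (Num.min (r1 / 4%:R) (r2 / 4%:R)) (Num.min (1 / 4%:R) (t / 4%:R)).
have [s0 sr1 sr2 s1 st] : [/\ 0 < s, s <= r1 / 4%:R, s <= r2 / 4%:R, s <= 1 / 4%:R & s <= t / 4%:R].
  by split; rewrite /s ?lt_min ?ge_min ?lexx ?orbT ?divr_gt0.
clearbody s.
exists (nball s z, nball s w); first by rewrite /= !inE; split; exact: nball_center.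
split.
- by apply: (nball_open (r := r1)) => //; lra.
- by apply: (nball_open (r := r2)) => //; lra.
apply/eqP/seteqP; split=> // u [[p [cp pz up]] [q [cq qw uq]]].
have [q' [cq' qw' zq]] : close (s *+ 2) (sval w) (sval z).
  rewrite -pz -qw; apply: (@close_down r2) => //; rewrite ?qw //; first lra; first lra.
  move=> i; rewrite mulr2n; have := up i; have := uq i.
  by rewrite !ltr_norml => /andP[? ?] /andP[? ?]; apply/andP; split; lra.
have oq : open_cube R _ q'.
  move=> i; have := zq i; have /andP[? ?] := m1 i; rewrite ltr_norml => /andP[? ?]; lra.
have [i] := Ht q' (etrans (esym qw') (nf_id _ oq)).
by have := zq i; rewrite /ccoord; lra.
Qed.

Lemma faces_finite n (C : cell n) : exists2 F : set {k & cell k},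
  finite_set F /\ (forall a, F a -> (tag a < n)%N)
  & forall x, ~ open_cube R n x -> F (existT (fun k => cell k : Type) (zdim (cmap C x)) (ccell (cmap C x))).
Proof.
elim: n C => [|n IH] C.
  exists set0; first by split=> //; exact: finite_set0.
  by move=> x []; case.
pose F0 (ie : 'I_n.+1 * bool) := sval (cid2 (IH (face ie.2 ie.1 C))).
pose F1 (ie : 'I_n.+1 * bool) := F0 ie `|` [set existT (fun k => cell k : Type) n (face ie.2 ie.1 C)].
exists (\bigcup_(ie in [set: 'I_n.+1 * bool]) F1 ie).
  split.
    apply: bigcup_finite => [|ie _]; first exact: finite_finset.
    rewrite finite_setU; split; last exact: finite_set1.
    by rewrite /F0; case: cid2 => F [].
  move=> a [ie _ [|->]] //; rewrite /F0; case: cid2 => F /= [_ H] _ /H; lia.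
move=> x nx.
have [/existsP[i /outsideP[e ie]]|] := boolP [exists i, outside x i]; last first.
  by move=> /existsPn ox; case: nx => i; exact: negbNE (ox i).
exists (i, e) => //; rewrite (cmap_face C ie).
have [ox|nox] := pselect (open_cube R n (delc i x)); last first.
  by left; rewrite /F0; case: cid2 => F _ /=; apply.
by right; rewrite /= /zdim /ccell /= nf_id.
Qed.

Definition cube_cw : CW_complex R cell.
Proof.
refine (@CWComplex R cell cspace cmap cspace_hausdorff _ _ _ _ _).
- by move=> n C; apply: continuous_subspaceT => x; exact: cmap_continuous.
- by move=> z; exists (zdim z), (ccell z), (ccoord z); split; [exact: ccoord_open|exact: cmapK].
- by move=> n m C D x y ox oy; exact: cmap_inj.
- move=> n C; have [F FP FC] := faces_finite C; exists F => // x _ /FC H.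
  exists (existT (fun k => cell k : Type) (zdim (cmap C x)) (ccell (cmap C x))), (ccoord (cmap C x)).
  by split=> //; [exact: ccoord_open|exact: cmapK].
move=> A; rewrite cspace_closedE; split=> H n C.
  by apply: closedI; [exact: closed_cube|exact: H].
(* Closedness inside the cube is turned into closedness in R^n by pulling back along [clamp]. *)
suff -> : cmap C @^-1` A = @clamp n @^-1` (cube R n `&` cmap C @^-1` A).
  by apply: closed_comp (H n C) => x _; exact: clamp_continuous.
apply/seteqP; split=> x /=; rewrite cmap_clamp; first by split; first exact: clamp_cube.
by case.
Defined.
End CubeComplex.

(** * Cellular homology of the cube complex *)

Lemma scaler_cst_continuous (R : realType) (V : normedModType R) (k : R) :
  continuous (fun x : V => k *: x).
Proof. by apply: contZ; [exact: cst_continuous|move=> x; exact: cvg_id]. Qed.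

(** [F e] is meant to be the face x_i = (-1)^e, so [false] is the positive resolution [a] and [true]
    the negative one [b]. *)
Lemma linear_signed_pair (V U W : lmodType rat) (L : {linear V -> W}) (K : {linear U -> W})
    i (F : bool -> V) a b : L (F false) = K a -> L (F true) = K b ->
  L (\sum_(e : bool) (-1) ^+ (i + e) *: F e) = K ((-1) ^+ i *: (a - b)).
Proof.
move=> Fa Fb; rewrite big_bool linearD !linearZ linearB /= Fa Fb addn1 addn0.
by rewrite exprS mulN1r scaleNr addrC -scalerBr.
Qed.

Section CellularHomology.
Context (R : realType) (cell : nat -> choiceType).
Variable face : forall n, bool -> 'I_n.+1 -> cell n.+1 -> cell n.
Hypothesis faceC : forall n (a b : bool) (i : 'I_n.+2) (j : 'I_n.+1) (C : cell n.+2),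
  face b j (face a i C) = face a (face_swap (i, j)).2 (face b (face_swap (i, j)).1 C).
Local Notation Z := (cspace R (@face)).
Local Notation g := (@cmap R cell face _).
Local Notation chin A n := (@chain_in R _ A n).
Local Notation rcyc A B n := (@rel_cycle R _ A B n).
Local Notation rbd A B n := (@rel_boundary R _ A B n).

Definition dilation (k t : R) : R := 1 + unit_clamp t * (k - 1).

Lemma dilation_ge1 k t : 1 <= k -> 1 <= dilation k t.
Proof.
move=> k1; have /andP[? ?] := unit_clamp_itv t.
by rewrite /dilation lerDl mulr_ge0 // subr_ge0.
Qed.

Definition expand (k : R) (q : Z * R) : Z := g (ccell q.1) (dilation k q.2 *: ccoord q.1).

(** A factor of at least 1 leaves extremal coordinates extremal, so scaling commutes with passing to
    faces and expansion is well defined on the complex. *)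
Lemma cmap_scale n (C : cell n) x (s : R) : 1 <= s ->
  g (ccell (g C x)) (s *: ccoord (g C x)) = g C (s *: x).
Proof.
move=> s1; move: n C x; apply: (nf_ind (face := @face)) => [n C x ox|n C i e x ex IH].
  by apply: cspace_eq; rewrite /= /ccell /ccoord /zdim /= [nf face C x]nf_id.
have esx : 1 <= (-1) ^+ (~~ e) * (s *: x) ord0 i.
  by rewrite mxE mulrCA (le_trans ex) // ler_peMl // (le_trans _ ex).
rewrite (cmap_face faceC _ esx) (cmap_face faceC _ ex) IH; congr cmap.
by apply/rowP => j; rewrite !mxE.
Qed.

Lemma expand_cmap k t n (C : cell n) x : 1 <= k -> expand k (g C x, t) = g C (dilation k t *: x).
Proof. by move=> k1; rewrite /expand /= cmap_scale // dilation_ge1. Qed.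

Lemma dilation_continuous k : continuous (dilation k).
Proof.
apply: (@contD _ R^o); first exact: cst_continuous.
by apply: contM; [exact: unit_clamp_continuous|exact: cst_continuous].
Qed.

Section ExpandContinuous.
Import ArrowAsCompactOpen.
(** The topology of the complex is a final one, which need not be compatible with a product by R.
    Since R is locally compact, the map may be curried into the compact-open topology, and
    continuity is then tested cube by cube. *)
Lemma expand_continuous k : 1 <= k -> continuous (expand k).
Proof.
move=> k1.
have H n (C : cell n) : continuous (fun q : 'rV[R]_n * R => expand k (g C q.1, q.2)).
  rewrite (_ : (fun q => _) = g C \o (fun q => dilation k q.2 *: q.1)); last first.
    by apply/funext => q; rewrite expand_cmap.
  apply: continuous_o; first exact: cmap_continuous.
  apply: contZ; last exact: continuous_fst.
  by apply: (continuous_o (@dilation_continuous k)); exact: continuous_snd.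
have -> : expand k = uncurry (fun z t => expand k (z, t)) by apply/funext => -[].
apply: continuous_uncurry.
- exact: locally_compactR.
- exact: Rhausdorff.
- apply: cspace_continuous => n C.
  by have [] := continuous_curry (H n C).
- move=> z t; rewrite -(cmapK z).
  by have [_ /(_ (ccoord z) t)] := continuous_curry (H _ (ccell z)).
Qed.
End ExpandContinuous.

Definition sk n : set Z := [set z | (zdim z < n)%N].
Definition pure n : set Z := [set z | zdim z = n].
Definition ocell n (C : cell n) : set Z := [set z | exists2 x, open_cube R n x & g C x = z].
Definition half n : set Z :=
  [set z | exists (C : cell n) x, (forall i : 'I_n, `|(x : 'rV[R]_n) ord0 i| <= 2^-1) /\ g C x = z].

Lemma half_open n (x : 'rV[R]_n) : (forall i, `|x ord0 i| <= 2^-1) -> open_cube R n x.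
Proof. by move=> H i; have := H i; rewrite ler_norml => /andP[? ?]; lra. Qed.

Lemma pureP n z : pure n z <-> exists C : cell n, ocell C z.
Proof.
split=> [<-|[C [x ox <-]]]; last exact: zdim_cmap_open.
by exists (ccell z), (ccoord z); [exact: ccoord_open|exact: cmapK].
Qed.

Lemma ocell_pure n (C : cell n) : ocell C `<=` pure n.
Proof. by move=> z Cz; apply/pureP; exists C. Qed.

Lemma ocell_inj n (C D : cell n) z : ocell C z -> ocell D z -> C = D.
Proof. by move=> [x ox <-] [y oy E]; have /mkp_inj[] := cmap_inj ox oy (esym E). Qed.

Lemma ocell_all n m (C : cell n) (D : cell m) x : open_cube R m x -> ocell C (g D x) ->
  forall y, open_cube R m y -> ocell C (g D y).
Proof.
move=> ox [u ou E] y oy; have nm : n = m by rewrite -(zdim_cmap_open face D ox) -E zdim_cmap_open.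
move: C u ou E; rewrite nm => C u ou E; exists y => //.
by have /mkp_inj[->] := cmap_inj ou ox E.
Qed.

Lemma closed_cells (S : set Z) :
  (forall n (C : cell n), (forall x, S (g C x)) \/ (forall x, open_cube R n x -> ~ S (g C x))) ->
  closed S.
Proof.
move=> H; apply: (closed_cspace faceC) => n C; have [SC|SC] := H _ C.
  by exists setT; split=> // x *; exact: SC.
by exists set0; split=> [||x ox /(SC _ ox)] //; exact: closed0.
Qed.

Lemma closed_sk n : closed (sk n).
Proof.
apply: closed_cells => m C; have [mn|nm] := ltnP m n; [left|right] => x.
  by rewrite /sk /=; apply: leq_ltn_trans (zdim_cmap faceC C x) mn.
by move=> ox; rewrite /sk /= zdim_cmap_open // ltnNge nm.
Qed.

Lemma closed_others n (C : cell n) : closed (sk n.+1 `\` ocell C).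
Proof.
apply: closed_cells => m D; have [mn|nm] := leqP m n; last first.
  by right => x ox [+ _]; rewrite /sk /= zdim_cmap_open // ltnS leqNgt nm.
have [[x [ox Dx]]|H] := pselect (exists x, open_cube R m x /\ ocell C (g D x)).
  by right => y oy [_]; apply; exact: ocell_all Dx _ oy.
left => x; split; first by rewrite /sk /= ltnS (leq_trans (zdim_cmap faceC D x)).
move=> Dx; have [ox|nox] := pselect (open_cube R m x); first by apply: H; exists x.
have := zdim_cmap_out faceC D nox; rewrite ltnNge; apply/negP/negPn.
by rewrite (ocell_pure Dx).
Qed.

Lemma closed_ocell n (C : cell n) : closed (sk n `|` ocell C).
Proof.
apply: closed_cells => m D; have [mn|nm] := ltnP m n.
  by left => x; left; rewrite /sk /= (leq_ltn_trans (zdim_cmap faceC D x)).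
have [[x [ox Dx]]|H] := pselect (exists x, open_cube R m x /\ ocell C (g D x)); last first.
  right => x ox []; first by rewrite /sk /= zdim_cmap_open // ltnNge nm.
  by move=> Dx; apply: H; exists x.
left => y; have [oy|noy] := pselect (open_cube R m y); first by right; exact: ocell_all Dx _ oy.
left; have := zdim_cmap_out faceC D noy; rewrite /sk /=.
by have := ocell_pure Dx; rewrite /pure /= zdim_cmap_open //; lia.
Qed.

Lemma closed_half n : closed (half n).
Proof.
apply: (closed_cspace faceC) => m D; have [mn|mn] := eqVneq m n; last first.
  exists set0; split=> //; first exact: closed0.
  move=> x ox [C [y [/half_open oy E]]]; case/eqP: mn.
  by rewrite -(zdim_cmap_open face D ox) -E zdim_cmap_open.
subst m; exists ((fun x : 'rV[R]_n => 2 *: x) @^-1` cube R n); split.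
- by apply: closed_comp (@closed_cube R n) => x _; exact: scaler_cst_continuous.
- move=> x cx; exists D, x; split=> // i; have := cx i; rewrite mxE => /andP[? ?].
  by rewrite ler_norml; apply/andP; split; lra.
- move=> x ox [C [y [hy /(cmap_inj (half_open hy) ox) /mkp_inj[_ <-]]]] i.
  by have := hy i; rewrite mxE ler_norml => /andP[? ?]; apply/andP; split; lra.
Qed.

Lemma open_setC (T : topologicalType) (A : set T) : closed A -> open (~` A).
Proof. by rewrite openC. Qed.

(** Relative to [pure n] an open cell is both open and closed; so [f] cannot leave the cell of [f 0]
    along a line through the origin. *)
Lemma one_cell n m (f : 'rV[R]_m -> Z) : continuous f -> (forall x, pure n (f x)) ->
  exists C : cell n, forall x, ocell C (f x).
Proof.
move=> cf pf; have [C Cf] := (pureP _ _).1 (pf 0); exists C => x.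
pose p (t : R) := f (t *: x).
have cp : continuous p.
  by apply: continuous_o => //; apply: contZ; [move=> ?; exact: cvg_id|exact: cst_continuous].
pose B := p @^-1` ocell C.
have BT : B = setT.
  have /connected_intervalP cT : is_interval [set: R] by [].
  apply: cT.
  - by exists 0; rewrite /B /p /= scale0r.
  - exists (p @^-1` (~` (sk n.+1 `\` ocell C))).
      by apply: open_comp (open_setC (@closed_others n C)) => t _; exact: cp.
    rewrite setTI; apply/seteqP; split=> t; rewrite /B /=; first by move=> ? [].
    by move=> H; apply: contrapT => H'; apply: H; split=> //; rewrite /sk /= (pf _).
  - exists (p @^-1` (sk n `|` ocell C)).
      by apply: closed_comp (@closed_ocell n C) => t _; exact: cp.
    rewrite setTI; apply/seteqP; split=> t; rewrite /B /=; first by right.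
    by case=> //; rewrite /sk /= (pf _) ltnn.
by have : B 1 by [rewrite BT]; rewrite /B /p /= scale1r.
Qed.

Definition cellx n (C : cell n) (z : Z) : 'rV[R]_n :=
  if pselect (exists2 x, open_cube R n x & g C x = z) is left e then sval (cid2 e) else 0.

Lemma cellxP n (C : cell n) z : ocell C z -> open_cube R n (cellx C z) /\ g C (cellx C z) = z.
Proof. by rewrite /cellx; case: pselect => // e _; case: cid2. Qed.

Lemma cellxK n (C : cell n) x : open_cube R n x -> cellx C (g C x) = x.
Proof.
move=> ox; have [|oy] := @cellxP _ C (g C x); first by exists x.
by move=> /(cmap_inj oy ox)/mkp_inj[].
Qed.

Lemma compact_cube n : compact (cube R n).
Proof.
have -> : cube R n = [set v : 'rV[R]_n | forall i, [set` `[-1, 1]%R] (v ord0 i)].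
  by apply/seteqP; split=> x H i; have := H i; rewrite /= in_itv.
by apply: (@rV_compact R n (fun=> `[-1, 1]%classic)) => i; exact: segment_compact.
Qed.

(** The inverse of the characteristic map on the open cell is continuous: the image of a closed part
    of the compact cube is compact, hence closed in a Hausdorff space, and boundary points of the
    cube have images of lower dimension. *)
Lemma cellx_continuous n (C : cell n) (T : topologicalType) (f : T -> Z) : continuous f ->
  (forall x, ocell C (f x)) -> continuous (cellx C \o f).
Proof.
move=> cf fC; apply/continuous_closedP => K cK.
suff -> : (cellx C \o f) @^-1` K = f @^-1` (g C @` (K `&` cube R n)).
  apply: closed_comp => [x _|]; first exact: cf.
  apply: compact_closed; first exact: cspace_hausdorff.
  apply: continuous_compact; first by apply: continuous_subspaceT => x; exact: cmap_continuous.
  by rewrite setIC; apply: compact_closedI => //; exact: compact_cube.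
apply/seteqP; split=> x /=.
  move=> Kx; exists (cellx C (f x)); last by have [] := cellxP (fC x).
  by split=> // i; have [/(_ i)/andP[? ?] _] := cellxP (fC x); rewrite !ltW.
move=> [y [Ky cy] E]; have [oy|noy] := pselect (open_cube R n y); first by rewrite -E cellxK.
have := zdim_cmap_out faceC C noy; rewrite E; have := ocell_pure (fC x); rewrite /pure /= => ->.
by rewrite ltnn.
Qed.

(* The part of a chain in the open cell of C, seen in the cube. *)
Definition rho n (C : cell n) m : singular_chain R Z m -> singular_chain R 'rV[R]_n m :=
  fglift (fun s : singular_simplex R Z m => if `[< range s `<=` ocell C >] then sx (cellx C \o hat s) else 0).
HB.instance Definition _ n (C : cell n) m := GRing.Linear.on (@rho n C m).

Lemma rho_in n (C : cell n) m (f : 'rV[R]_m.+1 -> Z) : continuous f ->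
  (forall x, ocell C (f x)) -> rho C (sx f) = sx (cellx C \o f).
Proof.
move=> cf fC; rewrite (sxE cf) /rho fglift1 asboolT; last by move=> _ [x _ <-]; exact: fC.
apply: sx_eq.
- apply: cellx_continuous; first exact: hat_continuous.
  by move=> x; exact: fC.
- exact: cellx_continuous.
- by move=> x Dx; change (cellx C (f (retv x)) = cellx C (f x)); rewrite retv_id.
Qed.

Lemma rho_out n (C : cell n) m (f : 'rV[R]_m.+1 -> Z) : continuous f ->
  (forall x, ~ ocell C (f x)) -> rho C (sx f) = 0.
Proof.
move=> cf fC; rewrite (sxE cf) /rho fglift1 asboolF // => /(_ (f (retv 0))) [|y oy E].
  by exists (ret 0).
by apply: (fC (retv 0)); exists y.
Qed.

(** By [one_cell] a simplex in [pure n] lies with all its faces in a single open cell, so selecting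
    the simplices of [C] commutes with the boundary. *)
Lemma rho_bd n (C : cell n) m c : c \in chin (pure n) m.+1 ->
  singular_boundary (rho C c) = rho C (singular_boundary c).
Proof.
move: c; apply: chain_in_ind => [|a f c cf fA IH]; first by rewrite !linear0.
rewrite !linearP /= IH; congr (_ + _); congr (_ *: _).
have cfi i : continuous (fun x => f (insert_coord i 0 x)) by apply: continuous_o => //; exact: insertc.
rewrite sbd_sx // linear_sum; have [D fD] := one_cell cf fA; have [CD|CD] := eqVneq C D.
  subst D; rewrite rho_in // sbd_sx; last exact: cellx_continuous.
  by apply: eq_bigr => i _; rewrite linearZ /= rho_in.
have nC x : ~ ocell C (f x) by move=> H; case/eqP: CD; exact: ocell_inj H (fD x).
rewrite rho_out // linear0 big1 // => i _.
by rewrite linearZ /= rho_out ?scaler0 // => x; exact: nC.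
Qed.

Lemma rho_chin n (C : cell n) m c (S : set Z) : c \in chin (pure n `&` S) m ->
  rho C c \in chin (open_cube R n `&` g C @^-1` S) m.
Proof.
move: c; apply: chain_in_ind => [|a f c cf fA IH]; first by rewrite linear0 rpred0.
rewrite linearP /= rpredD // rpredZ //.
have [D fD] := one_cell cf (fun x => proj1 (fA x)); have [CD|CD] := eqVneq C D.
  subst D; rewrite rho_in //; apply: sx_in => x _ /=.
  by have [? E] := cellxP (fD x); split=> //; rewrite /= E; have [] := fA x.
rewrite rho_out ?rpred0 // => x H; case/eqP: CD; exact: ocell_inj H (fD x).
Qed.

Lemma rho_push n (C : cell n) m w : w \in chin (open_cube R n) m -> rho C (pushf (g C) w) = w.
Proof.
have cg : continuous (g C) by exact: cmap_continuous.
move: w; apply: chain_in_ind => [|a f c cf fA IH]; first by rewrite !linear0.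
rewrite !linearP /= IH push_sx // rho_in; last 2 first.
- exact: continuous_o.
- by move=> x; exists (f x).
suff -> : cellx C \o (g C \o f) = f by [].
by apply/funext => x /=; exact: cellxK.
Qed.

Lemma push_rho n (C : cell n) m c : c \in chin (ocell C) m -> pushf (g C) (rho C c) = c.
Proof.
have cg : continuous (g C) by exact: cmap_continuous.
move: c; apply: chain_in_ind => [|a f c cf fA IH]; first by rewrite !linear0.
rewrite !linearP /= IH rho_in // push_sx //; last exact: cellx_continuous.
by congr (_ + _); congr (_ *: sx _); apply/funext => x /=; have [] := cellxP (fA x).
Qed.

Lemma cell_decomposition n m c : c \in chin (pure n) m ->
  exists s : seq (cell n), uniq s /\ c = \sum_(C <- s) pushf (g C) (rho C c).
Proof.
(* Asking for every larger duplicate-free list lets the two lists met in the induction on the chain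
   be replaced by a common one. *)
move=> cP; suff [s H] : exists s : seq (cell n), forall t, uniq t -> {subset s <= t} ->
    c = \sum_(C <- t) pushf (g C) (rho C c).
  exists (undup s); rewrite undup_uniq; split=> //.
  by apply: H; [exact: undup_uniq|move=> x; rewrite mem_undup].
move: c cP; apply: chain_in_ind => [|a f c cf fA [s IH]].
  by exists [::] => t _ _; rewrite big1 // => C _; rewrite !linear0.
have [D fD] := one_cell cf fA; exists (D :: s) => t ut st.
have {}IH := IH t ut (fun x xs => st x (mem_behead (s := D :: s) xs)).
under eq_bigr => C _ do rewrite !linearP /=.
rewrite big_split /= -IH -scaler_sumr; congr (_ + _); congr (_ *: _).
have Dt : D \in t by apply: st; exact: mem_head.
rewrite (bigD1_seq D) //= push_rho; last by apply: sx_in => x _.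
rewrite big1 ?addr0 // => C CD; rewrite rho_out ?linear0 // => x H.
by case/eqP: CD; exact: ocell_inj H (fD x).
Qed.

Definition outer n (d : R) : set 'rV[R]_n := [set x | exists i, d <= `|x ord0 i|].

(** A chain involves finitely many simplices with compact images; missing the origin, they keep a
    positive distance from it. *)
Lemma nz_margin n m v : v \in chin (@nz R n) m ->
  exists2 d, 0 < d <= 1 & v \in chin (outer d) m.
Proof.
move: v; apply: chain_in_ind => [|a f c cf fA [d /andP[d0 d1] cd]].
  by exists 1; rewrite ?rpred0 ?ltr01 //=.
have [e /andP[e0 e1] H] : exists2 e, 0 < e <= 1 & forall x, std_simplex R m x -> exists i, e <= `|f x ord0 i|.
  have /compact_near_coveringP := @compact_simplex R m.
  move/(_ R (0 : R)^'+ (fun e x => exists i, e <= `|f x ord0 i|)) => H.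
  have /H E : forall x, std_simplex R m x ->
      \forall x' \near x & i \near (0 : R)^'+, exists j, i <= `|f x' ord0 j|.
    move=> x _; have [j fj] : exists j, f x ord0 j != 0.
      apply/existsP; apply: contraNT (fA x) => /existsPn H'; apply/eqP/rowP => j.
      by rewrite mxE; apply/eqP; rewrite -[_ == _]negbK; exact: H'.
    have cfj : continuous (fun x => `|f x ord0 j|).
      apply: (continuous_o (g := fun t : R => `|t|)); first exact: norm_continuous.
      by apply: (continuous_o (g := fun x : 'rV[R]_n => x ord0 j)); [exact: continuous_entry|exact: cf].
    exists ([set x' | `|f x ord0 j| / 2 < `|f x' ord0 j|], [set e | e < `|f x ord0 j| / 2]); first split=> /=.
    - by apply: (cvgr_gt (F := nbhs x) _ (cfj x)); rewrite ltr_pdivrMr // ltr_pMr ?normr_gt0 // ltr1n.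
    - by apply: nbhs_right_lt; rewrite divr_gt0 // normr_gt0.
    by move=> [x' e] /= [? ?]; exists j; apply: ltW; apply: lt_trans; eassumption.
  near (0 : R)^'+ => e; exists e; last by near: e; exact: E.
  by apply/andP; split; near: e; [exact: nbhs_right_gt|exact: nbhs_right_le].
exists (Num.min d e); first by rewrite lt_min d0 e0 ge_min d1.
rewrite rpredD //; last by apply: chain_inS cd => x [i xi]; exists i; rewrite ge_min xi.
by rewrite rpredZ // sx_in // => x /H[i xi]; exists i; rewrite ge_min xi orbT.
Unshelve. all: by end_near. Qed.

Definition gen n (C : cell n) : singular_chain R Z n := pushf (g C) (cubech R n).

Lemma cmap_sk n (C : cell n) x : sk n.+1 (g C x).
Proof. by rewrite /sk /= ltnS zdim_cmap. Qed.

Lemma cmap_out n (C : cell n) x : outer 1 x -> sk n (g C x).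
Proof.
move=> [i xi]; apply: zdim_cmap_out => // ox; have := ox i.
by move: xi; rewrite -ltr_norml ltNge => ->.
Qed.

Lemma expand_sk k n z t : 1 <= k -> sk n z -> sk n (expand k (z, t)).
Proof.
move=> k1 zn; rewrite -(cmapK z) expand_cmap //.
by apply: leq_ltn_trans zn; exact: zdim_cmap.
Qed.

Lemma expand_id k : 1 <= k -> G0 (expand k) = id.
Proof.
move=> k1; apply/funext => z; rewrite /G0 -{1}(cmapK z) expand_cmap //.
by rewrite /dilation unit_clamp0 mul0r addr0 scale1r cmapK.
Qed.

Lemma expand1 k n (C : cell n) x : 1 <= k -> G1 (expand k) (g C x) = g C (k *: x).
Proof. by move=> k1; rewrite /G1 expand_cmap // /dilation unit_clamp1 mul1r addrC subrK. Qed.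

Lemma expand_hom k n c : 1 <= k -> c \in rcyc (sk n.+1) (sk n) n ->
  pushf (G1 (expand k)) c - c \in rbd (sk n.+1) (sk n) n.
Proof.
move=> k1 cc; have := sprism_hom (expand_continuous k1)
  (fun z t => @expand_sk k n.+1 z t k1) (fun z t => @expand_sk k n z t k1) cc.
by rewrite expand_id // push_id.
Qed.

Lemma expand1_continuous k : 1 <= k -> continuous (G1 (expand k)).
Proof. by move=> k1; apply: continuous_Gt; exact: expand_continuous. Qed.

Lemma outer_nz n : outer 1 `<=` @nz R n.
Proof. by move=> x [i xi]; apply/eqP => x0; move: xi; rewrite x0 mxE normr0 ler10. Qed.

Lemma cubech_outer n : cubech R n \in rcyc setT (outer 1) n.
Proof.
case: n => [|n]; first exact: chain_in_setT.
apply/andP; split; first exact: chain_in_setT.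
rewrite cubech_bd rpred_sum // => -[i e] _; rewrite rpredZ //.
apply: (push_in (A := setT)) => [x _|]; last exact: chain_in_setT.
by exists i; rewrite insert_same normrX normrN normr1 expr1n.
Qed.

Lemma cmap_rcyc n (C : cell n) w : w \in rcyc setT (outer 1) n -> pushf (g C) w \in rcyc (sk n.+1) (sk n) n.
Proof.
apply: rcyc_push; first exact: cmap_continuous.
  by move=> x _; exact: cmap_sk.
by move=> x; exact: cmap_out.
Qed.

(** [local_span] gives the relation modulo a chain off the origin, say at distance d. Expansion by
    1/d, homotopic to the identity, carries that chain out of the open cube and so into the lower
    skeleton. *)
Lemma span_cell n (C : cell n) w : w \in rcyc setT (outer 1) n ->
  exists a, pushf (g C) w - a *: gen C \in rbd (sk n.+1) (sk n) n.
Proof.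
move=> wc; have cg : continuous (g C) by exact: cmap_continuous.
have [a /rbdP[y [v [_ vn wE]]]] := local_span (rcycS (fun x H => H) (@outer_nz n) wc).
have [d /andP[d0 d1] vd] := nz_margin vn; have k1 : 1 <= d^-1 by rewrite invr_ge1 ?unitfE ?gt_eqF.
have cG := expand1_continuous k1; exists a.
have rG c : c \in rcyc setT (outer 1) n ->
    pushf (G1 (expand d^-1) \o g C) c - pushf (g C) c \in rbd (sk n.+1) (sk n) n.
  by move=> cc; rewrite -push_comp //; apply: expand_hom => //; exact: cmap_rcyc.
have alg (V : zmodType) (gw ga pw pa : V) : gw - ga = (pw - pa) - (pw - gw) + (pa - ga).
  by rewrite opprB [pw - pa + _]addrC !subrKA.
rewrite (alg _ _ _ (pushf (G1 (expand d^-1) \o g C) w) (a *: pushf (G1 (expand d^-1) \o g C) (cubech R n))).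
rewrite -scalerBr rpredD ?rpredZ ?rG ?cubech_outer // rpredB ?rG //.
rewrite -linearZ -linearB wE linearD /= -push_bd; last exact: continuous_o.
apply: rpredD.
  apply: rbd_bd; apply: (push_in (A := setT)) => [x _|]; last exact: chain_in_setT.
  by rewrite /= expand1 //; exact: cmap_sk.
apply: rbd_in; apply: push_in vd => x [i xi]; rewrite /= expand1 //; apply: cmap_out.
by exists i; rewrite mxE normrM gtr0_norm ?invr_gt0 // mulrC ler_pdivlMr // mul1r.
Qed.

Definition comb n : {freeg (cell n) / rat} -> singular_chain R Z n := fglift (@gen n).
HB.instance Definition _ n := GRing.Linear.on (@comb n).

Lemma comb1 n (C : cell n) : comb << C >> = gen C.
Proof. exact: fglift1. Qed.

Lemma rho_cyc n (C : cell n) c (S : set Z) : c \in rcyc (pure n) (pure n `&` S) n ->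
  rho C c \in rcyc setT (open_cube R n `&` g C @^-1` S) n.
Proof.
case: n C c => [|n] C c; first by move=> _; exact: chain_in_setT.
move=> /andP[cp cb]; apply/andP; split; first exact: chain_in_setT.
by rewrite rho_bd // rho_chin.
Qed.

Lemma split_cyc n N (c c1 c2 : singular_chain R Z n) (S : set Z) : c \in rcyc (sk n.+1) (sk n) n ->
  ssdN N c = c1 + c2 -> c1 \in chin (pure n) n -> c2 \in chin S n -> sk n `<=` S ->
  c1 \in rcyc (pure n) (pure n `&` S) n.
Proof.
case: n c c1 c2 => [|n] c c1 c2; first by [].
move=> /andP[_ cb] E c1p c2S kS; apply/andP; split=> //; apply: chain_inI; first exact: chain_in_bd.
have -> : c1 = ssdN N c - c2 by rewrite E addrK.
by rewrite linearB /= ssdN_bd rpredB ?chain_in_bd // ssdN_in //; exact: chain_inS cb.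
Qed.

Lemma half_pure n : half n `<=` pure n.
Proof. by move=> z [C [x [/half_open ox <-]]]; exact: zdim_cmap_open. Qed.

(** Subdivide for the complements of the lower skeleton and of the cubes of half size. Expansion by
    2 sends the second part into the lower skeleton. The first part splits over the open cells, and
    in each cell its boundary avoids the half cube, so after doubling it is a relative cycle to
    which [span_cell] applies. *)
Theorem cells_span n c : c \in rcyc (sk n.+1) (sk n) n ->
  exists a, c - comb a \in rbd (sk n.+1) (sk n) n.
Proof.
move=> cc; have k1 : 1 <= 2 :> R by rewrite ler1n.
have cG := expand1_continuous k1.
have cov : sk n.+1 `<=` ~` sk n `|` ~` half n.
  move=> z _; have [hz|] := pselect (half n z); last by right.
  by left; rewrite /sk /= (half_pure hz) ltnn.
have [N [c1 [c2 [cE c1A c2A]]]] :=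
  small_chain (open_setC (@closed_sk n)) (open_setC (@closed_half n)) cov (rcyc_in cc).
have c1p : c1 \in chin (pure n) n.
  by apply: chain_inS c1A => z [/= zn /negP]; rewrite /sk /pure /= in zn *; lia.
have c2h : c2 \in chin (~` half n) n by apply: chain_inS c2A => z [].
have kh : sk n `<=` ~` half n by move=> z zn /half_pure; rewrite /sk /pure /= in zn *; lia.
have c1c := split_cyc cc cE c1p c2h kh.
have [s [us c1E]] := cell_decomposition c1p.
have [b Hb] : exists b, pushf (G1 (expand 2)) c1 - comb b \in rbd (sk n.+1) (sk n) n.
  rewrite c1E linear_sum /=; elim: s {us c1E} => [|C s [b IH]].
    by exists 0; rewrite big_nil linear0 subr0 rpred0.
  have [|a Ha] := @span_cell n C (pushf (fun x : 'rV[R]_n => 2 *: x) (rho C c1)).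
    apply: rcyc_push (rho_cyc C c1c) => //; first exact: scaler_cst_continuous.
    move=> x [ox hx]; apply: contrapT => H; apply: hx; exists C, x; split=> // i.
    rewrite leNgt; apply/negP => xi; apply: H; exists i.
    by rewrite mxE normrM ger0_norm // mulrC -ler_pdivrMr // mul1r ltW.
  exists (a *: << C >> + b); rewrite big_cons linearP /= comb1 opprD addrACA rpredD //.
  suff -> : pushf (G1 (expand 2)) (pushf (g C) (rho C c1)) =
    pushf (g C) (pushf (fun x : 'rV[R]_n => 2 *: x) (rho C c1)) by [].
  have cg : continuous (g C) by exact: cmap_continuous.
  rewrite !push_comp //; last exact: scaler_cst_continuous.
  suff -> : G1 (expand 2) \o g C = g C \o (fun x : 'rV[R]_n => 2 *: x) by [].
  by apply/funext => x; rewrite /= expand1.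
exists b; rewrite -[c - _](subrKA (ssdN N c)) rpredD ?ssdN_rbd //.
have H := expand_hom k1 (ssdN_rcyc N cc).
rewrite -[ssdN N c - _](subrKA (pushf (G1 (expand 2)) (ssdN N c))) rpredD //.
  by rewrite -opprB rpredN.
rewrite [ssdN N c]cE linearD /= addrAC rpredD // rbd_in //.
apply: push_in c2A => z [zn hz]; rewrite -(cmapK z) expand1 //.
have [zn'|nz] := ltnP (zdim z) n.
  by apply: leq_ltn_trans zn'; exact: zdim_cmap.
have E : zdim z = n by apply/eqP; rewrite eqn_leq nz -ltnS zn.
rewrite /sk /= -[X in (_ < X)%N]E; apply: cmap_out.
apply: contrapT => H'; apply: hz; subst n; exists (ccell z), (ccoord z); split; last exact: cmapK.
move=> i; rewrite leNgt; apply/negP => xi; apply: H'; exists i.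
by rewrite mxE normrM ger0_norm // mulrC -ler_pdivrMr // mul1r ltW.
Qed.

Lemma closed_point (z : Z) : closed [set z].
Proof. by apply: accessible_closed_set1; apply: hausdorff_accessible; exact: cspace_hausdorff. Qed.

Lemma comb_center n (C : cell n) a : comb a - coeff C a *: gen C \in chin (~` [set g C 0]) n.
Proof.
elim/freeg_ind: a => [|k D a IH]; first by rewrite linear0 coeff0 scale0r subr0 rpred0.
rewrite linearP /= comb1 coeffD coeffZ coeffU mul1r scalerDl opprD addrACA rpredD //.
have [->|DC] := eqVneq D C; first by rewrite mulr1 subrr rpred0.
rewrite mulr0 scale0r subr0 rpredZ //; apply: (push_in (A := setT)) => [x _ E|]; last exact: chain_in_setT.
have o0 : open_cube R n 0 by move=> i; rewrite mxE ltrN10 ltr01.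
have [ox|nox] := pselect (open_cube R n x).
  by case/eqP: DC; have /mkp_inj[] := cmap_inj ox o0 E.
by have := zdim_cmap_out faceC D nox; rewrite E zdim_cmap_open // ltnn.
Qed.

Lemma cmap_center n (C : cell n) x : nz x -> (~` [set g C 0]) (g C x).
Proof.
move=> x0 E; have o0 : open_cube R n 0 by move=> i; rewrite mxE ltrN10 ltr01.
have [ox|nox] := pselect (open_cube R n x).
  by case/eqP: x0; have /mkp_inj[] := cmap_inj ox o0 E.
by have := zdim_cmap_out faceC C nox; rewrite E zdim_cmap_open // ltnn.
Qed.

(** For the coefficient at [C], enlarge the lower skeleton to the complement of the centre of [C]:
    there all other generators vanish. Excision to the open cell and [rho] bring the relation to
    R^n, where [local_homology_inj] applies. *)
Theorem cells_free n a : comb a \in rbd (sk n.+1) (sk n) n -> a = 0.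
Proof.
move=> Ha; apply/eqP/freeg_eqP => C; rewrite coeff0; set a0 := coeff C a.
have cg : continuous (g C) by exact: cmap_continuous.
have cs : continuous (fun x : 'rV[R]_n => 2^-1 *: x) by exact: scaler_cst_continuous.
set U := ~` [set g C 0].
(* The closed cube is not contained in the open one, on which [rho] inverts the characteristic map;
   the cube of half size is, and it represents the same class. *)
pose h := pushf (fun x : 'rV[R]_n => 2^-1 *: x) (cubech R n).
have Hh : h - cubech R n \in rbd setT (@nz R n) n.
  apply: (line_hom cs (A := setT) (B := @nz R n)) => //; last exact: cubech_cycle.
  move=> z t z0; rewrite /line /=.
  rewrite (_ : z + _ = (1 + unit_clamp t * (2^-1 - 1)) *: z); last first.
    by rewrite scalerDl scale1r -scalerA scalerBl scale1r.
  have /andP[? ?] := unit_clamp_itv t.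
  by rewrite /nz /= scaler_eq0 negb_or z0 andbT; apply/eqP; lra.
have ho : h \in chin (open_cube R n) n.
  apply: push_in (cubech_in R n) => x cx i; have /andP[? ?] := cx i.
  by rewrite mxE; apply/andP; split; lra.
have hc : h \in rcyc setT (@nz R n) n.
  apply: rcyc_push (cubech_cycle R n) => // x x0.
  by rewrite /nz /= scaler_eq0 negb_or invr_eq0 pnatr_eq0.
have kU : sk n `<=` U.
  move=> z zn E; move: zn; rewrite E /sk /= zdim_cmap_open ?ltnn // => i.
  by rewrite mxE ltrN10 ltr01.
have /rbdP[d [e [dA eU E]]] : a0 *: pushf (g C) h \in rbd (sk n.+1) U n.
  have H1 : a0 *: gen C \in rbd (sk n.+1) U n.
    rewrite -[a0 *: gen C](subKr (comb a)) rpredB //.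
      exact: rbdS (fun x H => H) kU Ha.
    by apply: rbd_in; exact: comb_center.
  rewrite -[a0 *: _](subrK (a0 *: gen C)) rpredD // -scalerBr rpredZ // -linearB /=.
  apply: rbd_push Hh => // x; first by move=> _; exact: cmap_sk.
  exact: cmap_center.
have cov : sk n.+1 `<=` ~` (sk n.+1 `\` ocell C) `|` U.
  move=> z zn; have [Cz|nCz] := pselect (ocell C z); first by left; case.
  by right=> Ez; apply: nCz; rewrite Ez; exists 0 => // i; rewrite mxE ltrN10 ltr01.
have [N [d1 [d2 [dE d1A d2A]]]] :=
  small_chain (open_setC (@closed_others n C)) (open_setC (@closed_point (g C 0))) cov dA.
have {}d1A : d1 \in chin (ocell C) n.+1.
  by apply: chain_inS d1A => z [zn H]; apply: contrapT => H'; exact: H.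
have {}d2A : d2 \in chin U n.+1 by apply: chain_inS d2A => z [].
have goC c : c \in chin (open_cube R n) n -> pushf (g C) c \in chin (ocell C) n.
  by apply: push_in => x ox; exists x.
pose X := pushf (g C) (ssdN N (a0 *: h)) - singular_boundary d1.
have hN : ssdN N (a0 *: h) \in chin (open_cube R n) n by rewrite ssdN_in // rpredZ.
have XU : X \in chin (pure n `&` U) n.
  apply: chain_inI.
    by apply: (chain_inS (@ocell_pure n C)); rewrite rpredB ?chain_in_bd // goC.
  rewrite /X -push_ssdN //.
  have -> : pushf (g C) (a0 *: h) = singular_boundary d + e by rewrite -E linearZ.
  rewrite linearD /= -ssdN_bd [ssdN N d]dE linearD /=.
  rewrite addrAC [_ + _ - singular_boundary d1]addrAC subrr add0r.
  by rewrite rpredD ?chain_in_bd // ssdN_in.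
have := rho_chin C XU; rewrite linearB /= rho_push //.
rewrite -rho_bd; last exact: chain_inS (@ocell_pure n C) d1A.
move=> HX; apply: (local_homology_inj (R := R) (n := n)).
rewrite -[a0 *: _](subKr (a0 *: h)) rpredB //; last first.
  by rewrite -scalerBr rpredZ.
rewrite -[a0 *: h](subrK (ssdN N (a0 *: h))) rpredD ?ssdN_rbd ?rpredZ //.
apply/rbdP; exists (rho C d1), (ssdN N (a0 *: h) - singular_boundary (rho C d1)); split.
- exact: chain_in_setT.
- by apply: chain_inS HX => x [ox xU]; apply/eqP => x0; apply: xU; rewrite x0.
- by rewrite addrC subrK.
Qed.

Lemma gen_rcyc n (C : cell n) : gen C \in rcyc (sk n.+1) (sk n) n.
Proof. by apply: cmap_rcyc; exact: cubech_outer. Qed.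

Lemma comb_rcyc n a : comb a \in rcyc (sk n.+1) (sk n) n.
Proof.
elim/freeg_ind: a => [|k C a IH]; first by rewrite linear0 rpred0.
by rewrite linearP /= comb1 rpredD // rpredZ // gen_rcyc.
Qed.

Lemma gen_bd n (C : cell n.+1) : singular_boundary (gen C) =
  comb (\sum_(i < n.+1) (-1) ^+ i *: (<< face true i C >> - << face false i C >>)).
Proof.
have cg : continuous (g C) by exact: cmap_continuous.
rewrite push_bd // cubech_bd.
rewrite -(pair_bigA _ (fun (i : 'I_n.+1) (e : bool) => (-1) ^+ (i + nat_of_bool e) *:
   pushf (insert_coord i ((-1) ^+ (nat_of_bool e))) (cubech R n))) /=.
rewrite !linear_sum; apply: eq_bigr => i _.
have H e : pushf (g C) (pushf (insert_coord i ((-1) ^+ (~~ e))) (cubech R n)) = gen (face e i C).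
  rewrite push_comp //; last exact: insertc.
  suff -> : g C \o insert_coord i ((-1) ^+ (~~ e)) = g (face e i C) by [].
  by apply/funext => x; rewrite /= cmap_insert.
apply: linear_signed_pair.
  exact: etrans (H true) (esym (comb1 _)).
exact: etrans (H false) (esym (comb1 _)).
Qed.

Lemma skeletonE n : @skeleton_lt R cell (cube_cw R faceC) n = sk n.
Proof.
apply/seteqP; split=> [z [k [C [x [kn _ <-]]]]|z zn].
  by apply: leq_ltn_trans kn; exact: zdim_cmap.
exists (zdim z), (ccell z), (ccoord z); split=> //; last exact: cmapK.
by move=> i; have /andP[? ?] := @ccoord_open _ _ _ z i; rewrite !ltW.
Qed.

Section Iso.
Variable d : forall n, {linear {freeg (cell n.+1) / rat} -> {freeg (cell n) / rat}}.
Hypothesis dE : forall n (C : cell n.+1), d n << C >> =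
  \sum_(i < n.+1) (-1) ^+ i *: (<< face true i C >> - << face false i C >>).

Lemma comb_bd n a : singular_boundary (comb a) = comb (d n a).
Proof.
elim/freeg_ind: a => [|k C a IH]; first by rewrite !linear0.
by rewrite !linearP /= IH comb1 gen_bd dE.
Qed.

(** [skeletonE] is only a propositional equality while the homology modules are types depending on
    the skeleta; with the skeleta as a variable it can be substituted at once. *)
Lemma comb_iso (S : nat -> set Z) : S = sk ->
  complex_iso
    (@QComplex (fun n => rel_homology R (S n.+1) (S n) n)
       (fun n => @connecting R Z (S n.+2) (S n.+1) (S n) n))
    (@QComplex (fun n => {freeg (cell n) / rat}) d).
Proof.
move=> ->; pose phi n (a : {freeg (cell n) / rat}) : rel_homology R (sk n.+1) (sk n) n :=
  subquotient_class _ (SubElt (comb_rcyc a)).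
have phiP n : linear (@phi n).
  by move=> k a b; rewrite /phi -linearP; congr subquotient_class; apply: val_inj; rewrite /= linearP.
pose phiL n : {linear {freeg (cell n) / rat} -> rel_homology R (sk n.+1) (sk n) n} :=
  HB.pack (@phi n) (GRing.isLinear.Build _ _ _ _ (@phi n) (phiP n)).
have phi_inj n : injective (@phi n).
  move=> a b /subquotient_classP /= ab; apply/eqP; rewrite -subr_eq0; apply/eqP.
  by apply: cells_free; rewrite linearB.
have phi_surj n x : exists a, @phi n a = x.
  have [a Ha] := cells_span (sub_valP (subquotient_repr x)).
  exists a; rewrite -[RHS]subquotient_reprK; apply/subquotient_classP.
  by rewrite /= -opprB rpredN.
pose psi n x := sval (cid (@phi_surj n x)).
have psiK n : cancel (@psi n) (@phi n) by move=> x; rewrite /psi; case: cid.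
have phiK n : cancel (@phi n) (@psi n) by move=> a; apply: phi_inj; rewrite psiK.
have psiP n : linear (@psi n).
  by move=> k x y; apply: phi_inj; rewrite (phiP n k (psi n x) (psi n y)) !psiK.
pose psiL n : {linear rel_homology R (sk n.+1) (sk n) n -> {freeg (cell n) / rat}} :=
  HB.pack (@psi n) (GRing.isLinear.Build _ _ _ _ (@psi n) (psiP n)).
exists psiL.
split=> [n|n x /=]; first by exists (@phi n).
apply: phi_inj; rewrite psiK -[x in LHS]psiK /phi connecting_class.
by congr subquotient_class; apply: val_inj; rewrite /= comb_bd.
Qed.
End Iso.
End CellularHomology.

Theorem cube_cw_iso (R : realType) (cell : nat -> choiceType)
  (face : forall n, bool -> 'I_n.+1 -> cell n.+1 -> cell n)
  (faceC : forall n (a b : bool) (i : 'I_n.+2) (j : 'I_n.+1) (C : cell n.+2),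
    face n b j (face n.+1 a i C) = face n a (face_swap (i, j)).2 (face n.+1 b (face_swap (i, j)).1 C))
  (d : forall n, {linear {freeg (cell n.+1) / rat} -> {freeg (cell n) / rat}})
  (dE : forall n (C : cell n.+1), d n << C >> =
    \sum_(i < n.+1) (-1) ^+ i *: (<< face n true i C >> - << face n false i C >>)) :
  complex_iso (cellular_complex (cube_cw R faceC)) (@QComplex (fun n => {freeg (cell n) / rat}) d).
Proof.
apply: (comb_iso faceC dE (S := @skeleton_lt R cell (cube_cw R faceC))).
by apply/funext => n; exact: skeletonE.
Qed.

(** * Smooth maps *)

Section Smooth.
Context (R : realType).
Implicit Types V W X : normedModType R.

Lemma CkP V W k (U : set V) (f : V -> W) :
  Ck k U f <-> forall x, U x -> Ck k [set x] f.
Proof.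
elim: k f => [|k IH] f /=.
  by split=> [fU x Ux _ -> //|fU x Ux]; [exact: fU|exact: (fU x Ux)].
split=> [[fU fD] x Ux|fU].
  split=> [_ ->|v]; first exact: fU.
  by apply: (IH _).1 => //; exact: fD.
split=> [x Ux|v]; first by have [+ _] := fU x Ux; apply.
by apply/(IH _) => x Ux; have [_ +] := fU x Ux; apply.
Qed.

Lemma near_eq_diff V W (f g : V -> W) x :
  (\forall y \near x, f y = g y) -> differentiable f x -> differentiable g x.
Proof.
move=> fg df.
have fgx : f x = g x := nbhs_singleton fg.
have /diff_locallyP[cf ef] := df.
suff eg : g \o shift x = cst (g x) + 'd f x +o_ (0 : V) id.
  by apply/diff_locallyP; rewrite (diff_unique cf eg).
apply/eqaddoP => e e0; move/eqaddoP: ef => /(_ _ e0).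
have : \forall y \near 0, f (y + x) = g (y + x).
  have : (fun y => y + x) @ (0 : V) --> x.
    by rewrite -{2}[x]add0r; apply: cvgD; [exact: cvg_id|exact: cvg_cst].
  by move/(_ _ fg).
by apply: filterS2 => y fgy; rewrite !fctE /= fgy fgx.
Qed.

Lemma Ck_near V W k (f g : V -> W) x :
  (\forall y \near x, f y = g y) -> Ck k [set x] f -> Ck k [set x] g.
Proof.
elim: k f g => [|k IH] f g fg /=.
  move=> /(_ x erefl) cf _ ->.
  rewrite /prop_for /continuous_at -(nbhs_singleton fg).
  by apply: cvg_trans cf; apply: near_eq_cvg.
move=> [df Df]; split=> [_ ->|v]; first by apply: near_eq_diff (df x erefl).
apply: IH (Df v); move/nbhs_interior: fg; apply: filterS => y fgy.
exact: near_eq_derive.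
Qed.

(** Smoothness as a property of the germ at [x], so that a function may be replaced by one that
    agrees with it near [x]. On open sets it gives back [smooth_on]. *)
Definition smooth_at V W (f : V -> W) (x : V) :=
  \forall y \near x, forall k, Ck k [set y] f.

Lemma smooth_at_near V W (f g : V -> W) x :
  (\forall y \near x, f y = g y) -> smooth_at f x -> smooth_at g x.
Proof.
move=> /nbhs_interior fg; apply: filterS2 fg => y fg fy k.
exact: Ck_near (fy k).
Qed.

Lemma smooth_at_nbhs V W (f : V -> W) x :
  smooth_at f x -> \forall y \near x, smooth_at f y.
Proof. exact: nbhs_interior. Qed.

Lemma smooth_onP V W (U : set V) (f : V -> W) : open U ->
  smooth_on U f <-> forall x, U x -> smooth_at f x.
Proof.
move=> oU; split=> [fU x Ux|fU k].
  apply: filterS (open_nbhs_nbhs (conj oU Ux)) => y Uy k.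
  by apply: (CkP _ _ _).1 Uy; exact: fU.
by apply/CkP => x Ux; have /nbhs_singleton := fU x Ux; exact.
Qed.

Lemma smooth_at_diff V W (f : V -> W) x : smooth_at f x -> differentiable f x.
Proof. by move/nbhs_singleton/(_ 1) => [+ _]; apply. Qed.

Lemma smooth_at_cont V W (f : V -> W) x : smooth_at f x -> {for x, continuous f}.
Proof. by move/smooth_at_diff/differentiable_continuous. Qed.

Lemma smooth_at_derive V W (f : V -> W) x v : smooth_at f x -> smooth_at ('D_v f) x.
Proof. by apply: filterS => y fy k; have [_ +] := fy k.+1; exact. Qed.

Lemma smooth_cst V W (a : W) x : smooth_at (fun _ : V => a) x.
Proof.
near=> y => k; elim: k a => [|k IH] a /=; first by move=> z _; exact: cvg_cst.
split=> [z _|v]; first exact: differentiable_cst.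
apply: (Ck_near (f := fun=> 0)) => //.
by near=> z; rewrite (derive_cst a).
Unshelve. all: by end_near. Qed.

Lemma smooth_linear V W (l : {linear V -> W}) x :
  continuous l -> smooth_at l x.
Proof.
move=> cl; near=> y => -[|k] /=; first by move=> _ ->; exact: cl.
split=> [z _|v]; first exact: linear_differentiable.
apply: (Ck_near (f := fun=> l v)).
  by near=> z; rewrite deriveE ?diff_lin //; exact: linear_differentiable.
by have /nbhs_singleton := smooth_cst (l v) y; apply.
Unshelve. all: by end_near. Qed.

Definition Ck_near_at V W k (f : V -> W) (x : V) := \forall y \near x, Ck k [set y] f.

Lemma smooth_atP V W (f : V -> W) x :
  (\forall y \near x, forall k, Ck_near_at k f y) -> smooth_at f x.
Proof. by apply: filterS => y fy k; exact: nbhs_singleton (fy k). Qed.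

Lemma smooth_at_Ck V W k (f : V -> W) x : smooth_at f x -> Ck_near_at k f x.
Proof. by apply: filterS. Qed.

Lemma Ck_near_derive V W k (f : V -> W) x v :
  Ck_near_at k.+1 f x -> Ck_near_at k ('D_v f) x.
Proof. by apply: filterS => y [_ +]; exact. Qed.

Lemma CkD V W k (f : V -> W) (g : V -> W) x :
  Ck_near_at k f x -> Ck_near_at k g x -> Ck_near_at k (fun y => f y + g y) x.
Proof.
elim: k f g x => [|k IH] f g x fx gx.
  by move: fx gx; apply: filterS2 => y fy gy /= _ ->; apply: cvgD; [exact: fy|exact: gy].
move: (nbhs_interior fx) (nbhs_interior gx); apply: filterS2 => y fy gy.
have df : \forall z \near y, differentiable f z.
  by apply: filterS fy => z [+ _]; exact.
have dg : \forall z \near y, differentiable g z.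
  by apply: filterS gy => z [+ _]; exact.
split=> [_ ->|v]; first by apply: differentiableD; [exact: (nbhs_singleton df)|
  exact: (nbhs_singleton dg)].
apply: (Ck_near (f := fun y => 'D_v f y + 'D_v g y)).
  move: df dg; apply: filterS2 => z df dg.
  by rewrite [RHS]deriveD //; exact: diff_derivable.
by apply: (nbhs_singleton (IH _ _ _ _ _)); exact: Ck_near_derive.
Qed.

Lemma smoothD V W (f g : V -> W) x :
  smooth_at f x -> smooth_at g x -> smooth_at (fun y => f y + g y) x.
Proof.
move=> /smooth_at_nbhs fx /smooth_at_nbhs gx; apply: smooth_atP.
by move: fx gx; apply: filterS2 => y fy gy k; apply: CkD; exact: smooth_at_Ck.
Qed.

Lemma smooth_lincomp V W X (l : {linear W -> X}) (f : V -> W) x :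
  continuous l -> smooth_at f x -> smooth_at (fun y => l (f y)) x.
Proof.
move=> cl fx; have := smooth_at_nbhs fx.
apply: filterS => {fx}y fx k; elim: k f fx => [|k IH] f fx /=.
  by move=> _ ->; apply: continuous_comp; [exact: smooth_at_cont|exact: cl].
split=> [_ ->|v].
  apply: differentiable_comp; first exact: smooth_at_diff.
  exact: linear_differentiable.
have := smooth_at_nbhs fx => fn.
apply: (Ck_near (f := fun y => l ('D_v f y))).
  near=> z; have fz : differentiable f z by apply: smooth_at_diff; near: z.
  have dl : differentiable l (f z) by exact: linear_differentiable.
  rewrite (deriveE _ fz) (deriveE _ (differentiable_comp fz dl)).
  by rewrite (diff_comp fz dl) /= diff_lin.
by apply: IH; exact: smooth_at_derive.
Unshelve. all: by end_near. Qed.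

Lemma scale_is_bilinear W :
  bilinear_for
    (GRing.Scale.Law.clone _ _ *:%R _) (GRing.Scale.Law.clone _ _ *:%R _)
    (@GRing.scale R W : R -> W -> W).
Proof.
split=> [u'|u] a x y /=; first by rewrite scalerDl scalerA.
by rewrite scalerDr !scalerA mulrC.
Qed.

Lemma diff_scale V W (a : V -> R) (f : V -> W) x :
  differentiable a x -> differentiable f x ->
  differentiable (fun y => a y *: f y) x /\
  forall v, 'D_v (fun y => a y *: f y) x = 'D_v a x *: f x + a x *: 'D_v f x.
Proof.
move=> da df; pose s := fun q : R * W => q.1 *: q.2.
pose sM := bilinear_isBilinear.Build R R W W _ _ _ (scale_is_bilinear W).
pose sB : {bilinear R -> W -> W} := HB.pack (@GRing.scale R W : R -> W -> W) sM.
have cs : continuous s by move=> q; apply: scale_continuous.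
have dp : differentiable (fun y => (a y, f y)) x by exact: differentiable_pair.
have ds q : differentiable s q by exact: (differentiable_bilin (f := sB)).
have ds' q : 'd s q = (fun p => q.1 *: p.2 + p.1 *: q.2) :> (R * W -> W).
  exact: (diff_bilin (f := sB)).
have d : differentiable (s \o (fun y => (a y, f y))) x by exact: differentiable_comp.
split=> // v; rewrite (deriveE _ da) (deriveE _ df) (deriveE _ d).
by rewrite (diff_comp dp (ds _)) /= ds' diff_pair //= addrC.
Qed.

Lemma Ck_pred V W k (f : V -> W) (x : V) : Ck_near_at k.+1 f x -> Ck k [set x] f.
Proof.
elim: k f x => [|k IH] f x.
  by move=> /nbhs_singleton[+ _] _ -> => /(_ x erefl)/differentiable_continuous.
move=> fx; split=> [|v]; first by have /nbhs_singleton[] := fx.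
by apply: IH; exact: Ck_near_derive.
Qed.

Lemma CkZ V W k (f : V -> R) (g : V -> W) x :
  Ck_near_at k f x -> Ck_near_at k g x -> Ck_near_at k (fun y => f y *: g y) x.
Proof.
elim: k f g x => [|k IH] f g x fx gx.
  by move: fx gx; apply: filterS2 => y fy gy /= _ ->; apply: cvgZ; [exact: fy|exact: gy].
move: (nbhs_interior fx) (nbhs_interior gx); apply: filterS2 => y fy gy.
have df : \forall z \near y, differentiable f z.
  by apply: filterS fy => z [+ _]; exact.
have dg : \forall z \near y, differentiable g z.
  by apply: filterS gy => z [+ _]; exact.
split=> [_ ->|v]; first by apply: (diff_scale _ _).1; [exact: (nbhs_singleton df)|
  exact: (nbhs_singleton dg)].
apply: (Ck_near (f := fun y => 'D_v f y *: g y + f y *: 'D_v g y)).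
  by move: df dg; apply: filterS2 => z df dg; rewrite (diff_scale df dg).2.
have le_k V' W' (h : V' -> W') z : Ck_near_at k.+1 h z -> Ck_near_at k h z.
  move/nbhs_interior; by apply: filterS => z'; exact: Ck_pred.
by apply: (nbhs_singleton (CkD (IH _ _ _ _ _) (IH _ _ _ _ _)));
  do [exact: Ck_near_derive|exact: le_k].
Qed.

Lemma smoothZ V W (a : V -> R) (f : V -> W) x :
  smooth_at a x -> smooth_at f x -> smooth_at (fun y => a y *: f y) x.
Proof.
move=> /smooth_at_nbhs fx /smooth_at_nbhs gx; apply: smooth_atP.
by move: fx gx; apply: filterS2 => y fy gy k; apply: CkZ; exact: smooth_at_Ck.
Qed.
End Smooth.

Section Composition.
Context (R : realType).
Implicit Types V W X : normedModType R.

(* Through such coordinates the chain rule becomes a finite sum. *)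
Definition has_coords W := exists (n : nat) (e : 'I_n -> W) (l : 'I_n -> {linear W -> R}),
  (forall i, continuous (l i)) /\ forall w, w = \sum_i l i w *: e i.

Lemma has_coords_R : has_coords R.
Proof.
exists 1%N, (fun=> 1), (fun=> idfun); split=> [i x|w]; first exact: cvg_id.
by rewrite big_ord1 /= /GRing.scale /= mulr1.
Qed.

Lemma has_coords_rV n : has_coords 'rV[R]_n.
Proof.
pose c i (x : 'rV[R]_n) := x ord0 i.
have cl i : linear (c i) by move=> a x y; rewrite /c !mxE.
pose L i : {linear 'rV[R]_n -> R} := HB.pack (c i) (GRing.isLinear.Build _ _ _ _ _ (cl i)).
exists n, (fun i => delta_mx ord0 i), L; split=> [i|w]; first exact: coord_continuous.
exact: row_sum_delta.
Qed.

Lemma has_coords_prod V W : has_coords V -> has_coords W -> has_coords (V * W)%type.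
Proof.
move=> [n [e [l [cl le]]]] [m [e' [l' [cl' le']]]].
pose c (i : 'I_(n + m)) (x : V * W) : R :=
  match fintype.split i with inl j => l j x.1 | inr j => l' j x.2 end.
have lc i : linear (c i).
  by move=> a x y; rewrite /c; case: fintype.split => j; rewrite -linearP.
pose L i : {linear (V * W)%type -> R} := HB.pack (c i) (GRing.isLinear.Build _ _ _ _ _ (lc i)).
exists (n + m)%N, (fun i => match fintype.split i with inl j => (e j, 0) | inr j => (0, e' j) end), L.
split=> [i|[v w]].
  rewrite /= /c; case: fintype.split => j x.
    by apply: continuous_comp; [exact: cvg_fst|exact: cl].
  by apply: continuous_comp; [exact: cvg_snd|exact: cl'].
rewrite big_split_ord /=.
under eq_bigr do rewrite /c (unsplitK (inl _)).
under [X in _ = _ + X]eq_bigr do rewrite /c (unsplitK (inr _)).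
rewrite {1}(le v) {1}(le' w) /=.
have s1 (r : seq 'I_n) : \sum_(i <- r) l i v *: (e i, 0 : W) = (\sum_(i <- r) l i v *: e i, 0).
  elim: r => [|i r IH]; rewrite ?big_nil // !big_cons IH.
  by congr pair => /=; rewrite scaler0 addr0.
have s2 (r : seq 'I_m) : \sum_(i <- r) l' i w *: (0 : V, e' i) = (0, \sum_(i <- r) l' i w *: e' i).
  elim: r => [|i r IH]; rewrite ?big_nil // !big_cons IH.
  by congr pair => /=; rewrite scaler0 addr0.
by rewrite s1 s2; congr pair; rewrite /= ?addr0 ?add0r.
Qed.

Lemma Ck_lincomp V W X k (l : {linear W -> X}) (f : V -> W) x :
  continuous l -> Ck_near_at k f x -> Ck_near_at k (fun y => l (f y)) x.
Proof.
move=> cl; elim: k f x => [|k IH] f x fx.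
  by move: fx; apply: filterS => y fy /= _ ->; apply: continuous_comp; [exact: fy|exact: cl].
move: (nbhs_interior fx); apply: filterS => y fy.
have df : \forall z \near y, differentiable f z.
  by apply: filterS fy => z [+ _]; exact.
split=> [_ ->|v].
  apply: differentiable_comp; first exact: (nbhs_singleton df).
  exact: linear_differentiable.
apply: (Ck_near (f := fun y => l ('D_v f y))).
  apply: filterS df => z fz.
  have dl : differentiable l (f z) by exact: linear_differentiable.
  rewrite (deriveE _ fz) (deriveE _ (differentiable_comp fz dl)).
  by rewrite (diff_comp fz dl) /= diff_lin.
by apply: (nbhs_singleton (IH _ _ _)); exact: Ck_near_derive.
Qed.

Lemma Ck_sum V W k n (F : 'I_n -> V -> W) x :
  (forall i, Ck_near_at k (F i) x) -> Ck_near_at k (fun y => \sum_(i < n) F i y) x.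
Proof.
move=> cF; elim: n F cF => [|n IH] F cF.
  apply: filterS (smooth_cst (V := V) (0 : W) x) => y /(_ k); apply: Ck_near.
  by near=> z; rewrite big_ord0.
have := CkD (IH _ (fun i => cF (widen_ord (leqnSn n) i))) (cF ord_max).
apply: filterS => y; apply: Ck_near.
by near=> z; rewrite big_ord_recr.
Unshelve. all: by end_near. Qed.

(** In coordinates of [W] a directional derivative of the composite is a finite sum of products of
    derivatives of [f] with composites of derivatives of [g], to which the induction hypothesis for
    k applies. *)
Lemma Ck_comp V W X k (f : V -> W) (g : W -> X) x : has_coords W ->
  Ck_near_at k f x -> Ck_near_at k g (f x) -> Ck_near_at k (g \o f) x.
Proof.
move=> [n [e [l [cl le]]]].
elim: k X g f x => [|k IH] X g f x fx gx.
  have := (nbhs_singleton fx) x erefl _ gx; move: fx; apply: filterS2 => y fy gy.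
  by move=> _ ->; apply: continuous_comp; [exact: fy|exact: gy].
have cf : {for x, continuous f}.
  by apply: differentiable_continuous; have [+ _] := nbhs_singleton fx; apply.
have := cf _ (nbhs_interior gx); move: (nbhs_interior fx).
apply: filterS2 => y fy gy {x cf fx gx}.
have df : \forall z \near y, differentiable f z.
  by apply: filterS fy => z [+ _]; exact.
have dg : \forall z \near y, differentiable g (f z).
  have cfy : {for y, continuous f} by exact: differentiable_continuous (nbhs_singleton df).
  have gyy : \forall z \near y, Ck k.+1 [set f z] g := cfy _ gy.
  by apply: filterS gyy => z [+ _]; exact.
have d v : \forall z \near y, 'D_v (g \o f) z =
    \sum_i l i ('D_v f z) *: (('D_(e i) g) \o f) z.
  move: df dg; apply: filterS2 => z dfz dgz.
  rewrite (deriveE _ (differentiable_comp dfz dgz)) (diff_comp dfz dgz) /=.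
  rewrite (deriveE _ dfz) {1}(le ('d f z v)) linear_sum; apply: eq_bigr => i _.
  by rewrite linearZ /= (deriveE _ dgz).
split=> [_ ->|v].
  by apply: differentiable_comp; [exact: (nbhs_singleton df)|exact: (nbhs_singleton dg)].
apply: (Ck_near (f := fun z => \sum_i l i ('D_v f z) *: (('D_(e i) g) \o f) z)).
  by apply: filterS (d v) => z ->.
apply: (nbhs_singleton (Ck_sum _)) => i; apply: CkZ.
  by apply: Ck_lincomp => //; exact: Ck_near_derive.
apply: IH; last exact: Ck_near_derive.
apply: filterS (nbhs_interior fy) => z; exact: Ck_pred.
Qed.

Lemma smooth_comp V W X (f : V -> W) (g : W -> X) x : has_coords W ->
  smooth_at f x -> smooth_at g (f x) -> smooth_at (g \o f) x.
Proof.
move=> hW fx gx; apply: smooth_atP.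
have := smooth_at_cont fx (smooth_at_nbhs gx); move: (smooth_at_nbhs fx).
by apply: filterS2 => y fy gy k; apply: Ck_comp => //; exact: smooth_at_Ck.
Qed.
End Composition.

Section RealSmooth.
Context (R : realType).
Implicit Types V W X : normedModType R.

Lemma smooth_id V (x : V) : smooth_at (@id V) x.
Proof. by apply: (smooth_linear (l := idfun)) => y; exact: cvg_id. Qed.

Lemma smooth_fst V W (p : V * W) : smooth_at (fun q : V * W => q.1) p.
Proof.
have ll : linear (@fst V W) by [].
pose lM := GRing.isLinear.Build _ _ _ _ _ ll.
pose L : {linear (V * W)%type -> V} := HB.pack (@fst V W) lM.
by apply: (smooth_linear (l := L)) => y; exact: cvg_fst.
Qed.

Lemma smooth_snd V W (p : V * W) : smooth_at (fun q : V * W => q.2) p.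
Proof.
have ll : linear (@snd V W) by [].
pose lM := GRing.isLinear.Build _ _ _ _ _ ll.
pose L : {linear (V * W)%type -> W} := HB.pack (@snd V W) lM.
by apply: (smooth_linear (l := L)) => y; exact: cvg_snd.
Qed.

Lemma smooth_pair V W X (f : X -> V) (g : X -> W) x :
  smooth_at f x -> smooth_at g x -> smooth_at (fun y => (f y, g y)) x.
Proof.
have l1 : linear (fun v : V => (v, 0 : W)).
  by move=> a u v; congr pair; rewrite /= scaler0 addr0.
have l2 : linear (fun w : W => (0 : V, w)).
  by move=> a u v; congr pair; rewrite /= scaler0 addr0.
pose L1 : {linear V -> (V * W)%type} := HB.pack (fun v : V => (v, 0 : W)) (GRing.isLinear.Build _ _ _ _ _ l1).
pose L2 : {linear W -> (V * W)%type} := HB.pack (fun w : W => (0 : V, w)) (GRing.isLinear.Build _ _ _ _ _ l2).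
move=> sf sg; apply: (smooth_at_near (f := fun y => L1 (f y) + L2 (g y))).
  by near=> y; congr pair; rewrite /= ?addr0 ?add0r.
apply: smoothD; apply: smooth_lincomp => //.
  by move=> v; apply: cvg_pair; [exact: cvg_id|exact: cvg_cst].
by move=> v; apply: cvg_pair; [exact: cvg_cst|exact: cvg_id].
Unshelve. all: by end_near. Qed.

Lemma smoothM V (f g : V -> R) x :
  smooth_at f x -> smooth_at g x -> smooth_at (fun y => f y * g y) x.
Proof. exact: smoothZ. Qed.

Lemma smoothN V W (f : V -> W) x : smooth_at f x -> smooth_at (fun y => - f y) x.
Proof.
move=> sf; apply: (smooth_at_near (f := fun y => (-1) *: f y)).
  by near=> y; rewrite scaleN1r.
by apply: smoothZ => //; exact: smooth_cst.
Unshelve. all: by end_near. Qed.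

Lemma smoothB V W (f g : V -> W) x :
  smooth_at f x -> smooth_at g x -> smooth_at (fun y => f y - g y) x.
Proof. by move=> sf sg; apply: smoothD => //; exact: smoothN. Qed.

(** The family is closed under differentiation up to linear combinations, so the order of
    differentiability is raised for all its members together. *)
Lemma smooth_family (e : nat -> R -> R) (a b : nat -> R) (i j : nat -> nat) :
  (forall k (x : R),
     is_derive x (1 : R) (e k) (a k * e (i k) x + b k * e (j k) x)) ->
  forall k x, smooth_at (e k) x.
Proof.
move=> de k x.
have D m (y : R) : differentiable (e m) y.
  by apply/derivable1_diffP; case: (de m y).
suff H m l (y : R) : Ck_near_at m (e l) y by apply: smooth_atP; near=> y => m; exact: H.
elim: m l y {k x} => [|m IH] k y.
  by near=> z; move=> _ ->; exact: differentiable_continuous.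
near=> z; split=> [_ ->//|v].
apply: (Ck_near (f := fun x => v *: (a k *: e (i k) x + b k *: e (j k) x))).
  near=> u; have [_ <-] := de k u; rewrite !deriveE //.
  by rewrite -linearZ /= /GRing.scale /= mulr1.
have cc (r : R) : Ck_near_at m (fun _ : R => r) z by exact: smooth_at_Ck (smooth_cst _ _).
exact: (nbhs_singleton (CkZ (cc _) (CkD (CkZ (cc _) (IH _ _)) (CkZ (cc _) (IH _ _))))).
Unshelve. all: by end_near. Qed.

Lemma smooth_inv (x : R) : x != 0 -> smooth_at (@GRing.inv R) x.
Proof.
have near0 (y : R) : y != 0 -> \forall z \near y, z != 0.
  by move=> y0; apply: open_nbhs_nbhs; split=> //; exact: open_neq.
suff H m y : y != 0 -> Ck_near_at m (@GRing.inv R) y.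
  by move=> x0; apply: smooth_atP; apply: filterS (near0 _ x0) => y y0 m; exact: H.
elim: m y {x} => [|m IH] y y0; apply: filterS (near0 _ y0) => z z0.
  by move=> _ ->; exact: inv_continuous.
split=> [_ ->|v]; first exact: differentiable_Rinv.
apply: (@Ck_near R _ R m (fun u : R => (- v) *: (u^-1 *: u^-1 : R)) _ z).
  apply: filterS (near0 _ z0) => u u0; rewrite deriveE; last exact: differentiable_Rinv.
  by rewrite diff_Rinv //= /GRing.scale /= expr2 invfM; ring.
have cc (r : R) : Ck_near_at m (fun _ : R => r) z by exact: smooth_at_Ck (smooth_cst _ _).
exact: (nbhs_singleton (CkZ (cc _) (CkZ (IH _ z0) (IH _ z0)))).
Qed.
End RealSmooth.

(** * Bump functions *)

Section Bumps.
Context (R : realType).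

Definition flat (k : nat) (x : R) : R := if 0 < x then x ^- k * expR (- x^-1) else 0.

Lemma flat_le k x : `|flat k x| <= (k.+1%:R ^+ k.+1) * `|x|.
Proof.
rewrite /flat; case: ifPn => [x0|_]; last by rewrite normr0 mulr_ge0 // exprn_ge0.
rewrite ger0_norm; last by rewrite mulr_ge0 ?expR_ge0 // invr_ge0 exprn_ge0 // ltW.
rewrite (ger0_norm (ltW x0)) expRN.
have H : (k.+1%:R * x) ^- k.+1 <= expR x^-1.
  have -> : x^-1 = k.+1%:R * (k.+1%:R * x)^-1.
    by rewrite invfM mulrA divff ?mul1r // pnatr_eq0.
  rewrite expRM_natl -exprVn; apply: lerXn2r; rewrite ?nnegrE ?expR_ge0 //.
    by rewrite invr_ge0 mulr_ge0 // ltW.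
  by apply: le_trans (expR_ge1Dx _); rewrite lerDr.
have p0 : 0 < (k.+1%:R * x) ^+ k.+1 by rewrite exprn_gt0 // mulr_gt0 // ltr0n.
have H2 : (expR x^-1)^-1 <= (k.+1%:R * x) ^+ k.+1.
  by rewrite -[leRHS]invrK lef_pV2 ?posrE ?expR_gt0 ?invr_gt0.
apply: le_trans (ler_wpM2l _ H2) _; first by rewrite invr_ge0 exprn_ge0 // ltW.
rewrite exprMn mulrCA ler_wpM2l ?exprn_ge0 //.
by rewrite (exprSr x) mulKf // expf_neq0 // gt_eqF.
Qed.

Lemma flatS k h : flat k h = h * flat k.+1 h.
Proof.
rewrite /flat; case: ifPn => [h0|_]; last by rewrite mulr0.
by rewrite exprS invfM !mulrA divff ?mul1r // gt_eqF.
Qed.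

(** This closes the family [flat] under differentiation. At 0 the difference quotient of [flat k] is
    [flat k.+1] by [flatS], which tends to 0 by [flat_le]. *)
Lemma flat_derive k (x : R) :
  is_derive x (1 : R) (flat k) (1 * flat k.+2 x + (- k%:R) * flat k.+1 x).
Proof.
have [x0|x0|->] := ltgtP x 0.
- have e y : y <= 0 -> flat k y = 0 by rewrite /flat leNgt => /negPf ->.
  have -> : 1 * flat k.+2 x + - k%:R * flat k.+1 x = 0.
    by rewrite /flat ltNge (ltW x0) /= mul1r mulr0 addr0.
  apply: (near_eq_is_derive (f := cst (0 : R))).
  by near=> y; rewrite e //; near: y; exact: lt_le_nbhsl.
- have xn0 : x != 0 by rewrite gt_eqF.
  apply: (near_eq_is_derive (f := (fun y : R => y^-1) ^+ k * (expR \o (fun y => - y^-1)))).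
    near=> y; rewrite /flat ifT; last by near: y; exact: lt_nbhsr.
    by rewrite !fctE exprVn.
  have dV : is_derive x (1 : R) (fun y : R => y^-1) (- x ^- 2 *: (1 : R)).
    exact: is_deriveV.
  have dN : is_derive x (1 : R) (fun y : R => - y^-1) (- (- x ^- 2 *: (1 : R))).
    exact: is_deriveN.
  have dE : is_derive x (1 : R) (expR \o (fun y => - y^-1)) (x ^- 2 * expR (- x^-1)).
    have H := @is_derive1_comp R expR (fun y => - y^-1) x _ _ (is_derive_expR (- x^-1)) dN.
    rewrite (_ : x ^- 2 * _ = expR (- x^-1) * (- (- x ^- 2)%:A)); first exact: H.
    by rewrite /GRing.scale /= mulr1 opprK mulrC.
  apply: is_derive_eq.
  rewrite /= !fctE /GRing.scale /= /flat x0.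
  case: k => [|k] /=.
    by rewrite !expr0 !mul0r !mulr0 !oppr0 !mul0r !addr0 !mul1r.
  by rewrite -!exprVn !exprS; ring.
- have D0 : h^-1 *: ((flat k \o shift 0) (h *: (1 : R)) - flat k 0) @[h --> 0^'] --> (0 : R).
    apply/cvgrPdist_le => e e0; near=> h.
    have h0 : h != 0 by near: h; exact: nbhs_dnbhs_neq.
    rewrite /= addr0 {2}/flat ltxx subr0 /GRing.scale /= mulr1 sub0r normrN.
    rewrite flatS mulKf //; apply: le_trans (flat_le _ _) _.
    rewrite mulrC -ler_pdivlMr ?exprn_gt0 ?ltr0n //.
    by near: h; apply: dnbhs0_le; rewrite divr_gt0 ?exprn_gt0 ?ltr0n.
  have -> : 1 * flat k.+2 0 + - k%:R * flat k.+1 0 = 0.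
    by rewrite /flat ltxx mulr0 mulr0 addr0.
  by split; [apply/cvg_ex; exists 0|exact/cvg_lim].
Unshelve. all: by end_near. Qed.

Lemma smooth_flat k x : smooth_at (flat k) x.
Proof.
exact: (@smooth_family R flat (fun=> 1) (fun k => - k%:R) (fun k => k.+2) (fun k => k.+1) flat_derive).
Qed.

Definition ramp := flat 0.

Lemma smooth_ramp x : smooth_at ramp x. Proof. exact: smooth_flat. Qed.

Lemma ramp_gt0 x : (0 < ramp x) = (0 < x).
Proof.
rewrite /ramp /flat; case: ifPn => [x0|]; last by rewrite ltxx.
by rewrite expr0 invr1 mul1r expR_gt0.
Qed.

Lemma ramp_ge0 x : 0 <= ramp x.
Proof. by rewrite /ramp /flat; case: ifPn => // x0; rewrite expr0 invr1 mul1r expR_ge0. Qed.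

Lemma ramp_eq0 x : (ramp x == 0) = (x <= 0).
Proof. by rewrite eq_le ramp_ge0 andbT leNgt ramp_gt0 leNgt. Qed.

Lemma smoothV_fun (V : normedModType R) (f : V -> R) x :
  f x != 0 -> smooth_at f x -> smooth_at (fun y => (f y)^-1) x.
Proof.
move=> f0 sf; apply: (smooth_comp (g := @GRing.inv R)) => //; first exact: has_coords_R.
exact: smooth_inv.
Qed.

Definition step (x : R) := ramp x / (ramp x + ramp (1 - x)).

Lemma step_den x : 0 < ramp x + ramp (1 - x).
Proof.
have [x0|x0] := lerP x 0.
  by rewrite ltr_wpDl ?ramp_ge0 // ramp_gt0; lra.
by rewrite ltr_wpDr ?ramp_ge0 // ramp_gt0.
Qed.

Lemma smooth_step x : smooth_at step x.
Proof.
apply: smoothM; first exact: smooth_ramp.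
apply: smoothV_fun; first by rewrite gt_eqF // step_den.
apply: smoothD; first exact: smooth_ramp.
apply: (@smooth_comp R R R R (fun y => 1 - y) ramp _ (has_coords_R R)); last exact: smooth_ramp.
by apply: smoothB; [exact: smooth_cst|exact: smooth_id].
Qed.

Lemma step_ge0 x : 0 <= step x.
Proof. by rewrite divr_ge0 ?ramp_ge0 // ltW // step_den. Qed.

Lemma step_le1 x : step x <= 1.
Proof. by rewrite ler_pdivrMr ?step_den // mul1r lerDl ramp_ge0. Qed.

Lemma step_le0 x : x <= 0 -> step x = 0.
Proof. by move=> x0; rewrite /step (_ : ramp x = 0) ?mul0r //; apply/eqP; rewrite ramp_eq0. Qed.

Lemma step_ge1 x : 1 <= x -> step x = 1.
Proof.
move=> x1; have r0 : ramp (1 - x) = 0 by apply/eqP; rewrite ramp_eq0; lra.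
by rewrite /step r0 addr0 divff // ramp_eq0; lra.
Qed.

Definition bump_line (d x : R) := ramp (d + x) * ramp (d - x).

(* Subtracting the nearest integer makes cbump periodic. *)
Definition nearest (s t : R) : R := (Num.floor (t - s + 2^-1))%:~R.

Definition cbump (s d t : R) := bump_line d (t - s - nearest s t).

Lemma bump_line_gt0 d x : (0 < bump_line d x) = (`|x| < d).
Proof.
rewrite /bump_line ltr_norml; apply/idP/idP => [|/andP[? ?]].
  rewrite lt0r mulf_eq0 negb_or !ramp_eq0 -!ltNge => /andP[/andP[? ?] _].
  by apply/andP; split; lra.
by rewrite mulr_gt0 // ramp_gt0; lra.
Qed.

Lemma bump_line_ge0 d x : 0 <= bump_line d x.
Proof. by rewrite mulr_ge0 ?ramp_ge0. Qed.

Lemma bump_line_eq0 d x : (bump_line d x == 0) = (d <= `|x|).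
Proof. by rewrite eq_le bump_line_ge0 andbT leNgt bump_line_gt0 leNgt. Qed.

Lemma smooth_bump_line d x : smooth_at (bump_line d) x.
Proof.
apply: smoothM.
  apply: (@smooth_comp R R R R (fun y => d + y) ramp _ (has_coords_R R)); last exact: smooth_ramp.
  by apply: smoothD; [exact: smooth_cst|exact: smooth_id].
apply: (@smooth_comp R R R R (fun y => d - y) ramp _ (has_coords_R R)); last exact: smooth_ramp.
by apply: smoothB; [exact: smooth_cst|exact: smooth_id].
Qed.

Lemma nearest_int s t : nearest s t \is a Num.int.
Proof. exact: intr_int. Qed.

Lemma nearest_dist s t : `|t - s - nearest s t| <= 2^-1.
Proof.
rewrite /nearest; have := floor_itv (t - s + 2^-1); rewrite intrD => /andP[? ?].
by rewrite ler_norml; apply/andP; split; lra.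
Qed.

(** The nearest integer jumps, but harmlessly: if [k] is another integer, the two are at least 1
    apart and both values of the bump are 0. So the integer can be held fixed near a given t, which
    gives smoothness. *)
Lemma cbump_eq s d t k : d <= 2^-1 -> k \is a Num.int -> `|t - s - k| < 1 - d ->
  cbump s d t = bump_line d (t - s - k).
Proof.
move=> d2 ki tk; rewrite /cbump; have [<-//|nk] := eqVneq (nearest s t) k.
have : 1 <= `|nearest s t - k|.
  by rewrite norm_intr_ge1 ?rpredB ?nearest_int // subr_eq0.
have := ler_distD (t - s) k (nearest s t); have := nearest_dist s t.
rewrite (distrC k (t - s)) (distrC (nearest s t) k) => n1 n2 n3.
have /eqP -> : bump_line d (t - s - nearest s t) == 0 by rewrite bump_line_eq0; lra.
by apply/esym/eqP; rewrite bump_line_eq0; lra.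
Qed.

Lemma cbump_gt0 s d t k : d <= 2^-1 -> k \is a Num.int -> `|t - s - k| < d -> 0 < cbump s d t.
Proof. by move=> d2 ki tk; rewrite (cbump_eq d2 ki) ?bump_line_gt0 //; lra. Qed.

Lemma cbump_neq0 s d t : cbump s d t != 0 -> exists2 k, k \is a Num.int & `|t - s - k| < d.
Proof.
rewrite /cbump bump_line_eq0 -ltNge => H.
by exists (nearest s t) => //; exact: nearest_int.
Qed.

Lemma cbump_ge0 s d t : 0 <= cbump s d t. Proof. exact: bump_line_ge0. Qed.

Lemma cbump_periodic s d : periodic1 (cbump s d).
Proof.
move=> t; rewrite /cbump /nearest; congr bump_line.
rewrite (_ : t + 1 - s + 2^-1 = t - s + 2^-1 + 1%:~R); last by lra.
by rewrite floorDrz ?intr_int // intrKfloor intrD; lra.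
Qed.

Lemma smooth_cbump s d t : d < 2^-1 -> smooth_at (cbump s d) t.
Proof.
move=> d2; pose k := nearest s t.
apply: (smooth_at_near (f := fun y => bump_line d (y - s - k))).
  have : \forall y \near t, `|y - s - k| < 1 - d.
    have c : {for t, continuous (fun y : R => `|y - s - k|)}.
      apply: cvg_norm; apply: cvgB; last exact: cvg_cst.
      by apply: cvgB; [exact: cvg_id|exact: cvg_cst].
    apply: (c [set r | r < 1 - d]); apply: open_nbhs_nbhs; split; first exact: open_lt.
    by have := nearest_dist s t; rewrite /= -/k; lra.
  by apply: filterS => y ky; rewrite (cbump_eq (ltW d2) (nearest_int s t)).
apply: (@smooth_comp R R R R (fun y => y - s - k) (bump_line d) _ (has_coords_R R));
  last exact: smooth_bump_line.
apply: smoothB; last exact: smooth_cst.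
by apply: smoothB; [exact: smooth_id|exact: smooth_cst].
Qed.
End Bumps.

(** * Smooth maps into the manifold *)

Section ManifoldSmooth.
Context (R : realType) (M : oriented_3manifold R).
Implicit Types (V W : normedModType R) (c d : chart R M).

(** One chart suffices, as transition maps are smooth. Continuity is included on a neighbourhood so
    that the property passes to nearby points. *)
Definition msmooth_at V (f : V -> M) (x : V) :=
  (\forall y \near x, {for y, continuous f}) /\
  exists c, [/\ mfd_atlas c, ch_dom c (f x) & smooth_at (ch_to c \o f) x].

Lemma transition_smooth c d p : mfd_atlas c -> mfd_atlas d ->
  ch_dom c p -> ch_dom d p -> smooth_at (ch_to d \o ch_from c) (ch_to c p).
Proof.
move=> ac ad cp dp; have [oc occ cto cfrom [_ ccf]] := mfd_chart ac.
have [od _ _ _ _] := mfd_chart ad.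
have [sm _] := mfd_oriented ac ad.
suff oU : open (ch_cod c `&` ch_from c @^-1` ch_dom d).
  apply: (smooth_onP _ oU).1 sm _ _; have [cc ce] := cto p cp.
  by split=> //=; rewrite ce.
rewrite openE => x [cx dx]; apply: filterI; first exact: open_nbhs_nbhs.
by apply: (ccf x cx); exact: open_nbhs_nbhs.
Qed.

Lemma msmooth_cont V (f : V -> M) x : msmooth_at f x -> {for x, continuous f}.
Proof. by move=> [/nbhs_singleton]. Qed.

Lemma near_dom V (f : V -> M) x c : mfd_atlas c -> {for x, continuous f} ->
  ch_dom c (f x) -> \forall y \near x, ch_dom c (f y).
Proof.
move=> ac cf fx; have [oc _ _ _ _] := mfd_chart ac.
by apply: cf; exact: open_nbhs_nbhs.
Qed.

Lemma msmooth_chart V (f : V -> M) x d : msmooth_at f x -> mfd_atlas d ->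
  ch_dom d (f x) -> smooth_at (ch_to d \o f) x.
Proof.
move=> sf ad dfx; have cfx := msmooth_cont sf; have [_ [c [ac cx sc]]] := sf.
apply: (smooth_at_near (f := (ch_to d \o ch_from c) \o (ch_to c \o f))).
  have [_ _ cto _ _] := mfd_chart ac.
  apply: filterS (near_dom ac cfx cx) => y cy /=.
  by have [_ ->] := cto _ cy.
apply: smooth_comp => //; first exact: has_coords_rV.
exact: transition_smooth.
Qed.

Lemma msmooth_nbhs V (f : V -> M) x : msmooth_at f x -> \forall y \near x, msmooth_at f y.
Proof.
move=> sf; have cfx := msmooth_cont sf; have [cf [c [ac cx sc]]] := sf.
move: (nbhs_interior cf) (near_dom ac cfx cx) (smooth_at_nbhs sc).
by apply: filterS3 => y cfy cy sy; split=> //; exists c.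
Qed.

Lemma smooth_mapP V (f : V -> M) : smooth_map f <-> forall x, msmooth_at f x.
Proof.
split=> [[cf sf] x|sf].
  split; first by near=> y; exact: cf.
  have [c ac cx] := mfd_cover (f x); exists c; split=> //.
  have [oc _ _ _ _] := mfd_chart ac.
  apply: (smooth_onP _ _).1 (sf c ac) _ _ => //.
  by apply: open_comp => // y _; exact: cf.
have cf : continuous f by move=> x; exact: msmooth_cont.
split=> // c ac; have [oc _ _ _ _] := mfd_chart ac.
apply/smooth_onP; first by apply: open_comp => // y _; exact: cf.
by move=> x cx; exact: msmooth_chart.
Unshelve. all: by end_near. Qed.

Lemma msmooth_near V (f g : V -> M) x : (\forall y \near x, f y = g y) ->
  msmooth_at f x -> msmooth_at g x.
Proof.
move=> fg [cf [c [ac cx sc]]]; split.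
  move: (nbhs_interior fg) cf; apply: filterS2 => y fgy cy.
  rewrite /prop_for /continuous_at -(nbhs_singleton fgy).
  by apply: cvg_trans cy; apply: near_eq_cvg.
exists c; split=> //; first by rewrite -(nbhs_singleton fg).
by apply: smooth_at_near sc; apply: filterS fg => y /= ->.
Qed.

Lemma msmooth_comp V W (g : V -> W) (f : W -> M) x : has_coords W ->
  smooth_at g x -> msmooth_at f (g x) -> msmooth_at (f \o g) x.
Proof.
move=> hW sg sf; have [cf [c [ac cx sc]]] := sf; split.
  have cgx := smooth_at_cont sg.
  move: (smooth_at_nbhs sg) (cgx _ cf); apply: filterS2 => y sgy cfy.
  by apply: continuous_comp => //; exact: smooth_at_cont.
by exists c; split=> //; exact: (smooth_comp hW sg sc).
Qed.

Lemma msmooth_from V (u : V -> 'rV[R]_3) c x : mfd_atlas c -> smooth_at u x ->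
  ch_cod c (u x) -> msmooth_at (ch_from c \o u) x.
Proof.
move=> ac su cux; have [oc occ cto cfrom [_ ccf]] := mfd_chart ac.
have nearc : \forall y \near x, ch_cod c (u y).
  by apply: (smooth_at_cont su); exact: open_nbhs_nbhs.
split.
  move: nearc (smooth_at_nbhs su); apply: filterS2 => y cy sy.
  by apply: continuous_comp; [exact: smooth_at_cont|exact: ccf].
exists c; split=> //; first by have [] := cfrom _ cux.
apply: smooth_at_near su; apply: filterS nearc => y cy /=.
by have [_ ->] := cfrom _ cy.
Qed.
End ManifoldSmooth.

(** * Velocities and transversality *)

Section Det3.
Context (R : realType).
Implicit Types a b v : 'rV[R]_3.

Definition det3 a b v := \det (\matrix_(k < 3) [:: a; b; v]`_k).

Local Notation "a $ i" := (a ord0 i) (at level 1, i at level 0, left associativity, format "a $ i").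

Lemma det3E a b v : det3 a b v =
  a$0 * (b$1 * v$2 - b$2 * v$1) - a$1 * (b$0 * v$2 - b$2 * v$0) +
  a$2 * (b$0 * v$1 - b$1 * v$0).
Proof.
rewrite /det3 (expand_det_row _ ord0) !big_ord_recl big_ord0 /cofactor.
rewrite !(expand_det_row _ ord0) !big_ord_recl !big_ord0 /cofactor !det_mx11 !mxE /=.
repeat match goal with |- context [fintype.lift ?h ?k] => first
  [ rewrite (_ : fintype.lift h k = 0); last by apply: val_inj
  | rewrite (_ : fintype.lift h k = 1); last by apply: val_inj
  | rewrite (_ : fintype.lift h k = 2); last by apply: val_inj ] end.
have e (w : 'rV[R]_3) i : w 0 i = w$i by congr (w _ _); exact: val_inj.
have -> : a 0 ord0 = a$0 by congr (a _ _); exact: val_inj.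
rewrite !e.
rewrite /bump /= ?addn0 ?expr0 ?expr1; ring.
Qed.

Lemma ord3_ind (P : 'I_3 -> Prop) : P 0 -> P 1 -> P 2 -> forall i, P i.
Proof.
move=> P0 P1 P2 [[|[|[|//]]] i3].
- by rewrite (_ : Ordinal i3 = 0) //; exact: val_inj.
- by rewrite (_ : Ordinal i3 = 1) //; exact: val_inj.
- by rewrite (_ : Ordinal i3 = 2) //; exact: val_inj.
Qed.

Lemma row_free2 a b : row_free (col_mx a b) <->
  (forall x y, x *: a + y *: b = 0 -> x = 0 /\ y = 0).
Proof.
rewrite -kermx_eq0; split=> [/eqP k0 x y E|H].
  have : (row_mx x%:M y%:M <= kermx (col_mx a b))%MS.
    by apply/sub_kermxP; rewrite mul_row_col !mul_scalar_mx.
  rewrite k0 submx0 => /eqP E0; have := congr1 lsubmx E0; have := congr1 rsubmx E0.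
  rewrite row_mxKl row_mxKr !linear0 => /matrixP/(_ ord0 ord0) + /matrixP/(_ ord0 ord0).
  by rewrite !mxE eqxx !mulr1n.
apply/eqP/row_matrixP => i; rewrite row0.
have : row i (kermx (col_mx a b)) *m col_mx a b = 0 by apply/sub_kermxP; exact: row_sub.
set u := row i _; rewrite -[u]hsubmxK mul_row_col [lsubmx u]mx11_scalar [rsubmx u]mx11_scalar.
by rewrite !mul_scalar_mx => /H[-> ->]; rewrite !raddf0 row_mx0.
Qed.

(** With [v] held fixed this turns transversality into the nonvanishing of a continuous function, an
    open condition. *)
Lemma transverseP a b : row_free (col_mx a b) <-> exists v, det3 a b v != 0.
Proof.
rewrite row_free2; split=> [H|[v D] x y E].
  apply: contrapT => /forallNP D.
  have {}D v : det3 a b v = 0 by apply/eqP; have /negP := D v; rewrite negbK.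
  have m12 : a$1 * b$2 - a$2 * b$1 = 0.
    by have := D (delta_mx ord0 0); rewrite det3E !mxE /= => E; rewrite -[RHS]E; ring.
  have m02 : a$0 * b$2 - a$2 * b$0 = 0.
    by have := D (- delta_mx ord0 1); rewrite det3E !mxE /= => E; rewrite -[RHS]E; ring.
  have m01 : a$0 * b$1 - a$1 * b$0 = 0.
    by have := D (delta_mx ord0 2%R); rewrite det3E !mxE /= => E; rewrite -[RHS]E; ring.
  have M i j : a$i * b$j - b$i * a$j = 0.
    move: i j; apply: ord3_ind; apply: ord3_ind; try (by rewrite mulrC subrr); lra.
  have a0 : a = 0.
    apply/rowP => i; rewrite mxE; have [] // := H (- b$i) a$i.
    by apply/rowP => j; rewrite !mxE; have := M i j; lra.
  have [] := H 1 0; last by move/eqP; rewrite oner_eq0.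
  by rewrite a0 scaler0 scale0r addr0.
have Ei i : x * a$i + y * b$i = 0 by have /rowP/(_ i) := E; rewrite !mxE.
split; apply/eqP; apply: contraNT D => /negPf x0; apply/eqP.
  apply: (mulfI (negbT x0)); rewrite mulr0 det3E.
  transitivity ((x * a$0 + y * b$0) * (b$1 * v$2 - b$2 * v$1)
   - (x * a$1 + y * b$1) * (b$0 * v$2 - b$2 * v$0) +
     (x * a$2 + y * b$2) * (b$0 * v$1 - b$1 * v$0)); first by ring.
  by rewrite !Ei; ring.
apply: (mulfI (negbT x0)); rewrite mulr0 det3E.
transitivity ((x * a$2 + y * b$2) * (a$1 * v$0 - a$0 * v$1)
   - (x * a$1 + y * b$1) * (a$2 * v$0 - a$0 * v$2) +
     (x * a$0 + y * b$0) * (a$2 * v$1 - a$1 * v$2)); first by ring.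
by rewrite !Ei; ring.
Qed.

Lemma det3M a b v (J : 'M[R]_3) : det3 (a *m J) (b *m J) (v *m J) = det3 a b v * \det J.
Proof.
rewrite /det3 -det_mulmx; congr (\det _); apply/row_matrixP => k.
rewrite row_mul !rowK; case: k => [[|[|[|//]]]] //=.
Qed.

Lemma det3_swap a b v : det3 b a (- v) = det3 a b v.
Proof. by rewrite !det3E !mxE; ring. Qed.

Lemma det3_comb a b v w x y : det3 a b (x *: v + y *: w) = x * det3 a b v + y * det3 a b w.
Proof. by rewrite !det3E !mxE; ring. Qed.

Lemma det3_continuous (T : topologicalType) (x : T) (f g h : T -> 'rV[R]_3) :
  {for x, continuous f} -> {for x, continuous g} -> {for x, continuous h} ->
  {for x, continuous (fun t => det3 (f t) (g t) (h t))}.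
Proof.
move=> cf cg ch.
have c (k : T -> 'rV[R]_3) i : {for x, continuous k} -> (fun t => (k t)$i) @ x --> (k x)$i.
  by move=> ck; apply: (@continuous_comp _ _ _ k (fun y : 'rV[R]_3 => y$i)) => //; exact: continuous_entry.
rewrite /prop_for /continuous_at det3E; under eq_fun do rewrite det3E.
by apply: (@cvgD _ R^o); [apply: (@cvgB _ R^o)|]; apply: cvgM; try (exact: c);
  apply: (@cvgB _ R^o); apply: cvgM; exact: c.
Qed.
End Det3.

Section Slices.
Context (R : realType) (Q : normedModType R).

Definition dt : Q * R := (0, 1).

Lemma slice_derive1 (W : normedModType R) (phi : Q * R -> W) q t :
  derive1 (fun t => phi (q, t)) t = 'D_dt phi (q, t).
Proof.
suff E : (fun h : R => h^-1 *: (phi (q, h + t) - phi (q, t))) =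
    (fun h : R => h^-1 *: ((phi \o shift (q, t)) (h *: dt) - phi (q, t))).
  by rewrite /derive1 /derive E.
apply/funext => h /=; congr (_ *: (phi _ - _)).
by congr pair; rewrite /= ?scaler0 ?add0r // [_ *: _]mulr1.
Qed.

Lemma line_derive (V W : normedModType R) (phi : V -> W) x v (s : R) :
  (derivable (fun s : R => phi (x + s *: v)) s 1 <-> derivable phi (x + s *: v) v) /\
  'D_1 (fun s : R => phi (x + s *: v)) s = 'D_v phi (x + s *: v).
Proof.
have E : (fun h : R => h^-1 *: (((fun s : R => phi (x + s *: v)) \o shift s) (h *: 1) - phi (x + s *: v))) =
    (fun h => h^-1 *: ((phi \o shift (x + s *: v)) (h *: v) - phi (x + s *: v))).
  apply/funext => h /=; congr (_ *: (phi _ - _)).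
  by rewrite [h *: 1]mulr1 scalerDl addrCA.
by rewrite /derivable /derive E.
Qed.

(** The mean value theorem is available one coordinate at a time; the intermediate point depends on
    [k]. *)
Lemma mvt_dir (V : normedModType R) n (phi : V -> 'rV[R]_n) x v k :
  (forall s, 0 <= s <= 1 -> smooth_at phi (x + s *: v)) ->
  exists2 s, 0 <= s <= 1 & phi (x + v) ord0 k - phi x ord0 k = ('D_v phi (x + s *: v)) ord0 k.
Proof.
move=> sm; pose f (s : R) := phi (x + s *: v) ord0 k.
have dphi s : 0 <= s <= 1 -> derivable phi (x + s *: v) v.
  by move=> /sm/smooth_at_diff; exact: diff_derivable.
have df (s : R) : 0 <= s <= 1 -> is_derive s 1 f (('D_v phi (x + s *: v)) ord0 k).
  move=> /dphi; have [[_ H1] H2] := @line_derive V _ phi x v s.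
  move=> /H1 H; rewrite -H2; have /derivable_mxP/(_ ord0 k) H' := H.
  by apply: DeriveDef => //; rewrite derive_mx // mxE.
have [||s] := @MVT R f (fun s => ('D_v phi (x + s *: v)) ord0 k) 0 1 ltr01.
- by move=> s; rewrite in_itv /= => /andP[s0 s1]; apply: df; rewrite !ltW.
- apply: continuous_in_subspaceT => s; rewrite inE /= in_itv /= => s01.
  by apply: differentiable_continuous; apply/derivable1_diffP; have [] := df s s01.
rewrite in_itv /= /f scale0r addr0 scale1r subr0 mulr1 => /andP[s0 s1] E.
by exists s => //; rewrite !ltW.
Qed.
End Slices.

Section Velocity.
Context (R : realType) (M : oriented_3manifold R) (Q : normedModType R).
Hypothesis hQ : has_coords Q.
Implicit Types (F : Q * R -> M) (c d : chart R M) (f : R -> M).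

Lemma velocity_slice c F q t :
  velocity c (fun t => F (q, t)) t = 'D_(dt Q) (ch_to c \o F) (q, t).
Proof. exact: (slice_derive1 (ch_to c \o F)). Qed.

Lemma msmooth_slice F q t : msmooth_at F (q, t) -> msmooth_at (fun t => F (q, t)) t.
Proof.
move=> sF; apply: (@msmooth_comp _ _ R^o _ (fun t : R^o => (q, t)) F) => //.
  by apply: has_coords_prod => //; exact: has_coords_R.
by apply: smooth_pair; [exact: smooth_cst|exact: smooth_id].
Qed.

Lemma velocity_continuous c F x : mfd_atlas c -> msmooth_at F x -> ch_dom c (F x) ->
  {for x, continuous (fun y => velocity c (fun t => F (y.1, t)) y.2)}.
Proof.
move=> ac sF cx; have sc := msmooth_chart sF ac cx.
rewrite (_ : (fun y => _) = 'D_(dt Q) (ch_to c \o F)).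
  exact: (smooth_at_cont (smooth_at_derive _ sc)).
by apply/funext => -[q t]; exact: velocity_slice.
Qed.

Definition transition c d p : 'M[R]_3 := jacobian (ch_to d \o ch_from c) (ch_to c p).

Lemma transition_det c d p : mfd_atlas c -> mfd_atlas d -> ch_dom c p -> ch_dom d p ->
  0 < \det (transition c d p).
Proof.
move=> ac ad cp dp; have [_ ] := mfd_oriented ac ad; apply.
by have [_ _ /(_ p cp)[? E] _ _] := mfd_chart ac; split=> //=; rewrite E.
Qed.

Lemma derive_chart (V : normedModType R) (f : V -> M) x v c d : msmooth_at f x ->
  mfd_atlas c -> mfd_atlas d -> ch_dom c (f x) -> ch_dom d (f x) ->
  'D_v (ch_to d \o f) x = 'D_v (ch_to c \o f) x *m transition c d (f x).
Proof.
move=> sf ac ad cx dx; have sc := msmooth_chart sf ac cx.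
have dT := smooth_at_diff (transition_smooth ac ad cx dx).
have dc := smooth_at_diff sc.
have [_ _ cto _ _] := mfd_chart ac.
have E : \forall y \near x, (ch_to d \o f) y = ((ch_to d \o ch_from c) \o (ch_to c \o f)) y.
  by apply: filterS (near_dom ac (msmooth_cont sf) cx) => y cy /=; have [_ ->] := cto _ cy.
rewrite (near_eq_derive v E) deriveE; last exact: differentiable_comp.
rewrite diff_comp // /transition /jacobian deriveE //.
by rewrite [RHS](mul_rV_lin1 ('d (ch_to d \o ch_from c) (ch_to c (f x)))).
Qed.

Lemma velocity_chart f t c d : msmooth_at f t -> mfd_atlas c -> mfd_atlas d ->
  ch_dom c (f t) -> ch_dom d (f t) -> velocity d f t = velocity c f t *m transition c d (f t).
Proof. by move=> *; rewrite /velocity !derive1E; exact: derive_chart. Qed.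

Lemma velocity_neq0 f t c d : msmooth_at f t -> mfd_atlas c -> mfd_atlas d ->
  ch_dom c (f t) -> ch_dom d (f t) -> velocity c f t != 0 -> velocity d f t != 0.
Proof.
move=> sf ac ad cx dx; apply: contra_neq => E.
have J := transition_det ac ad cx dx; move: E; rewrite (velocity_chart sf ac ad cx dx) => E.
have U : transition c d (f t) \in unitmx by rewrite unitmxE unitfE gt_eqF.
by rewrite -[LHS](mulmxK U) E mul0mx.
Qed.

Lemma transverse_chart f s t c d : msmooth_at f s -> msmooth_at f t -> f s = f t ->
  mfd_atlas c -> mfd_atlas d -> ch_dom c (f s) -> ch_dom d (f s) ->
  row_free (col_mx (velocity c f s) (velocity c f t)) ->
  row_free (col_mx (velocity d f s) (velocity d f t)).
Proof.
move=> sf tf st ac ad cx dx /transverseP[v D]; apply/transverseP.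
exists (v *m transition c d (f s)); rewrite (velocity_chart sf ac ad cx dx).
rewrite (velocity_chart tf ac ad) -?st // det3M mulf_neq0 //.
by rewrite gt_eqF // transition_det.
Qed.

(** Some coordinate of the velocity is nonzero and stays so nearby; a coincidence of two close
    parameters would make it vanish in between. The radius is the same for all q near [q0]. *)
Lemma locally_injective F q0 t0 c : msmooth_at F (q0, t0) -> mfd_atlas c ->
  ch_dom c (F (q0, t0)) -> velocity c (fun t => F (q0, t)) t0 != 0 ->
  exists2 r, 0 < r & \forall q \near q0, forall t t', `|t - t0| < r -> `|t' - t0| < r ->
    F (q, t) = F (q, t') -> t = t'.
Proof.
move=> sF ac cx v0; have sc := msmooth_chart sF ac cx.
have [k vk] : exists k, velocity c (fun t => F (q0, t)) t0 ord0 k != 0.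
  apply/existsP; apply: contraNT v0 => /existsPn H; apply/eqP/rowP => k.
  by rewrite mxE; apply/eqP; have := H k; rewrite negbK.
have cvk : {for (q0, t0), continuous (fun y => velocity c (fun t => F (y.1, t)) y.2 ord0 k)}.
  apply: (@continuous_comp _ _ _ (fun y : Q * R => velocity c (fun t => F (y.1, t)) y.2)
     (fun w : 'rV[R]_3 => w ord0 k)); first exact: velocity_continuous.
  exact: continuous_entry.
have nv : \forall y \near (q0, t0), velocity c (fun t => F (y.1, t)) y.2 ord0 k != 0.
  exact: (cvgr_neq0 (F := nbhs (q0, t0)) _ cvk vk).
have [[A B] /= [qA tB] AB] := filterI nv (smooth_at_nbhs sc).
have /nbhs_ballP[r /= r0 rB] := tB; exists r => //.
apply: filterS qA => q qA t t' tr t'r E; apply: contrapT => /eqP tt'.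
have seg s : 0 <= s <= 1 -> A q /\ B (t + s * (t' - t)).
  move=> /andP[s0 s1]; split=> //; apply: rB; rewrite -ball_normE /=.
  move: tr t'r; rewrite !ltr_norml => /andP[? ?] /andP[? ?].
  by apply/andP; split; nra.
have lin s : (q, t) + s *: ((t' - t) *: dt Q) = (q, t + s * (t' - t)) :> Q * R.
  by rewrite scalerA; congr pair; rewrite /= ?scaler0 ?addr0 // [_ *: _]mulr1.
have [|s s01 /eqP] := @mvt_dir R _ _ (ch_to c \o F) (q, t) ((t' - t) *: dt Q) k.
  by move=> s s01; rewrite lin; have [_] := AB (q, t + s * (t' - t)) (seg s s01).
have -> : (q, t) + (t' - t) *: dt Q = (q, t') :> Q * R.
  by rewrite -[_ *: dt Q]scale1r lin mul1r subrKC.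
rewrite lin /= E subrr eq_sym deriveE; last first.
  by apply: smooth_at_diff; have [_] := AB (q, t + s * (t' - t)) (seg s s01).
rewrite linearZ /= mxE mulf_eq0 subr_eq0 eq_sym (negPf tt') /= => /eqP E'.
have [/= ] := AB (q, t + s * (t' - t)) (seg s s01); rewrite velocity_slice deriveE ?E' ?eqxx //.
by have [_ /smooth_at_diff] := AB (q, t + s * (t' - t)) (seg s s01).
Qed.
End Velocity.

(** * Stability of singular knots *)

Section Circle.
Context (R : realType).
Implicit Types s t : R.

Lemma same_pt_refl t : same_pt t t.
Proof. by rewrite /same_pt subrr rpred0. Qed.

Lemma same_pt_sym s t : same_pt s t = same_pt t s.
Proof. by rewrite /same_pt -opprB rpredN. Qed.

Lemma same_pt_trans t s r : same_pt s t -> same_pt t r -> same_pt s r.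
Proof. by rewrite /same_pt => st tr; rewrite -(subrKA t) rpredD. Qed.

Lemma same_ptP s t : reflect (exists m : int, s = t + m%:~R) (same_pt s t).
Proof.
apply: (iffP idP) => [/intrP[m E]|[m ->]]; first by exists m; rewrite -E addrC subrK.
by rewrite /same_pt addrC addKr; apply/intrP; exists m.
Qed.

Lemma same_ptD t (m : int) : same_pt (t + m%:~R) t.
Proof. by apply/same_ptP; exists m. Qed.

Lemma periodicZ (T : Type) (f : R -> T) : periodic1 f -> forall (m : int) t, f (t + m%:~R) = f t.
Proof.
move=> pf; have pn (k : nat) t : f (t + k%:R) = f t.
  by elim: k => [|k IH]; rewrite ?addr0 // -addn1 natrD addrA pf.
move=> [k|k] t; first exact: pn.
by rewrite NegzE mulrNz -[in RHS](subrK k.+1%:R t) pn.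
Qed.

Lemma periodic_same (T : Type) (f : R -> T) s t : periodic1 f -> same_pt s t -> f s = f t.
Proof. by move=> pf /same_ptP[m ->]; exact: periodicZ. Qed.

Lemma same_pt_unit t : exists2 r, 0 <= r <= 1 & same_pt t r.
Proof.
exists (t - (Num.floor t)%:~R).
  by have := floor_itv t; rewrite intrD => /andP[? ?]; apply/andP; split; lra.
by rewrite same_pt_sym -mulrNz same_ptD.
Qed.

Lemma not_same_pt_near s t : ~~ same_pt s t -> \forall x \near (s, t), ~~ same_pt x.1 x.2.
Proof.
move=> st; have /andP[m0 m1] := floor_itv (s - t); set m := Num.floor _ in m0 m1.
have m0' : m%:~R < s - t.
  rewrite lt_neqAle m0 andbT; apply: contra st => /eqP E.
  by rewrite /same_pt -E; apply/intrP; exists m.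
have cs : continuous (fun x : R * R => x.1 - x.2).
  by apply: (@contB _ R^o); [exact: continuous_fst|exact: continuous_snd].
have H0 : \forall x \near (s, t), m%:~R < x.1 - x.2 by apply: (cvgr_gt (F := nbhs (s, t)) _ (cs (s, t))).
have H1 : \forall x \near (s, t), x.1 - x.2 < (m + 1)%:~R by apply: (cvgr_lt (F := nbhs (s, t)) _ (cs (s, t))).
move: H0 H1; apply: filterS2 => x /= x0 x1; apply/negP => /intrP[k E].
by move: x0 x1; rewrite E !ltr_int; lia.
Qed.
End Circle.

Section Core.
Context (R : realType) (M : oriented_3manifold R) (Q : normedModType R).
Hypothesis hQ : has_coords Q.
Implicit Types (t : R) (U V : set M).

Lemma separate (x y : M) : x <> y ->
  exists U V : set M, [/\ nbhs x U, nbhs y V & forall z, U z -> V z -> False].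
Proof.
move=> /eqP xy; have := @mfd_hausdorff _ M; rewrite open_hausdorff => /(_ x y xy)[[U V]].
rewrite /= !inE => -[xU yV] [oU oV UV]; exists U, V; split; try exact: open_nbhs_nbhs.
by move=> z Uz Vz; have : (U `&` V) z by []; rewrite UV.
Qed.

Lemma near_shift t0 r (m : int) : 0 < r -> \forall t \near t0, `|t - m%:~R - (t0 - m%:~R)| < r.
Proof.
move=> r0; apply/nbhs_ballP; exists r => // t; rewrite -ball_normE /= distrC => tr.
by rewrite (_ : t - _ - _ = t - t0) //; ring.
Qed.

Lemma velocity_same (c : chart R M) (f : R -> M) s t : periodic1 f -> same_pt s t ->
  velocity c f s = velocity c f t.
Proof.
move=> pf /same_ptP[m ->]; suff E : (fun h : R => h^-1 *: ((ch_to c \o f) (h + (t + m%:~R)) - (ch_to c \o f) (t + m%:~R))) =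
   (fun h => h^-1 *: ((ch_to c \o f) (h + t) - (ch_to c \o f) t)).
  by rewrite /velocity /derive1 E.
by apply/funext => h /=; rewrite addrA !(periodicZ pf).
Qed.

Section Filter.
Variable FF : set_system Q.
Hypothesis FFF : Filter FF.

Lemma ffS (A B : Q -> Prop) : (forall q, A q -> B q) -> FF A -> FF B.
Proof. by move=> AB; exact: filterS. Qed.

Lemma ffI (A B : Q -> Prop) : FF A -> FF B -> FF (fun q => A q /\ B q).
Proof. exact: filterI. Qed.

Lemma ffT (A : Q -> Prop) : (forall q, A q) -> FF A.
Proof. by move=> H; apply: ffS filterT => q _. Qed.

Lemma ff_forall (I : finType) (A : I -> Q -> Prop) : (forall i, FF (A i)) -> FF (fun q => forall i, A i q).
Proof. exact: (@filter_forall _ _ _ FF). Qed.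

(** Nearness for the product of the neighbourhoods of [x0] with [FF]. The filter is finer than the
    neighbourhoods of [q0], so that degenerate parameters close to [q0] can be left out. *)
Definition loc (T : topologicalType) (x0 : T) (A : T -> Q -> Prop) :=
  exists2 U, nbhs x0 U & exists2 C, FF C & forall x q, U x -> C q -> A x q.

Lemma locS (T : topologicalType) (x0 : T) (A B : T -> Q -> Prop) :
  (forall x q, A x q -> B x q) -> loc x0 A -> loc x0 B.
Proof. by move=> AB [U xU [C qC H]]; exists U => //; exists C => // x q Ux Cq; apply: AB; exact: H. Qed.

Lemma locI (T : topologicalType) (x0 : T) (A B : T -> Q -> Prop) :
  loc x0 A -> loc x0 B -> loc x0 (fun x q => A x q /\ B x q).
Proof.
move=> [U xU [C qC H]] [V xV [D qD H']]; exists (U `&` V); first exact: filterI.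
exists (C `&` D); first exact: filterI.
by move=> x q [? ?] [? ?]; split; [exact: H|exact: H'].
Qed.

Lemma loc_ff (T : topologicalType) (x0 : T) (A : Q -> Prop) : FF A -> loc x0 (fun _ => A).
Proof. by move=> qA; exists setT; [exact: filterT|exists A]. Qed.

Lemma loc_nbhs (T : topologicalType) (x0 : T) (A : T -> Prop) : nbhs x0 A -> loc x0 (fun x _ => A x).
Proof. by move=> xA; exists A => //; exists setT => //; exact: filterT. Qed.

Lemma loc_pair t0 t1 (A B : R -> Q -> Prop) : loc t0 A -> loc t1 B ->
  loc (t0, t1) (fun x q => A x.1 q /\ B x.2 q).
Proof.
move=> [U xU [C qC H]] [V xV [D qD H']]; exists (U `*` V); first by exists (U, V).
exists (C `&` D); first exact: filterI.
by move=> x q [? ?] [? ?]; split; [exact: H|exact: H'].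
Qed.

Lemma compact_loc (T : topologicalType) (K : set T) (A : T -> Q -> Prop) : compact K ->
  (forall x0, K x0 -> loc x0 A) -> FF (fun q => forall x, K x -> A x q).
Proof.
move=> /compact_near_coveringP/(_ Q FF (fun q x => A x q) FFF) cK H; apply: cK => x /H.
by move=> [U xU [C qC AUC]]; exists (U, C) => // -[y q] [/= ? ?]; exact: AUC.
Qed.

Lemma near_circle (A : R -> Q -> Prop) : (forall t0, loc t0 A) ->
  FF (fun q => forall t, 0 <= t <= 1 -> A t q).
Proof.
move=> H; have := compact_loc (@segment_compact R 0 1) (fun t _ => H t).
by apply: ffS => q Aq t t01; apply: Aq; rewrite /= in_itv.
Qed.

Lemma near_torus (A : R * R -> Q -> Prop) : (forall x0, loc x0 A) ->
  FF (fun q => forall t t', 0 <= t <= 1 -> 0 <= t' <= 1 -> A (t, t') q).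
Proof.
move=> H; have := compact_loc (compact_setX (@segment_compact R 0 1) (@segment_compact R 0 1)) (fun x _ => H x).
by apply: ffS => q Aq t t' t01 t'01; apply: Aq; split; rewrite /= in_itv.
Qed.

Variable q0 : Q.
Hypothesis FFq : forall A, nbhs q0 A -> FF A.

Lemma loc_q t0 (A : Q * R -> Prop) : (\forall y \near (q0, t0), A y) -> loc t0 (fun t q => A (q, t)).
Proof.
move=> [[B C] /= [qB tC] BC]; exists C => //; exists B; first exact: FFq.
by move=> t q Ct Bq; apply: BC.
Qed.

Variables (F : Q * R -> M).
Hypothesis sF : forall t, msmooth_at F (q0, t).
Hypothesis perF : FF (fun q => periodic1 (fun t => F (q, t))).
Local Notation f0 := (fun t => F (q0, t)).

Lemma loc_value t0 U : nbhs (f0 t0) U -> loc t0 (fun t q => U (F (q, t))).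
Proof. by move=> fU; apply: (loc_q (A := fun y => U (F y))); exact: (msmooth_cont (sF t0)). Qed.

Section Singular.
Variables (n : nat) (p0 : 'I_n -> M).
Hypothesis sing0 : is_singular_knot f0 p0.

Lemma immersed_near t0 : loc t0 (fun t q =>
  msmooth_at F (q, t) /\ exists c, [/\ mfd_atlas c, ch_dom c (F (q, t)) & velocity c (fun t => F (q, t)) t != 0]).
Proof.
have [c ac ct] := mfd_cover (f0 t0); have [[_ _ im] _ _ _ _] := sing0.
apply: (loc_q (A := fun y => msmooth_at F y /\ exists c, [/\ mfd_atlas c, ch_dom c (F y) &
  velocity c (fun t => F (y.1, t)) y.2 != 0])).
move: (msmooth_nbhs (sF t0)) (near_dom ac (msmooth_cont (sF t0)) ct).
have cv := velocity_continuous ac (sF t0) ct.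
have nv : \forall y \near (q0, t0), velocity c (fun t => F (y.1, t)) y.2 != 0.
  by apply: (cvgr_neq0 (F := nbhs (q0, t0)) _ cv); exact: (im c t0 ac ct).
by move: nv; apply: filterS3 => y vy sy cy; split=> //; exists c.
Qed.

Lemma local_inj t0 : exists2 r, 0 < r & FF (fun q => forall t t', `|t - t0| < r -> `|t' - t0| < r ->
    F (q, t) = F (q, t') -> t = t').
Proof.
have [c ac ct] := mfd_cover (f0 t0); have [[_ _ im] _ _ _ _] := sing0.
by have [r r0 H] := locally_injective (sF t0) ac ct (im c t0 ac ct); exists r => //; exact: FFq.
Qed.

Lemma no_coincidence t0 t0' : f0 t0 <> f0 t0' \/ same_pt t0 t0' ->
  loc (t0, t0') (fun x q => F (q, x.1) = F (q, x.2) -> same_pt x.1 x.2).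
Proof.
case=> [ne|/same_ptP[m E]].
  have [U [V [tU tV UV]]] := separate ne.
  apply: locS (loc_pair (loc_value tU) (loc_value tV)) => x q [Ux Vx] E.
  by case: (UV _ Ux); rewrite E.
have [r r0 H] := local_inj t0'.
apply: locS (locI (loc_pair (loc_nbhs (near_shift t0 m r0)) (loc_nbhs (near_shift t0' 0 r0)))
  (loc_ff _ (ffI H perF))) => x q [[]]; rewrite E addrK !subr0 => sr s'r [inj per] Fx.
have <- : x.1 - m%:~R = x.2.
  by apply: inj => //; rewrite -Fx -mulrNz; exact: (periodicZ per (- m)).
by rewrite -mulrNz same_pt_sym same_ptD.
Qed.

(** Compactness of the circle: a parameter mapped elsewhere at [q0] stays away from [Pi q], and a
    preimage of [p0 i] is represented near [s0] or [t0] up to an integer. *)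
Lemma preimage_near i (Pi : Q -> M) s0 t0 d1 d2 : (forall U, nbhs (p0 i) U -> FF (fun q => U (Pi q))) ->
  (forall r, f0 r = p0 i -> same_pt r s0 || same_pt r t0) -> 0 < d1 -> 0 < d2 ->
  FF (fun q => forall r, F (q, r) = Pi q ->
    (exists2 s, `|s - s0| < d1 & same_pt r s) \/ (exists2 t, `|t - t0| < d2 & same_pt r t)).
Proof.
move=> cv only d10 d20.
suff H : FF (fun q => forall r, 0 <= r <= 1 -> F (q, r) = Pi q ->
    (exists2 s, `|s - s0| < d1 & same_pt r s) \/ (exists2 t, `|t - t0| < d2 & same_pt r t)).
  apply: ffS (ffI H perF) => q [Hq per] r Fr; have [r' r'01 rr'] := same_pt_unit r.
  have Fr' : F (q, r') = Pi q by rewrite -Fr; apply: (periodic_same per); rewrite same_pt_sym.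
  by have [[s ss0 r's]|[t tt0 r't]] := Hq r' r'01 Fr'; [left; exists s|right; exists t] => //;
    apply: same_pt_trans rr' _.
apply: near_circle => r0; have [E|ne] := pselect (f0 r0 = p0 i); last first.
  have [U [V [rU pV UV]]] := separate ne.
  apply: locS (locI (loc_value rU) (loc_ff _ (cv _ pV))) => r q [Ur Vq] E.
  by case: (UV (Pi q)) => //; rewrite -E.
have H (x0 d : R) : 0 < d -> same_pt r0 x0 -> loc r0 (fun r q =>
    exists2 s, `|s - x0| < d & same_pt r s).
  move=> d0 /same_ptP[m Em]; apply: locS (loc_nbhs (near_shift r0 m d0)) => r _ rd.
  exists (r - m%:~R); first by move: rd; rewrite Em addrK.
  by rewrite -mulrNz same_pt_sym same_ptD.
have /orP[S|S] := only _ E.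
  by apply: locS (H s0 d1 d10 S) => x q Hx _; left.
by apply: locS (H t0 d2 d20 S) => x q Hx _; right.
Qed.

Variables (k : nat) (P : Q -> 'I_k -> M) (sg : 'I_k -> 'I_n).
Hypothesis sg_inj : injective sg.
Hypothesis cvP : forall j U, nbhs (p0 (sg j)) U -> FF (fun q => U (P q j)).

(* The double points p0 (sg j) persist, those outside the image of sg disappear. *)
Hypothesis persist : forall j t1 t2, ~~ same_pt t1 t2 -> f0 t1 = p0 (sg j) -> f0 t2 = p0 (sg j) ->
  loc (t1, t2) (fun x q => F (q, x.1) = F (q, x.2) -> F (q, x.1) = P q j).
Hypothesis persist_ex : forall j t1, f0 t1 = p0 (sg j) ->
  forall r, 0 < r -> FF (fun q => exists2 t, `|t - t1| < r & F (q, t) = P q j).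
Hypothesis disappear : forall i t1 t2, (forall j, i != sg j) -> ~~ same_pt t1 t2 ->
  f0 t1 = p0 i -> f0 t2 = p0 i -> loc (t1, t2) (fun x q => F (q, x.1) <> F (q, x.2)).

Lemma transverse_near t1 t2 : ~~ same_pt t1 t2 -> f0 t1 = f0 t2 ->
  loc (t1, t2) (fun x q => exists c, [/\ mfd_atlas c, ch_dom c (F (q, x.1)) &
      row_free (col_mx (velocity c (fun t => F (q, t)) x.1) (velocity c (fun t => F (q, t)) x.2))]).
Proof.
move=> t12 E; have [c ac ct] := mfd_cover (f0 t1); have [_ _ _ _ tr] := sing0.
have ct2 : ch_dom c (f0 t2) by rewrite -E.
have /transverseP[v D] := tr _ _ E t12 c ac ct.
pose D' (z : (R * R) * Q) := det3 (velocity c (fun t => F (z.2, t)) z.1.1) (velocity c (fun t => F (z.2, t)) z.1.2) v.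
have cD : {for ((t1, t2), q0), continuous D'}.
  apply: det3_continuous; last exact: cvg_cst.
    apply: (@continuous_comp _ _ _ (fun z : (R * R) * Q => (z.2, z.1.1))
      (fun y : Q * R => velocity c (fun t => F (y.1, t)) y.2)); last exact: velocity_continuous.
    apply: (@continuous_pair _ _ _ (fun z : (R * R) * Q => z.2)); first exact: continuous_snd.
    by apply: (continuous_o (g := fst)); exact: continuous_fst.
  apply: (@continuous_comp _ _ _ (fun z : (R * R) * Q => (z.2, z.1.2))
    (fun y : Q * R => velocity c (fun t => F (y.1, t)) y.2)); last exact: velocity_continuous.
  apply: (@continuous_pair _ _ _ (fun z : (R * R) * Q => z.2)); first exact: continuous_snd.
  by apply: (continuous_o (g := snd)); [exact: continuous_snd|exact: continuous_fst].
have [[A B] /= [tA qB] AB] : \forall z \near ((t1, t2), q0), D' z != 0.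
  exact: (cvgr_neq0 (F := nbhs ((t1, t2), q0)) _ cD D).
have lD : loc (t1, t2) (fun x q => D' (x, q) != 0).
  by exists A => //; exists B; [exact: FFq|move=> x q Ax Bq; exact: (AB (x, q))].
have lc : loc t1 (fun t q => ch_dom c (F (q, t))).
  by apply: (loc_q (A := fun y => ch_dom c (F y))); exact: (near_dom ac (msmooth_cont (sF t1)) ct).
apply: locS (locI lD (loc_pair lc (loc_nbhs (@filterT _ (nbhs t2) _)))) => x q [Dx [cx _]].
by exists c; split=> //; apply/transverseP; exists v.
Qed.

Lemma coincidences x0 : loc x0 (fun x q =>
  F (q, x.1) = F (q, x.2) -> ~~ same_pt x.1 x.2 -> (exists j, F (q, x.1) = P q j) /\
    exists c, [/\ mfd_atlas c, ch_dom c (F (q, x.1)) &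
      row_free (col_mx (velocity c (fun t => F (q, t)) x.1) (velocity c (fun t => F (q, t)) x.2))]).
Proof.
case: x0 => t1 t2; have [H|H] := pselect (f0 t1 <> f0 t2 \/ same_pt t1 t2).
  by apply: locS (no_coincidence H) => x q H' /H' ->.
have [E nS] : f0 t1 = f0 t2 /\ ~~ same_pt t1 t2.
  by split; [apply: contrapT => E; apply: H; left|apply/negP => S; apply: H; right].
have [_ _ _ dbl _] := sing0; have [i Ei] := dbl _ _ E nS.
have Ei2 : f0 t2 = p0 i by rewrite -E.
have tr := transverse_near nS E.
have [[j ij]|H'] := pselect (exists j, i = sg j).
  subst i; apply: locS (locI tr (persist nS Ei Ei2)) => x q [tx px] Ex _.
  by split=> //; exists j; exact: px.
have nsg j : i != sg j by apply/eqP => ij; apply: H'; exists j.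
by apply: locS (disappear nsg nS Ei Ei2) => x q ne /ne.
Qed.

(** Existence near the two old preimages is [persist_ex]. By [preimage_near] any further preimage is
    near one of them, and local injectivity identifies it. *)
Lemma preimages j : FF (fun q => exists s t, [/\ ~~ same_pt s t, F (q, s) = P q j, F (q, t) = P q j
  & forall r, F (q, r) = P q j -> same_pt r s || same_pt r t]).
Proof.
have [_ _ pre _ _] := sing0; have [s0 [t0 [nS Es Et only]]] := pre (sg j).
have [r1 r10 inj1] := local_inj s0; have [r2 r20 inj2] := local_inj t0.
have [[A B] /= [sA tB] AB] := not_same_pt_near nS.
have [/= r3 r30 A3] := (nbhs_ballP _ _).1 sA; have [/= r4 r40 B4] := (nbhs_ballP _ _).1 tB.
have u1 : 0 < Num.min r1 r3 by rewrite lt_min r10 r30.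
have u2 : 0 < Num.min r2 r4 by rewrite lt_min r20 r40.
have only_near := preimage_near (@cvP j) only r10 r20.
have := ffI inj1 (ffI inj2 (ffI only_near (ffI (persist_ex Es u1) (ffI (persist_ex Et u2) perF)))).
apply: ffS => q [i1 [i2 [on [[s sr Fs] [[t tr Ft] per]]]]].
move: sr tr; rewrite !lt_min => /andP[s1 s3] /andP[t2 t4].
exists s, t; split=> //.
  by apply: (AB (s, t)); split; [apply: A3|apply: B4]; rewrite -ball_normE /= distrC.
move=> r Fr; have [[s' s's rs']|[t' t't rt']] := on r Fr.
  apply/orP; left; rewrite (_ : s = s') //.
  by apply: i1 => //; rewrite Fs -Fr; exact: (periodic_same per).
apply/orP; right; rewrite (_ : t = t') //.
by apply: i2 => //; rewrite Ft -Fr; exact: (periodic_same per).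
Qed.

Lemma double_pts_distinct : FF (fun q => injective (P q)).
Proof.
have H (ij : 'I_k * 'I_k) : FF (fun q => P q ij.1 = P q ij.2 -> ij.1 = ij.2).
  case: ij => i j /=; have [->|ij] := eqVneq i j; first exact: ffT.
  have [|U [V [iU jV UV]]] := @separate (p0 (sg i)) (p0 (sg j)).
    by have [_ pI _ _ _] := sing0; move=> /pI/sg_inj/eqP; rewrite (negPf ij).
  apply: ffS (ffI (cvP iU) (cvP jV)) => q [Uq Vq] E.
  by case: (UV (P q i)) => //; rewrite E.
by apply: ffS (ff_forall H) => q Hq i j; exact: (Hq (i, j)).
Qed.

(** Compactness controls parameters in [0, 1] and pairs of them; all other parameters are reduced to
    these by periodicity, and the conditions found in one chart are moved to every chart. *)
Theorem singular_near : FF (fun q => is_singular_knot (fun t => F (q, t)) (P q)).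
Proof.
have := ffI (near_circle immersed_near) (ffI (near_torus coincidences)
  (ffI (ff_forall preimages) (ffI double_pts_distinct perF))).
apply: ffS => q [imq [coq [preq [injq per]]]].
pose f t := F (q, t).
have fS s t : same_pt s t -> f s = f t by exact: (periodic_same per).
have fE (m : int) : f = f \o (fun t => t - m%:~R).
  by apply/funext => s /=; rewrite -mulrNz [RHS](periodicZ per).
have imT t : msmooth_at f t /\ exists c, [/\ mfd_atlas c, ch_dom c (f t) & velocity c f t != 0].
  have [r r01 tr] := same_pt_unit t; have [sr [c [ac cr vr]]] := imq r r01.
  have sfr : msmooth_at f r by exact: msmooth_slice sr.
  split; last first.
    by exists c; rewrite (velocity_same c per tr) (fS _ _ tr).
  have /same_ptP[m tE] := tr; rewrite (fE m).
  apply: (@msmooth_comp _ _ R^o R^o) => //; first exact: has_coords_R.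
    by apply: (@smoothB _ R^o R^o); [exact: smooth_id|exact: smooth_cst].
  by rewrite /= tE addrK.
have pairs t t' : f t = f t' -> ~~ same_pt t t' -> (exists j, f t = P q j) /\
    exists c, [/\ mfd_atlas c, ch_dom c (f t) & row_free (col_mx (velocity c f t) (velocity c f t'))].
  have [r r01 tr] := same_pt_unit t; have [r' r'01 tr'] := same_pt_unit t'.
  move=> E nS; have [||[j Ej] [c [ac cr rf]]] := coq r r' r01 r'01.
  - by rewrite /= -[F _]/(f r) -[F (q, r')]/(f r') -(fS _ _ tr) -(fS _ _ tr').
  - apply: contra nS => /= rr'; apply: same_pt_trans tr _; apply: same_pt_trans rr' _.
    by rewrite same_pt_sym.
  rewrite /= in Ej cr rf; split; first by exists j; rewrite (fS _ _ tr).
  by exists c; rewrite (velocity_same c per tr) (velocity_same c per tr') (fS _ _ tr).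
split=> //.
- split=> //; first by apply/smooth_mapP => t; have [] := imT t.
  move=> d t ad dt; have [st [c [ac ct vt]]] := imT t.
  exact: velocity_neq0 vt.
- by move=> t t' E nS; have [] := pairs t t' E nS.
- move=> t t' E nS d ad dt; have [_ [c [ac ct rf]]] := pairs t t' E nS.
  by apply: transverse_chart rf => //; have [] := imT t; have [] := imT t'.
Qed.
End Singular.
End Filter.
End Core.

Section MeanValue.
Context (R : realType).
Local Notation "a $ i" := (a ord0 i) (at level 1, i at level 0, left associativity, format "a $ i").

Lemma det3_cramer (a b v : 'rV[R]_3) x y z : det3 a b v != 0 ->
  (forall k, x * a$k + y * b$k + z * v$k = 0) -> z = 0.
Proof.
move=> D E; apply: (mulIf D); rewrite mul0r det3E.
transitivity ((x * a$0 + y * b$0 + z * v$0) * (a$1 * b$2 - a$2 * b$1)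
   - (x * a$1 + y * b$1 + z * v$1) * (a$0 * b$2 - a$2 * b$0) +
     (x * a$2 + y * b$2 + z * v$2) * (a$0 * b$1 - a$1 * b$0)); first by ring.
by rewrite !E; ring.
Qed.

Lemma nbhs_row n (x : 'rV[R]_n) (U : set 'rV[R]_n) : nbhs x U ->
  exists2 e : R, 0 < e & forall y : 'rV[R]_n, (forall k, `|y$k - x$k| < e) -> U y.
Proof.
move=> /nbhs_ballP[e /= e0 eU]; exists e => // y H; apply: eU; split=> // i j.
by rewrite (ord1 i) -ball_normE /= distrC; exact: H.
Qed.

Lemma det3_near (a b v : 'rV[R]_3) : det3 a b v != 0 -> exists2 e : R, 0 < e &
  forall a' b' v' : 'rV[R]_3, (forall k, `|a'$k - a$k| < e) -> (forall k, `|b'$k - b$k| < e) ->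
    (forall k, `|v'$k - v$k| < e) -> det3 a' b' v' != 0.
Proof.
move=> D; pose f (z : ('rV[R]_3 * 'rV[R]_3) * 'rV[R]_3) := det3 z.1.1 z.1.2 z.2.
have cf : {for ((a, b), v), continuous f}.
  apply: det3_continuous; last exact: continuous_snd.
    by apply: (continuous_o (g := fst)); exact: continuous_fst.
  by apply: (continuous_o (g := snd)); [exact: continuous_snd|exact: continuous_fst].
have [[A V] /= [[[A1 A2] /= [n1 n2] A12] nV] AV] : \forall z \near ((a, b), v), f z != 0.
  exact: (cvgr_neq0 (F := nbhs ((a, b), v)) _ cf D).
have [e1 e10 H1] := nbhs_row n1; have [e2 e20 H2] := nbhs_row n2; have [e3 e30 H3] := nbhs_row nV.
exists (Num.min e1 (Num.min e2 e3)); first by rewrite !lt_min e10 e20.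
move=> a' b' v' Ha Hb Hv; apply: (AV ((a', b'), v')); split=> /=.
  by apply: (A12 (a', b')); split; [apply: H1|apply: H2] => k; [have := Ha k|have := Hb k];
    rewrite !lt_min => /and3P[].
by apply: H3 => k; have := Hv k; rewrite !lt_min => /and3P[].
Qed.

Lemma mvt_scaled (V : normedModType R) n (phi : V -> 'rV[R]_n) x v (z : R) k :
  (forall s, 0 <= s <= 1 -> smooth_at phi (x + (s * z) *: v)) ->
  exists2 s, 0 <= s <= 1 & phi (x + z *: v) ord0 k - phi x ord0 k = z * ('D_v phi (x + (s * z) *: v)) ord0 k.
Proof.
move=> sm; have [|s s01 E] := @mvt_dir R V n phi x (z *: v) k.
  by move=> s s01; rewrite scalerA; exact: sm.
have d := smooth_at_diff (sm s s01).
exists s => //; rewrite E scalerA deriveE // linearZ mxE; congr (_ * _).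
by rewrite -deriveE.
Qed.
End MeanValue.

Lemma convex_dist (R : realType) (r t y z a : R) : `|y - t| < r -> `|z - t| < r -> 0 <= a <= 1 ->
  `|y + a * (z - y) - t| < r.
Proof.
move=> yt zt /andP[a0 a1]; pose m := Num.max `|y - t| `|z - t|.
have mr : m < r by rewrite gt_max yt.
have -> : y + a * (z - y) - t = (1 - a) * (y - t) + a * (z - t) by ring.
apply: le_lt_trans mr; apply: le_trans (ler_normD _ _) _.
have -> : m = (1 - a) * m + a * m by ring.
by rewrite !normrM ger0_norm ?subr_ge0 // (ger0_norm a0) lerD // ler_wpM2l ?subr_ge0 // le_max lexx ?orbT.
Qed.

Lemma dist_subB (R : realType) (e a b v w : R) : `|a - v| < e / 2 -> `|b - w| < e / 2 ->
  `|a - b - (v - w)| < e.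
Proof.
move=> H1 H2; have -> : a - b - (v - w) = (a - v) - (b - w) by ring.
by apply: le_lt_trans (ler_normB _ _) _; rewrite (splitr e) ltrD.
Qed.

(** * Disappearance of a double point *)

Section Opening.
Context (R : realType) (M : oriented_3manifold R) (Q : normedModType R).
Hypothesis hQ : has_coords Q.
Variable FF : set_system Q.
Hypothesis FFF : Filter FF.
Variable q0 : Q.
Hypothesis FFq : forall A, nbhs q0 A -> FF A.
Variable F : Q * R -> M.

(* If the two branches separate at first order in the direction w, then they are disjoint
   near the former double point: subtract from a coincidence at q the coincidence at
   q - tau w and apply the mean value theorem in each coordinate. *)
Lemma opened (c : chart R M) (w : Q) (tau : Q -> R) (t1 t2 : R) : mfd_atlas c ->
  msmooth_at F (q0, t1) -> msmooth_at F (q0, t2) ->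
  ch_dom c (F (q0, t1)) -> ch_dom c (F (q0, t2)) ->
  det3 ('D_(dt Q) (ch_to c \o F) (q0, t1)) ('D_(dt Q) (ch_to c \o F) (q0, t2))
       ('D_((w, 0) : Q * R) (ch_to c \o F) (q0, t1) - 'D_((w, 0) : Q * R) (ch_to c \o F) (q0, t2)) != 0 ->
  (forall r, 0 < r -> FF (fun q => 0 < tau q < r)) ->
  (forall r, 0 < r -> FF (fun q => exists s s' : R, [/\ `|s - t1| < r, `|s' - t2| < r
     & F (q - tau q *: w, s) = F (q - tau q *: w, s')])) ->
  loc FF (t1, t2) (fun x q => F (q, x.1) <> F (q, x.2)).
Proof.
move=> ac s1 s2 c1 c2 D tauP ref.
have sm1 := msmooth_chart s1 ac c1; have sm2 := msmooth_chart s2 ac c2.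
set phi := ch_to c \o F in D sm1 sm2; set dw : Q * R := (w, 0) in D.
have [e e0 De] := det3_near D.
have near (t : R) : smooth_at phi (q0, t) -> exists2 r, 0 < r & forall q' t', `|q' - q0| < r -> `|t' - t| < r ->
    [/\ smooth_at phi (q', t'), forall k, `|('D_(dt Q) phi (q', t')) ord0 k - ('D_(dt Q) phi (q0, t)) ord0 k| < e
      & forall k, `|('D_dw phi (q', t')) ord0 k - ('D_dw phi (q0, t)) ord0 k| < e / 2].
  move=> sm; have cd v : {for (q0, t), continuous ('D_v phi)} by exact: smooth_at_cont (smooth_at_derive _ sm).
  have bd v d : 0 < d -> \forall y \near (q0, t), forall k, `|('D_v phi y) ord0 k - ('D_v phi (q0, t)) ord0 k| < d.
    move=> d0.
    have nU : nbhs ('D_v phi (q0, t)) [set y : 'rV[R]_3 | forall k, `|y ord0 k - ('D_v phi (q0, t)) ord0 k| < d].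
      apply/nbhs_ballP; exists d => //= x [_ H] k.
      by have := H ord0 k; rewrite -ball_normE /= distrC.
    exact: (cd v _ nU).
  have e20 : 0 < e / 2 by rewrite divr_gt0.
  have := filterI (smooth_at_nbhs sm) (filterI (bd (dt Q) e e0) (bd dw (e / 2) e20)).
  move=> [[A B] /= [qA tB] AB].
  have [/= ra ra0 HA] := (nbhs_ballP _ _).1 qA; have [/= rb rb0 HB] := (nbhs_ballP _ _).1 tB.
  exists (Num.min ra rb); first by rewrite lt_min ra0.
  move=> q' t'; rewrite !lt_min => /andP[qa _] /andP[_ tb].
  have [] := AB (q', t'); last by move=> ? [].
  by split; [apply: HA|apply: HB]; rewrite -ball_normE /= distrC.
have [r1 r10 H1] := near t1 sm1; have [r2 r20 H2] := near t2 sm2.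
pose r := Num.min r1 r2; have r0 : 0 < r by rewrite lt_min r10.
have rr1 : r <= r1 by rewrite ge_min lexx. have rr2 : r <= r2 by rewrite ge_min lexx orbT.
have w0 : 0 < `|w| + 1 by rewrite ltr_wpDl.
(* With [tau q] below this bound the shift by [tau q *: w] is shorter than r/2; adding 1 allows for
   w = 0. *)
have tr0 : 0 < r / 2 / (`|w| + 1) by rewrite !divr_gt0.
have nq : FF (fun q => `|q - q0| < r / 2).
  apply: FFq; apply/nbhs_ballP; exists (r / 2) => /=; first by rewrite divr_gt0.
  by move=> y; rewrite -ball_normE /= distrC.
have [c1n c2n] : (\forall y \near (q0, t1), ch_dom c (F y)) /\ (\forall y \near (q0, t2), ch_dom c (F y)).
  by split; apply: near_dom => //; exact: msmooth_cont.
have tn (t : R) : nbhs t (fun t' => `|t' - t| < r).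
  by apply/nbhs_ballP; exists r => //= y; rewrite -ball_normE /= distrC.
have L1 := loc_pair FFF (loc_nbhs FFF (tn t1)) (loc_nbhs FFF (tn t2)).
have L2 := ffI FFF nq (ffI FFF (tauP _ tr0) (ref _ r0)).
have L := locI FFF L1 (loc_ff (t1, t2) L2).
apply: locS L.
move=> [x1 x2] q /= [[x1t x2t] [qr [/andP[ta0 tar] [s [s' [st s't Es]]]]]] Ex.
set ta := tau q in ta0 tar Es; set q' := q - ta *: w in Es.
have qs z : 0 <= z <= 1 -> `|q' + (z * ta) *: w - q0| < r.
  move=> /andP[z0 z1]; have -> : q' + (z * ta) *: w - q0 = (q - q0) - ((1 - z) * ta) *: w.
    by rewrite /q' mulrBl mul1r scalerBl opprB -[_ + (z * ta) *: w]addrA [- (ta *: w) + _]addrC addrAC.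
  apply: le_lt_trans (ler_normB _ _) _; rewrite (splitr r) ltrD //.
  rewrite normrZ ger0_norm ?mulr_ge0 ?subr_ge0 //; last exact: ltW.
  apply: (@le_lt_trans _ _ (ta * (`|w| + 1))); last by rewrite -ltr_pdivlMr.
  have w_ge0 := normr_ge0 w; have ta_ge0 := ltW ta0.
  rewrite ler_pM ?mulr_ge0 ?subr_ge0 // ?ler_piMl // ?lerDl //.
  by rewrite gerBl.
have branch t y z k : (forall q' t', `|q' - q0| < r -> `|t' - t| < r ->
    [/\ smooth_at phi (q', t'), forall k, `|('D_(dt Q) phi (q', t')) ord0 k - ('D_(dt Q) phi (q0, t)) ord0 k| < e
      & forall k, `|('D_dw phi (q', t')) ord0 k - ('D_dw phi (q0, t)) ord0 k| < e / 2]) ->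
    `|y - t| < r -> `|z - t| < r -> exists ab : R * R, [/\ `|ab.1 - ('D_(dt Q) phi (q0, t)) ord0 k| < e,
      `|ab.2 - ('D_dw phi (q0, t)) ord0 k| < e / 2
      & phi (q, z) ord0 k - phi (q', y) ord0 k = (z - y) * ab.1 + ta * ab.2].
  move=> H yt zt.
  have l1 a : (q', y) + (a * (z - y)) *: dt Q = (q', y + a * (z - y)) :> Q * R.
    by congr pair; rewrite /= ?scaler0 ?addr0 // [_ *: _]mulr1.
  have l2 a : (q', z) + (a * ta) *: dw = (q' + (a * ta) *: w, z) :> Q * R.
    by congr pair; rewrite /= scaler0 addr0.
  have q'r : `|q' - q0| < r by have := qs 0; rewrite mul0r scale0r addr0; apply; rewrite lexx ler01.
  have [a a01|a a01 Ea] := @mvt_scaled R (Q * R)%type 3 phi (q', y) (dt Q) (z - y) k.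
    by rewrite l1; have [] := H q' (y + a * (z - y)) q'r (convex_dist yt zt a01).
  have [b b01|b b01 Eb] := @mvt_scaled R (Q * R)%type 3 phi (q', z) dw ta k.
    by rewrite l2; have [] := H (q' + (b * ta) *: w) z (qs _ b01) zt.
  exists (('D_(dt Q) phi (q', y + a * (z - y))) ord0 k, ('D_dw phi (q' + (b * ta) *: w, z)) ord0 k).
  split=> /=.
  - by have [_ + _] := H q' (y + a * (z - y)) q'r (convex_dist yt zt a01); apply.
  - by have [_ _] := H (q' + (b * ta) *: w) z (qs _ b01) zt; apply.
  rewrite -l1 -l2 -Ea -Eb -[z - y]mul1r -[ta]mul1r l1 l2 !mul1r subrKC.
  have -> : q' + ta *: w = q by rewrite /q' subrK.
  by rewrite [RHS]addrC subrKA.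
have H1' q'' t' : `|q'' - q0| < r -> `|t' - t1| < r -> _ := fun a b => H1 q'' t' (lt_le_trans a rr1) (lt_le_trans b rr1).
have H2' q'' t' : `|q'' - q0| < r -> `|t' - t2| < r -> _ := fun a b => H2 q'' t' (lt_le_trans a rr2) (lt_le_trans b rr2).
have /choice[u P1] := fun k => branch t1 s x1 k H1' st x1t.
have /choice[v P2] := fun k => branch t2 s' x2 k H2' s't x2t.
have D' : det3 (\row_k (u k).1) (\row_k (v k).1) (\row_k ((u k).2 - (v k).2)) != 0.
  apply: De => k; rewrite !mxE.
  - by have [] := P1 k.
  - by have [] := P2 k.
  by have [_ H1k _] := P1 k; have [_ H2k _] := P2 k; exact: dist_subB.
have : ta = 0.
  apply: (det3_cramer (x := x1 - s) (y := - (x2 - s')) D') => k; rewrite !mxE.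
  have [_ _ E1] := P1 k; have [_ _ E2] := P2 k.
  have Ep : phi (q, x1) = phi (q, x2) by rewrite /phi /= Ex.
  have Ep' : phi (q', s) = phi (q', s') by rewrite /phi /= Es.
  rewrite Ep Ep' E2 in E1.
  have -> : (x1 - s) * (u k).1 + - (x2 - s') * (v k).1 + ta * ((u k).2 - (v k).2) =
    ((x1 - s) * (u k).1 + ta * (u k).2) - ((x2 - s') * (v k).1 + ta * (v k).2) by ring.
  by rewrite E1 subrr.
by move=> ta_0; move: ta0; rewrite ta_0 ltxx.
Qed.
End Opening.

(** * Persistence of a double point *)

Section Persistence.
Context (R : realType) (M : oriented_3manifold R) (Q : normedModType R).
Variable FF : set_system Q.
Hypothesis FFF : Filter FF.
Variable q0 : Q.
Hypothesis FFq : forall A, nbhs q0 A -> FF A.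
Variable G : Q * R -> M.
Hypothesis sG : forall t, msmooth_at G (q0, t).
Hypothesis perG : FF (fun q => periodic1 (fun t => G (q, t))).
Local Notation f0 := (fun t => G (q0, t)).
Variables (n : nat) (p0 : 'I_n -> M).
Hypothesis sing0 : is_singular_knot f0 p0.
Variables (i : 'I_n) (Pi : Q -> M) (U0 : set M).
Hypothesis cvPi : forall U, nbhs (p0 i) U -> FF (fun q => U (Pi q)).
Hypothesis iU0 : nbhs (p0 i) U0.

(* Pi q is the only double point of G q near p0 i. *)
Definition persists := FF (fun q =>
  (forall r r', ~~ same_pt r r' -> G (q, r) = G (q, r') -> U0 (G (q, r)) -> G (q, r) = Pi q) /\
  exists r r', [/\ ~~ same_pt r r', G (q, r) = Pi q & G (q, r') = Pi q]).
Hypothesis perst : persists.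

Variable F : Q * R -> M.
Hypothesis FG : forall t, f0 t = p0 i -> loc FF t (fun t q => F (q, t) = G (q, t)).

Lemma persist_coincidence t1 t2 : ~~ same_pt t1 t2 -> f0 t1 = p0 i -> f0 t2 = p0 i ->
  loc FF (t1, t2) (fun x q => F (q, x.1) = F (q, x.2) -> F (q, x.1) = Pi q).
Proof.
move=> nS E1 E2; have U0f : nbhs (f0 t1) U0 by rewrite E1.
have L := locI FFF (loc_nbhs FFF (not_same_pt_near nS)) (locI FFF (loc_pair FFF (FG E1) (FG E2))
  (locI FFF (loc_pair FFF (loc_value FFq sG U0f) (loc_ff t2 perst)) (loc_ff (t1, t2) perst))).
apply: locS L => x q [nSx [[-> ->] [[Ux [H _]] _]]] Ex; exact: H nSx Ex Ux.
Qed.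

(** The two preimages of [Pi q] lie near [t1] or near the other old preimage [s1]. They cannot both
    be near [s1], where the curve is injective, so one of them is near [t1]. *)
Lemma persist_point t1 : f0 t1 = p0 i -> forall r, 0 < r ->
  FF (fun q => exists2 t, `|t - t1| < r & F (q, t) = Pi q).
Proof.
move=> E1 r r0; have [_ _ pre _ _] := sing0; have [s0 [t0 [nS Es Et only]]] := pre i.
have [s1 [nS1 only1]] : exists s1, ~~ same_pt t1 s1 /\ forall r, f0 r = p0 i -> same_pt r t1 || same_pt r s1.
  have /orP[S|S] := only _ E1.
    exists t0; split; first by apply: contra nS => /(same_pt_trans _); apply; rewrite same_pt_sym.
    move=> r' /only/orP[S'|->]; rewrite ?orbT //; apply/orP; left.
    by apply: same_pt_trans S' _; rewrite same_pt_sym.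
  exists s0; split; first by apply: contra nS => S'; apply: same_pt_trans S; rewrite same_pt_sym.
  move=> r' /only/orP[->|S']; rewrite ?orbT //; apply/orP; left.
  by apply: same_pt_trans S' _; rewrite same_pt_sym.
have [r1 r10 i1] := local_inj FFq sG sing0 t1; have [r2 r20 i2] := local_inj FFq sG sing0 s1.
have [A tA [C qC AC]] := FG E1; have [/= a a0 HA] := (nbhs_ballP _ _).1 tA.
pose d := Num.min r (Num.min r1 a); have d0 : 0 < d by rewrite !lt_min r0 r10.
have on := preimage_near FFF FFq sG perG cvPi only1 d0 r20.
have := ffI FFF i2 (ffI FFF qC (ffI FFF on (ffI FFF perst perG))).
apply: ffS => q [inj2 [Cq [onq [[_ [u [v [nSuv Gu Gv]]]] per]]]].
suff [s s1d Gs] : exists2 s, `|s - t1| < d & G (q, s) = Pi q.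
  move: s1d; rewrite !lt_min => /and3P[sr _ sa]; exists s => //.
  by rewrite AC //; apply: HA; rewrite -ball_normE /= distrC.
have [[s sd us]|[s ss us]] := onq u Gu; first by exists s => //; rewrite -Gu; apply: (periodic_same per); rewrite same_pt_sym.
have [[t td vt]|[t tt vt]] := onq v Gv; first by exists t => //; rewrite -Gv; apply: (periodic_same per); rewrite same_pt_sym.
have E : s = t.
  apply: inj2 => //; have -> : G (q, s) = G (q, u) by apply: (periodic_same per); rewrite same_pt_sym.
  have -> : G (q, t) = G (q, v) by apply: (periodic_same per); rewrite same_pt_sym.
  by rewrite Gu Gv.
by case/negP: nSuv; apply: same_pt_trans us _; rewrite E same_pt_sym.
Qed.
End Persistence.

(** The number m of double points may depend on q: when two pushes are compared, the auxiliary curve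
    still has the point being resolved at one end of the path. *)
Lemma singular_persists (R : realType) (M : oriented_3manifold R) (Q : normedModType R)
    (FF : set_system Q) (FFF : Filter FF) (G : Q * R -> M) (Pi : Q -> M) (U0 : set M) :
  FF (fun q => exists m (P : 'I_m -> M), [/\ is_singular_knot (fun t => G (q, t)) P,
    exists j, P j = Pi q & forall l, U0 (P l) -> P l = Pi q]) -> persists FF G Pi U0.
Proof.
apply: ffS => q [m [P [sing [j Pj] HU]]]; have [_ _ pre dbl _] := sing; split.
  by move=> r r' nS E Ur; have [l El] := dbl _ _ E nS; rewrite El; apply: HU; rewrite -El.
by have [s [t [nS Es Et _]]] := pre j; exists s, t; rewrite Es Et Pj.
Qed.

(** * Stability of the base point and of the order of the double points *)

Section Based.
Context (R : realType) (M : oriented_3manifold R) (Q : normedModType R).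
Variable FF : set_system Q.
Hypothesis FFF : Filter FF.
Variable q0 : Q.
Hypothesis FFq : forall A, nbhs q0 A -> FF A.
Variable F : Q * R -> M.
Hypothesis sF : forall t, msmooth_at F (q0, t).
Local Notation f0 := (fun t => F (q0, t)).
Variables (n : nat) (p0 : 'I_n -> M) (b0 : R).
Hypothesis based0 : is_based_knot f0 p0 b0.
Variables (k : nat) (P : Q -> 'I_k -> M) (sg : 'I_k -> 'I_n) (b : Q -> R).
Hypothesis sg_mono : forall i j : 'I_k, (i < j)%N -> (sg i < sg j)%N.
Hypothesis cvP : forall j U, nbhs (p0 (sg j)) U -> FF (fun q => U (P q j)).
Hypothesis cvb : forall r, 0 < r -> FF (fun q => `|b q - b0| < r).
Hypothesis persist_ex : forall j t1, f0 t1 = p0 (sg j) ->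
  forall r, 0 < r -> FF (fun q => exists2 t, `|t - t1| < r & F (q, t) = P q j).

Lemma avoid_near j (t0 : R) : f0 t0 <> p0 (sg j) -> loc FF t0 (fun t q => F (q, t) <> P q j).
Proof.
move=> ne; have [U [V [tU pV UV]]] := separate ne.
apply: locS (locI FFF (loc_value FFq sF tU) (loc_ff t0 (cvP pV))) => t q [Ut Vq] E.
by apply: (UV _ Ut); rewrite E.
Qed.

(** The base point is not a double point, so the first meeting parameter [s0] is strictly greater
    than [b0]. Avoidance of a later double point is obtained on [b0, s0] by compactness and on small
    intervals around both ends, which together cover the moved interval. *)
Lemma based_near : FF (fun q => is_singular_knot (fun t => F (q, t)) (P q)) ->
  FF (fun q => is_based_knot (fun t => F (q, t)) (P q) (b q)).
Proof.
move=> sing; have [sing0 bp ord] := based0.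
have base : FF (fun q => forall i, F (q, b q) <> P q i).
  apply: (ff_forall FFF) => i; have [U tU [C qC H]] := avoid_near (bp (sg i)).
  have [/= r r0 rU] := (nbhs_ballP _ _).1 tU.
  apply: ffS (ffI FFF (cvb r0) qC) => q [bq Cq]; apply: H => //; apply: rU.
  by rewrite -ball_normE /= distrC.
have order : FF (fun q => forall ij : 'I_k * 'I_k, (ij.1 < ij.2)%N ->
    exists s, [/\ b q <= s, F (q, s) = P q ij.1 & forall t, b q <= t <= s -> F (q, t) <> P q ij.2]).
  apply: (ff_forall FFF) => -[i j] /=; have [ij|] := boolP (i < j)%N; last first.
    by move=> _; apply: (ffT FFF).
  have [s0 [bs Es av]] := ord _ _ (sg_mono ij).
  have bs' : b0 < s0.
    by rewrite lt_neqAle bs andbT; apply/eqP => E; apply: (bp (sg i)); rewrite E.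
  have avin : FF (fun q => forall t, b0 <= t <= s0 -> F (q, t) <> P q j).
    have H (t0 : R) : `[b0, s0]%classic t0 -> loc FF t0 (fun t q => F (q, t) <> P q j).
      by rewrite /= in_itv /= => t01; exact: avoid_near (av t0 t01).
    have := compact_loc FFF (@segment_compact R b0 s0) H.
    by apply: (ffS FFF) => q Hq t t01; apply: Hq; rewrite /= in_itv.
  have [U1 tU1 [C1 qC1 H1]] : loc FF b0 (fun t q => F (q, t) <> P q j) by apply: avoid_near (av b0 _); rewrite lexx.
  have [U2 tU2 [C2 qC2 H2]] : loc FF s0 (fun t q => F (q, t) <> P q j) by apply: avoid_near (av s0 _); rewrite lexx bs.
  have [/= r1 r10 rU1] := (nbhs_ballP _ _).1 tU1; have [/= r2 r20 rU2] := (nbhs_ballP _ _).1 tU2.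
  have d0 : 0 < (s0 - b0) / 2 by rewrite divr_gt0 // subr_gt0.
  have e10 : 0 < Num.min r1 ((s0 - b0) / 2) by rewrite lt_min r10.
  have e20 : 0 < Num.min r2 ((s0 - b0) / 2) by rewrite lt_min r20.
  apply: (ffS FFF) (ffI FFF avin (ffI FFF qC1 (ffI FFF qC2 (ffI FFF (cvb e10) (persist_ex Es e20))))).
  move=> q [Hq [Cq1 [Cq2 [bq [s sq Fs]]]]] _; move: bq sq; rewrite !lt_min !ltr_norml.
  move=> /andP[/andP[b1 b2] /andP[b3 b4]] /andP[/andP[s1 s2] /andP[s3 s4]].
  exists s; split=> //; first lra.
  move=> t /andP[bt ts]; have [tb|tb] := ltrP t b0.
    by apply: H1 => //; apply: rU1; rewrite -ball_normE /= ltr_norml; apply/andP; split; lra.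
  have [st|st] := ltrP s0 t; last by apply: Hq; rewrite tb.
  by apply: H2 => //; apply: rU2; rewrite -ball_normE /= ltr_norml; apply/andP; split; lra.
apply: ffS (ffI FFF sing (ffI FFF base order)) => q [? [? H]]; split=> // i j ij.
exact: (H (i, j) ij).
Qed.
End Based.

(** * Isotopies *)

Section Stages.
Context (R : realType) (M : oriented_3manifold R).

(* The two flavours are treated together: based knots when bs is true. *)
Definition stage (bs : bool) n (f : R -> M) (p : 'I_n -> M) (b : R) :=
  if bs then is_based_knot f p b else is_singular_knot f p.

Lemma stage_sing bs n (f : R -> M) (p : 'I_n -> M) b : stage bs f p b -> is_singular_knot f p.
Proof. by case: bs => //= -[]. Qed.

Lemma stage_shift bs n (f : R -> M) (p : 'I_n -> M) b b' : same_pt b b' -> stage bs f p b -> stage bs f p b'.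
Proof.
case: bs => //= /same_ptP[m ->] [sing bp ord]; have [[per _ _] _ _ _ _] := sing.
split=> // [i|i j ij]; first by rewrite -(periodicZ per m).
have [s [bs fs av]] := ord i j ij; exists (s - m%:~R); split; first lra.
  by rewrite -mulrNz (periodicZ per).
move=> t t_in; rewrite -(periodicZ per m); apply: av; lra.
Qed.

Section Core.
Context (Q : normedModType R) (FF : set_system Q).
Hypothesis hQ : has_coords Q.
Hypothesis FFF : Filter FF.
Variable q0 : Q.
Hypothesis FFq : forall A, nbhs q0 A -> FF A.
Variables F G : Q * R -> M.
Hypothesis sF : forall t, msmooth_at F (q0, t).
Hypothesis sG : forall t, msmooth_at G (q0, t).
Hypothesis perF : FF (fun q => periodic1 (fun t => F (q, t))).
Hypothesis perG : FF (fun q => periodic1 (fun t => G (q, t))).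
Hypothesis FG0 : forall t, F (q0, t) = G (q0, t).
Variables (bs : bool) (n : nat) (p0 : 'I_n -> M) (b0 : R).
Hypothesis stage0 : stage bs (fun t => F (q0, t)) p0 b0.
Variables (k : nat) (P : Q -> 'I_k -> M) (sg : 'I_k -> 'I_n) (b : Q -> R).
Hypothesis sg_inj : injective sg.
Hypothesis sg_mono : forall i j : 'I_k, (i < j)%N -> (sg i < sg j)%N.
Hypothesis cvP : forall j U, nbhs (p0 (sg j)) U -> FF (fun q => U (P q j)).
Hypothesis cvb : forall r, 0 < r -> FF (fun q => `|b q - b0| < r).
Hypothesis FG : forall j t, F (q0, t) = p0 (sg j) -> loc FF t (fun t q => F (q, t) = G (q, t)).
Hypothesis perst : forall j, exists2 U, nbhs (p0 (sg j)) U & persists FF G (P^~ j) U.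
Hypothesis disappear : forall i t1 t2, (forall j, i != sg j) -> ~~ same_pt t1 t2 ->
  F (q0, t1) = p0 i -> F (q0, t2) = p0 i -> loc FF (t1, t2) (fun x q => F (q, x.1) <> F (q, x.2)).

(** Near the double points that are kept, [F] agrees with a family [G] in which they are known to
    persist; for [F] itself only the points outside the image of [sg] have to be studied. *)
Theorem stage_near : FF (fun q => stage bs (fun t => F (q, t)) (P q) (b q)).
Proof.
have EG : (fun t => F (q0, t)) = (fun t => G (q0, t)) by exact/funext.
have sing0 := stage_sing stage0.
have singG : is_singular_knot (fun t => G (q0, t)) p0 by rewrite -EG.
have ex j t1 : F (q0, t1) = p0 (sg j) ->
    forall r, 0 < r -> FF (fun q => exists2 t, `|t - t1| < r & F (q, t) = P q j).
  have [U jU pU] := perst j; rewrite FG0 => E.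
  apply: (persist_point FFF FFq sG perG singG (@cvP j) pU) => // t; rewrite -FG0; exact: FG.
have sing : FF (fun q => is_singular_knot (fun t => F (q, t)) (P q)).
  apply: (singular_near hQ FFF FFq sF perF sing0 sg_inj cvP) => // j t1 t2 nS.
  have [U jU pU] := perst j; rewrite !FG0 => E1 E2.
  by apply: (persist_coincidence FFF FFq sG jU pU) => // t; rewrite -FG0; exact: FG.
move: stage0; rewrite /stage; case: bs => // based0.
exact: (based_near FFF FFq sF based0 sg_mono cvP cvb ex).
Qed.
End Core.

Section Strip.
Implicit Types l u : R.

(** The displacement u = 0 is excluded because the double point is still present there, and times
    outside [0, 1] because nothing is known about the isotopy there. *)
Definition strip l0 : set_system (R * R) := [set A | exists2 r, 0 < r &
  forall l u, 0 <= l <= 1 -> `|l - l0| < r -> 0 < u < r -> A (l, u)].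

Lemma strip_filter l0 : Filter (strip l0).
Proof.
split.
- by exists 1.
- move=> A B [r r0 HA] [s s0 HB]; exists (Num.min r s); first by rewrite lt_min r0.
  move=> l u l01; rewrite !lt_min => /andP[lr ls] /andP[u0 /andP[ur us]].
  by split; [apply: HA|apply: HB] => //; apply/andP.
- by move=> A B AB [r r0 HA]; exists r => // l u *; apply: AB; exact: HA.
Qed.

Lemma strip_nbhs l0 (A : set (R * R)) : nbhs (l0, 0 : R) A -> strip l0 A.
Proof.
move=> /nbhs_ballP[r /= r0 rA]; exists r => // l u _ lr /andP[u0 ur]; apply: rA.
by split; rewrite -ball_normE /= distrC // subr0 gtr0_norm.
Qed.

Lemma strip_uniform (A : R * R -> Prop) : (forall l0, 0 <= l0 <= 1 -> strip l0 A) ->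
  exists2 e, 0 < e & forall l u, 0 <= l <= 1 -> 0 < u < e -> A (l, u).
Proof.
move=> H; have /compact_near_coveringP := @segment_compact R 0 1.
move/(_ R (0 : R)^'+ (fun e l => 0 <= l <= 1 -> forall u, 0 < u < e -> A (l, u))) => K.
have /K E : forall l, `[0, 1]%classic l -> \forall l' \near l & e \near (0 : R)^'+,
    0 <= l' <= 1 -> forall u, 0 < u < e -> A (l', u).
  rewrite /= => l; rewrite in_itv /= => /H[r r0 HA].
  exists ([set l' | `|l' - l| < r], [set e | e < r]); first split=> /=.
  - by apply/nbhs_ballP; exists r => //= y; rewrite -ball_normE /= distrC.
  - exact: nbhs_right_lt.
  by move=> [l' e] /= [l'r er] l'01 u /andP[u0 ue]; apply: HA => //; rewrite u0 (lt_trans ue).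
near (0 : R)^'+ => e; exists e; first by near: e; exact: nbhs_right_gt.
move=> l u l01 ue; have He : forall x, `[0, 1]%classic x -> 0 <= x <= 1 -> forall u, 0 < u < e -> A (x, u).
  by near: e.
by apply: He => //=; rewrite in_itv.
Unshelve. all: by end_near. Qed.

Lemma strip_range l0 : strip l0 (fun q => 0 <= q.1 <= 1).
Proof. by exists 1. Qed.

Lemma strip_small l0 r : 0 < r -> strip l0 (fun q => 0 < q.2 < r).
Proof. by move=> r0; exists r. Qed.

End Strip.

Lemma within01P (T : topologicalType) (g : R -> T) : {within `[0, 1], continuous g} <->
  forall l0, 0 <= l0 <= 1 -> forall U, nbhs (g l0) U ->
    exists2 r, 0 < r & forall l, 0 <= l <= 1 -> `|l - l0| < r -> U (g l).
Proof.
rewrite subspace_continuousP; split=> [H l0 l01 U gU|H l0 /=].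
  have /= := H l0; rewrite in_itv /= => /(_ l01 U gU) /nbhs_ballP[r /= r0 rU].
  exists r => // l l01' lr; apply: rU => /=; last by rewrite in_itv.
  by rewrite -ball_normE /= distrC.
rewrite in_itv /= => l01 U /(H l0 l01)[r r0 rU]; apply/nbhs_ballP; exists r => // l.
by rewrite -ball_normE /= distrC in_itv /= => lr l01'; exact: rU.
Qed.

Lemma strip_within l0 (T : topologicalType) (g : R -> T) (U : set T) : 0 <= l0 <= 1 ->
  {within `[0, 1], continuous g} -> nbhs (g l0) U -> strip l0 (fun q => U (g q.1)).
Proof.
by move=> l01 /within01P/(_ l0 l01 U)/[apply] -[r r0 H]; exists r => // l u l01' lr _; exact: H.
Qed.

Lemma locally_constant (E : R -> Prop) : (forall l0, 0 <= l0 <= 1 -> exists2 r, 0 < r &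
  forall l, 0 <= l <= 1 -> `|l - l0| < r -> (E l <-> E l0)) -> E 0 -> E 1.
Proof.
move=> H E0.
have o (A : R -> Prop) : open [set l | exists l0 r, [/\ A l0, 0 <= l0 <= 1, (forall l, 0 <= l <= 1 -> `|l - l0| < r -> (E l <-> E l0))
    & `|l - l0| < r]].
  rewrite openE => l [l0 [r [Al0 l01 Hr lr]]]; apply/nbhs_ballP.
  exists (r - `|l - l0|) => /=; first by rewrite subr_gt0.
  move=> l'; rewrite -ball_normE /= distrC => l'l; exists l0, r; split=> //.
  by rewrite -(subrKA l); apply: le_lt_trans (ler_normD _ _) _; lra.
have E' : (fun l => 0 <= l <= 1 /\ E l) = `[0, 1]%classic.
apply: (@segment_connected R 0 1).
- by exists 0; rewrite lexx ler01.
- exists [set l | exists l0 r, [/\ E l0, 0 <= l0 <= 1, (forall l, 0 <= l <= 1 -> `|l - l0| < r -> (E l <-> E l0)) & `|l - l0| < r]].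
    exact: o.
  apply/seteqP; split=> l /=; rewrite in_itv /=.
    by move=> [l01 El]; have [r r0 Hr] := H l l01; split=> //; exists l, r; rewrite subrr normr0.
  by move=> [l01 [l0 [r [El0 l001 Hr lr]]]]; split=> //; exact: (Hr l l01 lr).2.
- exists (~` [set l | exists l0 r, [/\ ~ E l0, 0 <= l0 <= 1, (forall l, 0 <= l <= 1 -> `|l - l0| < r -> (E l <-> E l0)) & `|l - l0| < r]]).
    by rewrite closedC; exact: (o (fun l => ~ E l)).
  apply/seteqP; split=> l /=; rewrite in_itv /=.
    move=> [l01 El]; split=> //; case=> l0 [r [nEl0 l001 Hr lr]].
    by apply: nEl0; exact: (Hr l l01 lr).1.
  move=> [l01 nE]; split=> //; apply: contrapT => nEl; apply: nE.
  by have [r r0 Hr] := H l l01; exists l, r; rewrite subrr normr0.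
have : (`[0, 1]%classic : set R) 1 by rewrite /= in_itv /= ler01 lexx.
by rewrite -E' => -[].
Qed.

Section Isotopy.
Variables (bs : bool) (n : nat).
Implicit Types (f : R -> M) (p : 'I_n -> M) (b : R) (H : R * R -> M) (P : R -> 'I_n -> M) (B : R -> R).

(** Common to both flavours. Unlike [based_isotopic] it asks for continuous paths of the double
    points and prescribes their ends; [based_continuous] and [based_unique] recover both. For
    ordered knots the base parameter is a dummy. *)
Definition isot f p b f' p' b' := exists H P B,
  [/\ smooth_map H,
      forall u : R, 0 <= u <= 1 -> stage bs (fun t => H (u, t)) (P u) (B u),
      (forall i, {within `[0, 1], continuous (fun u => P u i)}) /\ {within `[0, 1], continuous B},
      forall t, H (0, t) = f t /\ H (1, t) = f' t
    & [/\ forall i, P 0 i = p i /\ P 1 i = p' i, B 0 = b & same_pt (B 1) b']].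

Lemma has_coords_RR : has_coords (R * R)%type.
Proof. by apply: has_coords_prod; exact: has_coords_R. Qed.

Lemma within_step (T : topologicalType) (g : R -> T) (a : R -> R) : {within `[0, 1], continuous g} ->
  continuous a -> (forall l, 0 <= a l <= 1) -> {within `[0, 1], continuous (g \o a)}.
Proof.
move=> /within01P cg ca a01; apply/within01P => l0 l01 U gU.
have [r r0 Hr] := cg (a l0) (a01 l0) U gU.
have /nbhs_ballP[d /= d0 Hd] : \forall l \near l0, `|a l - a l0| < r.
  have : nbhs (a l0) [set x | `|x - a l0| < r].
    by apply/nbhs_ballP; exists r => //= y; rewrite -ball_normE /= distrC.
  exact: ca.
exists d => // l _ ld; apply: Hr => //; apply: Hd.
by rewrite -ball_normE /= distrC.
Qed.

Lemma step01 (l : R) : 0 <= step l <= 1.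
Proof. by rewrite step_ge0 step_le1. Qed.

Lemma step_continuous : continuous (@step R).
Proof. by move=> x; apply: smooth_at_cont; exact: smooth_step. Qed.

(* Reparametrizing by a smooth step, a path need only be smooth over [0, 1]. *)
Lemma path_isot H P B :
  (forall l t, 0 <= l <= 1 -> msmooth_at H (l, t)) ->
  (forall l, 0 <= l <= 1 -> stage bs (fun t => H (l, t)) (P l) (B l)) ->
  (forall i, {within `[0, 1], continuous (fun u => P u i)}) -> {within `[0, 1], continuous B} ->
  isot (fun t => H (0, t)) (P 0) (B 0) (fun t => H (1, t)) (P 1) (B 1).
Proof.
move=> sH st cP cB; exists (fun x => H (step x.1, x.2)), (P \o @step R), (B \o @step R).
have s0 : step 0 = 0 :> R by rewrite step_le0.
have s1 : step 1 = 1 :> R by rewrite step_ge1.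
split; rewrite /= ?s0 ?s1 //.
- apply/smooth_mapP => -[l t]; apply: (@msmooth_comp _ _ (R * R)%type (R * R)%type (fun x => (step x.1, x.2)) H).
  + exact: has_coords_RR.
  + apply: smooth_pair; last exact: smooth_snd.
    apply: (smooth_comp (g := @step R)); [exact: has_coords_R|exact: smooth_fst|exact: smooth_step].
  + by apply: sH; exact: step01.
- by move=> u _; apply: st; exact: step01.
- split=> [i|]; last exact: (within_step cB step_continuous step01).
  exact: (within_step (cP i) step_continuous step01).
- by split=> //; exact: same_pt_refl.
Qed.

Lemma within_cst (T : topologicalType) (x : T) : {within `[0, 1]%classic : set R, continuous (fun=> x)}.
Proof. by apply: continuous_subspaceT => y; exact: cvg_cst. Qed.

Lemma isot_refl f p b : stage bs f p b -> isot f p b f p b.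
Proof.
move=> st; apply: (@path_isot (fun x => f x.2) (fun=> p) (fun=> b)) => //.
- move=> l t _; have [[_ /smooth_mapP sf _] _ _ _ _] := stage_sing st.
  apply: (@msmooth_comp _ _ (R * R)%type R^o snd f) => //; first exact: has_coords_R.
  exact: smooth_snd.
- by move=> i; exact: within_cst.
- exact: within_cst.
Qed.

Lemma isot_end f p b f' p' b' b'' : same_pt b' b'' -> isot f p b f' p' b' -> isot f p b f' p' b''.
Proof.
move=> S [H [P [B [h1 h2 h3 h4 [h5 h6 h7]]]]]; exists H, P, B; split=> //; split=> //.
exact: same_pt_trans h7 S.
Qed.

Lemma cont_shift (m : R) B : {within `[0, 1], continuous B} -> {within `[0, 1], continuous (fun l => B l + m)}.
Proof.
move=> /within01P cB; apply/within01P => l0 l01 U /nbhs_ballP[e /= e0 eU].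
have [|r r0 Hr] := cB l0 l01 [set x | `|x - B l0| < e].
  by apply/nbhs_ballP; exists e => //= y; rewrite -ball_normE /= distrC.
exists r => // l l01' lr; apply: eU; rewrite -ball_normE /= distrC.
have -> : B l + m - (B l0 + m) = B l - B l0 by ring.
exact: Hr.
Qed.

Lemma isot_sym f p b f' p' b' : isot f p b f' p' b' -> isot f' p' b' f p b.
Proof.
move=> [H [P [B [/smooth_mapP h1 h2 [h3 h3'] h4 [h5 h6 /same_ptP[m h7]]]]]].
have c1 : continuous (fun l : R => 1 - l).
  by apply: (@contB _ R^o); [exact: cst_continuous|move=> x; exact: cvg_id].
pose H' x := H (1 - x.1, x.2); pose P' l := P (1 - l); pose B' l := B (1 - l) - m%:~R.
have rev (T : topologicalType) (g : R -> T) : {within `[0, 1], continuous g} -> {within `[0, 1], continuous (fun l => g (1 - l))}.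
  move=> /within01P cg; apply/within01P => l0 l01 U gU; have [|r r0 Hr] := cg (1 - l0) _ U gU; first lra.
  exists r => // l l01' lr; apply: Hr; first lra.
  by rewrite (_ : 1 - l - (1 - l0) = - (l - l0)) ?normrN //; ring.
have := @path_isot H' P' B'; rewrite /H' /P' /B' /= subr0 subrr.
rewrite (_ : (fun t => H (1, t)) = f'); last by apply/funext => t; have [] := h4 t.
rewrite (_ : (fun t => H (0, t)) = f); last by apply/funext => t; have [] := h4 t.
rewrite (_ : P 1 = p'); last by apply/funext => i; have [] := h5 i.
rewrite (_ : P 0 = p); last by apply/funext => i; have [] := h5 i.
rewrite h6 h7 addrK => K; apply: (@isot_end _ _ _ _ _ (b - m%:~R)); first by rewrite -mulrNz same_ptD.
apply: K.
- move=> l t _; apply: (@msmooth_comp _ _ (R * R)%type (R * R)%type (fun x => (1 - x.1, x.2)) H) => //.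
    exact: has_coords_RR.
  apply: smooth_pair; last exact: smooth_snd.
  by apply: (@smoothB _ _ R^o); [exact: smooth_cst|exact: smooth_fst].
- move=> l l01; apply: (@stage_shift _ _ _ _ (B (1 - l))); first by rewrite -mulrNz same_pt_sym same_ptD.
  by apply: h2; lra.
- by move=> i; apply: rev (h3 i).
- by apply: cont_shift; exact: rev.
Qed.

Lemma within_near (T : topologicalType) (g : R -> T) : (forall l0, 0 <= l0 <= 1 ->
  exists g' : R -> T, {within `[0, 1], continuous g'} /\ exists2 r, 0 < r & forall l, `|l - l0| < r -> g l = g' l) ->
  {within `[0, 1], continuous g}.
Proof.
move=> K; apply/within01P => l0 l01 U; have [g' [/within01P cg' [r r0 E]]] := K l0 l01.
rewrite E ?subrr ?normr0 // => gU; have [d d0 Hd] := cg' l0 l01 U gU.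
exists (Num.min r d); first by rewrite lt_min r0.
by move=> l l01'; rewrite lt_min => /andP[lr ld]; rewrite E //; exact: Hd.
Qed.

(** The first isotopy is run through during [1/8, 3/8], the second during [5/8, 7/8], so the
    concatenation is constant around 1/2 and hence smooth. Base parameters match at the junction
    only up to an integer [m], which is added to the second path. *)
Lemma isot_trans f p b f1 p1 b1 f2 p2 b2 : isot f p b f1 p1 b1 -> isot f1 p1 b1 f2 p2 b2 ->
  isot f p b f2 p2 b2.
Proof.
move=> [H1 [P1 [B1 [/smooth_mapP s1 st1 [cP1 cB1] e1 [q1 b01 /same_ptP[m b11]]]]]].
move=> [H2 [P2 [B2 [/smooth_mapP s2 st2 [cP2 cB2] e2 [q2 b02 b12]]]]].
pose a (l : R) := step (4 * l - 2^-1); pose a' (l : R) := step (4 * l - 5 / 2).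
have sl (k : R) x : smooth_at (fun l : R => step (4 * l - k)) x.
  apply: (smooth_comp (g := @step R)); [exact: has_coords_R| |exact: smooth_step].
  apply: (@smoothB _ _ R^o); last exact: smooth_cst.
  by apply: smoothM; [exact: smooth_cst|exact: smooth_id].
have ca : continuous a by move=> x; apply: smooth_at_cont; exact: sl.
have ca' : continuous a' by move=> x; apply: smooth_at_cont; exact: sl.
have a1 l : 3 / 8 <= l -> a l = 1 by move=> ?; apply: step_ge1; lra.
have a0 l : l <= 1 / 8 -> a l = 0 by move=> ?; apply: step_le0; lra.
have a'1 l : 7 / 8 <= l -> a' l = 1 by move=> ?; apply: step_ge1; lra.
have a'0 l : l <= 5 / 8 -> a' l = 0 by move=> ?; apply: step_le0; lra.
pose H x := if x.1 < 2^-1 then H1 (a x.1, x.2) else H2 (a' x.1, x.2).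
pose P l := if l < 2^-1 then P1 (a l) else P2 (a' l).
pose B l := if l < 2^-1 then B1 (a l) else B2 (a' l) + m%:~R.
have P12 : P1 1 = P2 0 by apply/funext => i; have [_ ->] := q1 i; have [-> _] := q2 i.
have F1 l : l < 5 / 8 -> [/\ forall t, H (l, t) = H1 (a l, t), P l = P1 (a l) & B l = B1 (a l)].
  move=> l58; rewrite /H /P /B /=; case: ltrP => // l12; rewrite a1; last lra.
  rewrite a'0; last lra.
  by split=> // [t|]; [have [_ ->] := e1 t; have [-> _] := e2 t|rewrite b02 b11].
have F2 l : 2^-1 < l -> [/\ forall t, H (l, t) = H2 (a' l, t), P l = P2 (a' l) & B l = B2 (a' l) + m%:~R].
  by move=> l12; rewrite /H /P /B /= ltNge (ltW l12).
have near (l0 : R) : (l0 < 5 / 8 /\ exists2 r : R, 0 < r & forall l : R, `|l - l0| < r -> l < 5 / 8) \/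
    (2^-1 < l0 /\ exists2 r : R, 0 < r & forall l : R, `|l - l0| < r -> 2^-1 < l).
  have [l58|l58] := ltrP l0 (5 / 8); [left|right]; split=> //; last 2 first.
  - lra.
  - by exists (l0 - 2^-1); [lra|move=> l; rewrite ltr_norml => /andP[? ?]; lra].
  by exists (5 / 8 - l0); [lra|move=> l; rewrite ltr_norml => /andP[? ?]; lra].
have ends : (fun t => H (0, t)) = f /\ (fun t => H (1, t)) = f2.
  split; apply/funext => t.
    by have [-> _ _] := F1 0 ltac:(lra); rewrite a0; [have [] := e1 t|lra].
  by have [-> _ _] := F2 1 ltac:(lra); rewrite a'1; [have [] := e2 t|lra].
have endP : P 0 = p /\ P 1 = p2.
  split; apply/funext => i.
    by have [_ -> _] := F1 0 ltac:(lra); rewrite a0; [have [] := q1 i|lra].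
  by have [_ -> _] := F2 1 ltac:(lra); rewrite a'1; [have [] := q2 i|lra].
have endB : B 0 = b /\ same_pt (B 1) b2.
  split; first by have [_ _ ->] := F1 0 ltac:(lra); rewrite a0 //; lra.
  have [_ _ ->] := F2 1 ltac:(lra); rewrite a'1; last lra.
  exact: same_pt_trans (same_ptD _ _) b12.
apply: (isot_end endB.2); rewrite -endB.1 -endP.1 -endP.2 -ends.1 -ends.2.
have in01 (k l : R) : 0 <= step (4 * l - k) <= 1 by exact: step01.
have sHa k H0 (l t : R) : (forall x, msmooth_at H0 x) -> msmooth_at (fun x : R * R => H0 (step (4 * x.1 - k), x.2)) (l, t).
  move=> s0; apply: (@msmooth_comp _ _ (R * R)%type (R * R)%type (fun x => (step (4 * x.1 - k), x.2)) H0) => //.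
    exact: has_coords_RR.
  apply: smooth_pair; last exact: smooth_snd.
  by apply: (smooth_comp (g := fun l : R => step (4 * l - k))); [exact: has_coords_R|exact: smooth_fst|exact: sl].
apply: path_isot.
- move=> l t _; have [[_ [r r0 Hr]]|[_ [r r0 Hr]]] := near l.
    apply: (msmooth_near (f := fun x => H1 (a x.1, x.2))); last exact: sHa.
    apply/nbhs_ballP; exists r => // -[l' t'] [/= lr _].
    by have [-> _ _] := F1 l' (Hr l' ltac:(by rewrite distrC)).
  apply: (msmooth_near (f := fun x => H2 (a' x.1, x.2))); last exact: sHa.
  apply/nbhs_ballP; exists r => // -[l' t'] [/= lr _].
  by have [-> _ _] := F2 l' (Hr l' ltac:(by rewrite distrC)).
- move=> l l01; have [[l58 _]|[l12 _]] := near l.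
    have [E -> ->] := F1 l l58; rewrite (_ : (fun t => _) = (fun t => H1 (a l, t))); last exact/funext.
    by apply: st1; exact: in01.
  have [E -> ->] := F2 l l12; rewrite (_ : (fun t => _) = (fun t => H2 (a' l, t))); last exact/funext.
  apply: (@stage_shift _ _ _ _ (B2 (a' l))); first by rewrite same_pt_sym same_ptD.
  by apply: st2; exact: in01.
- move=> i; apply: within_near => l0 _; have [[_ [r r0 Hr]]|[_ [r r0 Hr]]] := near l0.
    exists ((fun u => P1 u i) \o a); split; first exact: (within_step (cP1 i) ca (in01 _)).
    by exists r => // l /Hr/F1[_ -> _].
  exists ((fun u => P2 u i) \o a'); split; first exact: (within_step (cP2 i) ca' (in01 _)).
  by exists r => // l /Hr/F2[_ -> _].
- apply: within_near => l0 _; have [[_ [r r0 Hr]]|[_ [r r0 Hr]]] := near l0.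
    exists (B1 \o a); split; first exact: (within_step cB1 ca (in01 _)).
    by exists r => // l /Hr/F1[_ _ ->].
  exists (fun l => (B2 \o a') l + m%:~R); split.
    by apply: cont_shift; exact: (within_step cB2 ca' (in01 _)).
  by exists r => // l /Hr/F2[_ _ ->].
Qed.
End Isotopy.
End Stages.

(** * Displacements of a branch *)

Section Push.
Context (R : realType) (M : oriented_3manifold R).

Definition supp (k : R -> R) : set R := closure [set t | k t != 0].

Lemma supp_periodic (k : R -> R) t (m : int) : periodic1 k -> supp k t -> supp k (t + m%:~R).
Proof.
move=> pk st B /nbhs_ballP[e /= e0 eB]; have [|x [/= kx tx]] := st (ball t e); first exact: nbhsx_ballx.
exists (x + m%:~R); split; first by rewrite /= (periodicZ pk).
by apply: eB; move: tx; rewrite -!ball_normE /=; congr (`|_| < _); ring.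
Qed.

Lemma supp_neq0 (k : R -> R) t : k t != 0 -> supp k t.
Proof. by move=> kt; apply: (@subset_closure _ [set t | k t != 0]). Qed.

Lemma supp_off (k : R -> R) t : ~ supp k t -> \forall t' \near t, k t' = 0 /\ ~ supp k t'.
Proof.
move=> nt; have : nbhs t (~` supp k) by apply: open_nbhs_nbhs; split=> //; rewrite openC; exact: closed_closure.
apply: filterS => x nx; split=> //; apply/eqP; apply: contraPT nx => kx; apply; exact: supp_neq0.
Qed.

Section Family.
Context (Q : normedModType R).
Hypothesis hQ : has_coords Q.
Variables (G : Q * R -> M) (c : chart R M) (k : R -> R) (v : 'rV[R]_3) (a : Q -> R).

Definition pushed (x : Q * R) : M := push c k v (fun t => G (x.1, t)) (a x.1) x.2.

Lemma pushed_off x : k x.2 = 0 -> pushed x = G x.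
Proof. by rewrite /pushed /push => ->; rewrite eqxx; case: x. Qed.

Lemma pushed_periodic q : periodic1 k -> periodic1 (fun t => G (q, t)) -> periodic1 (fun t => pushed (q, t)).
Proof. by move=> pk pG t; rewrite /pushed /push /= pk pG. Qed.

Hypothesis ac : mfd_atlas c.

Lemma pushed_a0 x : a x.1 = 0 -> (k x.2 != 0 -> ch_dom c (G x)) -> pushed x = G x.
Proof.
rewrite /pushed /push; case: eqP => [|/eqP k0 -> /(_ isT)]; first by case: x.
have [_ _ toK _ _] := mfd_chart ac; case: x k0 => q t k0 /= /toK[_ e].
by rewrite mul0r scale0r addr0.
Qed.

Variable q0 : Q.
Hypothesis sG : forall t, msmooth_at G (q0, t).
Hypothesis sk : forall t, smooth_at k t.
Hypothesis sa : smooth_at a q0.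
Hypothesis dk : forall t, supp k t -> ch_dom c (G (q0, t)).

Lemma pushed0 t : a q0 = 0 -> pushed (q0, t) = G (q0, t).
Proof. by move=> a0; apply: pushed_a0 => //= /supp_neq0; exact: dk. Qed.

Lemma cod_a0 t : a q0 = 0 -> supp k t -> ch_cod c (ch_to c (G (q0, t)) + (a q0 * k t) *: v).
Proof.
have [_ _ toK _ _] := mfd_chart ac; move=> -> /dk/toK[? _].
by rewrite mul0r scale0r addr0.
Qed.

Hypothesis ck : forall t, supp k t -> ch_cod c (ch_to c (G (q0, t)) + (a q0 * k t) *: v).

Lemma smooth_amount t : smooth_at (fun x : Q * R => a x.1 * k x.2) (q0, t).
Proof.
apply: smoothM.
  by apply: (smooth_comp (f := fst) (g := a)); [exact: hQ|exact: smooth_fst|exact: sa].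
by apply: (smooth_comp (f := snd) (g := k)); [exact: has_coords_R|exact: smooth_snd|exact: sk].
Qed.

Lemma smooth_shifted t : supp k t -> smooth_at (fun x => ch_to c (G x) + (a x.1 * k x.2) *: v) (q0, t).
Proof.
move=> st; apply: smoothD; first exact: (msmooth_chart (sG t) ac (dk st)).
by apply: smoothZ; [exact: smooth_amount|exact: smooth_cst].
Qed.

Lemma shifted_near t : supp k t -> \forall x \near (q0, t),
  ch_dom c (G x) /\ ch_cod c (ch_to c (G x) + (a x.1 * k x.2) *: v).
Proof.
move=> st; have d := near_dom ac (msmooth_cont (sG t)) (dk st).
have [_ oc _ _ _] := mfd_chart ac.
have : \forall x \near (q0, t), ch_cod c (ch_to c (G x) + (a x.1 * k x.2) *: v).
  apply: (smooth_at_cont (smooth_shifted st)); apply: open_nbhs_nbhs; split => //; exact: ck.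
by move: d; apply: filterS2.
Qed.

(** Where k vanishes the chart formula returns G, so the case distinction in [push] disappears near
    the support; off the support the family is G. These two descriptions give smoothness
    everywhere. *)
Lemma pushed_near t : supp k t -> \forall x \near (q0, t),
  pushed x = ch_from c (ch_to c (G x) + (a x.1 * k x.2) *: v).
Proof.
move=> /shifted_near; apply: filterS => -[q s] [/= d _]; rewrite /pushed /push /=.
case: eqP => // ->; rewrite mulr0 scale0r addr0.
by have [_ _ toK _ _] := mfd_chart ac; have [_ ->] := toK _ d.
Qed.

Lemma pushed_off_near t : ~ supp k t -> \forall x \near (q0, t), pushed x = G x.
Proof.
move=> /supp_off nt.
have : \forall x \near (q0, t), k x.2 = 0 /\ ~ supp k x.2 by exact: (cvg_snd nt).
by apply: filterS => x [k0 _]; exact: pushed_off.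
Qed.

Lemma pushed_smooth t : msmooth_at pushed (q0, t).
Proof.
have [st|/pushed_off_near nt] := pselect (supp k t).
  apply: (@msmooth_near _ _ _ (fun x => ch_from c (ch_to c (G x) + (a x.1 * k x.2) *: v))).
    by apply: filterS (pushed_near st).
  apply: (@msmooth_from _ _ _ (fun x => ch_to c (G x) + (a x.1 * k x.2) *: v)) => //.
    exact: smooth_shifted.
  by have [] := nbhs_singleton (shifted_near st).
by apply: msmooth_near (sG t); apply: filterS nt.
Qed.

(** In the chart [c] the product rule leaves only the derivative of the amount, since the amount
    itself is 0 at [q0]; the Jacobian then transports the displacement to the chart [d]. *)
Lemma pushed_derive d t (w : Q * R) : a q0 = 0 -> mfd_atlas d -> ch_dom d (G (q0, t)) ->
  'D_w (ch_to d \o pushed) (q0, t) =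
  'D_w (ch_to d \o G) (q0, t) + (k t * 'D_(w.1) a q0) *: (v *m transition c d (G (q0, t))).
Proof.
move=> a0 ad dd; have [st|nt] := pselect (supp k t); last first.
  have [-> _] := nbhs_singleton (supp_off nt); rewrite mul0r scale0r addr0.
  apply: near_eq_derive => //; have := pushed_off_near nt; apply: filterS => x /= ->. by [].
have dG := dk st; have dF : ch_dom c (pushed (q0, t)) by rewrite pushed0.
rewrite (derive_chart w (pushed_smooth t) ac ad dF) ?pushed0 // (derive_chart w (sG t) ac ad dG dd).
rewrite scalemxAl -mulmxDl; congr (_ *m _).
rewrite (@near_eq_derive _ _ _ _ (fun x => ch_to c (G x) + (a x.1 * k x.2) *: v)).
- have sc : smooth_at (fun x => ch_to c (G x)) (q0, t) := msmooth_chart (sG t) ac dG.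
  have sA : smooth_at (fun x : Q * R => a x.1) (q0, t).
    by apply: (smooth_comp (f := fst) (g := a)); [exact: hQ|exact: smooth_fst|exact: sa].
  have sK : smooth_at (fun x : Q * R => k x.2 *: v) (q0, t).
    apply: smoothZ; last exact: smooth_cst.
    by apply: (smooth_comp (f := snd) (g := k)); [exact: has_coords_R|exact: smooth_snd|exact: sk].
  rewrite (_ : (fun x => _) = (fun x => ch_to c (G x)) + (fun x => a x.1 *: (k x.2 *: v))); last first.
    by apply/funext => x; rewrite -scalerA.
  rewrite deriveD.
  + congr (_ + _); have [_ ->] := diff_scale (smooth_at_diff sA) (smooth_at_diff sK).
    by rewrite /= a0 scale0r addr0 scalerA mulrC.
  + exact/diff_derivable/smooth_at_diff.
  + by apply: diff_derivable; have [] := diff_scale (smooth_at_diff sA) (smooth_at_diff sK).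
- have [_ _ _ fromK _] := mfd_chart ac; move: (pushed_near st) (shifted_near st); apply: filterS2.
  by move=> x /= -> [_ /fromK[_]].
Qed.

Lemma pushed_ok (FF : set_system Q) (FFF : Filter FF) (FFq : forall A, nbhs q0 A -> FF A) :
  periodic1 k -> (forall q, periodic1 (fun t => G (q, t))) ->
  FF (fun q => [/\ forall t, msmooth_at pushed (q, t),
    forall t, supp k t -> ch_dom c (G (q, t))
    & forall t, k t != 0 -> ch_cod c (ch_to c (G (q, t)) + (a q * k t) *: v)]).
Proof.
move=> pk pG.
have Ht : FF (fun q => forall t, 0 <= t <= 1 -> msmooth_at pushed (q, t) /\
   (supp k t -> ch_dom c (G (q, t)) /\ ch_cod c (ch_to c (G (q, t)) + (a q * k t) *: v))).
  apply: near_circle => t0.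
  have L1 := loc_q FFq (msmooth_nbhs (pushed_smooth t0)).
  have L2 : loc FF t0 (fun t q => supp k t -> ch_dom c (G (q, t)) /\ ch_cod c (ch_to c (G (q, t)) + (a q * k t) *: v)).
    have [st|/supp_off nt] := pselect (supp k t0).
      have L := loc_q FFq (shifted_near st); by apply: locS L => x q /=.
    have L := loc_nbhs FFF nt; by apply: locS L => x q [_ n] /n.
  exact: (locI FFF L1 L2).
move: Ht; apply: ffS => // q Hq.
have red (t : R) : exists2 r, 0 <= r <= 1 & exists m : int, r = t + m%:~R.
  by have [r r01 /same_ptP[m tr]] := same_pt_unit t; exists r => //; exists (- m); rewrite tr mulrNz; ring.
have Ho t : supp k t -> ch_dom c (G (q, t)) /\ ch_cod c (ch_to c (G (q, t)) + (a q * k t) *: v).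
  move=> st; have [r r01 [m rt]] := red t.
  by have := (Hq r r01).2; rewrite rt (periodicZ (pG q)) (periodicZ pk); apply; exact: supp_periodic.
split=> t; last first.
- by move=> kt; have [] := Ho t (supp_neq0 kt).
- by move=> st; have [] := Ho t st.
have [r r01 [m rt]] := red t; have [sr _] := Hq r r01.
rewrite (_ : pushed = pushed \o (fun x : Q * R => (x.1, x.2 + m%:~R))); last first.
  by apply/funext => -[q' t'] /=; rewrite (periodicZ (f := fun t => pushed (q', t))) //; exact: pushed_periodic.
apply: (@msmooth_comp _ _ (Q * R)%type (Q * R)%type (fun x : Q * R => (x.1, x.2 + m%:~R)) pushed); last by rewrite -rt.
  by apply: has_coords_prod => //; exact: has_coords_R.
apply: smooth_pair; first exact: smooth_fst.
by apply: (@smoothD _ _ R^o); [exact: smooth_snd|exact: smooth_cst].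
Qed.
End Family.
End Push.

Section Persisting.
Context (R : realType) (M : oriented_3manifold R).

Lemma isolate (I : finType) (p : I -> M) (j : I) : injective p ->
  exists2 U, nbhs (p j) U & exists2 V : I -> set M, forall l, nbhs (p l) (V l) &
    forall l z, U z -> V l z -> l = j.
Proof.
move=> pI.
have sep l : exists UV : set M * set M, [/\ nbhs (p j) UV.1, nbhs (p l) UV.2 & forall z, UV.1 z -> UV.2 z -> l = j].
  have [->|lj] := eqVneq l j; first by exists (setT, setT); split=> //=; exact: filterT.
  have [|U [V [nU nV UV]]] := @separate _ _ (p j) (p l); first by move/pI/esym/eqP; apply/negP.
  by exists (U, V); split=> // z Uz Vz; case: (UV z Uz Vz).
have [UV HUV] := choice sep.
exists [set z | forall l, (UV l).1 z]; first by apply: filter_forall => l; have [] := HUV l.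
exists (fun l => (UV l).2) => [l|l z Uz]; first by have [] := HUV l.
by have [_ _] := HUV l; apply; exact: Uz.
Qed.

Lemma stages_persist (Q : normedModType R) (FF : set_system Q) (FFF : Filter FF) (G : Q * R -> M) n
    (p0 : 'I_n -> M) (P : Q -> 'I_n -> M) (j : 'I_n) : injective p0 ->
  (forall l U, nbhs (p0 l) U -> FF (fun q => U (P q l))) ->
  FF (fun q => is_singular_knot (fun t => G (q, t)) (P q)) ->
  exists2 U, nbhs (p0 j) U & persists FF G (P^~ j) U.
Proof.
move=> pI cP sG; have [U nU [V nV UV]] := isolate j pI; exists U => //.
have nP := ff_forall FFF (fun l => cP l _ (nV l)).
apply: singular_persists; have := ffI FFF sG nP; apply: ffS => // q [sq Vq].
exists n, (P q); split=> //; first by exists j.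
by move=> l /UV/(_ (Vq l)) ->.
Qed.
End Persisting.

Section Branches.
Context (R : realType) (M : oriented_3manifold R).
Variables (bs : bool) (n : nat) (H : R * R -> M) (P : R -> 'I_n -> M) (B : R -> R).
Hypothesis sH : forall x, msmooth_at H x.
Hypothesis stH : forall l, 0 <= l <= 1 -> stage bs (fun t => H (l, t)) (P l) (B l).
Hypothesis cP : forall i, {within `[0, 1], continuous (fun l => P l i)}.
Variable l0 : R.
Hypothesis l01 : 0 <= l0 <= 1.
Let base (x : (R * R) * R) := H (x.1.1, x.2).

Lemma base_smooth x : msmooth_at base x.
Proof.
apply: (@msmooth_comp _ _ ((R * R) * R)%type (R * R)%type (fun x => (x.1.1, x.2)) H) => //.
  exact: (has_coords_RR R).
apply: smooth_pair; last exact: smooth_snd.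
apply: (smooth_comp (f := fst) (g := fst)); [exact: (has_coords_RR R)|exact: smooth_fst|exact: smooth_fst].
Qed.

Lemma double_pt_near (j : 'I_n) (U : set M) : nbhs (P l0 j) U -> strip l0 (fun q => U (P q.1 j)).
Proof. by move=> nU; exact: (strip_within l01 (@cP j) nU). Qed.

Lemma base_sing : strip l0 (fun q => is_singular_knot (fun t => H (q.1, t)) (P q.1)).
Proof. by move: (strip_range l0); apply: (ffS (strip_filter l0)) => // q /stH/stage_sing. Qed.

Lemma base_persists j : exists2 U, nbhs (P l0 j) U & persists (strip l0) base (fun q => P q.1 j) U.
Proof.
have [_ pI _ _ _] := stage_sing (stH l01).
exact: (stages_persist (G := base) (strip_filter l0) j pI double_pt_near base_sing).
Qed.

Lemma branch_near j t r : H (l0, t) = P l0 j -> 0 < r ->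
  strip l0 (fun q => exists2 s, `|s - t| < r & H (q.1, s) = P q.1 j).
Proof.
have FFF := @strip_filter R l0; have FFq := @strip_nbhs R l0.
have [U _ pU] := base_persists j.
have per' : strip l0 (fun q => periodic1 (fun t => H (q.1, t))).
  by move: base_sing; apply: ffS => // q [[]].
move=> E; apply: (@persist_point _ _ _ _ FFF (l0, 0) FFq base (fun _ => base_smooth _) per' _ _
  (stage_sing (stH l01)) j (fun q => P q.1 j) U (@double_pt_near j) pU base) => // t' _.
by exists setT; [exact: filterT|exists setT => //; exact: (ffT FFF)].
Qed.
End Branches.

(* In q = (l, u), l is the time in an isotopy H and u the size of a displacement. *)
Section OpeningNear.
Context (R : realType) (M : oriented_3manifold R).
Variables (bs : bool) (n : nat) (H : R * R -> M) (P : R -> 'I_n.+1 -> M) (B : R -> R) (i : 'I_n.+1).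
Hypothesis sH : forall x, msmooth_at H x.
Hypothesis stH : forall l, 0 <= l <= 1 -> stage bs (fun t => H (l, t)) (P l) (B l).
Hypothesis cP : forall i, {within `[0, 1], continuous (fun l => P l i)}.
Hypothesis cB : {within `[0, 1], continuous B}.
Variables (l0 : R) (F G : (R * R) * R -> M).
Hypothesis l01 : 0 <= l0 <= 1.
Let q0 : R * R := (l0, 0).
Hypothesis sF : forall t, msmooth_at F (q0, t).
Hypothesis sG : forall t, msmooth_at G (q0, t).
Hypothesis perF : forall q, periodic1 (fun t => F (q, t)).
Hypothesis perG : forall q, periodic1 (fun t => G (q, t)).
Hypothesis F0 : forall t, F (q0, t) = H (l0, t).
Hypothesis FH : strip l0 (fun q => forall t, F ((q.1, 0), t) = H (q.1, t)).
Hypothesis GH : forall t, G (q0, t) = H (l0, t).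
Hypothesis FG : forall j t, H (l0, t) = P l0 (fintype.lift i j) ->
  loc (strip l0) t (fun t q => F (q, t) = G (q, t)).
Hypothesis perst : forall j, exists2 U, nbhs (P l0 (fintype.lift i j)) U &
  persists (strip l0) G (fun q => P q.1 (fintype.lift i j)) U.
Hypothesis opens : forall s s', ~~ same_pt s s' -> H (l0, s) = P l0 i -> H (l0, s') = P l0 i ->
  exists d, [/\ mfd_atlas d, ch_dom d (P l0 i) &
   let e : (R * R) * R := ((0, 1), 0) in
   det3 (velocity d (fun t => H (l0, t)) s) (velocity d (fun t => H (l0, t)) s')
     ('D_e (ch_to d \o F) (q0, s) - 'D_e (ch_to d \o F) (q0, s')) != 0].

(** To see that the i-th double point disappears, [opened] is applied with the direction (0, 1) and
    [tau] = u: at u = 0 the curve is the stage of [H], whose two preimages of the double point give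
    the coincidence to be subtracted. *)
Lemma opening_near : strip l0 (fun q => stage bs (fun t => F (q, t)) (P q.1 \o fintype.lift i) (B q.1)).
Proof.
have FFF := @strip_filter R l0; have FFq := @strip_nbhs R l0.
have cvP := double_pt_near cP l01.
have EF : (fun t => F (q0, t)) = (fun t => H (l0, t)) by exact/funext.
apply: (@stage_near _ _ _ (strip l0) (has_coords_RR R) FFF q0 FFq F G sF sG
   (ffT FFF perF) (ffT FFF perG) _ bs n.+1 (P l0) (B l0) _ n
   (fun q => P q.1 \o fintype.lift i) (fintype.lift i) (fun q => B q.1)).
- by move=> t; rewrite F0 GH.
- by rewrite EF; exact: stH.
- exact: lift_inj.
- by move=> j j' jj'; rewrite /= /bump; lia.
- by move=> j U /cvP.
- move=> r r0; apply: (strip_within l01 cB (U := [set x | `|x - B l0| < r])).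
  by apply/nbhs_ballP; exists r => //= y; rewrite -ball_normE /= distrC.
- by move=> j t; rewrite F0; exact: FG.
- exact: perst.
move=> i' t1 t2 ni; have -> : i' = i.
  by case: (unliftP i i') => // j ij; have := ni j; rewrite ij eqxx.
rewrite !F0 => nS E1 E2; have [d [ad dd D]] := opens nS E1 E2.
have ex t := @branch_near _ _ _ _ _ _ _ sH stH cP l0 l01 i t.
have vE s : velocity d (fun t => H (l0, t)) s = 'D_(dt (R * R)%type) (ch_to d \o F) (q0, s).
  by rewrite -velocity_slice EF.
apply: (@opened _ _ _ _ FFF q0 FFq F d (0, 1) snd t1 t2 ad (sF t1) (sF t2)).
- by rewrite F0 E1.
- by rewrite F0 E2.
- by rewrite -!vE.
- by move=> r; exact: strip_small.
move=> r r0; have := ffI FFF FH (ffI FFF (ex t1 r E1 r0) (ex t2 r E2 r0)).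
apply: ffS => // -[l u] [/= FHl [[s s1 Es] [s' s2 Es']]]; exists s, s'; split=> //.
rewrite (_ : (l, u) - u *: (0, 1) = (l, 0)); first by rewrite !FHl Es Es'.
by congr pair; rewrite /= ?scaler0 ?subr0 // /GRing.scale /= mulr1 subrr.
Qed.
End OpeningNear.

Section Displacements.
Context (R : realType) (M : oriented_3manifold R).
Implicit Types (f : R -> M) (c d : chart R M) (k h : R -> R) (v : 'rV[R]_3).

(* resolving_push without its condition on the codomain of the chart, which holds after scaling k down. *)
Definition displaces (eps : bool) f (y : M) c k v (s s' : R) :=
  [/\ [/\ mfd_atlas c, ~~ same_pt s s', f s = y & f s' = y],
      [/\ periodic1 k, smooth_on setT k, forall t, 0 <= k t, 0 < k s & k s' = 0],
      supp k `<=` f @^-1` ch_dom c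
    & 0 < (-1) ^+ (~~ eps) * det3 (velocity c f s) (velocity c f s') v].

Lemma displacesP eps f y c h v : resolving_push eps f y c h v <-> (exists s s', displaces eps f y c h v s s') /\
  (forall u t : R, 0 <= u <= 1 -> h t != 0 -> ch_cod c (ch_to c (f t) + (u * h t) *: v)).
Proof.
split=> [[s [s' [h1 h2 h3 h4 h5]]]|[[s [s' [h1 h2 h3 h5]]] h4]]; last by exists s, s'.
by split=> //; exists s, s'.
Qed.

Lemma smooth_onT k t : smooth_on setT k -> smooth_at k t.
Proof. by move=> sk; have [H _] := smooth_onP k (@openT R); exact: H. Qed.

Lemma two_preimages n f (p : 'I_n -> M) i s s' t : is_singular_knot f p -> ~~ same_pt s s' ->
  f s = p i -> f s' = p i -> f t = p i -> same_pt t s || same_pt t s'.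
Proof.
move=> [_ _ /(_ i)[a [a' [_ _ _ H]]] _ _] nS /H Hs /H Hs' /H Ht.
case/orP: Hs => Hs; case/orP: Hs' => Hs'; case/orP: Ht => Ht; apply/orP.
- by left; apply: same_pt_trans Ht _; rewrite same_pt_sym.
- by case/negP: nS; apply: same_pt_trans Hs _; rewrite same_pt_sym.
- by left; apply: same_pt_trans Ht _; rewrite same_pt_sym.
- by right; apply: same_pt_trans Ht _; rewrite same_pt_sym.
- by right; apply: same_pt_trans Ht _; rewrite same_pt_sym.
- by left; apply: same_pt_trans Ht _; rewrite same_pt_sym.
- by case/negP: nS; apply: same_pt_trans Hs _; rewrite same_pt_sym.
- by left; apply: same_pt_trans Ht _; rewrite same_pt_sym.
Qed.

(** Through the difference k t - k t' the sign condition becomes independent of which preimage is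
    displaced, of their representatives modulo 1, and of the chart: exchanging the branches changes
    two signs. *)
Lemma displaces_sign eps n f (p : 'I_n -> M) i c k v s s' d t t' : is_singular_knot f p ->
  displaces eps f (p i) c k v s s' -> ~~ same_pt t t' -> f t = p i -> f t' = p i ->
  mfd_atlas d -> ch_dom d (p i) ->
  0 < (-1) ^+ (~~ eps) * ((k t - k t') * det3 (velocity d f t) (velocity d f t') (v *m transition c d (p i))).
Proof.
move=> sf [[ac nS E E'] [pk sk k0 ks ks'] dk D] nT Et Et' ad dd.
have [[per /smooth_mapP smf _] _ _ _ _] := sf.
have dc : ch_dom c (p i) by rewrite -E; apply: dk; apply: supp_neq0; rewrite gt_eqF.
rewrite (velocity_chart (smf t) ac ad) ?Et // (velocity_chart (smf t') ac ad) ?Et' //.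
rewrite det3M mulrA mulrA; apply: mulr_gt0; last exact: transition_det.
have St := two_preimages sf nS E E' Et; have St' := two_preimages sf nS E E' Et'.
have [/andP[S1 S2]|/andP[S1 S2]] : same_pt t s && same_pt t' s' \/ same_pt t s' && same_pt t' s.
- case/orP: St => S1; case/orP: St' => S2; rewrite S1 S2; [|by left|by right|];
  by case/negP: nT; apply: same_pt_trans S1 _; rewrite same_pt_sym.
- rewrite (velocity_same c per S1) (velocity_same c per S2) (periodic_same pk S1) (periodic_same pk S2).
  by rewrite ks' subr0 mulrAC mulr_gt0.
rewrite (velocity_same c per S1) (velocity_same c per S2) (periodic_same pk S1) (periodic_same pk S2).
rewrite ks' sub0r -[v in det3 _ _ v]opprK det3_swap.
have -> : det3 (velocity c f s) (velocity c f s') (- v) = - det3 (velocity c f s) (velocity c f s') v.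
  by have := det3_comb (velocity c f s) (velocity c f s') v v 0 (-1); rewrite scale0r add0r scaleN1r mul0r add0r mulN1r.
by rewrite mulrN -mulNr -mulrN opprK mulrAC mulr_gt0.
Qed.

(** Excluding [s'] from the closed support makes k vanish near [s'], which survives small motions of
    the curve; [displaces] only gives k s' = 0. *)
Definition localized n f (p : 'I_n.+1 -> M) i k s' :=
  (forall t j, supp k t -> f t <> p (fintype.lift i j)) /\ ~ supp k s'.

Lemma cbump_supp (s d t : R) : 0 < d -> supp (cbump s d) t -> exists m : int, `|t - s - m%:~R| < 2 * d.
Proof.
move=> d0 /(_ (ball t d))[|x [/= kx]]; first exact: nbhsx_ballx.
rewrite -ball_normE /= => tx; have [m /intrP[z ->] H] := cbump_neq0 kx; exists z.
rewrite (_ : t - s - z%:~R = (t - x) + (x - s - z%:~R)); last ring.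
by apply: le_lt_trans (ler_normD _ _) _; lra.
Qed.

(** The set [Z] to be avoided will be the support of another displacement, so as to get disjoint
    supports. *)
Lemma displacement_exists eps n f (p : 'I_n.+1 -> M) i (Z : set R) : is_singular_knot f p ->
  closed Z -> (forall t (m : int), Z (t + m%:~R) -> Z t) -> (forall t, Z t -> f t <> p i) ->
  exists c k v s s', [/\ displaces eps f (p i) c k v s s', localized f p i k s' & supp k `<=` ~` Z].
Proof.
move=> sf cZ pZ Zp; have [[per /smooth_mapP smf imm] pI two _ tr] := sf.
have [s [s' [nS E E' _]]] := two i; have [c ac dc] := mfd_cover (p i).
have := tr s s' (etrans E (esym E')) nS c ac; rewrite E => /(_ dc)/transverseP[w Dw].
have [v Dv] : exists v, 0 < (-1) ^+ (~~ eps) * det3 (velocity c f s) (velocity c f s') v.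
  set D := det3 _ _ w in Dw; have cw x : det3 (velocity c f s) (velocity c f s') (x *: w) = x * D.
    by have := det3_comb (velocity c f s) (velocity c f s') w w 0 x; rewrite scale0r add0r mul0r add0r.
  (* With this multiple of [w] the signed determinant is the square of [D]. *)
  exists (((-1) ^+ (~~ eps) * D) *: w); rewrite cw !mulrA -expr2 sqrr_sign mul1r -expr2.
  by rewrite exprn_even_gt0.
have : \forall t \near s, [/\ ch_dom c (f t), forall j, f t <> p (fintype.lift i j), ~~ same_pt t s' & ~ Z t].
  have H1 : \forall t \near s, ch_dom c (f t).
    by apply: (near_dom ac (msmooth_cont (smf s))); rewrite E.
  have H2 : \forall t \near s, forall j, f t <> p (fintype.lift i j).
    have := @filter_forall _ _ (fun j t => f t <> p (fintype.lift i j)) (nbhs s) _; apply => j.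
    have [|U [V [nU nV UV]]] := @separate _ _ (f s) (p (fintype.lift i j)).
      by rewrite E => /pI/eqP; apply/negP; exact: neq_lift.
    suff : nbhs s [set t | f t <> p (fintype.lift i j)] by [].
    have W : nbhs s (f @^-1` U) by exact: (msmooth_cont (smf s) nU).
    apply: filterS W => t Ut Ef; apply: (UV (f t)) => //.
    by rewrite Ef; exact: nbhs_singleton.
  have H3 : \forall t \near s, ~~ same_pt t s'.
    have := not_same_pt_near nS => -[[A1 A2] [nA1 nA2] HA]; apply: filterS nA1 => t A1t.
    by apply: (HA (t, s')); split => //; exact: nbhs_singleton.
  have H4 : \forall t \near s, ~ Z t.
    by apply: open_nbhs_nbhs; split; [rewrite openC|move=> /Zp].
  by apply: filterS (filterI (filterI H1 H4) (filterI H2 H3)) => t [[h1 h4] [h2 h3]].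
(* The support of a bump of radius d is only bounded by 2d, whence r/2; staying below 1/2 makes the
   periodic bump smooth. *)
move=> /nbhs_ballP[r /= r0 Hr]; pose d := Num.min (r / 2) (4^-1).
have d0 : 0 < d by rewrite lt_min divr_gt0 ?invr_gt0 ?ltr0n.
have d4 : d <= 4^-1 by rewrite ge_min lexx orbT.
have dr : 2 * d <= r by rewrite -ler_pdivlMl // mulrC ge_min lexx.
have ok t : supp (cbump s d) t -> [/\ ch_dom c (f t), forall j, f t <> p (fintype.lift i j), ~~ same_pt t s' & ~ Z t].
  move=> /(cbump_supp d0)[m tm]; have := Hr (t + (- m)%:~R); rewrite (periodicZ per).
  have -> : same_pt (t + (- m)%:~R) s' = same_pt t s'.
    by apply/idP/idP; apply: same_pt_trans; rewrite ?same_ptD // same_pt_sym same_ptD.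
  case=> [|h1 h2 h3 h4]; last by split=> // Zt; apply: h4; apply: (pZ _ m); rewrite mulrNz subrK.
  rewrite -ball_normE /= mulrNz (_ : s - _ = - (t - s - m%:~R)); last ring.
  by rewrite normrN (lt_le_trans tm).
have ns' : ~ supp (cbump s d) s' by move=> /ok[_ _]; rewrite same_pt_refl.
exists c, (cbump s d), v, s, s'; split; [|by split=> // t j /ok[]|by move=> t /ok[]].
split=> //; last by move=> t /ok[].
split.
- exact: cbump_periodic.
- apply/smooth_onP => [|x _]; first exact: openT.
  by apply: smooth_cbump; lra.
- by move=> t; exact: cbump_ge0.
- by apply: (@cbump_gt0 _ _ _ _ 0); rewrite ?rpred0 // ?subrr ?subr0 ?normr0 //; lra.
- by have [] := nbhs_singleton (supp_off ns').
Qed.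
End Displacements.

(** * Uniqueness of resolutions *)

Lemma derive_affine (R : realType) (V W : normedModType R) (phi : V -> W) (x w : V) (D : W) :
  (forall h : R, phi (h *: w + x) = phi x + h *: D) -> 'D_w phi x = D.
Proof.
move=> H; rewrite /derive; apply: cvg_lim => //.
apply: (cvg_trans _ (@cvg_cst _ D _ (0 : R)^' _)).
apply: near_eq_cvg; near=> h; rewrite /= H addrAC subrr add0r scalerA mulVf ?scale1r //.
by near: h; exact: nbhs_dnbhs_neq.
Unshelve. all: by end_near. Qed.

Lemma nbhs_box (R : realType) (l0 s s' : R) (A : set ((R * R) * (R * R))) : nbhs ((l0, s), (l0, s')) A ->
  exists2 r : R, 0 < r & forall l t t' : R, `|l - l0| < r -> `|t - s| < r -> `|t' - s'| < r ->
    A ((l, t), (l, t')).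
Proof.
move=> /nbhs_ballP[r /= r0 rb]; exists r => // l t t' lr tr t'r; apply: rb.
by split; split; rewrite -ball_normE /= distrC.
Qed.

Lemma det3_convex (R : realType) (e l x x' y y' : R) (a b v w : 'rV[R]_3) : 0 <= l <= 1 ->
  0 < e * ((x - x') * det3 a b v) -> 0 < e * ((y - y') * det3 a b w) ->
  det3 a b ((x * (1 - l)) *: v + (y * l) *: w - ((x' * (1 - l)) *: v + (y' * l) *: w)) != 0.
Proof.
move=> /andP[l0 l1] pos1 pos2.
have -> : (x * (1 - l)) *: v + (y * l) *: w - ((x' * (1 - l)) *: v + (y' * l) *: w) =
    ((x - x') * (1 - l)) *: v + ((y - y') * l) *: w.
  by rewrite (mulrBl (1 - l)) (mulrBl l) !scalerBl opprD addrACA.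
rewrite det3_comb.
move: pos1 pos2; move: (det3 a b v) (det3 a b w) (x - x') (y - y') => d1 d2 z z' pos1 pos2.
suff : 0 < e * (z * (1 - l) * d1 + z' * l * d2) by apply: contraTneq => ->; rewrite mulr0 ltxx.
rewrite (_ : e * _ = (1 - l) * (e * (z * d1)) + l * (e * (z' * d2))); last ring.
move: l0; rewrite le_eqVlt => /predU1P[<-|l0]; first by rewrite subr0 mul1r mul0r addr0.
by apply: ltr_wpDl; [apply: mulr_ge0; [rewrite subr_ge0|exact: ltW]|exact: mulr_gt0].
Qed.

Lemma displacement_exists0 (R : realType) (M : oriented_3manifold R) eps n (f : R -> M) (p : 'I_n.+1 -> M) i :
  is_singular_knot f p ->
  exists c k v s s', [/\ displaces eps f (p i) c k v s s', localized f p i k s' & supp k `<=` ~` set0].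
Proof. by move=> sf; apply: displacement_exists => //; exact: closed0. Qed.

Section Resolved.
Context (R : realType) (M : oriented_3manifold R).

Lemma push_smooth eps (f : R -> M) y c h v (Q : normedModType R) (a : Q -> R) q t : has_coords Q ->
  (forall t, msmooth_at f t) -> resolving_push eps f y c h v -> smooth_at a q -> 0 <= a q <= 1 ->
  msmooth_at (fun x : Q * R => push c h v f (a x.1) x.2) (q, t).
Proof.
move=> hQ sf rp sa a01; have [[s [s' [[ac _ _ _] [ph sh _ _ _] dh _]]] cd] := (displacesP eps f y c h v).1 rp.
apply: (@pushed_smooth _ _ _ hQ (fun x : Q * R => f x.2) c h v a ac q) => //.
- move=> t'; apply: (@msmooth_comp _ _ (Q * R)%type R^o snd f) => //; first exact: has_coords_R.
  exact: smooth_snd.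
- by move=> t'; exact: smooth_onT.
- move=> t' st; have [h0|hn] := eqVneq (h t') 0; last exact: cd.
  have [_ _ toK _ _] := mfd_chart ac.
  by rewrite h0 mulr0 scale0r addr0; have [] := toK _ (dh _ st).
Qed.

Definition resolved_by bs eps n (f : R -> M) (p : 'I_n.+1 -> M) b i c h v (g : R -> M) :=
  [/\ resolving_push eps f (p i) c h v,
      forall u : R, 0 < u <= 1 -> stage bs (push c h v f u) (p \o fintype.lift i) b
    & forall t, g t = push c h v f 1 t].

Definition resolved bs eps n (f : R -> M) (p : 'I_n.+1 -> M) b i (g : R -> M) :=
  exists c h v, resolved_by bs eps f p b i c h v g.

Section Moving.
Variables (bs eps : bool) (n : nat) (H : R * R -> M) (P : R -> 'I_n.+1 -> M) (B : R -> R) (i : 'I_n.+1).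
Hypothesis sH : forall x, msmooth_at H x.
Hypothesis perH : forall l, periodic1 (fun t => H (l, t)).
Hypothesis stH : forall l, 0 <= l <= 1 -> stage bs (fun t => H (l, t)) (P l) (B l).
Hypothesis cP : forall i, {within `[0, 1], continuous (fun l => P l i)}.
Hypothesis cB : {within `[0, 1], continuous B}.
Variables (l0 : R).
Hypothesis l01 : 0 <= l0 <= 1.
Variables (c : chart R M) (k : R -> R) (v : 'rV[R]_3) (s s' : R).
Hypothesis dis : displaces eps (fun t => H (l0, t)) (P l0 i) c k v s s'.
Hypothesis locl : localized (fun t => H (l0, t)) (P l0) i k s'.
Let base (x : (R * R) * R) := H (x.1.1, x.2).
Let F := pushed base c k v (fun q : R * R => q.2).

Let smooth_amt (q : R * R) : smooth_at (fun q : R * R => q.2) q.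
Proof. exact: smooth_snd. Qed.

Let dk t : supp k t -> ch_dom c (base ((l0, 0), t)).
Proof. by have [_ _ h _] := dis; exact: h. Qed.

Let ac : mfd_atlas c.
Proof. by have [[]] := dis. Qed.

Let sk t : smooth_at k t.
Proof. by have [_ [_ h _ _ _] _ _] := dis; exact: smooth_onT. Qed.

Let pk : periodic1 k.
Proof. by have [_ []] := dis. Qed.

Let sb := base_smooth sH.
Let ck t := @cod_a0 _ _ _ base c k v (fun q : R * R => q.2) ac (l0, 0) dk t erefl.
Let sF t : msmooth_at F ((l0, 0), t).
Proof. exact: (pushed_smooth (has_coords_RR R) ac (fun t => sb _) sk (smooth_amt _) dk ck). Qed.

Lemma moving_ok : strip l0 (fun q => [/\ forall t, msmooth_at F (q, t),
    forall t, supp k t -> ch_dom c (H (q.1, t))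
    & forall t, k t != 0 -> ch_cod c (ch_to c (H (q.1, t)) + (q.2 * k t) *: v)]).
Proof.
have := @pushed_ok _ _ _ (has_coords_RR R) base c k v (fun q => q.2) ac (l0, 0) (fun t => sb _) sk
  (smooth_amt _) dk ck _ (strip_filter l0) (@strip_nbhs _ l0) pk.
by apply=> q; exact: perH.
Qed.

Lemma moving_stage : strip l0 (fun q => stage bs (push c k v (fun t => H (q.1, t)) q.2) (P q.1 \o fintype.lift i) (B q.1)).
Proof.
have FFF := strip_filter l0.
suff : strip l0 (fun q => stage bs (fun t => F (q, t)) (P q.1 \o fintype.lift i) (B q.1)) by [].
apply: (@opening_near _ _ bs n H P B i sH stH cP cB l0 F base l01).
- exact: sF.
- by move=> t; exact: sb.
- by move=> q; apply: pushed_periodic => //; exact: perH.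
- by move=> q; exact: perH.
- by move=> t; exact: pushed0.
- move: moving_ok; apply: ffS => // q [_ d _] t; apply: pushed_a0 => //= kt.
  by apply: d; exact: supp_neq0.
- by [].
- move=> j t E; have [nt _] := locl.
  have /supp_off off : ~ supp k t by move=> /nt/(_ E).
  by have L := loc_nbhs FFF off; apply: locS L => x q [k0 _]; exact: pushed_off.
- by move=> j; exact: (base_persists stH cP).
have [[_ _ Es _] [_ _ _ ks _] _ _] := dis.
have dc : ch_dom c (P l0 i) by rewrite -Es; apply: dk; apply: supp_neq0; rewrite gt_eqF.
move=> t t' nT Et Et'; exists c; split=> //=.
have De r : H (l0, r) = P l0 i ->
    'D_(((0, 1), 0) : (R * R) * R) (ch_to c \o F) ((l0, 0), r) = k r *: (v *m transition c c (P l0 i)).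
  move=> Er; rewrite (pushed_derive (has_coords_RR R) ac (fun t => sb _) sk (smooth_amt _) dk ck) //; last first.
    by rewrite /base /= Er.
  rewrite /base /= Er (@derive_affine _ _ _ _ _ _ 0) ?add0r; last first.
    by move=> h; rewrite scaler0 addr0 /= /GRing.scale /= mulr0 !add0r.
  rewrite (@derive_affine _ _ R^o _ _ _ 1) ?mulr1 // => h.
  by rewrite /= /GRing.scale /= mulr1 addr0 add0r.
rewrite De // De // -scalerBl.
have := displaces_sign (stage_sing (stH l01)) dis nT Et Et' ac dc.
set x := velocity _ _ t; set y := velocity _ _ t'; set w := v *m _ => pos.
have := det3_comb x y w w 0 (k t - k t'); rewrite scale0r add0r mul0r add0r => ->.
by move: pos; apply: contraTneq => ->; rewrite mulr0 ltxx.
Qed.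

(** The displacement chosen at [l0] also serves nearby stages: the two preimages move little, the
    inequalities are open, and k still vanishes at the moved second preimage because it is
    localized. *)
Lemma moving_displaces : strip l0 (fun q => exists s s', displaces eps (fun t => H (q.1, t)) (P q.1 i) c k v s s').
Proof.
have FFF := strip_filter l0.
have [[_ nS Es Es'] [_ sk' k0 ks ks'] _ D] := dis.
have dcs : ch_dom c (H (l0, s)) by apply: dk; apply: supp_neq0; rewrite gt_eqF.
have dcs' : ch_dom c (H (l0, s')) by rewrite Es' -Es.
have vc t : ch_dom c (H (l0, t)) -> {for (l0, t), continuous (fun y => velocity c (fun t => H (y.1, t)) y.2)}.
  by move=> d; exact: velocity_continuous.
pose vel y := velocity c (fun t => H (y.1, t)) y.2.
have N1 : \forall z \near ((l0, s), (l0, s')), 0 < (-1) ^+ (~~ eps) * det3 (vel z.1) (vel z.2) v.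
  have E z : (-1) ^+ (~~ eps) * det3 (vel z.1) (vel z.2) v = det3 (vel z.1) (vel z.2) ((-1) ^+ (~~ eps) *: v).
    by have := det3_comb (vel z.1) (vel z.2) v v 0 ((-1) ^+ (~~ eps)); rewrite scale0r add0r mul0r add0r.
  have C : {for ((l0, s), (l0, s')), continuous (fun z => det3 (vel z.1) (vel z.2) ((-1) ^+ (~~ eps) *: v))}.
    apply: det3_continuous; last exact: cvg_cst.
      by apply: (@continuous_comp _ _ _ fst vel); [exact: cvg_fst|exact: vc].
    by apply: (@continuous_comp _ _ _ snd vel); [exact: cvg_snd|exact: vc].
  have : 0 < det3 (vel (l0, s)) (vel (l0, s')) ((-1) ^+ (~~ eps) *: v) by rewrite -(E ((l0, s), (l0, s'))).
  move=> pos; have : \forall z \near ((l0, s), (l0, s')), 0 < det3 (vel z.1) (vel z.2) ((-1) ^+ (~~ eps) *: v).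
    by apply: (cvgr_gt (F := nbhs ((l0, s), (l0, s'))) _ C).
  by apply: filterS => z; rewrite E.
have [r1 r10 H1] : exists2 r : R, 0 < r & forall l t t' : R, `|l - l0| < r -> `|t - s| < r -> `|t' - s'| < r ->
    0 < (-1) ^+ (~~ eps) * det3 (vel (l, t)) (vel (l, t')) v.
  have [r r0 rb] := nbhs_box N1; exists r; first exact: r0.
  exact: rb.
have [r2 r20 H2] : exists2 r : R, 0 < r & forall t t' : R, `|t - s| < r -> `|t' - s'| < r -> ~~ same_pt t t'.
  have /nbhs_ballP[r /= r0 rb] := not_same_pt_near nS; exists r => // t t' tr t'r; apply: (rb (t, t')).
  by split; rewrite -ball_normE /= distrC.
have [r3 r30 H3] : exists2 r : R, 0 < r & forall t : R, `|t - s| < r -> 0 < k t.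
  have /nbhs_ballP[r /= r0 rb] : \forall t \near s, 0 < k t.
    by apply: (cvgr_gt (F := nbhs s) _ (smooth_at_cont (sk s))).
  by exists r => // t tr; apply: rb; rewrite -ball_normE /= distrC.
have [r4 r40 H4] : exists2 r : R, 0 < r & forall t : R, `|t - s'| < r -> k t = 0.
  have [_ /supp_off/nbhs_ballP[r /= r0 rb]] := locl.
  by exists r => // t tr; have [] := rb t _ => //; rewrite -ball_normE /= distrC.
have [r [r0 rr1 rr2 [rr3 rr4]]] : exists r, [/\ 0 < r, r <= r1, r <= r2 & r <= r3 /\ r <= r4].
  by exists (Num.min (Num.min r1 r2) (Num.min r3 r4)); rewrite !lt_min !ge_min !lexx r10 r20 r30 r40 !orbT.
have ex t := @branch_near _ _ _ _ _ _ _ sH stH cP l0 l01 i t r.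
have L : strip l0 (fun q => `|q.1 - l0| < r) by exists r.
have := ffI FFF moving_ok (ffI FFF L (ffI FFF (ex s Es r0) (ex s' Es' r0))).
apply: ffS => // -[l u] [/= [_ dl _] [lr [[t tr Et] [t' tr' Et']]]]; exists t, t'; split.
- by split; [exact: ac|apply: H2; apply: lt_le_trans rr2|exact: Et|exact: Et'].
- split; [exact: pk|exact: sk'|exact: k0| |]; first by apply: H3; apply: lt_le_trans rr3.
  by apply: H4; apply: lt_le_trans rr4.
- exact: dl.
by apply: (H1 l t t'); apply: lt_le_trans rr1.
Qed.

(** Pushing by u' along the bump u k is pushing by u' u along k, so all amounts between 0 and 1 stay
    in the range where [moving_stage] holds. *)
Lemma moving_resolved : exists2 r : R, 0 < r & forall l u, 0 <= l <= 1 -> `|l - l0| < r -> 0 < u < r ->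
  resolved_by bs eps (fun t => H (l, t)) (P l) (B l) i c (fun t => u * k t) v (push c k v (fun t => H (l, t)) u) /\
  isot bs (push c k v (fun t => H (l0, t)) u) (P l0 \o fintype.lift i) (B l0)
    (push c k v (fun t => H (l, t)) u) (P l \o fintype.lift i) (B l).
Proof.
have FFF := strip_filter l0.
have [r r0 Hr] := ffI FFF moving_ok (ffI FFF moving_stage moving_displaces).
exists r => // l u l1 lr ur; split.
  have pE u' t : push c (fun t => u * k t) v (fun t => H (l, t)) u' t = push c k v (fun t => H (l, t)) (u' * u) t.
    by rewrite /push mulf_eq0 gt_eqF ?mulrA; case/andP: ur.
  have u01 u' : 0 < u' <= 1 -> 0 < u' * u < r.
    move=> /andP[u'0 u'1]; case/andP: ur => u0 ur; rewrite mulr_gt0 //=.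
    by apply: le_lt_trans ur; rewrite ler_piMl // ltW.
  have u0 : 0 < u by case/andP: ur.
  split.
  - apply/displacesP; split.
      have [_ [_ [t [t' [h1 [h2 h3 h4 h5 h6] h7 h8]]]]] := Hr l u l1 lr ur.
      exists t, t'; split=> //.
        split=> [t0||t0||]; rewrite ?h2 //.
        - apply/smooth_onP => [|x _]; first exact: openT.
          by apply: smoothM; [exact: smooth_cst|exact: sk].
        - by apply: mulr_ge0; [exact: ltW|exact: h4].
        - exact: mulr_gt0.
        - by rewrite h6 mulr0.
      apply: subset_trans h7; apply: closure_subset => t0 /=; apply: contraNN => /eqP ->.
      by rewrite mulr0.
    move=> u' t /andP[u'0 u'1]; rewrite mulf_eq0 gt_eqF //= mulrA => kt.
    have := u'0; rewrite le_eqVlt => /predU1P[<-|u'pos].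
      rewrite !mul0r scale0r addr0; have [[_ dl _] _] := Hr l u l1 lr ur.
      have [_ _ toK _ _] := mfd_chart ac.
      by have [] := toK _ (dl t (supp_neq0 kt)).
    have [[_ _ cd] _] := Hr l (u' * u) l1 lr (u01 u' ltac:(by rewrite u'pos)).
    exact: cd.
  - move=> u' u'01; have [_ [st _]] := Hr l (u' * u) l1 lr (u01 u' u'01).
    by rewrite (_ : push _ _ _ _ u' = push c k v (fun t => H (l, t)) (u' * u)) //; apply/funext.
  - by move=> t; rewrite pE mul1r.
(* For the isotopy the amount u is kept, and the time runs along the segment from [l0] to [l]. *)
pose a (m : R) := l0 + m * (l - l0).
have a01 m : 0 <= m <= 1 -> 0 <= a m <= 1 /\ `|a m - l0| < r.
  move=> m01; rewrite /a addrAC subrr add0r normrM; case/andP: m01 => m0 m1; split.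
    rewrite (_ : l0 + m * (l - l0) = (1 - m) * l0 + m * l); last ring.
    case/andP: l1 => l0' l1'; case/andP: l01 => l00 l011; apply/andP; split.
      by rewrite addr_ge0 // mulr_ge0 // subr_ge0.
    rewrite -[leRHS](subrK m) lerD // -[leRHS]mulr1; apply: ler_wpM2l => //; rewrite subr_ge0 //.
  by apply: le_lt_trans lr; rewrite ler_piMl // ger0_norm.
have a0 : a 0 = l0 by rewrite /a mul0r addr0.
have a1 : a 1 = l by rewrite /a mul1r addrC subrK.
have sa m : smooth_at a m.
  apply: (@smoothD _ _ R^o); first exact: smooth_cst.
  by apply: (@smoothM _ R^o); [exact: smooth_id|exact: smooth_cst].
have ca : continuous a by move=> m; apply: smooth_at_cont; exact: sa.
have wa (T : topologicalType) (g : R -> T) : {within `[0, 1], continuous g} -> {within `[0, 1], continuous (g \o a)}.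
  move=> /within01P cg; apply/within01P => m m01 U nU; have [la lar] := a01 m m01.
  have [d d0 Hd] := cg (a m) la U nU.
  have /nbhs_ballP[e /= e0 He] : \forall x \near m, `|a x - a m| < d.
    have : nbhs (a m) [set x | `|x - a m| < d].
      by apply/nbhs_ballP; exists d => //= y; rewrite -ball_normE /= distrC.
    exact: ca.
  exists e => // x x01 xm; have [lax _] := a01 x x01; apply: Hd => //; apply: He.
  by rewrite -ball_normE /= distrC.
have := @path_isot _ _ bs n (fun x => F ((a x.1, u), x.2)) (fun m => P (a m) \o fintype.lift i) (B \o a).
rewrite /= a0 a1; apply.
- move=> m t m01; have [la lar] := a01 m m01; have [[sm _ _] _] := Hr (a m) u la lar ur.
  apply: (@msmooth_comp _ _ (R * R)%type ((R * R) * R)%type (fun x => ((a x.1, u), x.2)) F) => //.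
    by apply: has_coords_prod; [exact: (has_coords_RR R)|exact: has_coords_R].
  apply: smooth_pair; last exact: smooth_snd.
  apply: smooth_pair; last exact: smooth_cst.
  by apply: (smooth_comp (f := fst) (g := a)); [exact: has_coords_R|exact: smooth_fst|exact: sa].
- by move=> m m01; have [la lar] := a01 m m01; have [_ [st _]] := Hr (a m) u la lar ur.
- by move=> j; exact: (wa _ (fun l => P l (fintype.lift i j)) (@cP (fintype.lift i j))).
- exact: wa.
Qed.
End Moving.

Lemma resolved_path bs eps n (f : R -> M) (p : 'I_n.+1 -> M) b i c h v u : stage bs f p b ->
  resolving_push eps f (p i) c h v ->
  (forall u : R, 0 < u <= 1 -> stage bs (push c h v f u) (p \o fintype.lift i) b) -> 0 < u <= 1 ->
  isot bs (push c h v f u) (p \o fintype.lift i) b (push c h v f 1) (p \o fintype.lift i) b.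
Proof.
move=> st rp sp /andP[u0 u1]; pose a (l : R) := u + l * (1 - u).
have a01 l : 0 <= l <= 1 -> 0 < a l <= 1.
  move=> /andP[l0 l1]; rewrite /a; apply/andP; split; first by rewrite ltr_pwDl // mulr_ge0 // subr_ge0.
  by rewrite -[leRHS](subrK u) addrC lerD2r ler_piMl // subr_ge0.
have := @path_isot _ _ bs n (fun x => push c h v f (a x.1) x.2) (fun=> p \o fintype.lift i) (fun=> b).
have a0 : a 0 = u by rewrite /a mul0r addr0.
have a1 : a 1 = 1 by rewrite /a mul1r addrC subrK.
rewrite /= a0 a1; apply.
- move=> l t l01; have [[_ /smooth_mapP sf _] _ _ _ _] := stage_sing st.
  apply: (@push_smooth eps f (p i) c h v R a l t (has_coords_R R) sf rp).
    apply: (@smoothD _ _ R^o); first exact: smooth_cst.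
    by apply: (@smoothM _ R^o); [exact: smooth_id|exact: smooth_cst].
  by have /andP[/ltW-> ->] := a01 l l01.
- by move=> l l01; apply: sp; exact: a01.
- by move=> j; exact: within_cst.
- exact: within_cst.
Qed.

(* Push first by u (1 - l) along h *: v, then by u l along the localized k *: w.  To first order in
   u the two displacements add up, and the sign condition on them is convex. *)
Section Compare.
Variables (bs eps : bool) (n : nat) (f : R -> M) (p : 'I_n.+1 -> M) (b : R) (i : 'I_n.+1).
Hypothesis st : stage bs f p b.
Variables (c : chart R M) (h : R -> R) (v : 'rV[R]_3).
Hypothesis rp : resolving_push eps f (p i) c h v.
Hypothesis sp : forall u : R, 0 < u <= 1 -> stage bs (push c h v f u) (p \o fintype.lift i) b.
Variables (c' : chart R M) (k : R -> R) (w : 'rV[R]_3) (s s' : R).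
Hypothesis dis : displaces eps f (p i) c' k w s s'.
Hypothesis locl : localized f p i k s'.

Let base (x : (R * R) * R) := f x.2.
Let a (q : R * R) := q.2 * (1 - q.1).
Let a' (q : R * R) := q.2 * q.1.
Let G := pushed base c h v a.
Let F := pushed G c' k w a'.

Let sf t : msmooth_at f t.
Proof. by have [[_ /smooth_mapP sf _] _ _ _ _] := stage_sing st; exact: sf. Qed.

Let pf : periodic1 f.
Proof. by have [[]] := stage_sing st. Qed.

Let sb x : msmooth_at base x.
Proof.
apply: (@msmooth_comp _ _ ((R * R) * R)%type R^o snd f) => //; first exact: has_coords_R.
exact: smooth_snd.
Qed.

Let sa q : smooth_at a q.
Proof.
apply: smoothM; first exact: smooth_snd.
by apply: (@smoothB _ _ R^o); [exact: smooth_cst|exact: smooth_fst].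
Qed.

Let sa' q : smooth_at a' q.
Proof. by apply: smoothM; [exact: smooth_snd|exact: smooth_fst]. Qed.

Let a00 l : a (l, 0) = 0. Proof. by rewrite /a mul0r. Qed.
Let a'00 l : a' (l, 0) = 0. Proof. by rewrite /a' mul0r. Qed.

Lemma compare l0 : 0 <= l0 <= 1 -> strip l0 (fun q => [/\ forall t, msmooth_at F (q, t),
  forall t, supp k t -> ch_dom c' (G (q, t)) & stage bs (fun t => F (q, t)) (p \o fintype.lift i) b]).
Proof.
move=> l01; have FFF := strip_filter l0; have FFq := @strip_nbhs R l0.
have [[s1 [s1' dis1]] cd] := (displacesP eps f (p i) c h v).1 rp.
have [[ac _ _ _] [ph sh _ _ _] dh _] := dis1.
have [[ac' _ Es Es'] [pk sk _ ks _] dk _] := dis.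
have sh' t := smooth_onT t sh; have sk' t := smooth_onT t sk.
have ck t := @cod_a0 _ _ _ base c h v a ac (l0, 0) dh t (a00 l0).
have G0 t : G ((l0, 0), t) = f t by apply: pushed0.
have sG t : msmooth_at G ((l0, 0), t) by exact: (pushed_smooth (has_coords_RR R) ac (fun t => sb _) sh' (sa _) dh ck).
have dkG t : supp k t -> ch_dom c' (G ((l0, 0), t)) by rewrite G0; exact: dk.
have ck' t := @cod_a0 _ _ _ G c' k w a' ac' (l0, 0) dkG t (a'00 l0).
have sF t : msmooth_at F ((l0, 0), t) by exact: (pushed_smooth (has_coords_RR R) ac' sG sk' (sa' _) dkG ck').
have pG q : periodic1 (fun t => G (q, t)) by exact: pushed_periodic.
have pF q : periodic1 (fun t => F (q, t)) by apply: pushed_periodic.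
have ok := @pushed_ok _ _ _ (has_coords_RR R) G c' k w a' ac' (l0, 0) sG sk' (sa' _) dkG ck' _ FFF FFq pk pG.
suff sS : strip l0 (fun q => stage bs (fun t => F (q, t)) (p \o fintype.lift i) b).
  by have := ffI FFF ok sS; apply: ffS => // q [[h1 h2 _] h3].
have G00 l t : G ((l, 0), t) = f t.
  by apply: (@pushed_a0 _ _ _ base c h v a ac ((l, 0), t)) => //= ht; apply: dh; exact: supp_neq0.
apply: (@opening_near _ _ bs n (fun x => f x.2) (fun=> p) (fun=> b) i _ _ _ _ l0 F G l01 sF sG pF pG).
- move=> x; apply: (@msmooth_comp _ _ (R * R)%type R^o snd f) => //; first exact: has_coords_R.
  exact: smooth_snd.
- by [].
- by move=> j; exact: within_cst.
- exact: within_cst.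
- by move=> t; rewrite /F pushed0.
- apply: (ffT FFF) => q t; have -> : F ((q.1, 0), t) = G ((q.1, 0), t); last exact: G00.
  apply: (@pushed_a0 _ _ _ G c' k w a' ac' ((q.1, 0), t)) => [|/= kt]; first exact: a'00.
  by rewrite G00; apply: dk; exact: supp_neq0.
- by move=> t; exact: G0.
- move=> j t E; have [nt _] := locl.
  have /supp_off off : ~ supp k t by move=> /nt/(_ E).
  by have L := loc_nbhs FFF off; apply: locS L => x q [k0 _]; exact: pushed_off.
- move=> j; have [_ pI _ _ _] := stage_sing st.
  have [U nU [V nV UV]] := isolate (fintype.lift i j) pI; exists U => //.
  apply: singular_persists => //; have := strip_small l0 (@ltr01 R); move: (strip_range l0).
  move=> H1 H2; have := ffI FFF H1 H2; apply: ffS => // -[l u] [/= /andP[l0' l1'] /andP[u0 u1]].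
  (* At l = 1 the first push is switched off and the curve is f with all its double points;
     otherwise it is a proper push of f, without the i-th one. *)
  have [l1|l1] := eqVneq l 1.
    exists n.+1, p; split.
    + rewrite (_ : (fun t => _) = f); first exact: stage_sing st.
      apply/funext => t; apply: (@pushed_a0 _ _ _ base c h v a ac ((l, u), t)) => [|/= ht].
        by rewrite /a /= l1 subrr mulr0.
      by apply: dh; exact: supp_neq0.
    + by exists (fintype.lift i j).
    + by move=> l' Ul'; congr p; apply: (UV l' _ Ul'); exact: nbhs_singleton.
  exists n, (p \o fintype.lift i); split.
  + have := sp (u := u * (1 - l)); rewrite -/(a (l, u)) => Sp; apply: stage_sing (Sp _).
    rewrite /a /= mulr_gt0 //=; last by rewrite subr_gt0 lt_neqAle l1.
    by apply: mulr_ile1; [exact: ltW|rewrite subr_ge0|exact: ltW|rewrite gerBl].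
  + by exists j.
  + move=> l' Ul'; apply: (congr1 p); apply: (UV _ _ Ul'); exact: (nbhs_singleton (nV (fintype.lift i l'))).
move=> t t' nT Et Et'; exists c'; have dc : ch_dom c' (p i) by rewrite -Es; apply: dk; apply: supp_neq0; rewrite gt_eqF.
split=> //=.
have De r : f r = p i ->
    'D_(((0, 1), 0) : (R * R) * R) (ch_to c' \o F) ((l0, 0), r) =
      (h r * (1 - l0)) *: (v *m transition c c' (p i)) + (k r * l0) *: (w *m transition c' c' (p i)).
  move=> Er; rewrite (pushed_derive (has_coords_RR R) ac' sG sk' (sa' _) dkG ck') ?G0 ?Er //.
  rewrite (pushed_derive (has_coords_RR R) ac (fun t => sb _) sh' (sa _) dh ck) //; last first.
    by rewrite /base /= Er.
  rewrite /base /= Er (@derive_affine _ _ _ _ _ _ 0) ?add0r; last first.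
    by move=> x; rewrite scaler0 addr0 /= /GRing.scale /= mulr0 !add0r.
  rewrite (@derive_affine _ _ R^o _ _ _ (1 - l0)); last first.
    by move=> x; rewrite /a /= /GRing.scale /= mulr1 mulr0 add0r addr0 mul0r add0r.
  rewrite (@derive_affine _ _ R^o _ _ _ l0) // => x.
  by rewrite /a' /= /GRing.scale /= mulr1 mulr0 add0r addr0 mul0r add0r.
have pos1 := displaces_sign (stage_sing st) dis1 nT Et Et' ac' dc.
have pos2 := displaces_sign (stage_sing st) dis nT Et Et' ac' dc.
by rewrite (De t Et) (De t' Et'); exact: (det3_convex l01 pos1 pos2).
Qed.

(** The given push is first shrunk along its own path to the amount u; then l runs from 0 to 1 in
    the double push, whose ends are the two pushes by u. *)
Lemma resolved_displaced : exists2 r : R, 0 < r & forall u, 0 < u < r ->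
  isot bs (push c h v f 1) (p \o fintype.lift i) b (push c' k w f u) (p \o fintype.lift i) b.
Proof.
have [r r0 Hr] := strip_uniform compare; exists (Num.min r 1); first by rewrite lt_min r0 ltr01.
move=> u; rewrite lt_min => /andP[u0 /andP[ur u1]].
have u01 : 0 < u <= 1 by rewrite u0 ltW.
have ur' : 0 < u < r by rewrite u0.
apply: isot_trans (isot_sym (resolved_path st rp sp u01)) _.
have := @path_isot _ _ bs n (fun x => F ((x.1, u), x.2)) (fun=> p \o fintype.lift i) (fun=> b).
have [[s1 [s1' [[ac _ _ _] _ dh _]]] cd] := (displacesP eps f (p i) c h v).1 rp.
have [[ac' _ _ _] _ _ _] := dis.
have E0 : (fun t => F ((0, u), t)) = push c h v f u.
  have [_ d _] := Hr 0 u ltac:(by rewrite lexx ler01) ur'.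
  apply/funext => t; rewrite /F pushed_a0 /a' /= ?mulr0 // => [|kt].
    by rewrite /G /pushed /a /= subr0 mulr1.
  by apply: d; exact: supp_neq0.
have E1 : (fun t => F ((1, u), t)) = push c' k w f u.
  have GE t : G ((1, u), t) = f t.
    apply: (@pushed_a0 _ _ _ base c h v a ac ((1, u), t)) => [|/= ht]; first by rewrite /a /= subrr mulr0.
    by apply: dh; exact: supp_neq0.
  by apply/funext => t; rewrite /F /pushed /a' /= mulr1 /push; rewrite GE.
rewrite /= E0 E1; apply.
- move=> l t l01; have [sm _ _] := Hr l u l01 ur'.
  apply: (@msmooth_comp _ _ (R * R)%type ((R * R) * R)%type (fun x => ((x.1, u), x.2)) F) => //.
    by apply: has_coords_prod; [exact: (has_coords_RR R)|exact: has_coords_R].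
  apply: smooth_pair; last exact: smooth_snd.
  by apply: smooth_pair; [exact: smooth_fst|exact: smooth_cst].
- by move=> l l01; have [_ _ ?] := Hr l u l01 ur'.
- by move=> j; exact: within_cst.
- exact: within_cst.
Qed.
End Compare.

Lemma isot_global bs n (f : R -> M) (p : 'I_n -> M) b f' p' b' : isot bs f p b f' p' b' -> exists H P B,
  [/\ smooth_map H, forall u, stage bs (fun t => H (u, t)) (P u) (B u),
      (forall i, {within `[0, 1], continuous (fun u : R => P u i)}) /\ {within `[0, 1], continuous B},
      (fun t => H (0, t)) = f /\ (fun t => H (1, t)) = f'
    & [/\ P 0 = p, P 1 = p', B 0 = b & same_pt (B 1) b']].
Proof.
move=> [H [P [B [/smooth_mapP h1 h2 [h3 h3'] h4 [h5 h6 h7]]]]].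
have s0 : step 0 = 0 :> R by rewrite step_le0.
have s1 : step 1 = 1 :> R by rewrite step_ge1.
exists (fun x => H (step x.1, x.2)), (P \o @step R), (B \o @step R); split.
- apply/smooth_mapP => x; apply: (@msmooth_comp _ _ (R * R)%type (R * R)%type (fun x => (step x.1, x.2)) H) => //.
    exact: (has_coords_RR R).
  apply: smooth_pair; last exact: smooth_snd.
  by apply: (smooth_comp (g := @step R)); [exact: has_coords_R|exact: smooth_fst|exact: smooth_step].
- by move=> u; have := h2 (step u) (step01 u).
- split=> [j|]; last exact: (within_step h3' (@step_continuous R) (@step01 R)).
  exact: (within_step (h3 j) (@step_continuous R) (@step01 R)).
- by rewrite /= s0 s1; split; apply/funext => t; have [] := h4 t.
- by rewrite /= s0 s1; split=> //; apply/funext => j; have [] := h5 j.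
Qed.

Lemma resolved_displacement bs eps n (f : R -> M) (p : 'I_n.+1 -> M) b i c k v s s' : stage bs f p b ->
  displaces eps f (p i) c k v s s' -> localized f p i k s' ->
  exists2 r : R, 0 < r & forall u, 0 < u < r ->
  resolved_by bs eps f p b i c (fun t => u * k t) v (push c k v f u).
Proof.
move=> st dis locl; have [[pf /smooth_mapP sf _] _ _ _ _] := stage_sing st.
have sH x : msmooth_at (fun x : R * R => f x.2) x.
  apply: (@msmooth_comp _ _ (R * R)%type R^o snd f) => //; first exact: has_coords_R.
  exact: smooth_snd.
have z01 : 0 <= (0 : R) <= 1 by lra.
have [r r0 Hr] := @moving_resolved bs eps n (fun x => f x.2) (fun=> p) (fun=> b) i sH (fun _ => pf)
  (fun _ _ => st) (fun j => @within_cst R M (p j)) (@within_cst R R b) 0 z01 c k v s s' dis locl.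
exists r => // u ur; have [|Hu _] := Hr 0 u z01 _ ur; first by rewrite subrr normr0.
exact: Hu.
Qed.

Lemma resolved_exists bs eps n (f : R -> M) (p : 'I_n.+1 -> M) b i : stage bs f p b ->
  exists g, resolved bs eps f p b i g.
Proof.
move=> st; have [c [k [v [s [s' [dis locl _]]]]]] := displacement_exists0 eps i (stage_sing st).
have [r r0 Hr] := resolved_displacement st dis locl.
by exists (push c k v f (r / 2)), c, (fun t => r / 2 * k t), v; apply: Hr; lra.
Qed.

(** Both are isotopic to the push by one common small amount along the same localized
    displacement. *)
Lemma resolved_unique bs eps n (f : R -> M) (p : 'I_n.+1 -> M) b i g g' : stage bs f p b ->
  resolved bs eps f p b i g -> resolved bs eps f p b i g' ->
  isot bs g (p \o fintype.lift i) b g' (p \o fintype.lift i) b.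
Proof.
move=> st [c [h [v [rp sp gE]]]] [c' [h' [v' [rp' sp' gE']]]].
have [d [k [w [s [s' [dis locl _]]]]]] := displacement_exists0 eps i (stage_sing st).
have [r r0 Hr] := resolved_displaced st rp sp dis locl.
have [r' r'0 Hr'] := resolved_displaced st rp' sp' dis locl.
have -> : g = push c h v f 1 by apply/funext.
have -> : g' = push c' h' v' f 1 by apply/funext.
pose u := Num.min r r' / 2; have m0 : 0 < Num.min r r' by rewrite lt_min r0.
have m1 : Num.min r r' <= r by rewrite ge_min lexx.
have m2 : Num.min r r' <= r' by rewrite ge_min lexx orbT.
apply: isot_trans (Hr u _) (isot_sym (Hr' u _)); rewrite /u; lra.
Qed.

(** The property [E], that every resolution of the stage at time l is isotopic to g, is locally
    constant: a displacement chosen at [l0] resolves all nearby stages with isotopic results, and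
    [resolved_unique] compares it with any other resolution. *)
Theorem resolved_isot bs eps n (f f' : R -> M) (p p' : 'I_n.+1 -> M) b b' i g g' : isot bs f p b f' p' b' ->
  resolved bs eps f p b i g -> resolved bs eps f' p' b' i g' ->
  isot bs g (p \o fintype.lift i) b g' (p' \o fintype.lift i) b'.
Proof.
move=> /isot_global[H [P [B [/smooth_mapP sH stH [cP cB] [H0 H1] [P0 P1 B0 B1]]]]] rg rg'.
have st : stage bs f p b by rewrite -H0 -P0 -B0.
have rg1 : resolved bs eps f' p' (B 1) i g'.
  have [c [h [v [rp sp gE]]]] := rg'; exists c, h, v; split=> // u u01.
  by apply: stage_shift (sp u u01); rewrite same_pt_sym.
apply: (isot_end B1).
pose E l := forall g', resolved bs eps (fun t => H (l, t)) (P l) (B l) i g' ->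
  isot bs g (p \o fintype.lift i) b g' (P l \o fintype.lift i) (B l).
suff : E 1 by rewrite -P1; apply; rewrite H1 P1.
apply: (@locally_constant R E); last first.
  by move=> g1; rewrite P0 B0 H0; exact: resolved_unique.
move=> l0 l01; have [c [k [v [s [s' [dis locl _]]]]]] := displacement_exists0 eps i (stage_sing (stH l0)).
have perH l : periodic1 (fun t => H (l, t)) by have [[]] := stage_sing (stH l).
have [r r0 Hr] := moving_resolved sH perH (fun l _ => stH l) cP cB l01 dis locl.
have ur : 0 < r / 2 < r by lra.
exists r => // l l1 lr; have [Rl' Il] := Hr l (r / 2) l1 lr ur.
have Rl : resolved bs eps (fun t => H (l, t)) (P l) (B l) i (push c k v (fun t => H (l, t)) (r / 2)).
  by exists c, (fun t => r / 2 * k t), v; exact: Rl'.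
have [R0' _] := Hr l0 (r / 2) l01 ltac:(by rewrite subrr normr0) ur.
have R0 : resolved bs eps (fun t => H (l0, t)) (P l0) (B l0) i (push c k v (fun t => H (l0, t)) (r / 2)).
  by exists c, (fun t => r / 2 * k t), v; exact: R0'.
split=> El g1 rg1'.
  by apply: isot_trans (resolved_unique (stH l0) R0 rg1'); apply: isot_trans (El _ Rl) (isot_sym Il).
by apply: isot_trans (resolved_unique (stH l) Rl rg1'); apply: isot_trans (El _ R0) Il.
Qed.
End Resolved.

(** * Commutation of resolutions *)

Section Commute.
Context (R : realType) (M : oriented_3manifold R).

Lemma lift_swap n (i : 'I_n.+2) (j : 'I_n.+1) : let k := (face_swap (i, j)).1 in let l := (face_swap (i, j)).2 in
  fintype.lift k l = i /\ forall m : 'I_n, fintype.lift i (fintype.lift j m) = fintype.lift k (fintype.lift l m).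
Proof.
move=> k l; split; first by rewrite -[RHS](congr1 fst (face_swapK (i, j))).
have lE : l = unbump j i :> nat by exact: face_swap2.
by move=> m; apply: ord_inj; rewrite /= lE bumpC.
Qed.

(** The conditions only see the curve on the support of the bump and its velocity at the double
    point, so a change elsewhere, such as another push with disjoint support, does not affect
    them. *)
Lemma resolving_push_eq eps (f f' : R -> M) y c h v : resolving_push eps f y c h v ->
  (forall t, supp h t \/ f t = y -> \forall t' \near t, f t' = f' t') -> resolving_push eps f' y c h v.
Proof.
case/displacesP => -[s [s' [[ac nS E E'] [ph sh h0 hs hs'] dh D]]] cd eqf.
have eqv t : supp h t \/ f t = y -> f t = f' t /\ velocity c f t = velocity c f' t.
  move=> /eqf nt; split; first exact: nbhs_singleton nt.
  rewrite /velocity !derive1E; apply: near_eq_derive => //.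
  by apply: filterS nt => t' /= ->.
have [fs vs] := eqv s (or_intror E); have [fs' vs'] := eqv s' (or_intror E').
apply/displacesP; split.
  exists s, s'; split.
  - by rewrite -fs -fs'.
  - by [].
  - by move=> t st; have [ft _] := eqv t (or_introl st); rewrite /= -ft; exact: dh.
  by rewrite -vs -vs'.
move=> u t u01 ht; have [ft _] := eqv t (or_introl (supp_neq0 ht)).
by rewrite -ft; exact: cd.
Qed.

Definition corner : set_system (R * R) := [set A | exists2 r : R, 0 < r &
  forall u w : R, 0 < u < r -> 0 < w < r -> A (u, w)].

Lemma corner_filter : Filter corner.
Proof.
split.
- by exists 1.
- move=> A B [r r0 HA] [s s0 HB]; exists (Num.min r s); first by rewrite lt_min r0.
  move=> u w; rewrite !lt_min => /andP[u0 /andP[ur us]] /andP[w0 /andP[wr ws]].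
  by split; [apply: HA|apply: HB]; apply/andP.
- by move=> A B AB [r r0 HA]; exists r => // u w *; apply: AB; exact: HA.
Qed.

Lemma corner_nbhs (A : set (R * R)) : nbhs (0 : R * R) A -> corner A.
Proof.
move=> /nbhs_ballP[r /= r0 rA]; exists r => // u w /andP[u0 ur] /andP[w0 wr]; apply: rA.
by split; rewrite -ball_normE /= sub0r normrN gtr0_norm.
Qed.

Section Two.
Variables (bs : bool) (n : nat) (f : R -> M) (p : 'I_n.+2 -> M) (b : R) (e1 e2 : bool).
Hypothesis st : stage bs f p b.
Let base (x : (R * R) * R) := f x.2.

Let sf t : msmooth_at f t.
Proof. by have [[_ /smooth_mapP sf _] _ _ _ _] := stage_sing st; exact: sf. Qed.

Let pf : periodic1 f.
Proof. by have [[]] := stage_sing st. Qed.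

Let sb x : msmooth_at base x.
Proof.
apply: (@msmooth_comp _ _ ((R * R) * R)%type R^o snd f) => //; first exact: has_coords_R.
exact: smooth_snd.
Qed.

(** Moving the parameter by -a(q) along d switches off the displacement at [p i] and leaves the
    other one unchanged; there the coincidence at [p i] is still present, and [opened] applies with
    [tau] = a. *)
Lemma two_opened i (c c' : chart R M) k k' v v' s s' (a a' : R * R -> R) (d : R * R) :
  displaces e1 f (p i) c k v s s' ->
  [/\ mfd_atlas c', periodic1 k', forall t, smooth_at k' t & supp k' `<=` f @^-1` ch_dom c'] ->
  (forall t, supp k' t -> f t <> p i) ->
  (forall q, smooth_at a q) -> (forall q, smooth_at a' q) -> a 0 = 0 -> a' 0 = 0 ->
  (forall (h : R) x, a (h *: d + x) = a x + h) -> (forall (h : R) x, a' (h *: d + x) = a' x) ->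
  (forall r : R, 0 < r -> corner (fun q => 0 < a q < r)) ->
  forall t1 t2, ~~ same_pt t1 t2 -> f t1 = p i -> f t2 = p i ->
  loc corner (t1, t2) (fun x q => pushed (pushed base c k v a) c' k' v' a' (q, x.1) <>
     pushed (pushed base c k v a) c' k' v' a' (q, x.2)).
Proof.
move=> dis [ac' pk' sk' dk'] off sa sa' a0 a'0 da da' ca t1 t2 nS E1 E2.
have FFF := corner_filter.
have [[ac _ Es _] [pk sk0 _ ks _] dk _] := dis; have sk t := smooth_onT t sk0.
set G := pushed base c k v a; set F := pushed G c' k' v' a'.
have ck t := @cod_a0 _ _ _ base c k v a ac 0 dk t a0.
have G0 q t : a q = 0 -> G (q, t) = f t.
  move=> aq; apply: (@pushed_a0 _ _ _ base c k v a ac (q, t)) => //= ht.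
  by apply: dk; exact: supp_neq0.
have sG t : msmooth_at G (0, t) by exact: (pushed_smooth (has_coords_RR R) ac (fun t => sb _) sk (sa _) dk ck).
have dkG t : supp k' t -> ch_dom c' (G (0, t)) by rewrite G0 //; exact: dk'.
have ck' t := @cod_a0 _ _ _ G c' k' v' a' ac' 0 dkG t a'0.
have sF t : msmooth_at F (0, t) by exact: (pushed_smooth (has_coords_RR R) ac' sG sk' (sa' _) dkG ck').
have dc : ch_dom c (p i) by rewrite -Es; apply: dk; apply: supp_neq0; rewrite gt_eqF.
have F0 t : F (0, t) = f t by rewrite /F pushed0 // G0.
have De r : f r = p i ->
    'D_((d, 0) : (R * R) * R) (ch_to c \o F) (0, r) = k r *: (v *m transition c c (p i)).
  move=> Er; rewrite (pushed_derive (has_coords_RR R) ac' sG sk' (sa' _) dkG ck') ?G0 ?Er //.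
  rewrite (pushed_derive (has_coords_RR R) ac (fun t => sb _) sk (sa _) dk ck) //; last first.
    by rewrite /base /= Er.
  rewrite /base /= Er (@derive_affine _ _ _ _ _ _ 0) ?add0r; last first.
    by move=> x; rewrite scaler0 addr0 /= /GRing.scale /= mulr0 !add0r.
  rewrite (@derive_affine _ _ R^o _ _ _ 1); last by move=> x; rewrite da /GRing.scale /= mulr1.
  rewrite (@derive_affine _ _ R^o _ _ _ 0); last by move=> x; rewrite da' /GRing.scale /= mulr0 addr0.
  by rewrite mulr1 mulr0 scale0r addr0.
have vE t : f t = p i -> 'D_(dt (R * R)%type) (ch_to c \o F) (0, t) = velocity c f t.
  move=> Et; rewrite -velocity_slice; congr (velocity c _ t); exact/funext.
apply: (@opened _ _ _ _ FFF 0 corner_nbhs F c d a t1 t2 ac (sF t1) (sF t2)).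
- by rewrite F0 E1.
- by rewrite F0 E2.
- rewrite !vE // !De // -scalerBl.
  have := displaces_sign (stage_sing st) dis nS E1 E2 ac dc.
  set x := velocity _ _ t1; set y := velocity _ _ t2; set z := v *m _ => pos.
  have := det3_comb x y z z 0 (k t1 - k t2); rewrite scale0r add0r mul0r add0r => ->.
  by move: pos; apply: contraTneq => ->; rewrite mulr0 ltxx.
- exact: ca.
move=> r r0; apply: (ffT FFF) => q; exists t1, t2; rewrite !subrr !normr0; split=> //.
have Fq t : f t = p i -> F (q - a q *: d, t) = f t.
  move=> Et; have [k0 _] := nbhs_singleton (supp_off (fun st => off t st Et)).
  rewrite /F pushed_off //; apply: G0.
  by have := da (a q) (q - a q *: d); rewrite addrC subrK => aE; lra.
by rewrite !Fq // E1 E2.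
Qed.
End Two.

Lemma push_scale (c : chart R M) k v (f : R -> M) (w u : R) : w != 0 ->
  push c (fun t => w * k t) v f u = push c k v f (u * w).
Proof.
by move=> w0; apply/funext => t; rewrite /push mulf_eq0 (negPf w0) mulrA.
Qed.

Lemma push_off_near (c : chart R M) k v (f : R -> M) (u t : R) : ~ supp k t ->
  \forall t' \near t, f t' = push c k v f u t'.
Proof. by move=> /supp_off; apply: filterS => t' [k0 _]; rewrite /push k0 eqxx. Qed.

Lemma supp_scale (k : R -> R) (w : R) : supp (fun t => w * k t) `<=` supp k.
Proof. by apply: closure_subset => t /=; apply: contraNN => /eqP ->; rewrite mulr0. Qed.

(** Both orders are read off from one family with two amounts, all of whose members with small
    positive amounts are knots without the two double points. A second push acts on the curve
    already displaced, which agrees with f near the second support and double point. *)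
Theorem resolved_commute bs n (f : R -> M) (p : 'I_n.+2 -> M) b e1 e2 i j : stage bs f p b ->
  let i2 := (face_swap (i, j)).1 in let j2 := (face_swap (i, j)).2 in
  exists K1 K2 L, [/\ resolved bs e1 f p b i K1, resolved bs e2 K1 (p \o fintype.lift i) b j L,
    resolved bs e2 f p b i2 K2, resolved bs e1 K2 (p \o fintype.lift i2) b j2 L
    & (p \o fintype.lift i) \o fintype.lift j = (p \o fintype.lift i2) \o fintype.lift j2].
Proof.
move=> st i2 j2; have FFF := corner_filter; have sing := stage_sing st.
have [i2j2 swap] : fintype.lift i2 j2 = i /\ forall m : 'I_n, fintype.lift i (fintype.lift j m) = fintype.lift i2 (fintype.lift j2 m).
  exact: lift_swap.
have pE : (p \o fintype.lift i) \o fintype.lift j = (p \o fintype.lift i2) \o fintype.lift j2.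
  by apply/funext => m /=; rewrite swap.
have [c [k [v [s [s' [dis locl _]]]]]] := displacement_exists0 e1 i sing.
have [[ac _ _ _] [pk sk0 _ _ _] dk _] := dis.
have Zk t : supp k t -> f t <> p i2 by exact: locl.1.
have Zp t (m : int) : supp k (t + m%:~R) -> supp k t.
  by move=> sx; have := supp_periodic (m := - m) pk sx; rewrite mulrNz addrK.
(* The support of the first displacement is passed as the set to be avoided; being localized, it
   contains no preimage of [p i2]. *)
have [c' [k' [v' [t [t' [dis' locl' sep]]]]]] := displacement_exists e2 sing (@closed_closure _ _) Zp Zk.
have [[ac' _ _ _] [pk' sk0' _ _ _] dk' _] := dis'.
have sk x := smooth_onT x sk0; have sk' x := smooth_onT x sk0'.
have Zk' x : supp k' x -> f x <> p i by move=> sx; rewrite -i2j2; exact: locl'.1.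
pose base (x : (R * R) * R) := f x.2.
pose F := pushed (pushed base c k v fst) c' k' v' snd.
pose F' := pushed (pushed base c' k' v' snd) c k v fst.
have FF' : F = F'.
  apply/funext => -[[u w] x]; rewrite /F /F' /pushed /push /=.
  have [kx|kx] := eqVneq (k x) 0 => //; have [k'x|k'x] := eqVneq (k' x) 0 => //.
  by case: (sep x (supp_neq0 k'x)); exact: supp_neq0.
have sfst (q : R * R) : smooth_at (fst : R * R -> R) q by exact: smooth_fst.
have ssnd (q : R * R) : smooth_at (snd : R * R -> R) q by exact: smooth_snd.
have [[pf /smooth_mapP sf _] pI _ _ _] := sing.
have sb x : msmooth_at base x.
  apply: (@msmooth_comp _ _ ((R * R) * R)%type R^o snd f) => //; first exact: has_coords_R.
  exact: smooth_snd.
have F0 x : F (0, x) = f x.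
  rewrite /F; have G0 : pushed base c k v fst (0, x) = f x.
    by apply: (@pushed_a0 _ _ _ base c k v fst ac (0, x)) => //= kx; apply: dk; exact: supp_neq0.
  rewrite (@pushed_a0 _ _ _ (pushed base c k v fst) c' k' v' snd ac' (0, x)) //= => kx.
  by rewrite G0; apply: dk'; exact: supp_neq0.
have sF x : msmooth_at F (0, x).
  have ck y := @cod_a0 _ _ _ base c k v fst ac 0 dk y erefl.
  have sG y : msmooth_at (pushed base c k v fst) (0, y).
    exact: (pushed_smooth (has_coords_RR R) ac (fun t => sb _) sk (sfst _) dk ck).
  have dG y : supp k' y -> ch_dom c' (pushed base c k v fst (0, y)).
    move=> sy; rewrite (@pushed_a0 _ _ _ base c k v fst ac (0, y)) //= => [|ky]; first exact: dk'.
    by apply: dk; exact: supp_neq0.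
  have ck' y := @cod_a0 _ _ _ (pushed base c k v fst) c' k' v' snd ac' 0 dG y erefl.
  exact: (pushed_smooth (has_coords_RR R) ac' sG sk' (ssnd _) dG ck').
have pG q : periodic1 (fun x => pushed base c k v fst (q, x)) by exact: pushed_periodic.
have pF q : periodic1 (fun x => F (q, x)) by exact: pushed_periodic.
have fE : (fun x => F (0, x)) = f by exact/funext.
have cP (P : R * R -> Prop) : (forall q, P q) -> corner P by exact: (ffT FFF).
have [r r0 Hr] : corner (fun q => stage bs (fun x => F (q, x)) (p \o fintype.lift i \o fintype.lift j) b).
  apply: (@stage_near _ _ _ corner (has_coords_RR R) FFF 0 corner_nbhs F base sF (fun x => sb _)
    (cP _ pF) (cP _ (fun=> pf)) _ bs n.+2 p b _ n (fun=> p \o fintype.lift i \o fintype.lift j)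
    (fintype.lift i \o fintype.lift j) (fun=> b)).
  - by move=> x; rewrite F0.
  - by rewrite fE.
  - by move=> x y /= /lift_inj/lift_inj.
  - by move=> x y xy /=; rewrite /bump; lia.
  - by move=> x U nU; apply: cP => _; exact: nbhs_singleton.
  - by move=> y y0; apply: cP => _; rewrite subrr normr0.
  - move=> m x; rewrite F0 => fx.
    have n1 : ~ supp k x by move=> /(locl.1 x (fintype.lift j m)).
    have n2 : ~ supp k' x by move=> /(locl'.1 x (fintype.lift j2 m)); rewrite -swap.
    have L := locI FFF (loc_nbhs FFF (supp_off n1)) (loc_nbhs FFF (supp_off n2)).
    by apply: locS L => y q [[k0 _] [k'0 _]]; rewrite /F pushed_off // pushed_off.
  - move=> m; apply: (@stages_persist R M _ corner FFF base n.+2 p (fun=> p) (fintype.lift i (fintype.lift j m)) pI).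
      by move=> l U nU; apply: cP => _; exact: nbhs_singleton.
    exact: cP.
  move=> i' t1 t2 ni nS; rewrite !F0; case: (unliftP i i') ni => [m ->|-> _].
    case: (unliftP j m) => [l -> /(_ l)|-> _]; first by rewrite eqxx.
    move=> E1 E2; rewrite FF'.
    apply: (@two_opened bs n f p b e2 st i2 c' c k' k v' v t t' snd fst (0, 1) dis') => //.
    + by move=> h x; rewrite /= /GRing.scale /= mulr1 addrC.
    + by move=> h x; rewrite /= /GRing.scale /= mulr0 add0r.
    + by move=> y y0; exists y.
  move=> E1 E2; apply: (@two_opened bs n f p b e1 st i c c' k k' v v' s s' fst snd (1, 0) dis) => //.
  + by move=> h x; rewrite /= /GRing.scale /= mulr1 addrC.
  + by move=> h x; rewrite /= /GRing.scale /= mulr0 add0r.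
  + by move=> y y0; exists y.
have [r1 r10 Hr1] := resolved_displacement st dis locl.
have [r2 r20 Hr2] := resolved_displacement st dis' locl'.
have [u [u0 ur ur1 ur2]] : exists u : R, [/\ 0 < u, u < r, u < r1 & u < r2].
  exists (Num.min r (Num.min r1 r2) / 2); have m0 : 0 < Num.min r (Num.min r1 r2) by rewrite !lt_min r0 r10.
  have m1 : Num.min r (Num.min r1 r2) <= r by rewrite ge_min lexx.
  have m2 : Num.min r (Num.min r1 r2) <= r1 by rewrite !ge_min lexx orbT.
  have m3 : Num.min r (Num.min r1 r2) <= r2 by rewrite !ge_min lexx !orbT.
  by move: (Num.min r _) m0 m1 m2 m3 => m *; split; lra.
have [] := (Hr1 u ltac:(by rewrite u0), Hr2 u ltac:(by rewrite u0)).
have un : u != 0 by rewrite gt_eqF.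
have in_r u' : 0 < u' <= 1 -> 0 < u' * u < r.
  move=> /andP[u'0 u'1]; rewrite mulr_gt0 //=.
  by apply: le_lt_trans ur; rewrite ler_piMl // ltW.
have uin : 0 < u < r by rewrite u0.
move=> R1 R2; have [rp1 _ _] := R1; have [rp2 _ _] := R2.
exists (push c k v f u), (push c' k' v' f u), (fun x => F ((u, u), x)); split=> //.
- by exists c, (fun t => u * k t), v.
- exists c', (fun t => u * k' t), v'; split.
  + apply: (resolving_push_eq rp2) => x sx; apply: push_off_near => kx.
    by case: sx => [/supp_scale sx|]; [exact: (sep x sx)|exact: Zk].
  + move=> u' u'01; rewrite push_scale //; exact: (Hr u (u' * u) uin (in_r _ u'01)).
  + by move=> x; rewrite push_scale // mul1r.
- by exists c', (fun t => u * k' t), v'.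
exists c, (fun t => u * k t), v; split.
- rewrite /= i2j2; apply: (resolving_push_eq rp1) => x sx; apply: push_off_near => kx.
  by case: sx => [/supp_scale sx|]; [exact: (sep x kx)|exact: Zk'].
- move=> u' u'01; rewrite push_scale // -pE.
  by have := Hr (u' * u) u (in_r _ u'01) uin; rewrite FF'.
- by move=> x; rewrite push_scale // mul1r FF'.
Qed.
End Commute.

(** * Based isotopies carry the double points continuously *)

Local Notation "x $ k" := (x ord0 k) (at level 2, format "x $ k").
Section Order.
Context (R : realType) (M : oriented_3manifold R).

Lemma double_pt_of n (f : R -> M) (p p' : 'I_n -> M) j : is_singular_knot f p -> is_singular_knot f p' ->
  exists i, p' j = p i.
Proof.
move=> [_ _ _ dbl _] [_ _ /(_ j)[s [t [nS Es Et _]]] _ _].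
by have [i Ei] := dbl s t (etrans Es (esym Et)) nS; exists i; rewrite -Es.
Qed.

Lemma mono_id n (sg : 'I_n -> 'I_n) : (forall i j : 'I_n, (i < j)%N -> (sg i < sg j)%N) -> sg =1 id.
Proof.
move=> mono; have up k (i : 'I_n) : nat_of_ord i = k -> (i <= sg i)%N.
  elim: k i => [|k IHk] i ik; first by rewrite ik.
  have kn : (k < n)%N by rewrite -ltnS -ik ltnS ltnW.
  by rewrite ik; apply: leq_ltn_trans (IHk (Ordinal kn) erefl) (mono _ _ _); rewrite /= ik.
have down k (i : 'I_n) : (n - i)%N = k -> (sg i <= i)%N.
  elim: k i => [|k IHk] i ik; first by have := ltn_ord i; lia.
  have [j|] := ltnP i.+1 n; last by have := ltn_ord (sg i); lia.
  have := IHk (Ordinal j) _; rewrite /= => /(_ ltac:(lia)) sj.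
  by have := mono i (Ordinal j) (ltnSn i); lia.
by move=> i; apply: ord_inj; apply/eqP; rewrite eqn_leq (down _ i erefl) (up _ i erefl).
Qed.

(** The labellings differ by a map [sg] of the labels. If [sg] reversed a pair, each of the two
    points would be met strictly before the other; so [sg] is increasing, hence the identity. *)
Lemma based_unique n (f : R -> M) (p p' : 'I_n -> M) b : is_based_knot f p b -> is_based_knot f p' b -> p = p'.
Proof.
move=> [sp _ op] [sp' _ op'].
have /choice[sg sgE] : forall j, exists i, p' j = p i by move=> j; exact: double_pt_of sp sp'.
have [_ pI' _ _ _] := sp'.
suff : sg =1 id by move=> E; apply/funext => j; rewrite sgE E.
apply: mono_id => i j ij; rewrite ltnNge leq_eqVlt; apply/negP => /orP[/eqP/ord_inj E|ji].
  by have := pI' j i; rewrite !sgE E => /(_ erefl) ijE; rewrite ijE ltnn in ij.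
have [s [bs fs av]] := op' i j ij; have [s2 [bs2 fs2 av2]] := op _ _ ji.
have [ss|ss] := leP s s2.
  by apply: (av2 s); rewrite ?bs //= -sgE.
by apply: (av s2); rewrite ?bs2 ?ltW //= sgE.
Qed.

Lemma singular_relabel n (f : R -> M) (p : 'I_n -> M) (ta : 'I_n -> 'I_n) : bijective ta -> is_singular_knot f p ->
  is_singular_knot f (p \o ta).
Proof.
move=> bij [im pI two dbl tr]; have [tb taK tbK] := bij; split=> //.
- by move=> i j /= /pI; exact: bij_inj.
- by move=> i; exact: two.
- by move=> s t E nS; have [i Ei] := dbl s t E nS; exists (tb i); rewrite /= tbK.
Qed.

Lemma det3_rot (a b v : 'rV[R]_3) : det3 b v a = det3 a b v.
Proof. by rewrite !det3E; ring. Qed.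

Section Limits.
Context (Q : normedModType R) (FF : set_system Q).
Hypothesis hQ : has_coords Q.
Hypothesis FFF : Filter FF.
Variable q0 : Q.
Hypothesis FFq : forall A, nbhs q0 A -> FF A.
Variable F : Q * R -> M.
Hypothesis sF : forall t, msmooth_at F (q0, t).
Hypothesis perF : FF (fun q => periodic1 (fun t => F (q, t))).
Variables (n : nat) (p0 : 'I_n -> M).
Let f0 t := F (q0, t).
Hypothesis sing0 : is_singular_knot f0 p0.

(* The mean value theorem on both branches writes the difference of two nearby coincidences as a
   linear relation between vectors close to the two velocities. *)
Lemma transverse_unique t1 t2 : ~~ same_pt t1 t2 -> f0 t1 = f0 t2 ->
  exists2 r, 0 < r & FF (fun q => forall s s' t t', `|s - t1| < r -> `|s' - t1| < r -> `|t - t2| < r -> `|t' - t2| < r ->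
    F (q, s) = F (q, t) -> F (q, s') = F (q, t') -> s = s').
Proof.
move=> nS E; have [_ _ _ _ tr] := sing0; have [c ac c1] := mfd_cover (f0 t1).
have c2 : ch_dom c (f0 t2) by rewrite -E.
have /transverseP[v D] := tr _ _ E nS c ac c1; have [e e0 De] := det3_near D.
have branch (t : R) : ch_dom c (f0 t) -> exists2 r, 0 < r & forall q s s', `|q - q0| < r -> `|s - t| < r -> `|s' - t| < r ->
    exists A : 'rV[R]_3, (forall k, `|A$k - (velocity c f0 t)$k| < e) /\
      forall k, (ch_to c (F (q, s)))$k - (ch_to c (F (q, s')))$k = (s - s') * A$k.
  move=> ct; have sm := msmooth_chart (sF t) ac ct; set phi := ch_to c \o F in sm.
  have vE : velocity c f0 t = 'D_(dt Q) phi (q0, t) by rewrite -velocity_slice.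
  have nU : nbhs ('D_(dt Q) phi (q0, t)) [set y : 'rV[R]_3 | forall k, `|y ord0 k - ('D_(dt Q) phi (q0, t)) ord0 k| < e].
    apply/nbhs_ballP; exists e => //= x [_ H] k.
    by have := H ord0 k; rewrite -ball_normE /= distrC.
  have := filterI (smooth_at_nbhs sm) (smooth_at_cont (smooth_at_derive (dt Q) sm) nU).
  move=> [[A B] /= [qA tB] AB].
  have [/= ra ra0 HA] := (nbhs_ballP _ _).1 qA; have [/= rb rb0 HB] := (nbhs_ballP _ _).1 tB.
  exists (Num.min ra rb); first by rewrite lt_min ra0.
  move=> q s s'; rewrite !lt_min => /andP[qa _] /andP[_ sb] /andP[_ s'b].
  have box y : `|y - t| < rb -> smooth_at phi (q, y) /\ forall k, `|('D_(dt Q) phi (q, y)) ord0 k - ('D_(dt Q) phi (q0, t)) ord0 k| < e.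
    move=> yb; have [] := AB (q, y); last by [].
    by split; [apply: HA|apply: HB]; rewrite -ball_normE /= distrC.
  have pt (a : R) : ((q, s') : Q * R) + a *: dt Q = (q, s' + a).
    by congr pair; rewrite /= ?scaler0 ?addr0 // /GRing.scale /= mulr1.
  have ex k : exists a : R, `|a - (velocity c f0 t)$k| < e /\ (phi (q, s))$k - (phi (q, s'))$k = (s - s') * a.
    have [|a a01] := @mvt_scaled _ _ _ phi (q, s') (dt Q) (s - s') k.
      by move=> a a01; rewrite pt; have [] := box _ (convex_dist s'b sb a01).
    rewrite !pt (_ : s' + (s - s') = s) => [Ek|]; last by rewrite addrC subrK.
    exists ('D_(dt Q) phi (q, s' + a * (s - s')))$k; split=> //.
    by rewrite vE; have [_] := box _ (convex_dist s'b sb a01).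
  have [A' HA'] := choice ex; exists (\row_k A' k).
  by split=> k; rewrite mxE; have [] := HA' k.
have [r1 r10 H1] := branch t1 c1; have [r2 r20 H2] := branch t2 c2.
pose r := Num.min r1 r2; have r0 : 0 < r by rewrite lt_min r10.
exists r => //; have nq : FF (fun q => `|q - q0| < r).
  by apply: FFq; apply/nbhs_ballP; exists r => //= y; rewrite -ball_normE /= distrC.
move: nq; apply: ffS => // q; rewrite !lt_min => /andP[q1 q2] s s' t t'.
rewrite !lt_min => /andP[s1 _] /andP[s'1 _] /andP[_ t2'] /andP[_ t'2] Es Es'.
have [A [cA EA]] := H1 q s s' q1 s1 s'1; have [B [cB EB]] := H2 q t t' q2 t2' t'2.
have det : det3 B v A != 0.
  by rewrite det3_rot; apply: De => // k; rewrite subrr normr0.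
apply/eqP; rewrite -subr_eq0; apply/eqP; apply: (det3_cramer (x := - (t - t')) (y := 0) det) => k.
by rewrite mul0r addr0 mulNr -EA -EB Es Es'; ring.
Qed.

Variable P : Q -> 'I_n -> M.
Hypothesis singF : FF (fun q => is_singular_knot (fun t => F (q, t)) (P q)).

(** Compactness of the torus of pairs replaces compactness of the manifold: a pair of distinct
    parameters creates a new coincidence only close to an old one. *)
Lemma double_pts_near (U : 'I_n -> set M) : (forall i, nbhs (p0 i) (U i)) ->
  FF (fun q => forall j, exists i, U i (P q j)).
Proof.
move=> nU.
have H : FF (fun q => forall t t', 0 <= t <= 1 -> 0 <= t' <= 1 ->
    F (q, t) = F (q, t') -> ~~ same_pt t t' -> exists i, U i (F (q, t))).
  apply: (near_torus FFF (A := fun x q => F (q, x.1) = F (q, x.2) -> ~~ same_pt x.1 x.2 -> exists i, U i (F (q, x.1)))).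
  move=> [t t']; have [no|yes] := pselect (f0 t <> f0 t' \/ same_pt t t').
    have L := no_coincidence FFF FFq sF perF sing0 no.
    by apply: locS L => x q S Ex nSx; rewrite S in nSx.
  have [E nS] : f0 t = f0 t' /\ ~~ same_pt t t'.
    by split; [apply: contrapT => E; apply: yes; left|apply/negP => S; apply: yes; right].
  have [_ _ _ dbl _] := sing0; have [i Ei] := dbl _ _ E nS.
  have L : loc FF t (fun t q => U i (F (q, t))) 
    by apply: (loc_value FFq sF); rewrite -[F _]/(f0 t) Ei.
  have L' : loc FF t' (fun _ _ => True) by exists setT; [exact: filterT|exists setT => //; exact: (ffT FFF)].
  by have LL := loc_pair FFF L L'; apply: locS LL => x q [Ux _] _ _; exists i.
have := ffI FFF H (ffI FFF singF perF); apply: ffS => // q [Hq [[_ _ two _ _] per]] j.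
have [s [t [nS Es Et _]]] := two j.
have [s' s'1 ss'] := same_pt_unit s; have [t' t'1 tt'] := same_pt_unit t.
have Fs : F (q, s') = P q j by rewrite -Es; apply: (periodic_same per); rewrite same_pt_sym.
have Ft : F (q, t') = P q j by rewrite -Et; apply: (periodic_same per); rewrite same_pt_sym.
rewrite -Fs; apply: (Hq s' t') => //; first by rewrite Fs.
apply: contraNN nS => S; apply: same_pt_trans ss' _; apply: same_pt_trans S _.
by rewrite same_pt_sym.
Qed.

Lemma pair_near i j s0 t0 r : (forall U, nbhs (p0 i) U -> FF (fun q => U (P q j))) ->
  ~~ same_pt s0 t0 -> f0 s0 = p0 i -> f0 t0 = p0 i -> 0 < r ->
  FF (fun q => exists s t, [/\ `|s - s0| < r, `|t - t0| < r, F (q, s) = P q j & F (q, t) = P q j]).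
Proof.
move=> cv nS Es Et r0.
have only x : f0 x = p0 i -> same_pt x s0 || same_pt x t0 by exact: two_preimages sing0 nS Es Et.
have [r1 r10 inj1] := local_inj FFq sF sing0 s0; have [r2 r20 inj2] := local_inj FFq sF sing0 t0.
have d10 : 0 < Num.min r r1 by rewrite lt_min r0. have d20 : 0 < Num.min r r2 by rewrite lt_min r0.
have near := preimage_near FFF FFq sF perF cv only d10 d20.
have := ffI FFF inj1 (ffI FFF inj2 (ffI FFF near (ffI FFF singF perF))).
apply: ffS => // q [i1 [i2 [on [[_ _ two _ _] per]]]].
have [x [y [nxy Fx Fy _]]] := two j.
have eqF a a' : same_pt a a' -> F (q, a') = F (q, a) by move=> S; apply: (periodic_same per); rewrite same_pt_sym.
have [[a]|[a]] := on x Fx; rewrite lt_min => /andP[ar a1] xa; have [[a']|[a']] := on y Fy; rewrite lt_min => /andP[a'r a'1] ya'.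
- case/negP: nxy; rewrite (same_pt_trans xa) // same_pt_sym (i1 a a') //.
  by rewrite (eqF _ _ xa) (eqF _ _ ya') Fx.
- by exists a, a'; rewrite (eqF _ _ xa) (eqF _ _ ya').
- by exists a', a; rewrite (eqF _ _ xa) (eqF _ _ ya').
- case/negP: nxy; rewrite (same_pt_trans xa) // same_pt_sym (i2 a a') //.
  by rewrite (eqF _ _ xa) (eqF _ _ ya') Fx.
Qed.

End Limits.

Lemma isolate_all n (p : 'I_n -> M) : injective p -> exists2 W : 'I_n -> set M, forall i, nbhs (p i) (W i) &
  forall i l z, W i z -> W l z -> i = l.
Proof.
move=> pI; have /choice[UV HUV] : forall i, exists UV : set M * ('I_n -> set M),
    [/\ nbhs (p i) UV.1, forall l, nbhs (p l) (UV.2 l) & forall l z, UV.1 z -> UV.2 l z -> l = i].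
  by move=> i; have [U nU [V nV HV]] := isolate i pI; exists (U, V).
exists (fun i z => (UV i).1 z /\ forall l, (UV l).2 i z) => [i|i l z [_ H1] [H2 _]].
  apply: filterI; first by have [] := HUV i.
  by apply: filter_forall => l; have [_ nl _] := HUV l; exact: nl.
by have [_ _] := HUV l; apply; [exact: H2|exact: H1].
Qed.

(* Along an ultrafilter each P j tends to some p0 (sg j).  By transversality two double points cannot
   merge, so that sg is bijective, and the order in which the double points are met makes sg increasing. *)
Lemma ultra_order (Q : normedModType R) (FF : set_system Q) (UF : UltraFilter FF) (hQ : has_coords Q) (q0 : Q)
    (FFq : forall A, nbhs q0 A -> FF A) (F : Q * R -> M) n (p0 : 'I_n -> M) (b0 : R) (P : Q -> 'I_n -> M) (b : Q -> R) :
  (forall t, msmooth_at F (q0, t)) -> is_based_knot (fun t => F (q0, t)) p0 b0 ->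
  FF (fun q => is_based_knot (fun t => F (q, t)) (P q) (b q)) ->
  (forall r, 0 < r -> FF (fun q => `|b q - b0| < r)) ->
  forall j U, nbhs (p0 j) U -> FF (fun q => U (P q j)).
Proof.
move=> sF based0 basedF cvb; have FFF : Filter FF by exact: filter_filter.
have sing0 : is_singular_knot (fun t => F (q0, t)) p0 by have [] := based0.
have singF : FF (fun q => is_singular_knot (fun t => F (q, t)) (P q)) by move: basedF; apply: ffS => // q [].
have perF : FF (fun q => periodic1 (fun t => F (q, t))) by move: singF; apply: ffS => // q [[]].
have [W nW disj] := isolate_all (let: And5 _ pI _ _ _ := sing0 in pI).
have near V : (forall i, nbhs (p0 i) (V i)) -> FF (fun q => forall j, exists i, V i (P q j)).
  exact: (double_pts_near FFF FFq sF perF sing0 singF).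
have pick A : FF A -> exists q, A q by move=> /filter_ex.
have ex j : exists i, FF (fun q => W i (P q j)).
  apply: contrapT => no; have : FF (fun q => forall i, ~ W i (P q j)).
    apply: (ff_forall FFF) => i; have [Wi|//] := in_ultra_setVsetC (fun q => W i (P q j)) UF.
    by case: no; exists i.
  by move=> H; have [q [nq /(_ j)[i Wi]]] := pick _ (ffI FFF H (near W nW)); case: (nq i).
have [sg sgW] := choice ex.
have cv j V : nbhs (p0 (sg j)) V -> FF (fun q => V (P q j)).
  move=> nV; pose W' i := if i == sg j then W i `&` V else W i.
  have nW' i : nbhs (p0 i) (W' i).
    by rewrite /W'; case: eqP => [->|_] //; exact: filterI.
  have := ffI FFF (sgW j) (near W' nW'); apply: ffS => // q [Wj /(_ j)[i]].
  rewrite /W'; case: eqP => [_ []//|ne Wi]; case: ne; exact: disj Wi Wj.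
have two := let: And5 _ _ two _ _ := sing0 in two.
have sgI : injective sg.
  move=> j j' E; have [s [t [nS Es Et _]]] := two (sg j).
  have [r r0 uniq] := transverse_unique FFF FFq sF sing0 nS (etrans Es (esym Et)).
  have N := pair_near FFF FFq sF perF sing0 singF (cv j) nS Es Et r0.
  have cv' V : nbhs (p0 (sg j)) V -> FF (fun q => V (P q j')) by rewrite E; exact: cv.
  have N' := pair_near FFF FFq sF perF sing0 singF cv' nS Es Et r0.
  have [q [u [[x [y [xr yr Fx Fy]]] [[x' [y' [xr' yr' Fx' Fy']]] [_ pI _ _ _]]]]] :=
    pick _ (ffI FFF uniq (ffI FFF N (ffI FFF N' singF))).
  apply: pI; rewrite -Fx -Fx'; congr (F (q, _)).
  by apply: (u x x' y y') => //; [rewrite Fx Fy|rewrite Fx' Fy'].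
have bij := injF_bij sgI; pose ta := invF sgI.
have taK i : sg (ta i) = i by exact: f_invF.
have bta : bijective ta by exists sg; [exact: f_invF|exact: invF_f].
have cvta i V : nbhs (p0 i) V -> FF (fun q => V ((P q \o ta) i)).
  by move=> nV; apply: cv; rewrite taK.
(* Relabelled by the inverse of [sg], the double points converge with the right labels, and
   [based_near] shows that they are met in this order; by [based_unique] the relabelling is
   trivial. *)
have : FF (fun q => is_based_knot (fun t => F (q, t)) (P q \o ta) (b q)).
  apply: (@based_near _ _ _ _ FFF q0 FFq F sF n p0 b0 based0 n (fun q => P q \o ta) id b) => //.
    move=> i t1 E1 r r0; have [s [t [nS Es Et only]]] := two i.
    have [t2 [nS2 E2]] : exists t2, ~~ same_pt t1 t2 /\ F (q0, t2) = p0 i.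
      case/orP: (only t1 E1) => S; [exists t|exists s]; split=> //; apply: contraNN nS => S'.
        by apply: same_pt_trans S'; rewrite same_pt_sym.
      by rewrite same_pt_sym; apply: same_pt_trans S'; rewrite same_pt_sym.
    have cv' V : nbhs (p0 i) V -> FF (fun q => V (P q (ta i))) by exact: cvta.
    have := pair_near FFF FFq sF perF sing0 singF cv' nS2 E1 E2 r0.
    by apply: ffS => // q [x [y [xr _ Fx _]]]; exists x.
  by move: singF; apply: ffS => // q; exact: singular_relabel.
move=> H; have [q [H1 H2]] := pick _ (ffI FFF H basedF).
have E := based_unique H1 H2; have [[_ pI _ _ _] _ _] := H2.
have taE i : ta i = i by apply: pI; exact: (congr1 (@^~ i) E).
by move=> j U /cvta /=; rewrite taE.
Qed.

(** If continuity fails at [l0], the nearby times with [P l i] outside [U] generate a proper filter;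
    an ultrafilter refining it contradicts [ultra_order]. *)
Lemma based_continuous (H : R * R -> M) n (P : R -> 'I_n -> M) (B : R -> R) : smooth_map H ->
  (forall u, 0 <= u <= 1 -> is_based_knot (fun t => H (u, t)) (P u) (B u)) ->
  {within `[0, 1], continuous B} -> forall i, {within `[0, 1], continuous (fun u => P u i)}.
Proof.
move=> /smooth_mapP sH st /within01P cB i; apply/within01P => l0 l01 U nU; apply: contrapT => no.
pose FF : set_system R := [set A | exists2 r : R, 0 < r & forall l, 0 <= l <= 1 -> `|l - l0| < r -> ~ U (P l i) -> A l].
have fFF : ProperFilter FF.
  apply: Build_ProperFilter_ex => [A [r r0 HA]|].
    apply: contrapT => nA; apply: no; exists r => // l l1 lr; apply: contrapT => nUl.
    by apply: nA; exists l; exact: HA.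
  split.
  - by exists 1.
  - move=> A C [r r0 HA] [s s0 HC]; exists (Num.min r s); first by rewrite lt_min r0.
    by move=> l l1; rewrite lt_min => /andP[lr ls] nUl; split; [exact: HA|exact: HC].
  - by move=> A C sAC [r r0 HA]; exists r => // l *; apply: sAC; exact: HA.
have [G [UG FG]] := ultraFilterLemma fFF.
have Gq A : nbhs l0 A -> G A.
  move=> /nbhs_ballP[r /= r0 rA]; apply: FG; exists r => // l _ lr _; apply: rA.
  by rewrite -ball_normE /= distrC.
have G1 : G (fun l => U (P l i)).
  apply: (ultra_order UG (has_coords_R R) Gq (fun t => sH (l0, t)) (st l0 l01) _ _ nU).
    by apply: FG; exists 1 => // l l1 _ _; exact: st.
  move=> r r0; have [|d d0 Hd] := cB l0 l01 [set x | `|x - B l0| < r].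
    by apply/nbhs_ballP; exists r => //= y; rewrite -ball_normE /= distrC.
  by apply: FG; exists d => // l l1 ld _; exact: Hd.
have G2 : G (fun l => ~ U (P l i)) by apply: FG; exists 1.
by have [l [?]] := filter_ex (filterI G1 G2).
Qed.
End Order.

(** * The complexes of knots *)

Lemma resolved_stage (R : realType) (M : oriented_3manifold R) bs eps n (f : R -> M) (p : 'I_n.+1 -> M) b i g :
  resolved bs eps f p b i g -> stage bs g (p \o fintype.lift i) b.
Proof.
move=> [c [h [v [_ st gE]]]]; have -> : g = push c h v f 1 by apply/funext.
by apply: st; rewrite ltr01 lexx.
Qed.

Section Flavours.
Context (R : realType) (M : oriented_3manifold R) (X : knot_flavour) (bs : bool).
Variables (kmap : forall n, knots X n -> R -> M) (kpts : forall n, knots X n -> 'I_n -> M)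
  (kbase : forall n, knots X n -> R).
Hypothesis stageK : forall n (K : knots X n), stage bs (kmap K) (kpts K) (kbase K).
Hypothesis makeK : forall m (K : knots X m) n (f : R -> M) (p : 'I_n -> M), stage bs f p (kbase K) ->
  exists L : knots X n, [/\ kmap L = f, kpts L = p & kbase L = kbase K].
Hypothesis isoK : forall n (K L : knots X n),
  isotopic K L <-> isot bs (kmap K) (kpts K) (kbase K) (kmap L) (kpts L) (kbase L).
Hypothesis resK : forall n eps (K : knots X n.+1) i (L : knots X n),
  resolves eps K i L <-> [/\ resolved bs eps (kmap K) (kpts K) (kbase K) i (kmap L),
    kpts L = kpts K \o fintype.lift i & kbase L = kbase K].

Lemma isotopic_refl n (K : knots X n) : isotopic K K.
Proof. by apply/isoK; exact: isot_refl. Qed.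

Lemma isotopic_sym n (K L : knots X n) : isotopic K L -> isotopic L K.
Proof.
move=> /isoK KL; apply/isoK; exact: isot_sym.
Qed.

Lemma isotopic_trans n (K L N : knots X n) : isotopic K L -> isotopic L N -> isotopic K N.
Proof. by move=> /isoK KL /isoK LN; apply/isoK; exact: isot_trans KL LN. Qed.

Lemma knot_type_eq n (C D : knot_type X n) K L : sval C K -> sval D L -> isotopic K L -> C = D.
Proof.
case: C D => C HC [D HD] /= CK DL KL; apply: eq_exist => /=.
have [K0 EC] := HC; have [L0 ED] := HD; rewrite EC in CK; rewrite ED in DL; rewrite EC ED.
have KL0 : isotopic K0 L0.
  by apply: isotopic_trans CK (isotopic_trans KL _); exact: isotopic_sym.
apply/seteqP; split=> N /= H; last exact: isotopic_trans KL0 H.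
by apply: isotopic_trans H; exact: isotopic_sym.
Qed.

Lemma knot_type_iso n (C : knot_type X n) K L : sval C K -> sval C L -> isotopic K L.
Proof.
case: C => C [K0 EC] /=; rewrite EC /= => H1 H2.
by apply: isotopic_trans H2; exact: isotopic_sym.
Qed.

Lemma knot_type_rep n (C : knot_type X n) : exists K, sval C K.
Proof. by case: C => C [K E] /=; exists K; rewrite E; exact: isotopic_refl. Qed.

Definition class n (K : knots X n) : knot_type X n := exist _ [set L | isotopic K L] (ex_intro _ K erefl).

Lemma classP n (K : knots X n) : sval (class K) K.
Proof. exact: isotopic_refl. Qed.

Lemma resolution_exists n eps (C : knot_type X n.+1) i : exists D, resolution eps C i D.
Proof.
have [K CK] := knot_type_rep C; have [g Rg] := resolved_exists eps i (stageK K).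
have [L [Lf Lp Lb]] := makeK (resolved_stage Rg).
exists (class L), K, L; split=> //; first exact: classP.
by apply/resK; rewrite Lf.
Qed.

Lemma resolution_unique n eps (C : knot_type X n.+1) i D D' : resolution eps C i D -> resolution eps C i D' -> D = D'.
Proof.
move=> [K [L [CK DL /resK[r1 p1 b1]]]] [K' [L' [CK' DL' /resK[r2 p2 b2]]]].
apply: (knot_type_eq DL DL'); apply/isoK; rewrite p1 p2 b1 b2.
by have /isoK I := knot_type_iso CK CK'; exact: resolved_isot I r1 r2.
Qed.

Definition face n (eps : bool) (i : 'I_n.+1) (C : knot_type X n.+1) : knot_type X n :=
  sval (cid (resolution_exists eps C i)).

Lemma faceP n eps (C : knot_type X n.+1) i D : resolution eps C i D <-> D = face eps i C.
Proof.
have H := svalP (cid (resolution_exists eps C i)); split=> [H'|->//].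
exact: resolution_unique H' H.
Qed.

(** On one representative [resolved_commute] provides a single curve that is the double resolution
    in either order; uniqueness of resolutions passes this to classes. *)
Lemma faceC n e1 e2 (i : 'I_n.+2) (j : 'I_n.+1) (C : knot_type X n.+2) :
  face e2 j (face e1 i C) = face e1 (face_swap (i, j)).2 (face e2 (face_swap (i, j)).1 C).
Proof.
have [K CK] := knot_type_rep C.
have [K1 [K2 [L [r1 r1L r2 r2L pE]]]] := resolved_commute e1 e2 i j (stageK K).
have [L1 [L1f L1p L1b]] := makeK (resolved_stage r1).
have [L2 [L2f L2p L2b]] := makeK (resolved_stage r2).
have [N [Nf Np Nb]] := makeK (resolved_stage r1L).
have F1 : class L1 = face e1 i C.
  apply/faceP; exists K, L1; split=> //; first exact: classP.
  by apply/resK; rewrite L1f.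
have F2 : class L2 = face e2 (face_swap (i, j)).1 C.
  apply/faceP; exists K, L2; split=> //; first exact: classP.
  by apply/resK; rewrite L2f.
rewrite -F1 -F2; transitivity (class N); [apply/esym|]; apply/faceP.
  exists L1, N; split; [exact: classP|exact: classP|].
  by apply/resK; rewrite Nf Np Nb L1f L1p L1b.
exists L2, N; split; [exact: classP|exact: classP|].
by apply/resK; rewrite Nf Np Nb L2f L2p L2b pE.
Qed.

Lemma resolveE n eps (C : knot_type X n.+1) i : resolve eps C i = [freeg [:: (1, face eps i C)]].
Proof.
rewrite /resolve; case: pselect => [e|]; last by case; exact: resolution_exists.
by congr [freeg [:: (1, _)]]; apply/faceP; exact: svalP (cid e).
Qed.

Lemma flavour_complex : exists Z : CW_complex R (knot_type X),
  knot_attached Z /\ complex_iso (cellular_complex Z) (knot_complex X).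
Proof.
exists (cube_cw R (cell := fun n => knot_type X n : choiceType) faceC); split.
  move=> n C i eps D /faceP -> x _; exact: (cmap_insert (cell := fun n => knot_type X n : choiceType) faceC C i eps x).
apply: (@cube_cw_iso R (fun n => knot_type X n : choiceType) _ faceC (cpx_d (knot_complex X))) => n C /=.
rewrite liftU scale1r /knot_boundary; apply: eq_bigr => i _.
by rewrite !resolveE.
Qed.
End Flavours.

Lemma ordered_complex (R : realType) (M : oriented_3manifold R) :
  exists Z : CW_complex R (knot_type (ordered_flavour M)),
  knot_attached Z /\ complex_iso (cellular_complex Z) (knot_complex (ordered_flavour M)).
Proof.
(* The constant 0 is a dummy base parameter. *)
apply: (@flavour_complex R M (ordered_flavour M) false (@knot_map R M) (@double_pt R M) (fun _ _ => 0)).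
- by move=> n K; exact: singular_knotP K.
- by move=> m K n f p fp; exists (SingularKnot fp).
- move=> n K L; split.
    move=> [H [P [h1 h2 h3 h4 h5]]]; exists H, P, (fun=> 0); split=> //.
      by split=> //; exact: within_cst.
    by split=> //; exact: same_pt_refl.
  by move=> [H [P [B [h1 h2 [h3 _] h4 [h5 _ _]]]]]; exists H, P; split.
- move=> n eps K i L; split.
    move=> [c [h [v [h1 h2 h3 h4]]]]; split=> //; last exact/funext.
    by exists c, h, v.
  move=> [[c [h [v [h1 h2 h3]]]] h4 _]; exists c, h, v; split=> // j.
  by rewrite h4.
Qed.

Lemma based_complex (R : realType) (M : oriented_3manifold R) :
  exists Z : CW_complex R (knot_type (based_flavour M)),
  knot_attached Z /\ complex_iso (cellular_complex Z) (knot_complex (based_flavour M)).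
Proof.
apply: (@flavour_complex R M (based_flavour M) true (@based_map R M) (@based_double_pt R M) (@base_pt R M)).
- by move=> n K; exact: based_knotP K.
- by move=> m K n f p fp; exists (BasedKnot fp).
- move=> n K L; split.
    move=> [H [P [B [h1 h2 h3 h4 [h5 h6]]]]]; exists H, P, B; split=> //.
      by split=> //; exact: based_continuous h1 h2 h3.
    have E0 : (fun t => H (0, t)) = based_map K by apply/funext => t; have [] := h4 t.
    have E1 : (fun t => H (1, t)) = based_map L by apply/funext => t; have [] := h4 t.
    (* A based isotopy does not prescribe the labels at its ends; they are determined by the order
       from the base point. *)
    have P0 : P 0 = based_double_pt K.
      have := h2 0 ltac:(by rewrite lexx ler01); rewrite E0 h5 => /based_unique; apply.
      exact: based_knotP K.
    have P1 : P 1 = based_double_pt L.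
      have := h2 1 ltac:(by rewrite lexx ler01); rewrite E1 => st1.
      have := @stage_shift R M true n _ _ _ _ h6 st1; move/based_unique; apply.
      exact: based_knotP L.
    by split=> // i; rewrite P0 P1.
  by move=> [H [P [B [h1 h2 [_ h3] h4 [_ h5 h6]]]]]; exists H, P, B; split.
- move=> n eps K i L; split.
    move=> [c [h [v [h1 h2 h3 h4 h5]]]]; split=> //; last exact/funext.
    by exists c, h, v.
  move=> [[c [h [v [h1 h2 h3]]]] h4 h5]; exists c, h, v; split=> // j.
  by rewrite h4.
Qed.

Theorem theorem2p14 (R : realType) (M : oriented_3manifold R) :
  (exists CKb : CW_complex R (knot_type (based_flavour M)),
     knot_attached CKb /\
     complex_iso (cellular_complex CKb) (knot_complex (based_flavour M))) /\
  (exists CK0 : CW_complex R (knot_type (ordered_flavour M)),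
     knot_attached CK0 /\
     complex_iso (cellular_complex CK0) (knot_complex (ordered_flavour M))).
Proof. by split; [exact: based_complex|exact: ordered_complex]. Qed.
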